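(* Let $F$ be a $2$-adic field and $R_0=\mathbb{Q}$. Let $A=\mathcal{O}_F^{\times2}\cap\mathbb{Z}_2^\times$, so $\mathbb{Z}_2^{\times2}\subseteq A\subseteq\mathbb{Z}_2^\times$. The odd part $\omega_{\psi,X}^-$ of the Weil representation can be realised over - each of the fields $\mathbb{Q}[\sqrt{-2}]$ and $\mathbb{Q}[\sqrt{-1}]$ if $A=\mathbb{Z}_2^\times$, and its character field is then $\mathbb{Q}$; - its character field $\mathbb{Q}[\sqrt{-2}]$ if $A=[3]$; - its character field $\mathbb{Q}[\sqrt{-1}]$ if $A=[5]$; - $\mathbb{Q}[\zeta_8]$ if $A=[-1]$, and its character field is then $\mathbb{Q}[\sqrt2]$; - its character field $\mathbb{Q}[\zeta_8]$ if $A=\mathbb{Z}_2^{\times2}$. The Schur index of $\omega_{\psi,X}^-$ is $2$ if $A=\mathbb{Z}_2^\times$ or $A=[-1]$, and $1$ otherwise.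
   Context: $F$ is a finite extension of $\mathbb{Q}_2$ with ring of integers $\mathcal{O}_F$. For $\alpha\in\mathbb{Z}_2^\times$, $[\alpha]=\langle\alpha,\mathbb{Z}_2^{\times2}\rangle$ is the subgroup of $\mathbb{Z}_2^\times$ generated by $\alpha$ and the squares; $\{1,-1,3,5\}$ represents $\mathbb{Z}_2^\times/\mathbb{Z}_2^{\times2}$. $\mathcal{K}=\bigcup_k\mathbb{Q}[\zeta_{2^k}]$, with $\zeta_n$ a primitive $n$-th root of unity. $\psi:F\to\mathcal{K}^\times$ is a non-trivial smooth character. Weil representation. Let $(W,\langle\ ,\ \rangle)$ be a nonzero symplectic $F$-vector space with a complete polarisation $W=X\oplus Y$ (transverse Lagrangians). The Heisenberg group is $H=W\times F$ with law $(w,t)(w',t')=(w+w',t+t'+\frac12\langle w,w'\rangle)$; $\mathrm{Sp}(W)$ acts by $g\cdot(w,t)=(gw,t)$. The Heisenberg representation $\rho_\psi$ is realised on $C_c^\infty(Y,\mathcal{K})$ by $\rho_\psi(x+y,t)f(y')=\psi(t)\psi(\langle y',x\rangle+\frac12\langle y,x\rangle)f(y'+y)$. The metaplectic group $\mathrm{Mp}(W)=\mathrm{Sp}(W)\times_{c_X}\{\pm1\}$ is, up to isomorphism, the non-trivial topological double cover of $\mathrm{Sp}(W)$. The Weil representation $\omega_{\psi,X}$ is the smooth representation of $\mathrm{Mp}(W)$ on $C_c^\infty(Y,\mathcal{K})$ characterised by: the central element $-1$ acts by $-1$; $\omega_{\psi,X}(\tilde g)\rho_\psi(h)\omega_{\psi,X}(\tilde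 g)^{-1}=\rho_\psi(g\cdot h)$ for $\tilde g$ above $g\in\mathrm{Sp}(W)$ and $h\in H$; and $(n,1)$ above $n\in N(X)$ (unipotent radical of the stabiliser of $X$, which lifts to $\mathrm{Mp}(W)$) acts by $f(y)\mapsto\psi(\frac12\langle by,y\rangle)f(y)$ with $b=(n-\mathrm{id}_W)|_Y:Y\to X$. The odd part $\omega_{\psi,X}^-$ is its restriction to the odd functions on $Y$; it is admissible and absolutely irreducible. Fields. For an admissible, finitely generated, absolutely irreducible smooth representation $V$ of a locally profinite group $G$ over an algebraic extension $R$ of $R_0$, the character field $R(V)$ is the subfield of $R$ generated by $R_0$ and the traces on $V$ of the elements of the Hecke algebra $C_c^\infty(G,R_0)$; it equals the fixed field of $\{\sigma\in\mathrm{Aut}(R):V^\sigma\simeq V\}$, where $V^\sigma$ is the twist of $V$ by $\sigma$. A subfield $R'$ of an algebraic closure $\bar R$ of $R$ is a field of realisation of $V$ ($V$ can be realised over $R'$) if there is a smooth representation $V'$ of $G$ over $R'$ with $V'\otimes_{R'}\bar R\simeq V\otimes_R\bar R$. The Schur index $m(V)$ is the infimum of the degrees $[R':R(V)]$ over the fields of realisation $R'$ of $V$. *)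

(* Defs.v *)
From HB Require Import structures.
From mathcomp Require Import all_boot all_order all_algebra all_field sesquilinear.
From mathcomp Require Import all_classical topology.
From mathcomp Require Import zify ring.

Set Implicit Arguments.
Unset Strict Implicit.
Unset Printing Implicit Defensive.
Import Order.TTheory GRing.Theory Num.Theory.
Local Open Scope classical_set_scope.
Local Open Scope ring_scope.

(* The ring Z_2 as the inverse limit of the Z/2^n: x n is the representative in
   [0, 2^n) of the residue class of x modulo 2^n. *)
Definition Z2_coherent : pred (nat -> int) :=
  fun x => `[< forall n, x n = (x n.+1 %% 2 ^+ n)%Z >].
Record Z2 := Z2_of { Z2_val : nat -> int; _ : Z2_coherent Z2_val }.
HB.instance Definition _ := [isSub for Z2_val].
HB.instance Definition _ := [Choice of Z2 by <:].

Section Z2Ring.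
Implicit Types x y z : Z2.

Lemma Z2_step x n : Z2_val x n = (Z2_val x n.+1 %% 2 ^+ n)%Z.
Proof. by case: x => x /= /asboolP. Qed.

Lemma Z2_mod x n : (Z2_val x n %% 2 ^+ n)%Z = Z2_val x n.
Proof. by rewrite Z2_step modz_mod. Qed.

Lemma Z2_eq x y : Z2_val x =1 Z2_val y -> x = y.
Proof. by move=> xy; apply/val_inj/funext. Qed.

Lemma Z2_mk_subproof (f : nat -> int) :
  (forall n, (f n = f n.+1 %[mod 2 ^+ n])%Z) ->
  Z2_coherent (fun n => (f n %% 2 ^+ n)%Z).
Proof.
move=> fP; apply/asboolP => n; rewrite fP; apply/eqP; rewrite eq_sym eqz_mod_dvd.
rewrite {2}(divz_eq (f n.+1) (2 ^+ n.+1)) opprD addrC addrNK rpredN.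
by apply/dvdz_mull/dvdz_exp2l.
Qed.

Definition Z2_mk f fP : Z2 := Z2_of (@Z2_mk_subproof f fP).

Lemma Z2_cst_subproof (m : int) : forall n : nat, (m = m %[mod 2 ^+ n])%Z.
Proof. by []. Qed.
Lemma Z2_add_subproof x y n :
  (Z2_val x n + Z2_val y n = Z2_val x n.+1 + Z2_val y n.+1 %[mod 2 ^+ n])%Z.
Proof. by rewrite (Z2_step x) (Z2_step y) modzDm. Qed.
Lemma Z2_opp_subproof x n : (- Z2_val x n = - Z2_val x n.+1 %[mod 2 ^+ n])%Z.
Proof. by rewrite (Z2_step x) modzNm. Qed.
Lemma Z2_mul_subproof x y n :
  (Z2_val x n * Z2_val y n = Z2_val x n.+1 * Z2_val y n.+1 %[mod 2 ^+ n])%Z.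
Proof. by rewrite (Z2_step x) (Z2_step y) modzMm. Qed.

Definition Z2_cst m := Z2_mk (Z2_cst_subproof m).
Definition Z2_add x y := Z2_mk (Z2_add_subproof x y).
Definition Z2_opp x := Z2_mk (Z2_opp_subproof x).
Definition Z2_mul x y := Z2_mk (Z2_mul_subproof x y).

Lemma Z2_addA : associative Z2_add.
Proof. by move=> x y z; apply: Z2_eq => n /=; rewrite modzDml modzDmr addrA. Qed.
Lemma Z2_addC : commutative Z2_add.
Proof. by move=> x y; apply: Z2_eq => n /=; rewrite addrC. Qed.
Lemma Z2_add0 : left_id (Z2_cst 0) Z2_add.
Proof. by move=> x; apply: Z2_eq => n /=; rewrite modzDml add0r Z2_mod. Qed.
Lemma Z2_addN : left_inverse (Z2_cst 0) Z2_opp Z2_add.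
Proof. by move=> x; apply: Z2_eq => n /=; rewrite modzDml addNr. Qed.
Lemma Z2_mulA : associative Z2_mul.
Proof. by move=> x y z; apply: Z2_eq => n /=; rewrite modzMml modzMmr mulrA. Qed.
Lemma Z2_mulC : commutative Z2_mul.
Proof. by move=> x y; apply: Z2_eq => n /=; rewrite mulrC. Qed.
Lemma Z2_mul1 : left_id (Z2_cst 1) Z2_mul.
Proof. by move=> x; apply: Z2_eq => n /=; rewrite modzMml mul1r Z2_mod. Qed.
Lemma Z2_mulDl : left_distributive Z2_mul Z2_add.
Proof. by move=> x y z; apply: Z2_eq => n /=; rewrite modzMml modzDm mulrDl. Qed.
Lemma Z2_1neq0 : Z2_cst 1 != Z2_cst 0.
Proof. by apply/eqP => /(congr1 (fun x => Z2_val x 1)). Qed.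

HB.instance Definition _ :=
  GRing.isZmodule.Build Z2 Z2_addA Z2_addC Z2_add0 Z2_addN.
HB.instance Definition _ := GRing.Zmodule_isComNzRing.Build Z2
  Z2_mulA Z2_mulC Z2_mul1 Z2_mulDl Z2_1neq0.

Definition Z2_unit : pred Z2 := fun x => `[< exists y, y * x = 1 >].
Definition Z2_inv x :=
  if pselect (exists y, y * x = 1) is left e then projT1 (cid e) else x.

Lemma Z2_mulVx : {in Z2_unit, left_inverse 1 Z2_inv *%R}.
Proof.
move=> x /asboolP xu; rewrite /Z2_inv; case: pselect => // e.
by case: (cid e).
Qed.
Lemma Z2_unitPl x y : y * x = 1 -> Z2_unit x.
Proof. by move=> yx; apply/asboolP; exists y. Qed.
Lemma Z2_inv_out : {in [predC Z2_unit], Z2_inv =1 id}.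
Proof.
by move=> x /negP xNu; rewrite /Z2_inv; case: pselect => // e; case: xNu; apply/asboolP.
Qed.
HB.instance Definition _ :=
  GRing.ComNzRing_hasMulInverse.Build Z2 Z2_mulVx Z2_unitPl Z2_inv_out.

Lemma Z2_eqmod x m k : (Z2_val x (m + k)%N = Z2_val x m %[mod 2 ^+ m])%Z.
Proof.
elim: k => [|k IH]; first by rewrite addn0.
rewrite -IH [X in _ = (X %% _)%Z]Z2_step addnS; apply/eqP; rewrite eqz_mod_dvd.
rewrite {1}(divz_eq (Z2_val x (m + k).+1) (2 ^+ (m + k))) addrK.
by apply/dvdz_mull/dvdz_exp2l; rewrite leq_addr.
Qed.

Lemma Z2_neq0 x : x != 0 -> exists n, forall k, ~~ (2 ^+ n %| Z2_val x (n + k)%N)%Z.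
Proof.
move=> x0; apply: contrapT => H; case/negP: x0; apply/eqP/Z2_eq => n /=.
rewrite mod0z -Z2_mod; apply: contrapT => xn; apply: H; exists n => k.
by apply/negP => /dvdz_mod0P; rewrite Z2_eqmod.
Qed.

Lemma Z2_integral : forall x y, x * y = 0 -> (x == 0) || (y == 0).
Proof.
move=> x y xy0; case: eqVneq => //= /Z2_neq0[n xn]; apply: contrapT => /negP.
move=> /Z2_neq0[m ym]; move: (xn m) (ym n); rewrite (addnC m n).
have := congr1 (fun z => Z2_val z (n + m)%N) xy0; rewrite /= mod0z.
move=> /dvdz_mod0P; set a := Z2_val x _; set b := Z2_val y _.
have E k : `|2 ^+ k : int|%N = (2 ^ k)%N by rewrite abszX.
rewrite !dvdzE abszM !E => dab.
have [a0|a0] := posnP (absz a); first by rewrite a0 dvdn0.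
have [b0|b0] := posnP (absz b); first by rewrite b0 dvdn0.
have V (k z : nat) (z0 : (0 < z)%N) : (2 ^ k %| z)%N = (k <= logn 2 z)%N.
  exact: (pfactor_dvdn k (isT : prime 2) z0).
move: dab; rewrite !V ?muln_gt0 ?a0 ?b0 // lognM //.
lia.
Qed.
HB.instance Definition _ := GRing.ComUnitRing_isIntegral.Build Z2 Z2_integral.
End Z2Ring.

Notation Q2 := {fraction Z2}.

Section TwoAdicField.
Variable F : fieldExtType Q2.

Definition Z2_to : Z2 -> F := in_alg F \o @FracField.tofrac Z2.
HB.instance Definition _ := GRing.RMorphism.copy Z2_to (in_alg F \o @FracField.tofrac Z2).

Definition ring_of_integers : set F := [set x | integralOver Z2_to x].
Local Notation O_F := ring_of_integers.

Lemma Z2_to_eq0 (a : Z2) : (Z2_to a == 0) = (a == 0).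
Proof. by rewrite -(tofrac_eq0 a) -(fmorph_eq0 (in_alg F)). Qed.

Lemma integer_Z2 (a : Z2) : O_F (Z2_to a). Proof. exact: integral_id. Qed.
Lemma integer0 : O_F 0. Proof. exact: integral0. Qed.
Lemma integer1 : O_F 1. Proof. exact: integral1. Qed.
Lemma integerD x y : O_F x -> O_F y -> O_F (x + y).
Proof. exact: integral_add. Qed.
Lemma integerN x : O_F x -> O_F (- x).
Proof. exact: integral_opp. Qed.
Lemma integerM x y : O_F x -> O_F y -> O_F (x * y).
Proof. exact: integral_mul. Qed.

Lemma integerX x n : O_F x -> O_F (x ^+ n).
Proof.
by move=> xO; elim: n => [|n IH]; rewrite ?exprS //; [exact: integer1|exact: integerM].
Qed.

Lemma frac_denom (q : Q2) : exists2 d : Z2, d != 0 &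
  exists n : Z2, FracField.tofrac d * q = FracField.tofrac n.
Proof.
elim/quotW: q => r; exists r.2; first exact: denom_ratioP.
exists r.1; unlock FracField.tofrac; rewrite !piE; apply/eqmodP.
rewrite /= FracField.equivfE /FracField.mulf !numden_Ratio ?mulf_neq0 ?oner_eq0 ?denom_ratioP //.
by rewrite mulr1 mul1r.
Qed.

(* Every family of elements of F has a common non-zero denominator in O_F *)
Lemma common_denom (I : finType) (x : I -> F) :
  (forall i, exists c : F, [/\ c != 0, O_F c & O_F (c * x i)]) ->
  exists c : F, [/\ c != 0, O_F c & forall i, O_F (c * x i)].
Proof.
move=> /choice[c cP]; exists (\prod_i c i); split.
- by apply/prodf_neq0 => i _; case: (cP i).
- by apply: big_ind => [||i _]; [exact: integer1|exact: integerM|case: (cP i)].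
move=> i; rewrite (bigD1 i) //= mulrAC; apply: integerM; first by case: (cP i).
by apply: big_ind => [||j _]; [exact: integer1|exact: integerM|case: (cP j)].
Qed.

Lemma integer_denom (x : F) : exists c : F, [/\ c != 0, O_F c & O_F (c * x)].
Proof.
set p := minPoly 1%VS x.
have p_mon : p \is monic := monic_minPoly _ _.
have [q pq] : exists q, p = map_poly (in_alg F) q by apply/polyOver1P/minPolyOver.
have [i|c [c0 cO cP]] := @common_denom 'I_(size p) (fun i => p`_i).
  have [d d0 [n dn]] := frac_denom q`_i; exists (Z2_to d).
  rewrite Z2_to_eq0 d0; split=> //; first exact: integer_Z2.
  have -> : Z2_to d * p`_i = Z2_to n; last exact: integer_Z2.
  have -> : p`_i = in_alg F q`_i by have := coef_map (in_alg F) q i; rewrite -pq.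
  by rewrite -[LHS](rmorphM (in_alg F)) dn.
exists c; split=> //; have sp : (size p = (size p).-1.+1)%N.
  by rewrite prednK // lt0n size_poly_eq0 monic_neq0.
set d := (size p).-1 in sp.
pose r := \poly_(i < d.+1) (c ^+ (d - i) * p`_i).
have rd : r`_d = 1.
  by rewrite coef_poly ltnSn subnn mul1r; move/monicP: p_mon.
have sr : size r = d.+1 by rewrite size_poly_eq // subnn mul1r -/(lead_coef p) (monicP p_mon) oner_eq0.
apply: (@integral_root_monic _ _ Z2_to _ r).
- by rewrite monicE lead_coefE sr rd.
- rewrite /root horner_poly.
  have -> : \sum_(i < d.+1) c ^+ (d - i) * p`_i * (c * x) ^+ i = c ^+ d * p.[x].
    rewrite horner_coef sp mulr_sumr; apply: eq_bigr => i _.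
    have dE : c ^+ d = c ^+ (d - i) * c ^+ i by rewrite -exprD subnK // -ltnS.
    by rewrite dE exprMn mulrACA.
  by have /eqP-> := root_minPoly 1%VS x; rewrite mulr0.
apply/integral_poly => i; rewrite coef_poly; case: ltnP => [|_]; last exact: integer0.
rewrite ltnS leq_eqVlt => /predU1P[->|lid].
  by rewrite subnn mul1r -/(lead_coef p) (monicP p_mon); exact: integer1.
rewrite -(subnSK lid) exprSr -mulrA; apply: integerM; first exact: integerX.
by have li : (i < size p)%N; [rewrite sp ltnS ltnW|exact: (cP (Ordinal li))].
Qed.
End TwoAdicField.

Section LinearTopology.
Variables (F : fieldExtType Q2) (V : vectType F).
Implicit Types (U : set V) (c : F).
Local Notation O_F := (@ring_of_integers F).

(* F is locally compact with the c O_F, 0 != c in O_F, as a basis of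
   neighbourhoods of 0; the natural topology of a finite-dimensional F-vector
   space is the product topology in the coordinates of a basis (it does not
   depend on the basis). *)
Definition lattice c : set V :=
  [set w | forall i, [set c * a | a in O_F] (coord (vbasis {:V}) i w)].

Definition linear_open U := forall u, U u ->
  exists c, [/\ c != 0, O_F c & forall w, lattice c w -> U (u + w)].

Lemma latticeM c d : O_F d -> lattice (c * d) `<=` lattice c.
Proof.
move=> dO w wL i; have [a aO <-] := wL i; exists (d * a); first exact: integerM.
by rewrite mulrA.
Qed.

Lemma latticeD c w w' : lattice c w -> lattice c w' -> lattice c (w + w').
Proof.
move=> wL wL' i; have [a aO E] := wL i; have [b bO E'] := wL' i.
by exists (a + b); [exact: integerD|rewrite mulrDr E E' linearD].
Qed.

Lemma lattice0 c : lattice c 0.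
Proof. by move=> i; exists 0; [exact: integer0|rewrite mulr0 linear0]. Qed.

Lemma linear_openT : linear_open setT.
Proof.
by move=> u _; exists 1; split=> //; [exact: oner_neq0|exact: integer1].
Qed.

Lemma linear_openI : setI_closed linear_open.
Proof.
move=> A B oA oB u [/oA[c [c0 cO cA]] /oB[d [d0 dO dB]]].
exists (c * d); split; [by rewrite mulf_neq0|exact: integerM|].
move=> w wL; split; first by apply: cA; exact: latticeM dO _ wL.
by apply: dB; move: wL; rewrite mulrC; exact: latticeM.
Qed.

Lemma linear_open_bigU (I : Type) (f : I -> set V) :
  (forall i, linear_open (f i)) -> linear_open (\bigcup_i f i).
Proof.
move=> fo u [i _ /fo[c [c0 cO cf]]]; exists c; split=> // w wL.
by exists i => //; apply: cf.
Qed.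

(* Alias of V carrying this topology; algebraic operations are those of V.
   F itself is topologised as the F-vector space F^o. *)
Definition ltop : Type := V.
HB.instance Definition _ := Choice.copy ltop V.
HB.instance Definition _ := isOpenTopological.Build ltop
  linear_openT linear_openI linear_open_bigU.
End LinearTopology.

Section LinearTopologyTheory.
Variables (F : fieldExtType Q2).
Local Notation O_F := (@ring_of_integers F).

Lemma ltop_openE (V : vectType F) (U : set (ltop V)) : open U = @linear_open F V U.
Proof. by []. Qed.

Lemma nbhs_ltopP (V : vectType F) (u : ltop V) (A : set (ltop V)) :
  nbhs u A <-> exists c : F, [/\ c != 0, O_F c & forall w : V, lattice c w -> A (u + w)].
Proof.
split=> [|[c [c0 cO cA]]].
  by rewrite nbhsE => -[B [/[apply] [[c [c0 cO cB]]]] BA]; exists c; split=> // w /cB /BA.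
rewrite nbhsE; exists [set v | exists2 w : V, lattice c w & v = u + w]; last first.
  by move=> _ [w wL ->]; exact: cA.
split; last by exists 0; [exact: lattice0|rewrite addr0].
move=> _ [w wL ->]; exists c; split=> // w' wL'; exists (w + w'); last by rewrite addrA.
exact: latticeD.
Qed.

Lemma linear_continuous (V V' : vectType F) (L : {linear V -> V'}) :
  continuous (L : ltop V -> ltop V').
Proof.
move=> u A /= /nbhs_ltopP[c [c0 cO cA]]; apply/nbhs_ltopP.
pose x (ij : 'I_(\dim {:V}) * 'I_(\dim {:V'})) : F :=
  coord (vbasis {:V'}) ij.2 (L (vbasis {:V})`_ij.1).
have [ij|d [d0 dO dx]] := @common_denom F _ x; first exact: integer_denom.
exists (c * d); split; [by rewrite mulf_neq0|exact: integerM|] => w wL /=.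
rewrite linearD; apply: cA => j.
have /choice[a aP] : forall i, exists a, O_F a /\ c * d * a = coord (vbasis {:V}) i w.
  by move=> i; have [a aO aE] := wL i; exists a.
exists (\sum_i d * x (i, j) * a i).
  apply: big_ind => [||i _]; [exact: integer0|exact: integerD|].
  by apply: integerM => //; case: (aP i).
rewrite [in RHS](coord_vbasis (memvf w)) !linear_sum mulr_sumr; apply: eq_bigr => i _.
by rewrite !linearZ /= -(aP i).2 /x /= (mulrAC d) !mulrA.
Qed.

Lemma translation_continuous (V : vectType F) (v : V) :
  continuous (fun u : ltop V => u + v : ltop V).
Proof.
move=> u A /= /nbhs_ltopP[c [c0 cO cA]]; apply/nbhs_ltopP; exists c; split=> // w wL.
by rewrite /= addrAC; exact: cA.
Qed.
End LinearTopologyTheory.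

(* C_c^oo(T, K). The set where a locally constant function does not vanish is
   closed, so it is the support. *)
Section CompactlySupported.
Variables (T : topologicalType) (K : fieldType).
Implicit Types f g : T -> K^o.

Definition locally_constant f := forall x, \forall y \near x, f y = f x.

Definition is_Cc : {pred (T -> K^o)} :=
  fun f => `[< locally_constant f /\ compact [set x | f x != 0] >].

Record Cc := Cc_of { Cc_val :> T -> K^o; _ : is_Cc Cc_val }.
HB.instance Definition _ := [isSub for Cc_val].
HB.instance Definition _ := [Choice of Cc by <:].

Lemma CcP (f : Cc) : locally_constant f /\ compact [set x | f x != 0].
Proof. by case: f => f /= /asboolP. Qed.

Lemma closed_support f : locally_constant f -> closed [set x | f x != 0].
Proof.
move=> fl; rewrite -openC openE => x /= fx; apply: filterS (fl x) => y /= ->.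
by [].
Qed.

Lemma Cc_submod_closed : submod_closed is_Cc.
Proof.
split.
  apply/asboolP; split; first by move=> x; near=> y.
  rewrite (_ : [set x | _] = set0); first exact: compact0.
  by apply/seteqP; split=> // x /=; rewrite eqxx.
move=> a f g /asboolP[fl fc] /asboolP[gl gc]; apply/asboolP.
have hl : locally_constant (a *: f + g).
  move=> x; move: (fl x) (gl x); apply: filterS2 => y fy gy.
  by rewrite !fctE fy gy.
split=> //; apply: subclosed_compact (closed_support hl) (compactU fc gc) _.
move=> x /=; rewrite !fctE; case: (eqVneq (f x) 0) => [->|]; last by left.
by rewrite scaler0 add0r; right.
Unshelve. all: by end_near. Qed.

HB.instance Definition _ := GRing.isSubmodClosed.Build K (T -> K^o) is_Cc Cc_submod_closed.
HB.instance Definition _ := [SubChoice_isSubLmodule of Cc by <:].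
End CompactlySupported.

(* Q[z] *)
Definition Qadj (z : algC) : set algC :=
  [set (map_poly ratr p).[z] | p in [set: {poly rat}]].

Lemma Qadj_horner z (p : {poly rat}) x :
  Qadj z x -> Qadj z (map_poly ratr p).[x].
Proof.
move=> [q _ <-]; exists (p \Po q) => //.
by rewrite map_comp_poly horner_comp.
Qed.

Lemma QadjB z x y : Qadj z x -> Qadj z y -> Qadj z (x - y).
Proof.
by move=> [p _ <-] [q _ <-]; exists (p - q) => //; rewrite rmorphB hornerD hornerN.
Qed.

Lemma QadjM z x y : Qadj z x -> Qadj z y -> Qadj z (x * y).
Proof.
by move=> [p _ <-] [q _ <-]; exists (p * q) => //; rewrite rmorphM hornerM.
Qed.

Lemma QadjV z x : Qadj z x -> Qadj z x^-1.
Proof.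
have [-> z0|x0 zx] := eqVneq x 0; first by rewrite invr0.
have [p [_ p_mon] pP] := minCpolyP x.
have px : root (map_poly ratr p) x by rewrite pP.
have p0 : p`_0 != 0.
  apply/eqP => p00; pose q := p %/ 'X.
  have pE : p = q * 'X.
    by apply/eqP; rewrite -dvdp_eq -['X]subr0 dvdp_XsubCl rootE horner_coef0 p00.
  have qx : root (map_poly ratr q) x.
    by move: px; rewrite pE rmorphM /= map_polyX rootM rootX (negPf x0) orbF.
  have q0 : q != 0 by apply: contraTneq p_mon => q0; rewrite pE q0 mul0r monicE lead_coef0 eq_sym oner_eq0.
  rewrite pP in qx; have := dvdp_leq q0 qx.
  by rewrite pE size_mulX // ltnn.
have [q pE] : exists q, p = q * 'X + (p`_0)%:P.
  exists (p %/ 'X); rewrite {1}(divp_eq p 'X); congr (_ + _).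
  by rewrite -['X]subr0 modp_XsubC horner_coef0.
have qxE : (map_poly ratr q).[x] * x = - ratr p`_0.
  move: px; rewrite {1}pE rmorphD rmorphM /= map_polyX map_polyC /= rootE.
  by rewrite hornerD hornerM hornerX hornerC addr_eq0 => /eqP.
have -> : x^-1 = (map_poly ratr (- (p`_0)^-1 *: q)).[x].
  apply: (mulIf x0); rewrite mulVf // map_polyZ hornerZ -mulrA qxE.
  by rewrite rmorphN fmorphV mulrNN mulVf // fmorph_eq0.
exact: Qadj_horner.
Qed.

Lemma Qadj_sub z z' : Qadj z' z -> Qadj z `<=` Qadj z'.
Proof. by move=> zz' _ [p _ <-]; exact: Qadj_horner. Qed.

Lemma QadjX (z : algC) n : Qadj z (z ^+ n).
Proof. by exists 'X^n => //; rewrite map_polyXn hornerXn. Qed.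

Definition cyclotomic2 : {pred algC} := fun x =>
  `[< exists k z, (2 ^ k).-primitive_root z /\ Qadj z x >].

Lemma cyclotomic2_join x y : x \in cyclotomic2 -> y \in cyclotomic2 ->
  exists k z, [/\ (2 ^ k).-primitive_root z, Qadj z x & Qadj z y].
Proof.
have H k l (z w : algC) : (k <= l)%N -> (2 ^ k).-primitive_root z ->
    (2 ^ l).-primitive_root w -> Qadj z `<=` Qadj w.
  move=> kl zP wP; apply: Qadj_sub.
  have z1 : z ^+ (2 ^ l) = 1 by rewrite -(subnKC kl) expnD exprM (prim_expr_order zP) expr1n.
  by have [i ->] := prim_rootP wP z1; exact: QadjX.
move=> /asboolP[k [z [zP zx]]] /asboolP[l [w [wP wy]]].
have [kl|/ltnW lk] := leqP k l.
  by exists l, w; split=> //; apply: (H k l z w).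
by exists k, z; split=> //; apply: (H l k w z).
Qed.

Lemma cyclotomic2_divring : divring_closed cyclotomic2.
Proof.
split.
- have [z zP] := @C_prim_root_exists (2 ^ 0) isT.
  by apply/asboolP; exists 0%N, z; split=> //; rewrite -(expr0 z); exact: QadjX.
- move=> x y /cyclotomic2_join /[apply] -[k [z [zP zx zy]]]; apply/asboolP.
  by exists k, z; split=> //; exact: QadjB.
move=> x y /cyclotomic2_join /[apply] -[k [z [zP zx zy]]]; apply/asboolP.
by exists k, z; split=> //; apply: QadjM => //; exact: QadjV.
Qed.
HB.instance Definition _ :=
  GRing.isDivringClosed.Build algC cyclotomic2 cyclotomic2_divring.

(* The union of the Q[zeta_(2^k)], with algC as its algebraic closure *)
Record Kcyc := Kcyc_of { Kcyc_val : algC; _ : Kcyc_val \in cyclotomic2 }.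
HB.instance Definition _ := [isSub for Kcyc_val].
HB.instance Definition _ := [Choice of Kcyc by <:].
HB.instance Definition _ := [SubChoice_isSubComUnitRing of Kcyc by <:].
HB.instance Definition _ := [SubComUnitRing_isSubIntegralDomain of Kcyc by <:].
HB.instance Definition _ := [SubIntegralDomain_isSubField of Kcyc by <:].
HB.instance Definition _ := GRing.RMorphism.copy Kcyc_val (\val : Kcyc -> algC).

Record smooth_character (F : fieldExtType Q2) (K : fieldType) := SmoothCharacter {
  char_fun :> F -> K;
  char_neq0 : forall t, char_fun t != 0;
  charD : forall s t, char_fun (s + t) = char_fun s * char_fun t;
  char_smooth : locally_constant (char_fun : ltop (F^o : vectType F) -> K^o) }.

Definition nontrivial_character (F : fieldExtType Q2) (K : fieldType)
  (psi : smooth_character F K) := exists t, psi t != 1.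

Definition complete_polarisation (F : fieldType) (W : vectType F)
    (form : {skew_symmetric W}) (X Y : {vspace W}) :=
  [/\ orthov form X = X, orthov form Y = Y,
      (X :&: Y = 0)%VS & (X + Y = fullv)%VS].

Lemma two_neq0 (F : fieldExtType Q2) : 2 != 0 :> F.
Proof.
have -> : 2 = Z2_to F 2 by rewrite rmorphD rmorph1.
rewrite Z2_to_eq0; apply/eqP => /(congr1 (fun x => Z2_val x 2)).
by [].
Qed.

Lemma heisenberg_cocycle (K : fieldType) (t t' a b c d e g : K) : 2 != 0 :> K ->
  t + t' + 2^-1 * (a - b) + (c + d + 2^-1 * (e + b + (a + g))) =
  t + (c + 2^-1 * e) + t' + (d + a + 2^-1 * g).
Proof. by move=> ?; field. Qed.

Section HeisenbergRepresentation.
Variables (F : fieldExtType Q2) (K : fieldType) (W : vectType F).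
Variables (form : {skew_symmetric W}) (X Y : {vspace W}).
Variable psi : smooth_character F K.
Local Notation "<< u , v >>" := (form u v).

Definition heisenberg : Type := W * F.
Definition heisenberg_mul (h k : heisenberg) : heisenberg :=
  (h.1 + k.1, h.2 + k.2 + 2^-1 * << h.1, k.1 >>).

Notation SY := (Cc (ltop (subvs_of Y)) K).

(* rho_psi(x + y, t), where w = h.1 is decomposed as x + y along X (+) Y *)
Definition heisenberg_rep_fun (h : heisenberg) (f : ltop (subvs_of Y) -> K^o) :
    ltop (subvs_of Y) -> K^o := fun y' : subvs_of Y =>
  let x := daddv_pi X Y h.1 in let y := daddv_pi Y X h.1 in
  psi h.2 * psi (<< vsval y', x >> + 2^-1 * << y, x >>) * f (y' + vsproj Y y).

Lemma heisenberg_rep_fun_Cc h (f : SY) : is_Cc (heisenberg_rep_fun h f).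
Proof.
have [fl fc] := CcP f; rewrite /heisenberg_rep_fun.
set x := daddv_pi X Y h.1; set y := daddv_pi Y X h.1.
have shift_cont := @translation_continuous F (subvs_of Y).
apply/asboolP; split.
  move=> u.
  have phi_lin : linear (fun z : subvs_of Y => << vsval z, x >> : F^o).
    by move=> a z z'; rewrite linearP /= linearDl linearZl.
  pose phi : {linear subvs_of Y -> F^o} :=
    HB.pack (fun z : subvs_of Y => << vsval z, x >> : F^o)
      (GRing.isLinear.Build F (subvs_of Y) F^o _ _ phi_lin).
  have phi_cont := @linear_continuous F _ _ phi.
  have N1 : \forall z \near u, psi (phi z + 2^-1 * << y, x >>) = psi (phi u + 2^-1 * << y, x >>).
    apply: (phi_cont u [set z | psi (z + _) = psi (phi u + _)]).
    exact: (@translation_continuous F F^o (2^-1 * << y, x >>) _ _ (char_smooth psi _)).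
  have N2 : \forall z \near u, f (z + vsproj Y y) = f (u + vsproj Y y).
    exact: shift_cont (vsproj Y y) u _ (fl _).
  by move: N1 N2; apply: filterS2 => z /= -> ->.
rewrite (_ : [set z | _] = (fun z : ltop (subvs_of Y) => z - vsproj Y y : ltop (subvs_of Y)) @` [set z | f z != 0]).
  by apply: continuous_compact fc; apply: continuous_subspaceT; exact: shift_cont.
apply/seteqP; split=> [z /=|_ /= [z fz <-]].
  rewrite !mulf_eq0 !negb_or => /andP[_ fz]; exists (z + vsproj Y y) => //.
  by rewrite addrK.
by rewrite !mulf_neq0 ?char_neq0 // subrK.
Qed.

Definition heisenberg_rep h (f : SY) : SY := Cc_of (heisenberg_rep_fun_Cc h f).

Lemma heisenberg_repM h k f : complete_polarisation form X Y ->
  heisenberg_rep (heisenberg_mul h k) f = heisenberg_rep h (heisenberg_rep k f).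
Proof.
move=> [oX oY XY0 XYW]; apply/val_inj/funext => u /=; rewrite /heisenberg_rep_fun /=.
have dec w : w = daddv_pi X Y w + daddv_pi Y X w.
  by rewrite daddv_pi_add // XYW memvf.
have vX w : daddv_pi X Y w \in orthov form X by rewrite oX memv_pi.
have vY w : daddv_pi Y X w \in orthov form Y by rewrite oY memv_pi.
have /(_ _)/mem_orthovP/(_ _ (memv_pi X Y _)) XX := vX.
have /(_ _)/mem_orthovP/(_ _ (memv_pi Y X _)) YY := vY.
rewrite !(linearD (daddv_pi _ _)) vsprojK ?memv_pi //.
have -> : u + vsproj Y (daddv_pi Y X h.1 + daddv_pi Y X k.1) =
    u + vsproj Y (daddv_pi Y X h.1) + vsproj Y (daddv_pi Y X k.1).
  by rewrite (linearD (vsproj Y)) addrA.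
rewrite !mulrA; congr (_ * _).
have E : << h.1, k.1 >> = << daddv_pi Y X h.1, daddv_pi X Y k.1 >> -
   << daddv_pi Y X k.1, daddv_pi X Y h.1 >>.
  rewrite {1}(dec h.1) {1}(dec k.1) linearDl !linearDr /= XX YY add0r addr0 addrC.
  by congr (_ + _); rewrite hermC /= expr1 mulN1r.
rewrite -!charD; congr (psi _); rewrite E !linearDr /= !linearDl.

exact: heisenberg_cocycle (two_neq0 F).
Qed.
End HeisenbergRepresentation.

HB.mixin Record isTopGroup T & monoid.Group T & Topological T := {
  mulg_continuous : continuous (fun gh : T * T => (gh.1 * gh.2)%g);
  invg_continuous : continuous (fun g : T => (g^-1)%g) }.

#[short(type="topGroupType")]
HB.structure Definition TopGroup :=
  {T of monoid.Group T & Topological T & isTopGroup T}.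

Section Representations.
Variable G : topGroupType.

Record representation (R : fieldType) (V : lmodType R) (pi : G -> V -> V) : Prop := {
  rep_linear : forall g, linear (pi g);
  rep1 : forall v, pi 1%g v = v;
  repM : forall g h v, pi (g * h)%g v = pi g (pi h v) }.

Definition smooth_rep (R : fieldType) (V : lmodType R) (pi : G -> V -> V) : Prop :=
  representation pi /\ forall v, open [set g | pi g v = v].

Definition compact_open_subgroup (U : set G) : Prop :=
  [/\ compact U, open U, U 1%g & forall g h, U g -> U h -> U (g^-1 * h)%g].

(* A rational-valued left Haar measure on a locally profinite group; only its
   values on compact open sets matter *)
Definition left_Haar_measure (mu : set G -> rat) : Prop :=
  [/\ forall (g : G) (A : set G), compact A -> open A -> mu [set (g * a)%g | a in A] = mu A,
      forall A B : set G, compact A -> open A -> compact B -> open B ->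
        A `&` B = set0 -> mu (A `|` B) = mu A + mu B &
      forall A : set G, compact A -> open A -> A !=set0 -> 0 < mu A].

(* s represents without repetition a finite family of left cosets x U that
   covers D *)
Definition coset_cover (U D : set G) (s : seq G) : Prop :=
  [/\ uniq s, {in s &, forall x y, U (x^-1 * y)%g -> x = y} &
      forall g, D g -> exists2 x, x \in s & U (x^-1 * g)%g].

(* T v is the integral over G of phi(g) pi(g) v. If U fixes v and phi is right
   U-invariant, the integrand is constant on the cosets x U, which have measure
   mu U, so that the integral is the finite sum below. *)
Definition hecke_operator (mu : set G -> rat) (R : fieldType) (V : lmodType R)
    (pi : G -> V -> V) (phi : Cc G rat) (T : V -> V) : Prop :=
  forall (v : V) (U : set G) (s : seq G), compact_open_subgroup U ->
    (forall u, U u -> pi u v = v) ->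
    (forall g u, U u -> phi (g * u)%g = phi g) ->
    coset_cover U [set g | phi g != 0] s ->
    T v = \sum_(x <- s) ratr (mu U * phi x) *: pi x v.

(* The trace of an endomorphism of finite rank, computed on a finite-dimensional
   subspace (with basis e) that contains its image *)
Definition has_trace (R : fieldType) (V : lmodType R) (T : V -> V) (t : R) : Prop :=
  exists n (e : 'I_n -> V) (M : 'M[R]_n),
    [/\ forall c : 'I_n -> R, \sum_i c i *: e i = 0 -> forall i, c i = 0,
        forall v, exists c : 'I_n -> R, T v = \sum_i c i *: e i,
        forall j, T (e j) = \sum_i M i j *: e i & t = \tr M].

Definition hecke_traces (R : fieldType) (V : lmodType R) (pi : G -> V -> V) : set R :=
  [set t | exists mu phi T,
    [/\ left_Haar_measure mu, hecke_operator mu pi phi T & has_trace T t]].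

Definition is_subfield (R : fieldType) (E : set R) : Prop :=
  [/\ E 1, forall x y, E x -> E y -> E (x - y) & forall x y, E x -> E y -> E (x / y)].

(* With R_0 = Q. The field does not depend on the Haar measure, as two of them
   are proportional by a rational factor. *)
Definition character_field (R : fieldType) (V : lmodType R) (pi : G -> V -> V) : set R :=
  smallest (@is_subfield R) (range ratr `|` hecke_traces pi).

(* e : V -> T exhibits the S-vector space T as the tensor product of V with S
   over k, by its universal property *)
Definition scalar_extension (k S : fieldType) (j : {rmorphism k -> S})
    (V : lmodType k) (T : lmodType S) (e : V -> T) : Prop :=
  linear_for (j \; *:%R) e /\
  forall (M : lmodType S) (f : V -> M), linear_for (j \; *:%R) f ->
    exists! g : T -> M, linear g /\ forall v, g (e v) = f v.

(* tau is the extension of pi to T = V (x)_k S *)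
Definition base_change (k S : fieldType) (j : {rmorphism k -> S})
    (V : lmodType k) (pi : G -> V -> V) (T : lmodType S) (tau : G -> T -> T)
    (e : V -> T) : Prop :=
  [/\ scalar_extension j e, forall g, linear (tau g) &
      forall g v, tau g (e v) = e (pi g v)].

(* The subfield E of Rbar is the image of j; a common base change to Rbar is an
   isomorphism between V' (x)_E Rbar and V (x)_R Rbar. *)
Definition realised_over (R Rbar : fieldType) (iota : {rmorphism R -> Rbar})
    (V : lmodType R) (pi : G -> V -> V) (E : set Rbar) : Prop :=
  exists (k : fieldType) (j : {rmorphism k -> Rbar})
         (V' : lmodType k) (pi' : G -> V' -> V')
         (T : lmodType Rbar) (tau : G -> T -> T) (e : V -> T) (e' : V' -> T),
    [/\ range j = E, smooth_rep pi',
        base_change iota pi tau e & base_change j pi' tau e'].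

(* [E : k] = d *)
Definition has_degree (L : fieldType) (E k : set L) (d : nat) : Prop :=
  k `<=` E /\ exists b : 'I_d -> L, (forall i, E (b i)) /\
    forall x, E x -> exists! c : 'I_d -> L,
      (forall i, k (c i)) /\ x = \sum_i c i * b i.

(* A field of realisation of infinite degree does not affect the infimum when
   there is one of finite degree. *)
Definition is_schur_index (R Rbar : fieldType) (iota : {rmorphism R -> Rbar})
    (V : lmodType R) (pi : G -> V -> V) (m : nat) : Prop :=
  let degrees := [set d | exists E : set Rbar, realised_over iota pi E /\
    has_degree E (iota @` character_field pi) d] in
  degrees m /\ forall d, degrees d -> (m <= d)%N.
End Representations.

Section WeilRepresentation.
Variables (F : fieldExtType Q2) (K : fieldType) (W : vectType F).
Variables (form : {skew_symmetric W}) (X Y : {vspace W}).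
Variable psi : smooth_character F K.
Local Notation "<< u , v >>" := (form u v).
Local Notation SY := (Cc (ltop (subvs_of Y)) K).

(* Preserving a nondegenerate form implies being invertible. *)
Definition symplectic_group : set 'End(W) := [set g | forall u v, << g u, g v >> = << u, v >>].

(* The unipotent radical N(X) of the stabiliser of the Lagrangian X: the
   symplectic maps that act trivially on X and on W / X *)
Definition unipotent_radical : set 'End(W) :=
  [set n | symplectic_group n /\ (forall x, x \in X -> n x = x) /\ forall w, n w - w \in X].

(* p : Mp -> Sp(W) is a non-trivial topological double cover: a continuous open
   surjective homomorphism, locally injective (a local homeomorphism), with kernel
   of order 2, that is not a product, i.e. has no continuous splitting. It is
   unique up to isomorphism. *)
Record metaplectic_cover (Mp : topGroupType) (p : Mp -> 'End(W)) : Prop := {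
  mp1 : p 1%g = \1%VF;
  mpM : forall g h, p (g * h)%g = (p g \o p h)%VF;
  mp_range : range p = symplectic_group;
  mp_continuous : continuous (p : Mp -> ltop 'End(W));
  mp_open : forall U : set Mp, open U ->
    exists2 O : set (ltop 'End(W)), open O & p @` U = O `&` symplectic_group;
  mp_locally_injective : exists U : set Mp,
    [/\ open U, U 1%g & {in U &, injective p}];
  mp_degree2 : exists2 z : Mp, z != 1%g & forall g, p g = \1%VF <-> g = 1%g \/ g = z;
  mp_nontrivial : ~ exists s : 'End(W) -> Mp,
    [/\ {within symplectic_group : set (ltop 'End(W)), continuous (s : ltop 'End(W) -> Mp)},
        forall g, symplectic_group g -> p (s g) = g &
        forall g h, symplectic_group g -> symplectic_group h -> s (g \o h)%VF = (s g * s h)%g] }.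

(* N(X) is uniquely divisible, so it lifts to Mp(W) in a unique way; the
   lift s is n |-> (n, 1) in the cocycle model of Mp(W). *)
Record Weil_representation (Mp : topGroupType) (p : Mp -> 'End(W))
    (omega : Mp -> SY -> SY) : Prop := {
  weil_smooth : smooth_rep omega;
  weil_central : forall z f, z != 1%g -> p z = \1%VF -> omega z f = - f;
  weil_heisenberg : forall g (h : heisenberg W) f,
    omega g (heisenberg_rep form X psi h (omega g^-1%g f)) = heisenberg_rep form X psi (p g h.1, h.2) f;
  weil_unipotent : exists s : 'End(W) -> Mp,
    [/\ forall n, unipotent_radical n -> p (s n) = n,
        forall n n', unipotent_radical n -> unipotent_radical n' ->
          s (n \o n')%VF = (s n * s n')%g &
        forall n (f : SY) (y : subvs_of Y), unipotent_radical n ->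
          omega (s n) f y = psi (2^-1 * << n (vsval y) - vsval y, vsval y >>) * f y] }.

Definition is_odd : {pred SY} := fun f => `[< forall y : subvs_of Y, f (- y) = - f y >].

Lemma odd_submod_closed : submod_closed is_odd.
Proof.
split; first by apply/asboolP => y /=; rewrite oppr0.
move=> a f g /asboolP fo /asboolP go; apply/asboolP => y /=.
by rewrite [LHS]/= !fctE /= fo go scalerN opprD.
Qed.
HB.instance Definition _ := GRing.isSubmodClosed.Build K SY is_odd odd_submod_closed.

Record odd_Cc := OddCc { odd_val :> SY; _ : odd_val \in is_odd }.
HB.instance Definition _ := [isSub for odd_val].
HB.instance Definition _ := [Choice of odd_Cc by <:].
HB.instance Definition _ := [SubChoice_isSubLmodule of odd_Cc by <:].

(* omega_odd is the restriction of omega to the odd functions *)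
Definition odd_part (Mp : topGroupType) (omega : Mp -> SY -> SY)
    (omega_odd : Mp -> odd_Cc -> odd_Cc) : Prop :=
  forall g f, odd_val (omega_odd g f) = omega g (odd_val f).
End WeilRepresentation.

Definition two_adic_units : set Z2 := [set a | a \is a GRing.unit].
Definition two_adic_square_units : set Z2 :=
  [set a | exists2 u, u \is a GRing.unit & a = u ^+ 2].
Definition is_unit_subgroup (B : set Z2) : Prop :=
  [/\ B `<=` two_adic_units, B 1 & forall a b, B a -> B b -> B (a / b)].
(* [alpha], the subgroup of Z_2^* generated by alpha and the squares *)
Definition unit_class (alpha : Z2) : set Z2 :=
  smallest is_unit_subgroup (alpha |` two_adic_square_units).

Definition integer_units (F : fieldExtType Q2) : set F :=
  [set u | [/\ u != 0, ring_of_integers u & ring_of_integers u^-1]].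
(* A, the intersection of O_F^{* 2} and Z_2^* *)
Definition square_units (F : fieldExtType Q2) : set Z2 :=
  [set a | a \is a GRing.unit /\
    exists2 u, integer_units u & Z2_to F a = u ^+ 2].

(* Main.v *)
Require Import Defs.
From HB Require Import structures.
From mathcomp Require Import all_boot all_order all_algebra all_field sesquilinear.
From mathcomp Require Import all_classical topology.
From mathcomp Require Import zify ring.

(* Let sigma_a be the automorphism z |-> z^a of K for a a 2-adic unit, so that
   psi^sigma_a(t) = psi(a t).  If a = u^2 with u a unit of O_F, the semilinear map
   I_u : f(y) |-> sigma_a(f(y / u)) commutes with omega(g): both I_u omega(g) I_u^-1
   and omega(g) intertwine the Heisenberg representation, hence differ by a
   character of Mp(W), which is trivial because transvections, on which the two
   agree, generate Sp(W).  For a = 3, 5, 9 the group generated by I_u acts with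
   finite orbits and Galois descent (Lagrange interpolation at the conjugates of
   a root of unity) realises omega^- over the fixed field of sigma_a, namely
   Q[sqrt -2], Q[i] and Q[zeta_8].  The same operators show that A fixes the
   character field.

   Conversely, if a is not a square in F, some trace is moved by sigma_a.  Let e
   be the projector onto the invariants of a small compact open subgroup, and L a
   linear form on Y.  For odd differences d_y of indicator functions of cosets,
   unitarity gives p_y = (e d_y)(y) / 2 >= 0, and composing e with unipotent
   elements gives operators of trace t(c) = sum_y psi(c L(y)^2) p_y.  Averaging
   psi(-c) t(c) over a large lattice gives the sum of the p_y with L(y)^2 close
   to 1.  If every t(c) were fixed by sigma_a, then t(c) would also be
   sum_y psi(a c L(y)^2) sigma_a(p_y), of average 0 because a v^2 stays away
   from 1; so e would kill these d_y, which it does not.  So the character field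
   is the fixed field of A.

   If -1 = u^2, the character field is real.  A realisation over a real field
   would give an antilinear involution J commuting with Mp(W), while I_u, for
   complex conjugation, satisfies I_u^2 = -1 since omega^- is odd.  By
   equivariance under multiplication operators, J I_u scales the value at y by a
   constant c, which is the same at y / u; then J^2 = 1 reads 1 = - |c|^2.  So
   the index is at least 2. *)

Set Implicit Arguments.
Unset Strict Implicit.
Unset Printing Implicit Defensive.
Import Order.TTheory GRing.Theory Num.Theory.
Local Open Scope classical_set_scope.
Local Open Scope ring_scope.

(** * 2-adic integers and the ring of integers of F *)

Section TwoAdicIntegers.
Implicit Types x y : Z2.

(** The exponents 3, 5 and 9 have infinite order in the 2-adic units, so [I_u] returns to a vector
    only after a number of steps that depends on it; there is such a number because
    [u^(2^(k + 1)) = b^(2^k)] tends to 1 when [u^2 = b]. As 9 is the square of the unit 3 in every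
    F, Q[zeta_8] is always a field of realisation and contains the character field, and everything
    is decided by which of 3, 5, -1 lie in A. If -1 does, Q[i] or Q[zeta_8] is quadratic over the
    character field, which gives the upper bound 2; if not, one of the three realisations is over
    the character field itself.

    Admissibility, unitarity and the Haar measure are not part of the data. The measure comes from
    compact open subgroups of Mp(W) defined by congruences on the image in Sp(W). A function
    invariant under an open subgroup is also invariant under small Heisenberg vectors, hence has
    bounded support and level. Unitarity is obtained for elements that fix a nonzero function, since
    uniqueness of the Heisenberg-invariant hermitian form leaves only a scalar, which is read off at
    that function. *)

Lemma Z2_cstE (m : int) : Z2_cst m = m%:~R.
Proof.
have H (n : nat) : Z2_cst n = n%:R.
  elim: n => [//|n IH]; rewrite -(addn1 n) natrD -IH; apply: Z2_eq => k /=.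
  by rewrite PoszD modzDm.
case: m => n; first by rewrite H.
rewrite NegzE mulrNz; apply: Z2_eq => k /=; rewrite -[_%:~R]/(n.+1%:R) -H /=.
by rewrite modzNm.
Qed.

Lemma Z2_val_int (m : int) n : Z2_val m%:~R n = (m %% 2 ^+ n)%Z.
Proof. by rewrite -Z2_cstE. Qed.

Lemma Z2_valM x y n : Z2_val (x * y) n = (Z2_val x n * Z2_val y n %% 2 ^+ n)%Z.
Proof. by []. Qed.

Lemma Z2_valB x y n : Z2_val (x - y) n = ((Z2_val x n - Z2_val y n) %% 2 ^+ n)%Z.
Proof. by rewrite /= modzDmr. Qed.

Lemma Z2_val_dvd x m k : (Z2_val x m == 0) = (2 ^+ m %| Z2_val x (m + k)%N)%Z.
Proof.
by rewrite -Z2_mod -(Z2_eqmod x m k); apply/eqP/idP => [/dvdz_mod0P|/dvdz_mod0P].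
Qed.

(** The quotient is built from residues: modulo [2^k] it is the residue of [x] modulo [2^(n + k)],
    divided by [2^n]. *)
Lemma Z2_dvdP x n : reflect (exists w, x = 2 ^+ n * w) (Z2_val x n == 0).
Proof.
have p2 k : 2 ^+ k != 0 :> int by rewrite expf_neq0.
apply: (iffP eqP) => [xn|[w ->]]; last first.
  rewrite -[2]/(2%:~R) -rmorphXn Z2_valM Z2_val_int modzz mul0r.
  by rewrite mod0z.
have xd k : (2 ^+ n %| Z2_val x (n + k)%N)%Z by rewrite -Z2_val_dvd xn.
have fP k : ((Z2_val x (n + k)%N %/ 2 ^+ n)%Z = (Z2_val x (n + k.+1)%N %/ 2 ^+ n)%Z %[mod 2 ^+ k])%Z.
  apply/eqP; rewrite eqz_mod_dvd -(@dvdz_mul2l (2 ^+ n)) ?p2 // -exprD mulrBr.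
  rewrite ![2 ^+ n * _]mulrC !divzK ?xd // -eqz_mod_dvd addnS.
  by rewrite [in X in X == _]Z2_step modz_mod.
exists (Z2_mk fP); apply: Z2_eq => k.
rewrite -[2]/(2%:~R) -rmorphXn Z2_valM Z2_val_int /= modzMml modzMmr mulrC divzK ?xd //.
by rewrite addnC Z2_eqmod Z2_mod.
Qed.

Lemma Z2_congrP x y n :
  reflect (exists w, x - y = 2 ^+ n * w) (Z2_val x n == Z2_val y n).
Proof.
rewrite (_ : _ == _ = (Z2_val (x - y) n == 0)); first exact: Z2_dvdP.
rewrite Z2_valB -[in LHS]Z2_mod -[in LHS](Z2_mod y) eqz_mod_dvd.
by apply/idP/eqP => [/dvdz_mod0P|/dvdz_mod0P].
Qed.

Lemma Z2_eq0 x : (forall n, exists w, x = 2 ^+ n * w) -> x = 0.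
Proof.
move=> H; apply: Z2_eq => n; rewrite /= mod0z.
by have /Z2_dvdP/eqP := H n.
Qed.

(** Completeness of [Z_2]: the diagonal residues of [A n] modulo [2^n] are coherent and define the
    limit. *)
Lemma Z2_complete (A : nat -> Z2) : (forall n, exists w, A n.+1 - A n = 2 ^+ n * w) ->
  exists z, forall n, exists w, z - A n = 2 ^+ n * w.
Proof.
move=> H.
have fP n : (Z2_val (A n) n = Z2_val (A n.+1) n.+1 %[mod 2 ^+ n])%Z.
  have /Z2_congrP/eqP <- := H n.
  by rewrite [in LHS]Z2_step modz_mod.
by exists (Z2_mk fP) => n; apply/Z2_congrP; rewrite /= Z2_mod.
Qed.

Lemma Z2_val1_cases x : (Z2_val x 1 == 0) || (Z2_val x 1 == 1).
Proof.
rewrite -(Z2_mod x 1) expr1; have := @modz_ge0 (Z2_val x 1) 2 isT.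
have := @ltz_pmod (Z2_val x 1) 2 isT.
by case: (_ %% _)%Z => [[|[|n]]|n].
Qed.

Lemma Z2_unitE x : (x \is a GRing.unit) = (Z2_val x 1 == 1).
Proof.
apply/idP/idP => [/mulrV/(congr1 (fun z => Z2_val z 1))|/eqP x1].
  have := Z2_val1_cases x; rewrite Z2_valM /=; case: eqP => //= -> _.
  by rewrite mul0r.
have /Z2_dvdP[w] : Z2_val (1 - x) 1 == 0 by rewrite Z2_valB x1.
rewrite expr1 => xE.
(* The inverse of [x = 1 - 2 w] is the sum of the geometric series in [2 w]. *)
have [n|z zP] := @Z2_complete (fun n => \sum_(i < n) (2 * w) ^+ i).
  by rewrite big_ord_recr /= addrAC subrr add0r exprMn; exists (w ^+ n).
have zx : x * z = 1.
  apply/eqP; rewrite -subr_eq0; apply/eqP/Z2_eq0 => n; have [v /eqP] := zP n.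
  rewrite subr_eq => /eqP ->; exists (x * v - w ^+ n).
  have -> : x = 1 - 2 * w by rewrite -xE opprB addrC subrK.
  have E : (1 - 2 * w) * \sum_(i < n) (2 * w) ^+ i = 1 - 2 ^+ n * w ^+ n.
    by rewrite -exprMn -[RHS]opprB (subrX1 (2 * w)) -[RHS]mulNr opprB.
  by rewrite mulrDr E; ring.
by apply/unitrP; exists z; rewrite mulrC.
Qed.

Lemma Z2_factor x : x != 0 -> exists n (u : Z2), u \is a GRing.unit /\ x = 2 ^+ n * u.
Proof.
move=> x0.
have ex : exists n, ~~ (Z2_val x n.+1 == 0).
  apply: contrapT => H; case/eqP: x0; apply: Z2_eq => n; rewrite /= mod0z.
  case: n => [|n]; first by rewrite -Z2_mod expr0 modz1.
  by apply/eqP; apply: contrapT => /negP xn; apply: H; exists n.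
case: (ex_minnP ex) => n xn nmin.
have /Z2_dvdP[u xE] : Z2_val x n == 0.
  case: n xn nmin => [|n] xn nmin; first by rewrite -Z2_mod expr0 modz1.
  by apply: contraT => /nmin; rewrite ltnn.
exists n, u; split=> //; rewrite Z2_unitE; have /orP[/Z2_dvdP[w uE]|//] := Z2_val1_cases u.
by case/Z2_dvdP: xn; exists w; rewrite xE uE mulrA -exprSr.
Qed.

(** Hensel's lemma where the derivative [2 A] is not a unit: the error stays in [2^(n + 3)] while
    the correction is [2^(n + 2)], which is why the start has to be right modulo 8. *)
Lemma Z2_sqrt x : Z2_val x 3 == 1 -> exists2 u, u \is a GRing.unit & x = u ^+ 2.
Proof.
move=> x3.
pose P n (A : Z2) := A \is a GRing.unit /\ exists w, x - A ^+ 2 = 2 ^+ (n + 3) * w.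
have step n A : P n A -> exists B, P n.+1 B /\ exists w, B - A = 2 ^+ n * w.
  (* Adding [2^(n + 2)] to [A] changes the error by [2^(n + 3) A] modulo [2^(n + 4)]; as [A] is odd,
     this cures exactly the case of odd [w]. *)
  move=> [Au [w xA]]; have [/Z2_dvdP[v wE]|/Z2_dvdP[v wE]] : (Z2_val w 1 == 0) \/ (Z2_val (w - A) 1 == 0).
    have := Z2_val1_cases w; rewrite Z2_valB; case: eqP => /= [_ _|_ /eqP ->]; [by left|right].
    by move: Au; rewrite Z2_unitE => /eqP ->.
  - exists A; split; last by exists 0; rewrite subrr mulr0.
    by split=> //; exists v; rewrite xA wE expr1 mulrA -exprSr.
  exists (A + 2 ^+ (n + 2)); split; last by exists 4; rewrite addrC addKr exprD; ring.
  split.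
    move: Au; rewrite !Z2_unitE => /eqP A1; apply/eqP; rewrite -A1.
    by apply/eqP/Z2_congrP; exists (2 ^+ (n + 1)); rewrite addrAC subrr add0r !exprD; ring.
  exists (v - 2 ^+ n).
  have -> : x - (A + 2 ^+ (n + 2)) ^+ 2 = (x - A ^+ 2) - 2 ^+ (n + 3) * A - 2 ^+ (n + 4) * 2 ^+ n.
    by rewrite !exprD; ring.
  rewrite xA.
  have -> : w = A + 2 * v by rewrite -[w in LHS](subrK A) wE expr1 addrC.
  by rewrite addSn exprS !exprD; ring.
pose S n := {A | P n A}.
have A0 : S 0%N.
  exists 1; split; first exact: unitr1.
  have /(@Z2_congrP x 1 3)[w E] : Z2_val x 3 == Z2_val 1 3 by rewrite (eqP x3).
  by exists w; rewrite expr1n.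
have stepS n (A : S n) : {B : S n.+1 | exists w, sval B - sval A = 2 ^+ n * w}.
  case: A => A /= /step/cid[B [PB BA]].
  by exists (exist _ B PB).
pose s := fix s n : S n := if n is n'.+1 then sval (stepS n' (s n')) else A0.
have [n|z zP] := @Z2_complete (fun n => sval (s n)).
  by rewrite /=; case: (stepS n (s n)).
exists z.
  have [w E] := zP 1; have [u _] := svalP (s 1).
  move: u; rewrite !Z2_unitE => /eqP <-; apply/Z2_congrP; by exists w.
apply/eqP; rewrite -subr_eq0; apply/eqP/Z2_eq0 => n.
have [w /eqP] := zP n; rewrite subr_eq => /eqP ->; have [_ [v E]] := svalP (s n).
exists (8 * v - 2 ^+ n * w ^+ 2 - 2 * w * sval (s n)).
set A := sval (s n) in E *.
have -> : x - (2 ^+ n * w + A) ^+ 2 = (x - A ^+ 2) - (2 ^+ n) ^+ 2 * w ^+ 2 - 2 * 2 ^+ n * w * A by ring.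
by rewrite E exprD; ring.
Qed.

Lemma Z2_unit_mod8 x : x \is a GRing.unit ->
  exists2 a : int, a \in [:: 1; 3; 5; -1] & exists2 u, u \is a GRing.unit & x = a%:~R * u ^+ 2.
Proof.
move=> xu.
have xm : (Z2_val x 3 %% 8)%Z = Z2_val x 3 := Z2_mod x 3.
have x8 : Z2_val x 3 \in [:: 1; 3; 5; 7 : int].
  move: xu; rewrite Z2_unitE [Z2_val x 1]Z2_step [Z2_val x 2]Z2_step.
  have := @modz_ge0 (Z2_val x 3) 8 isT; have := @ltz_pmod (Z2_val x 3) 8 isT; rewrite xm.
  by case: (Z2_val x 3) => // -[|[|[|[|[|[|[|[|r]]]]]]]].
have [a aS /Z2_sqrt[u uu E]] : exists2 a : int, a \in [:: 1; 3; 5; -1] & Z2_val (a%:~R * x) 3 == 1.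
  have H (a : int) : Z2_val (a%:~R * x) 3 = ((a %% 8)%Z * Z2_val x 3 %% 8)%Z.
    by rewrite Z2_valM Z2_val_int.
  by move: x8; rewrite !inE => /or4P[] /eqP xE; [exists 1|exists 3|exists 5|exists (-1)];
    rewrite ?H ?xE.
have au : (a%:~R : Z2) \is a GRing.unit.
  by move: aS; rewrite Z2_unitE Z2_val_int !inE => /or4P[] /eqP ->.
exists a => //; exists (u / a%:~R); first by rewrite unitrM uu unitrV.
by apply: (mulrI au); rewrite E mulrA -expr2 -exprMn mulrC divrK.
Qed.
End TwoAdicIntegers.

(** * The filtration of F by multiples of the ring of integers *)

Section RingOfIntegers.
Variable F : fieldExtType Q2.
Local Notation O_F := (@ring_of_integers F).
Implicit Types (x y : F) (n m : int).

Lemma integer_Z2M (a : Z2) x : O_F x -> O_F (Z2_to F a * x).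
Proof. by apply: integerM; exact: integer_Z2. Qed.

Lemma integer_int (a : int) : O_F a%:~R.
Proof. by rewrite -(rmorph_int (Z2_to F)); exact: integer_Z2. Qed.

Lemma integer_sum (I : Type) (r : seq I) (P : pred I) (f : I -> F) :
  (forall i, P i -> O_F (f i)) -> O_F (\sum_(i <- r | P i) f i).
Proof. by move=> H; apply: big_ind => //; [exact: integer0|exact: integerD]. Qed.

(** Multiplying an integral equation of degree [d] for [1/2] by [2^d] leaves the leading coefficient
    1 as the only odd term. It makes the chain of the [2^n O_F] strictly decreasing. *)
Lemma half_not_integer : ~ O_F 2^-1.
Proof.
move=> [p p_mon /rootP]; set q := map_poly _ _.
have sp : (size p = (size p).-1.+1)%N by rewrite prednK // lt0n size_poly_eq0 monic_neq0.
set d := (size p).-1 in sp.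
have sq : size q = d.+1.
  by rewrite -sp; apply: size_map_poly_id0; rewrite (monicP p_mon) rmorph1 oner_eq0.
rewrite horner_coef sq => /(congr1 (fun t => 2 ^+ d * t)); rewrite mulr0 mulr_sumr => E.
have {}E : Z2_to F (\sum_(i < d.+1) p`_i * 2 ^+ (d - i)) = 0.
  rewrite -E rmorph_sum; apply: eq_bigr => i _.
  rewrite rmorphM rmorphXn /= rmorph_nat /q coef_map /= mulrCA exprVn; congr (_ * _).
  have i_le : (i <= d)%N by rewrite -ltnS.
  by rewrite expfB_cond // (negPf (two_neq0 F)).
have /eqP := E; rewrite Z2_to_eq0 => /eqP /(congr1 (fun z => Z2_val z 1)).
rewrite big_ord_recr /= subnn expr0 mulr1 -/(lead_coef p).
rewrite (monicP p_mon); have [w ->] : exists w, \sum_(i < d) p`_i * 2 ^+ (d - i) = 2 * w.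
  exists (\sum_(i < d) p`_i * 2 ^+ (d - i).-1); rewrite mulr_sumr; apply: eq_bigr => i _.
  by rewrite mulrCA -exprS prednK // subn_gt0.
have /eqP -> // : Z2_val (2 * w) 1 == 0 by apply/Z2_dvdP; exists w; rewrite expr1.
Qed.

(** The fractional ideal [2^n O_F] for an integer [n]. With powers of 2 in place of powers of a
    uniformiser, no valuation on [F] has to be constructed. *)
Definition scaled n : set F := [set x | O_F (2 ^ (- n) * x)].

Local Notation O := scaled.

Let two0 : 2 != 0 :> F. Proof. exact: two_neq0. Qed.

Lemma scaled0 n : O n 0. Proof. by rewrite /O /= mulr0; exact: integer0. Qed.
Lemma scaledN n x : O n x -> O n (- x).
Proof. by rewrite /O /= mulrN; exact: integerN. Qed.
Lemma scaledD n x y : O n x -> O n y -> O n (x + y).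
Proof. by rewrite /O /= mulrDr; exact: integerD. Qed.
Lemma scaledB n x y : O n x -> O n y -> O n (x - y).
Proof. by move=> ? ?; apply: scaledD => //; exact: scaledN. Qed.
Lemma scaled_sum n (I : Type) (r : seq I) (P : pred I) (f : I -> F) :
  (forall i, P i -> O n (f i)) -> O n (\sum_(i <- r | P i) f i).
Proof. by move=> H; apply: big_ind => //; [exact: scaled0|exact: scaledD]. Qed.
Lemma scaled_integer x : O 0 x <-> O_F x.
Proof. by rewrite /O /= oppr0 expr0z mul1r. Qed.
Lemma scaledM n m x y : O n x -> O m y -> O (n + m) (x * y).
Proof.
by move=> xn ym; rewrite /O /= opprD expfzDr // mulrACA; exact: integerM.
Qed.
Lemma scaledM0 n x y : O_F x -> O n y -> O n (x * y).
Proof. by move=> /scaled_integer xO /(scaledM xO); rewrite add0r. Qed.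
Lemma scaled_pow n : O n (2 ^ n).
Proof. by rewrite /O /= -expfzDr // addNr expr0z; exact: integer1. Qed.
Lemma scaledMpow n m x : O n x -> O (n + m) (2 ^ m * x).
Proof. by move=> xn; rewrite addrC; apply: scaledM => //; exact: scaled_pow. Qed.
Lemma scaled_leq n m : n <= m -> O m `<=` O n.
Proof.
move=> nm x xm; rewrite /O /= (_ : - n = (m - n) + - m); last by ring.
rewrite expfzDr // -mulrA; apply: integerM => //.
have [k ->] : exists k : nat, m - n = k.
  by exists `|m - n|%N; rewrite gez0_abs // subr_ge0.
by rewrite -exprnP; apply: integerX; exact: (integer_int 2).
Qed.
Lemma scaled_div n x : O n x -> exists2 y, O_F y & x = 2 ^ n * y.
Proof.
by move=> xn; exists (2 ^ (- n) * x) => //; rewrite mulrA -expfzDr // addrN expr0z mul1r.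
Qed.

Lemma integer_sqrt x : O_F (x ^+ 2) -> O_F x.
Proof.
move=> xO; apply: (@integral_root_monic _ _ (Z2_to F) _ ('X^2 - (x ^+ 2)%:P)).
- by rewrite monicXnsubC.
- by rewrite rootE !hornerE subrr.
apply/integral_poly => i; rewrite coefB coefXn coefC.
apply: integerD; first by case: eqP => _; [exact: integer1|exact: integer0].
by apply: integerN; case: eqP => _ //; exact: integer0.
Qed.

Lemma scaled_sqrt n x : O (n + n) (x ^+ 2) -> O n x.
Proof.
by rewrite /O /= => H; apply: integer_sqrt; rewrite exprMn expr2 -expfzDr // -opprD.
Qed.

(* A nonzero integer c divides the constant coefficient of a suitable monic
   polynomial annihilating it. *)
Lemma integer_dvd_pow2 x : x != 0 -> O_F x -> exists k : nat, O (- k%:Z) x^-1.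
Proof.
move=> x0 [p p_mon].
have p0 : p != 0 by exact: monic_neq0.
elim: {p}(size p) {-2}p (leqnn (size p)) p_mon p0 => [|s IH] p; first by rewrite leqn0 size_poly_eq0 => /eqP ->; rewrite eqxx.
move=> sp p_mon p0 px.
have [q pE] : exists q, p = q * 'X + (p`_0)%:P.
  by elim/poly_ind: p {sp p_mon p0 px} => [|q c _]; [exists 0; rewrite coef0 mul0r add0r|exists q; rewrite coefD coefMX coefC add0r].
have qm : q != 0 -> q \is monic /\ (size q < size p)%N.
  move=> q0; have sq : size (q * 'X) = (size q).+1 by rewrite size_mulX.
  have sc : (size (p`_0)%:P < size (q * 'X)%R)%N.
    by rewrite sq ltnS (leq_trans (size_polyC_leq1 _)) // lt0n size_poly_eq0.
  by split; [move: p_mon; rewrite !monicE {1}pE lead_coefDl // lead_coefMX|rewrite [in X in (_ < X)%N]pE size_polyDl // sq].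
have [c0|c0] := eqVneq p`_0 0.
  have q0 : q != 0 by apply: contraNneq p0 => q0; rewrite pE c0 q0 mul0r add0r.
  have [q_mon qs] := qm q0; apply: (IH q) => //; first by rewrite -ltnS (leq_trans qs).
  move: px; rewrite pE c0 addr0 rmorphM /= map_polyX rootM rootX (negPf x0) orbF.
  by [].
have qx : (map_poly (Z2_to F) q).[x] * x = - Z2_to F p`_0.
  by move: px; rewrite {1}pE rmorphD rmorphM /= map_polyX map_polyC /= rootE !hornerE addr_eq0 => /eqP.
have [k [u [uu cE]]] := Z2_factor c0; exists k; rewrite /O /= opprK -exprnP.
suff -> : 2 ^+ k * x^-1 = Z2_to F (- u^-1) * (map_poly (Z2_to F) q).[x].
  apply: integer_Z2M; rewrite horner_coef; apply: integer_sum => i _.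
  by rewrite coef_map; apply: integer_Z2M; apply: integerX; exists p.
apply: (mulIf x0); rewrite mulfVK // -mulrA qx cE.
have -> : Z2_to F (- u^-1) * - Z2_to F (2 ^+ k * u) = Z2_to F (2 ^+ k).
  by rewrite -rmorphN -rmorphM /= mulrNN mulrCA mulVr // mulr1.
by rewrite rmorphXn /= rmorph_nat.
Qed.

Lemma scaled_ex x : exists k : nat, O (- k%:Z) x.
Proof.
have [c [c0 cO cx]] := integer_denom x; have [k kc] := integer_dvd_pow2 c0 cO.
by exists k; rewrite -(mulKf c0 x) mulrC; exact: scaledM0.
Qed.

Lemma scaled_exs (I : finType) (f : I -> F) : exists k : nat, forall i, O (- k%:Z) (f i).
Proof.
have [k kP] := choice (fun i => scaled_ex (f i)).
exists (\max_i k i)%N => i; apply: scaled_leq (kP i).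
by rewrite lerN2 lez_nat; exact: leq_bigmax.
Qed.

(** If [x] were nonzero, [x^-1] would lie in some [2^(-k) O_F], and multiplying it by [x] in
    [2^(k + 1) O_F] would put 1 in [2 O_F]. *)
Lemma scaled_eq0 x : (forall n : nat, O n x) -> x = 0.
Proof.
move=> H; apply: contrapT => /eqP x0; have [k kx] := scaled_ex x^-1.
apply: half_not_integer; have := scaledM (H k.+1) kx.
rewrite mulfV // (_ : k.+1%:Z - k%:Z = 1); last by rewrite -addn1 PoszD addrAC subrr add0r.
by rewrite /O /= mulr1 -exprN1.
Qed.
End RingOfIntegers.

Section RingOfIntegersGenerators.
Variable F : fieldExtType Q2.
Local Notation O_F := (@ring_of_integers F).
Local Notation O := (@scaled F).

(* Linear independence of integers modulo 2 implies linear independence over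
   Q_2, which bounds the dimension of O_F / 2 O_F. *)
Lemma integer_basis : exists r (g : 'I_r -> F), (forall i, O_F (g i)) /\
  forall x, O_F x -> exists a : 'I_r -> Z2, O 1 (x - \sum_i Z2_to F (a i) * g i).
Proof.
pose ind r (g : 'I_r -> F) := (forall i, O_F (g i)) /\
  forall a : 'I_r -> Z2, O 1 (\sum_i Z2_to F (a i) * g i) -> forall i, Z2_val (a i) 1 == 0.
have ind_le r (g : 'I_r -> F) : ind r g -> (r <= \dim {:F})%N.
  move=> [gO gi].
  have gf : free [tuple g i | i < r].
    apply/freeP => q; under eq_bigr => i _ do rewrite -tnth_nth tnth_mktuple.
    move=> q0.
    have [d [d0 [a aE]]] : exists d : Z2, d != 0 /\ exists a : 'I_r -> Z2, forall i, FracField.tofrac d * q i = FracField.tofrac (a i).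
      have /choice[d dP] : forall i, exists d, d != 0 /\ exists n, FracField.tofrac d * q i = FracField.tofrac n.
        by move=> i; have [d d0 [n nE]] := frac_denom (q i); exists d; split=> //; exists n.
      exists (\prod_i d i); split; first by apply/prodf_neq0 => i _; case: (dP i).
      have /choice[n nP] := fun i => (dP i).2.
      exists (fun i => \prod_(j | j != i) d j * n i) => i.
      by rewrite (bigD1 i) //= !tofracM -nP mulrAC mulrC.
    have aS : \sum_i Z2_to F (a i) * g i = 0.
      transitivity (FracField.tofrac d *: \sum_i q i *: g i); last by rewrite q0 scaler0.
      rewrite scaler_sumr; apply: eq_bigr => i _.
      by rewrite scalerA aE -[in RHS](mul1r (g i)) scalerAl.
    have az : forall n i, exists w, a i = 2 ^+ n * w.
      elim=> [|n IHn]; first by move=> i; exists (a i); rewrite mul1r.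
      have /choice[w wE] := IHn.
      have w0 : \sum_i Z2_to F (w i) * g i = 0.
        apply: (mulfI (expf_neq0 n (two_neq0 F))); rewrite mulr0 -[RHS]aS mulr_sumr.
        apply: eq_bigr => i _; rewrite wE rmorphM rmorphXn /= rmorph_nat.
        by rewrite mulrA.
      move=> i; have /Z2_dvdP[v wv] : Z2_val (w i) 1 == 0.
        by apply: gi; rewrite w0; exact: scaled0.
      by exists v; rewrite wE wv mulrA -exprD addn1.
    move=> i; have a0 : a i = 0 by apply: Z2_eq0 => n.
    have /eqP := aE i; rewrite a0 tofrac0 mulf_eq0 tofrac_eq0 (negPf d0) /=.
    by move/eqP.
  have := dimvS (subvf <<[tuple g i | i < r]>>%VS).
  by rewrite (eqP gf) size_tuple.
have [r [[g [gO gi]] rmax]] : exists r, (exists g, ind r g) /\ forall s, (exists g, ind s g) -> (s <= r)%N.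
  have ex0 : exists r, `[< exists g, ind r g >].
    by exists 0%N; apply/asboolP; exists (fun _ => 0); split=> [|? _] [].
  have bd r : `[< exists g, ind r g >] -> (r <= \dim {:F})%N by move=> /asboolP[g /ind_le].
  case: (ex_maxnP ex0 bd) => r /asboolP rP rmax; exists r; split=> // s sP.
  by apply: rmax; apply/asboolP.
exists r, g; split=> // x xO; apply: contrapT => Hx.
suff : (r.+1 <= r)%N by rewrite ltnn.
apply: rmax; exists (fun i => if unlift ord_max i is Some j then g j else x); split.
  by move=> i; case: unliftP => [j _|_].
move=> a; rewrite big_ord_recr /= unlift_none.
under eq_bigr => i _.
  have -> : widen_ord (leqnSn r) i = lift ord_max i by apply/val_inj; rewrite /= /bump leqNgt ltn_ord.
  rewrite liftK; over.
move=> aO.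
have amax : Z2_val (a ord_max) 1 == 0.
  have /orP[//|] := Z2_val1_cases (a ord_max); rewrite -Z2_unitE => au; case: Hx.
  exists (fun i => - (a ord_max)^-1 * a (lift ord_max i)).
  have -> : x - \sum_i Z2_to F (- (a ord_max)^-1 * a (lift ord_max i)) * g i =
     Z2_to F (a ord_max)^-1 * (\sum_i Z2_to F (a (lift ord_max i)) * g i + Z2_to F (a ord_max) * x).
    rewrite mulrDr mulrA -rmorphM mulVr // rmorph1 mul1r addrC; congr (_ + _).
    rewrite mulr_sumr -sumrN; apply: eq_bigr => i _.
    by rewrite !rmorphM rmorphN !mulNr opprK mulrA.
  by apply: scaledM0 => //; exact: integer_Z2.
move=> i; case: (unliftP ord_max i) => [j ->|-> //].
apply: (gi (fun j => a (lift ord_max j))).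
have /Z2_dvdP[w wE] := amax; move: aO; rewrite wE expr1 => aO.
have := scaledB aO (_ : O 1 (Z2_to F (2 * w) * x)); rewrite addrK; apply.
rewrite rmorphM rmorph_nat -mulrA -[1]addr0; apply: scaledM; first exact: (scaled_pow F 1).
by apply/scaled_integer; exact: integer_Z2M.
Qed.

(** Successive approximation with generators modulo 2: each remainder is divided by 2 and expanded
    again, and the partial sums of the coefficients converge in [Z_2]. The compactness of lattices
    rests on it. *)
Lemma integer_generators : exists r (g : 'I_r -> F),
  forall x, O_F x -> exists a : 'I_r -> Z2, x = \sum_i Z2_to F (a i) * g i.
Proof.
have [r [g [gO gP]]] := integer_basis; exists r, g => x xO.
have /choice[d dP] : forall y, exists az : ('I_r -> Z2) * F, O_F y ->
    O_F az.2 /\ y = \sum_i Z2_to F (az.1 i) * g i + 2 * az.2.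
  move=> y; have [yO|yO] := pselect (O_F y); last by exists (fun _ => 0, 0).
  have [a /scaled_div[z zO zE]] := gP y yO; exists (a, z) => _; split=> //.
  by rewrite -zE addrC subrK.
pose s n := iter n (fun y => (d y).2) x.
have sO n : O_F (s n) by elim: n => //= n /dP[].
pose A i n := \sum_(k < n) 2 ^+ k * (d (s k)).1 i.
have xE n : x = \sum_i Z2_to F (A i n) * g i + 2 ^+ n * s n.
  elim: n => [|n IHn].
    by rewrite mul1r big1 ?add0r // => i _; rewrite /A big_ord0 rmorph0 mul0r.
  rewrite [LHS]IHn; have [_ {1}->] := dP _ (sO n); rewrite mulrDr addrA mulrA -exprSr.
  congr (_ + _); rewrite mulr_sumr -big_split; apply: eq_bigr => i _ /=.
  by rewrite /A big_ord_recr /= rmorphD rmorphM rmorphXn rmorph_nat /= mulrDl mulrA.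
have /choice[z zP] : forall i, exists z, forall n, exists w, z - A i n = 2 ^+ n * w.
  move=> i; apply: Z2_complete => n; exists ((d (s n)).1 i).
  by rewrite /A big_ord_recr /= addrAC subrr add0r.
exists z; apply/eqP; rewrite -subr_eq0; apply/eqP/scaled_eq0 => n.
rewrite {1}(xE n) addrAC; apply: scaledD.
  rewrite -sumrB; apply: scaled_sum => i _; rewrite -mulrBl -rmorphB.
  have [w /(congr1 -%R)] := zP i n; rewrite opprB => ->.
  rewrite rmorphN rmorphM rmorphXn rmorph_nat mulNr -mulrA; apply: scaledN.
  rewrite -[n%:Z]addr0; apply: scaledM; first exact: (scaled_pow F n).
  by apply/scaled_integer/integer_Z2M.
rewrite -[n%:Z]addr0; apply: scaledM; first exact: (scaled_pow F n).
exact/scaled_integer.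
Qed.
End RingOfIntegersGenerators.

(** * Lattices, characters and locally constant functions *)

Section Transversals.
Variable T : eqType.
Implicit Types (E : T -> T -> Prop) (D : set T) (s : seq T).

Definition equivalence_Prop E := [/\ forall x, E x x, forall x y, E x y -> E y x &
  forall x y z, E x y -> E y z -> E x z].

Definition transversal E D s := [/\ uniq s, {in s &, forall x y, E x y -> x = y} &
  forall g, D g -> exists2 x, x \in s & E x g].

Lemma sub_transversal E D D' s : D' `<=` D -> transversal E D s -> transversal E D' s.
Proof. by move=> DD' [us sE sD]; split=> // g /DD' /sD. Qed.

(** Double counting: an [x] in [s] with [f x] nonzero is equivalent to exactly one [y] in [s'], so
    both sums equal a sum over equivalent pairs. *)
Lemma sum_transversal (V : zmodType) E D s s' (f : T -> V) : equivalence_Prop E ->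
  (forall x y, E x y -> f x = f y) -> (forall x, f x != 0 -> D x) ->
  transversal E D s -> transversal E D s' -> \sum_(x <- s) f x = \sum_(x <- s') f x.
Proof.
move=> [Er Es Et] fE fD sP s'P.
have H s1 s2 : transversal E D s2 -> \sum_(x <- s1) f x =
    \sum_(x <- s1) \sum_(y <- s2) (if `[< E x y >] then f x else 0).
  move=> [us2 s2E s2D]; apply: eq_bigr => x _; have [fx0|fx0] := eqVneq (f x) 0.
    by rewrite fx0 big1 // => y _; case: ifP.
  have [y ys2 yx] := s2D x (fD x fx0).
  rewrite (bigD1_seq y) //= (asboolT (Es _ _ yx)) big1_seq ?addr0 // => z /andP[zy zs2].
  rewrite asboolF // => xz; case/eqP: zy; apply/esym/s2E => //.
  exact: Et yx xz.
rewrite (H s s') // (H s' s) // exchange_big /=; apply: eq_bigr => y _; apply: eq_bigr => x _.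
case: asboolP => xy; first by rewrite (asboolT (Es _ _ xy)) (fE _ _ xy).
by rewrite asboolF // => yx; apply/xy/Es.
Qed.

(** Concatenating the [t x] gives a transversal of the finer relation that meets each coarse class
    [r] times. It serves both for lattices and for cosets of open subgroups. *)
Lemma sum_transversal_refine (V : zmodType) E E' D s s' (f : T -> V) (t : T -> seq T) r :
  equivalence_Prop E -> equivalence_Prop E' -> (forall x y, E' x y -> E x y) ->
  (forall x y, E x y -> f x = f y) -> (forall x, f x != 0 -> D x) ->
  transversal E D s -> transversal E' D s' ->
  (forall x, transversal E' (E x) (t x) /\ size (t x) = r) ->
  (forall x y, y \in t x -> E x y) ->
  \sum_(x <- s') f x = (\sum_(x <- s) f x) *+ r.
Proof.
move=> [Er Es Et] E'P EE' fE fD [us sE sD] s'P tP tE.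
have ft : transversal E' D (flatten [seq t x | x <- s]).
  split.
  - elim: s us sE {sD} => //= x s IH /andP[xs us] sE; rewrite cat_uniq.
    have [[ut _ _] _] := tP x; rewrite ut /= IH //; last first.
      by move=> y z ys zs; apply: sE; rewrite inE ?ys ?zs orbT.
    rewrite andbT; apply/hasPn => y /flatten_mapP[z zs yz]; apply/negP => yx.
    have xz : E x z by apply: Et (tE _ _ yx) (Es _ _ (tE _ _ yz)).
    by move: xs; rewrite (sE x z) ?inE ?eqxx ?zs ?orbT.
  - move=> y y' /flatten_mapP[x xs yx] /flatten_mapP[x' x's y'x'] yy'.
    have xx' : x = x'.
      by apply: sE => //; apply: (Et _ y) (tE _ _ yx) _; apply: (Et _ y') (EE' _ _ yy') (Es _ _ (tE _ _ y'x')).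
    by subst x'; have [[_ H _] _] := tP x; apply: H.
  - move=> g /sD[x xs xg]; have [[_ _ H] _] := tP x; have [y yx yg] := H g xg.
    by exists y => //; apply/flatten_mapP; exists x.
rewrite (sum_transversal E'P _ fD s'P ft); last by move=> x y /EE'; exact: fE.
rewrite big_flatten big_map -sumrMnl; apply: eq_bigr => x _.
rewrite (eq_big_seq (fun=> f x)); last by move=> y /tE /fE.
by rewrite big_const_seq count_predT (tP x).2 iter_addr_0.
Qed.

Lemma transversal_prune E D s : equivalence_Prop E ->
  (forall g, D g -> exists2 x, x \in s & E x g) -> exists s', transversal E D s'.
Proof.
move=> [Er Es Et]; elim: s D => [|x s IH] D sD; first by exists [::]; split.
have [s' [us' s'E s'D]] : exists s', transversal E (D `\` E x) s'.
  apply: IH => g [/sD[y]]; rewrite inE => /predU1P[->//|ys yg] _.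
  by exists y.
have [s1 [us1 s1E s1D s1x]] : exists s1, [/\ uniq s1, {in s1 &, forall x y, E x y -> x = y},
    forall g, (D `\` E x) g -> exists2 y, y \in s1 & E y g & forall y, y \in s1 -> ~ E x y].
  exists [seq y <- s' | ~~ `[< E x y >]]; split.
  - exact: filter_uniq.
  - by move=> y z; rewrite !mem_filter => /andP[_ ys] /andP[_ zs]; exact: s'E.
  - move=> g [Dg xg]; have [y ys' yg] := s'D g (conj Dg xg); exists y => //.
    rewrite mem_filter ys' andbT; apply/asboolPn => xy; apply: xg; exact: Et xy yg.
  - by move=> y; rewrite mem_filter => /andP[/asboolPn].
exists (x :: s1); split.
- by rewrite /= us1 andbT; apply/negP => /s1x; apply.
- move=> y z; rewrite !inE => /predU1P[->|ys1] /predU1P[->|zs1] //.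
  + by move=> /(s1x _ zs1).
  + by move=> /Es /(s1x _ ys1).
  + exact: s1E.
move=> g Dg; have [xg|xg] := pselect (E x g); first by exists x; rewrite ?mem_head.
by have [y ys yg] := s1D g (conj Dg xg); exists y => //; rewrite inE ys orbT.
Qed.
End Transversals.

(* A topology given by a decreasing sequence of equivalence relations with open
   classes, such as the cosets of a basis of open subgroups *)
Section UniformPartitions.
Variables (T : topologicalType) (E : nat -> T -> T -> Prop).
Hypothesis E_equiv : forall n, equivalence_Prop (E n).
Hypothesis E_decr : forall m n x y, (m <= n)%N -> E n x y -> E m x y.
Hypothesis E_nbhs : forall x (A : set T), nbhs x A <-> exists n, forall y, E n x y -> A y.

(** Points [y n] violating [Q n] would have a cluster point in [D]; near it some [Q n] holds, and
    monotonicity of [Q] contradicts the later terms. *)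
Lemma compact_uniform (D : set T) (Q : nat -> T -> Prop) : compact D ->
  (forall m n y, (m <= n)%N -> Q m y -> Q n y) ->
  (forall x, D x -> exists n, forall y, E n x y -> D y -> Q n y) -> exists n, forall y, D y -> Q n y.
Proof.
move=> Dc Qmon QD; apply: contrapT => H.
have /choice[y yP] : forall n, exists y, D y /\ ~ Q n y.
  move=> n; apply: contrapT => Hn; apply: H; exists n => y Dy; apply: contrapT => nQ.
  by apply: Hn; exists y.
have FD : (y @ \oo) D by exists 0%N => // n _; exact: (yP n).1.
have [x [Dx xcl]] := Dc _ _ FD.
have [n nP] := QD x Dx.
have [||z [[m nm <-] xm]] := xcl [set y m | m in [set m | (n <= m)%N]] (fun z => E n x z).
- by exists n => // m nm; exists m.
- by apply/E_nbhs; exists n.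
by apply: (yP m).2; apply: Qmon nm _; apply: nP => //; exact: (yP m).1.
Qed.

Lemma compact_transversal (D : set T) n : compact D -> exists s, transversal (E n) D s.
Proof.
move=> Dc; have [s sD] : exists s : seq T, forall g, D g -> exists2 x, x \in s & E n x g; last first.
  exact: transversal_prune sD.
apply: contrapT => H.
have /choice[g gP] : forall s : seq T, exists x, D x /\ forall y, y \in s -> ~ E n y x.
  move=> s; apply: contrapT => Hs; apply: H; exists s => x Dx; apply: contrapT => nx.
  by apply: Hs; exists x; split=> // y ys yx; apply: nx; exists y.
(* Without a finite cover there is a sequence of pairwise inequivalent points, two of which fall
   into the class of a cluster point. *)
pose s := fix s k := if k is k'.+1 then g (s k') :: s k' else [::].
pose y k := g (s k).
have ys j k : (j < k)%N -> y j \in s k.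
  elim: k => //= k IH; rewrite ltnS leq_eqVlt => /predU1P[->|/IH jk]; first exact: mem_head.
  by rewrite inE jk orbT.
have FD : (y @ \oo) D by exists 0%N => // k _; exact: (gP _).1.
have [x [Dx xcl]] := Dc _ _ FD.
have [_ Es Et] := E_equiv n.
have xn : nbhs x (fun z => E n x z) by apply/E_nbhs; exists n.
have [|z [[j _ <-] xj]] := xcl [set y m | m in [set m | (0 <= m)%N]] _ _ xn.
  by exists 0%N => // m _; exists m.
have [|_ [[k jk <-] xk]] := xcl [set y m | m in [set m | (j < m)%N]] _ _ xn.
  by exists j.+1 => // m jm; exists m.
by apply: ((gP (s k)).2 (y j) (ys j k jk)); apply: Et (Es _ _ xj) xk.
Qed.

Lemma locally_constant_uniform (R : Type) (D : set T) (f : T -> R) : compact D ->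
  (forall x, D x -> exists n, forall y, E n x y -> f y = f x) ->
  exists n, forall x, D x -> forall y, E n x y -> f y = f x.
Proof.
move=> Dc fl; apply: (@compact_uniform D (fun n x => forall y, E n x y -> f y = f x)) => //.
  by move=> m n x mn H y /(E_decr mn); exact: H.
move=> x Dx; have [n nP] := fl x Dx; exists n => y xy _ z yz.
have [_ _ Et] := E_equiv n.
by rewrite (nP y xy); apply: nP; exact: Et xy yz.
Qed.

Lemma Cc_uniform (K : fieldType) (f : T -> K^o) : locally_constant f ->
  compact [set x | f x != 0] -> exists n, forall x y, E n x y -> f x = f y.
Proof.
move=> fl fc; have [|n nP] := @locally_constant_uniform _ _ f fc.
  by move=> x _; have /E_nbhs := fl x.
exists n => x y xy; have [fx0|fx0] := eqVneq (f x) 0; last by rewrite (nP x).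
have [fy0|fy0] := eqVneq (f y) 0; first by rewrite fx0.
by apply: nP => //; have [_ Es _] := E_equiv n; exact: Es.
Qed.

Lemma uniform_closed n (A : set T) : (forall x y, E n x y -> A x -> A y) -> closed A.
Proof.
move=> AE; rewrite -openC openE => x Ax; apply/E_nbhs; exists n => y xy Ay; apply: Ax.
by have [_ Es _] := E_equiv n; apply: AE Ay; exact: Es.
Qed.

Lemma uniform_open n (A : set T) : (forall x y, E n x y -> A x -> A y) -> open A.
Proof.
by move=> AE; rewrite openE => x Ax; apply/E_nbhs; exists n => y /AE; apply.
Qed.
End UniformPartitions.

(** * Lattices in finite-dimensional spaces *)

Section Lattices.
Variables (F : fieldExtType Q2) (V : vectType F).
Local Notation O := (@scaled F).
Implicit Types (w : V) (n m : int).

Definition Lat n : set V := [set w | forall i, O n (coord (vbasis {:V}) i w)].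

Lemma Lat0 n : Lat n 0.
Proof. by move=> i; rewrite linear0; exact: scaled0. Qed.
Lemma LatD n w w' : Lat n w -> Lat n w' -> Lat n (w + w').
Proof. by move=> H H' i; rewrite linearD; exact: scaledD (H i) (H' i). Qed.
Lemma LatN n w : Lat n w -> Lat n (- w).
Proof. by move=> H i; rewrite linearN; exact: scaledN (H i). Qed.
Lemma LatB n w w' : Lat n w -> Lat n w' -> Lat n (w - w').
Proof. by move=> ? ?; apply: LatD => //; exact: LatN. Qed.
Lemma LatBC n w w' : Lat n (w - w') -> Lat n (w' - w).
Proof. by move=> /LatN; rewrite opprB. Qed.
Lemma Lat_sum n (I : Type) (r : seq I) (P : pred I) (f : I -> V) :
  (forall i, P i -> Lat n (f i)) -> Lat n (\sum_(i <- r | P i) f i).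
Proof. by move=> H; apply: big_ind => //; [exact: Lat0|exact: LatD]. Qed.
Lemma LatZ m n a w : O m a -> Lat n w -> Lat (m + n) (a *: w).
Proof. by move=> am wn i; rewrite linearZ; exact: scaledM am (wn i). Qed.
Lemma Lat_leq n m : n <= m -> Lat m `<=` Lat n.
Proof. by move=> nm w wm i; exact: scaled_leq (wm i). Qed.
Lemma Lat_ex w : exists k : nat, Lat (- k%:Z) w.
Proof. exact: scaled_exs. Qed.
Lemma Lat_eq0 w : (forall n : nat, Lat n w) -> w = 0.
Proof.
move=> H; rewrite (coord_vbasis (memvf w)) big1 // => i _.
by rewrite (_ : coord _ _ _ = 0) ?scale0r //; apply: scaled_eq0 => n; exact: H.
Qed.

Lemma Lat_comb (I : finType) (v : I -> V) : exists r : nat, forall n (a : I -> F),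
  (forall i, O n (a i)) -> Lat (n - r%:Z) (\sum_i a i *: v i).
Proof.
have [r rP] := choice (fun i => Lat_ex (v i)).
exists (\max_i r i)%N => n a aP; apply: Lat_sum => i _.
apply: LatZ => //; apply: Lat_leq (rP i).
by rewrite lerN2 lez_nat; exact: leq_bigmax.
Qed.

Lemma latticeE n : @lattice F V (2 ^ n) = Lat n.
Proof.
apply/seteqP; split=> w H i; have := H i.
  by move=> [a aO <-]; rewrite -[X in O X]addr0; apply: scaledM; [exact: scaled_pow|exact/scaled_integer].
by move=> /scaled_div[y yO yE]; exists y.
Qed.

Lemma nbhs_LatP (u : ltop V) (A : set (ltop V)) :
  nbhs u A <-> exists n : nat, forall w, Lat n w -> A (u + w).
Proof.
split=> [/nbhs_ltopP[c [c0 cO cA]]|[n nA]]; last first.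
  apply/nbhs_ltopP; exists (2 ^ (n : int)); rewrite latticeE; split=> //.
    by rewrite expfz_neq0 // two_neq0.
  by rewrite -exprnP; apply: integerX; exact: (integer_int F 2).
have [n nc] := integer_dvd_pow2 c0 cO; exists n => w wn; apply: cA => i.
exists (c^-1 * coord (vbasis {:V}) i w); last by rewrite mulVKf.
by apply/scaled_integer; rewrite -(addNr n%:Z); apply: scaledM => //; exact: wn.
Qed.

Definition Lat_rel (n : nat) (u v : ltop V) : Prop := Lat n (v - u : V).

Lemma Lat_rel_equiv (n : nat) : equivalence_Prop (Lat_rel n).
Proof.
split=> [x|x y|x y z]; rewrite /Lat_rel; first by rewrite subrr; exact: Lat0.
  exact: LatBC.
by move=> xy yz; have := LatD yz xy; rewrite addrA subrK.
Qed.

Lemma Lat_rel_decr (m n : nat) x y : (m <= n)%N -> Lat_rel n x y -> Lat_rel m x y.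
Proof. by move=> mn; apply: Lat_leq; rewrite lez_nat. Qed.

Lemma Lat_rel_nbhs x (A : set (ltop V)) : nbhs x A <-> exists n : nat, forall y, Lat_rel n x y -> A y.
Proof.
rewrite nbhs_LatP; split=> -[n nA]; exists n => y.
  by move=> /nA; rewrite addrC subrK.
by move=> yn; apply: nA; rewrite /Lat_rel addrC addKr.
Qed.

Lemma ultra_finite_partition (T : Type) (T' : choiceType) (G : set_system T) (f : T -> T') (s : seq T') :
  UltraFilter G -> G [set x | f x \in s] -> exists2 t, t \in s & G [set x | f x = t].
Proof.
move=> GU; elim: s => [|t s IH] Gs.
  by have [x] := filter_ex Gs.
have [Gt|Gt] := in_ultra_setVsetC [set x | f x = t] GU.
  by exists t => //; exact: mem_head.
have [|t' t's Gt'] := IH; last by exists t' => //; rewrite inE t's orbT.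
by apply: filterS2 Gs Gt => x /= + xt; rewrite inE => /predU1P[].
Qed.

Lemma Lat_generators n : exists (I : finType) (g : I -> V), forall w, Lat n w ->
  exists a : I -> Z2, w = \sum_i Z2_to F (a i) *: g i.
Proof.
have [r [g gP]] := integer_generators F.
exists ('I_(\dim {:V}) * 'I_r)%type.
exists (fun ij : 'I_(\dim {:V}) * 'I_r => (2 ^ n * g ij.2) *: (vbasis {:V})`_ij.1) => w wn.
have /choice[a aP] : forall i, exists a : 'I_r -> Z2,
    coord (vbasis {:V}) i w = \sum_j Z2_to F (a j) * (2 ^ n * g j).
  move=> i; have [y yO ->] := scaled_div (wn i); have [a ->] := gP y yO.
  by exists a; rewrite mulr_sumr; apply: eq_bigr => j _; rewrite mulrCA.
exists (fun ij => a ij.1 ij.2); rewrite [LHS](coord_vbasis (memvf w)).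
rewrite -(pair_big xpredT xpredT (fun i j => Z2_to F (a i j) *: ((2 ^ n * g j) *: (vbasis {:V})`_i))) /=.
apply: eq_bigr => i _; rewrite aP scaler_suml; apply: eq_bigr => j _.
by rewrite scalerA.
Qed.

(** An ultrafilter on the lattice selects one value for each residue of each coefficient with
    respect to the generators, as there are finitely many; the selected residues are coherent and
    define the limit. *)
Lemma compact_Lat n : compact (Lat n : set (ltop V)).
Proof.
rewrite compact_ultra => G GU GL.
have [I [g gP]] := Lat_generators n.
have /choice[a aP] : forall w, exists a : I -> Z2, Lat n w -> w = \sum_i Z2_to F (a i) *: g i.
  move=> w; have [/gP[a wE]|nw] := pselect (Lat n w); first by exists a.
  by exists (fun=> 0).
have /choice[z zP] : forall i, exists z : Z2, forall k, G [set w | Z2_val (a w i) k = Z2_val z k].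
  move=> i; have /choice[f fP] : forall k, exists t, G [set w | Z2_val (a w i) k = t].
    move=> k; pose s := [seq Posz j | j <- iota 0 (2 ^ k)].
    have [|t ts Gt] := @ultra_finite_partition _ _ G (fun w => Z2_val (a w i) k) s GU; last by exists t.
    apply: filterS filterT => w _ /=; rewrite -Z2_mod.
    have p2 : 2 ^+ k = (2 ^ k)%N%:Z :> int by rewrite -natz natrX.
    have := @modz_ge0 (Z2_val (a w i) k) (2 ^+ k); have := @ltz_pmod (Z2_val (a w i) k) (2 ^+ k).
    rewrite p2; case: (_ %% _)%Z => // j jlt jge; last first.
      by have := jge; rewrite -p2 expf_neq0 // => /(_ isT).
    apply/mapP; exists j => //; rewrite mem_iota add0n /=.
    by rewrite -ltz_nat; apply: jlt; rewrite ltz_nat expn_gt0.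
  have fc k : (f k = f k.+1 %[mod 2 ^+ k])%Z.
    have [w [<- <-]] := filter_ex (filterI (fP k) (fP k.+1)).
    by rewrite [in LHS]Z2_step modz_mod.
  exists (Z2_mk fc) => k; apply: filterS (fP k) => w /= wk.
  by rewrite -wk Z2_mod.
pose v : ltop V := \sum_i Z2_to F (z i) *: g i.
have [r rP] := Lat_comb g.
have close (N : nat) : G [set w | Lat n w /\ Lat N (w - v : V)].
  have GA : G [set w | forall i, Z2_val (a w i) (N + r) = Z2_val (z i) (N + r)].
    by apply: filter_forall => i; exact: zP.
  apply: filterS2 GL GA => w wn wz; split=> //.
  rewrite {1}(aP w wn) /v -sumrB; under eq_bigr => i _ do rewrite -scalerBl -rmorphB.
  rewrite (_ : N%:Z = (N + r)%N%:Z - r%:Z); last by rewrite PoszD addrK.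
  apply: rP => i; have /eqP/Z2_congrP[w' ->] := wz i.
  rewrite rmorphM rmorphXn rmorph_nat -[X in O X]addr0; apply: scaledM.
    exact: (scaled_pow F (N + r)%N).
  by apply/scaled_integer; exact: integer_Z2.
exists v; split.
  have [k nk] : exists k : nat, n <= k by exists `|n|%N; rewrite abszE ler_norm.
  have [w [wn wv]] := filter_ex (close k).
  have := LatB wn (Lat_leq nk wv); rewrite opprB addrC subrK; exact.
move=> A /nbhs_LatP[N NA]; apply: filterS (close N) => w [_ wv].
by have := NA _ wv; rewrite addrC subrK.
Qed.
End Lattices.

Section Boundedness.
Variable F : fieldExtType Q2.
Local Notation O := (@scaled F).
Implicit Types (n m : int).

(** On the line [F^o], [Lat] refers to the chosen [vbasis], which may differ from 1; hence it agrees
    with the ideals [2^n O_F] only up to a bounded shift. *)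
Lemma Lat_regular : exists r : nat,
  (forall n (x : F), @Lat F F^o n x -> O (n - r%:Z) x) /\
  (forall n (x : F), O n x -> @Lat F F^o (n - r%:Z) x).
Proof.
have [r1 r1P] := scaled_exs (fun i : 'I_(\dim {:F^o}) => (vbasis {:F^o})`_i : F).
have [r2 r2P] := scaled_exs (fun i : 'I_(\dim {:F^o}) => coord (vbasis {:F^o}) i 1 : F).
exists (maxn r1 r2); split=> n x xn.
  rewrite (coord_vbasis (memvf (x : F^o))); apply: scaled_sum => i _.
  apply: scaledM => //; apply: scaled_leq (r1P i).
  by rewrite lerN2 lez_nat leq_maxl.
move=> i; have -> : coord (vbasis {:F^o}) i x = x * coord (vbasis {:F^o}) i 1.
  by rewrite -[in LHS](mulr1 x) -[x * 1]/(x *: (1 : F^o)) linearZ.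
apply: scaledM => //; apply: scaled_leq (r2P i).
by rewrite lerN2 lez_nat leq_maxr.
Qed.

Lemma bilinear_bounded (V1 V2 V3 : vectType F) (b : V1 -> V2 -> V3) :
  (forall w, linear (b w)) -> (forall w', linear (b^~ w')) -> exists r : nat,
  forall n m w w', Lat n w -> Lat m w' -> Lat (n + m - r%:Z) (b w w').
Proof.
move=> bl br.
pose bL w : {linear V2 -> V3} := HB.pack (b w) (GRing.isLinear.Build F V2 V3 _ _ (bl w)).
pose bR w' : {linear V1 -> V3} := HB.pack (b^~ w') (GRing.isLinear.Build F V1 V3 _ _ (br w')).
have [r rP] := Lat_comb (fun ij : 'I_(\dim {:V1}) * 'I_(\dim {:V2}) =>
   b (vbasis {:V1})`_ij.1 (vbasis {:V2})`_ij.2).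
exists r => n m w w' wn w'm.
have -> : b w w' = \sum_(ij : 'I_(\dim {:V1}) * 'I_(\dim {:V2}))
   (coord (vbasis {:V1}) ij.1 w * coord (vbasis {:V2}) ij.2 w') *: b (vbasis {:V1})`_ij.1 (vbasis {:V2})`_ij.2.
  rewrite -(pair_big xpredT xpredT (fun i j => (coord (vbasis {:V1}) i w * coord (vbasis {:V2}) j w') *:
     b (vbasis {:V1})`_i (vbasis {:V2})`_j)) /=.
  rewrite {1}(coord_vbasis (memvf w)) -[LHS]/(bR w' _) linear_sum; apply: eq_bigr => i _.
  rewrite linearZ /= {1}(coord_vbasis (memvf w')) -[b _ _]/(bL _ _) linear_sum scaler_sumr.
  by apply: eq_bigr => j _; rewrite linearZ /= scalerA.
by apply: rP => ij; apply: scaledM; [exact: wn|exact: w'm].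
Qed.

Lemma bilinear_form_bounded (V1 V2 : vectType F) (b : V1 -> V2 -> F^o) :
  (forall w, linear (b w)) -> (forall w', linear (b^~ w')) -> exists r : nat,
  forall n m w w', Lat n w -> Lat m w' -> O (n + m - r%:Z) (b w w').
Proof.
move=> bl br; have [r rP] := bilinear_bounded bl br; have [r' [rP' _]] := Lat_regular.
exists (r + r')%N => n m w w' wn w'm; rewrite PoszD opprD addrA; apply: rP'.
exact: rP.
Qed.

Lemma linear_bounded (V V' : vectType F) (L : {linear V -> V'}) : exists r : nat,
  forall n w, Lat n w -> Lat (n - r%:Z) (L w).
Proof.
have [r rP] := Lat_comb (fun i : 'I_(\dim {:V}) => L (vbasis {:V})`_i); exists r => n w wn.
rewrite {1}(coord_vbasis (memvf w)) linear_sum; under eq_bigr => i _ do rewrite linearZ.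
by apply: rP => i; exact: wn.
Qed.

Lemma functional_bounded (V : vectType F) (L : V -> F^o) : linear L -> exists r : nat,
  forall n w, Lat n w -> O (n - r%:Z) (L w).
Proof.
move=> Ll; pose L' : {linear V -> F^o} := HB.pack L (GRing.isLinear.Build F V F^o _ _ Ll).
have [r rP] := linear_bounded L'; have [r' [rP' _]] := Lat_regular.
exists (r + r')%N => n w wn; rewrite PoszD opprD addrA; apply: rP'.
exact: (rP _ _ wn).
Qed.

(** Separating functionals form an injective linear map to row vectors, whose left inverse has
    bounded denominators. *)
Lemma functionals_bounded (V : vectType F) (k : nat) (l : 'I_k -> V -> F^o) :
  (forall i, linear (l i)) -> (forall w, (forall i, l i w = 0) -> w = 0) -> exists r : nat,
  forall n w, (forall i, O n (l i w)) -> Lat (n - r%:Z) w.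
Proof.
move=> ll lsep; pose f w : 'rV[F]_k := \row_i l i w.
have fl : linear f by move=> a u v; apply/rowP => i; rewrite !mxE ll.
pose f' : {linear V -> 'rV[F]_k} := HB.pack f (GRing.isLinear.Build F V 'rV[F]_k _ _ fl).
pose g := linfun f'.
have gE w : g w = f w by rewrite lfunE.
have g0 : lker g == 0%VS.
  rewrite -subv0; apply/subvP => w; rewrite memv_ker memv0 gE => /eqP/rowP w0.
  by apply/eqP/lsep => i; have := w0 i; rewrite !mxE.
have [r rP] := Lat_comb (fun i : 'I_k => (g^-1)%VF (delta_mx 0 i)).
exists r => n w wn; rewrite -[w](lker0_lfunK g0) gE [f w]row_sum_delta linear_sum.
under eq_bigr => i _ do rewrite linearZ mxE /=.
exact: rP.
Qed.

(** On the compact [O_F] the function [a v^2 - 1] has no zero, so it stays away from 0 uniformly. A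
    [v] with [a v^2] near 1 is integral because [a^-1] is. *)
Lemma nonsquare_separated (a : F) : O 0 a -> O 0 a^-1 -> a != 0 -> (forall v, a * v ^+ 2 != 1) ->
  exists s : nat, forall v, ~ O s (a * v ^+ 2 - 1).
Proof.
move=> aO aVO a0 aN.
have [r [r1 r2]] := Lat_regular.
pose D := [set x : ltop F^o | O 0 (x : F)].
have Dc : compact D.
  apply: subclosed_compact (@compact_Lat F F^o (0 - r%:Z)) _; last by move=> x /r2.
  apply: (uniform_closed (@Lat_rel_equiv _ _) (@Lat_rel_nbhs F F^o) (n := r)) => x y xy xO.
  have {}xy : O 0 (y - x : F) by have := r1 _ _ xy; rewrite subrr.
  by have := scaledD xO xy; rewrite [X in O 0 X]addrC subrK.
have [m n y mn H /(scaled_leq _) yn|x xO|s sP] := compact_uniform (@Lat_rel_nbhs F F^o)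
   (Q := fun (n : nat) x => ~ O n (a * (x : F) ^+ 2 - 1)) Dc.
- by apply: H; apply: yn; rewrite lez_nat.
- have [s xs] : exists s : nat, ~ O s (a * x ^+ 2 - 1).
    apply: contrapT => H; have /eqP := aN x; apply; apply/eqP; rewrite -subr_eq0.
    by apply/eqP/scaled_eq0 => s; apply: contrapT => xs; apply: H; exists s.
  exists (s + r)%N => y xy yO ys; apply: xs.
  have xy' : O s (y - x : F) by have := r1 _ _ xy; rewrite PoszD addrK.
  rewrite (_ : _ - 1 = a * y ^+ 2 - 1 - (y - x : F) * (a * (y + x : F))); last by ring.
  apply: scaledB; first by apply: scaled_leq ys; rewrite lez_nat leq_addr.
  rewrite -[s%:Z]addr0; apply: scaledM => //.
  by rewrite -[0](addr0 0); apply: scaledM => //; exact: scaledD.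
exists s => v vs; apply: (sP v) => //; apply/scaled_integer/integer_sqrt.
have : O 0 (a * v ^+ 2).
  rewrite -(subrK 1 (a * v ^+ 2)); apply: scaledD.
    by apply: scaled_leq vs; rewrite lez_nat.
  by apply/scaled_integer; exact: integer1.
by move=> /(scaledM aVO); rewrite mulKf // addr0 => /scaled_integer.
Qed.
End Boundedness.

(** * Conductors of smooth characters *)

Section SmoothCharacters.
Variables (F : fieldExtType Q2) (K : fieldType) (psi : smooth_character F K).
Local Notation O := (@scaled F).
Implicit Types (s t c : F).

Lemma char0 : psi 0 = 1.
Proof.
apply: (mulfI (char_neq0 psi 0)); rewrite mulr1 -charD.
by rewrite addr0.
Qed.
Lemma charN t : psi (- t) = (psi t)^-1.
Proof.
apply: (mulfI (char_neq0 psi t)); rewrite -charD subrr char0 mulfV //; exact: char_neq0.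
Qed.
Lemma charB s t : psi (s - t) = psi s / psi t.
Proof. by rewrite charD charN. Qed.
Lemma charMn t n : psi (t *+ n) = psi t ^+ n.
Proof. by elim: n => [|n IH]; [rewrite mulr0n char0|rewrite mulrS charD IH exprS]. Qed.

Lemma char_level : exists k : nat, forall t, O k t -> psi t = 1.
Proof.
have /nbhs_LatP[n nP] := char_smooth psi 0; have [r [_ rP]] := Lat_regular F.
exists (n + r)%N => t tO; rewrite -char0 -[t]add0r; apply: nP.
by have := rP _ _ tO; rewrite PoszD addrK.
Qed.

Lemma char_functional_level (V : vectType F) (L : V -> F^o) : linear L ->
  exists n : nat, forall w, Lat n w -> psi (L w) = 1.
Proof.
move=> /functional_bounded[r rP]; have [k kP] := char_level.
exists (k + r)%N => w wn; apply: kP.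
by have := rP _ _ wn; rewrite PoszD addrK.
Qed.

Lemma char_square_level (V : vectType F) (L : V -> F^o) (c : F) (N : nat) : linear L ->
  exists n : nat, forall c' w u, O 0 c' -> Lat (- N%:Z) u -> Lat n w ->
    psi (c' * c * L (u + w) ^+ 2) = psi (c' * c * L u ^+ 2).
Proof.
move=> Ll; have [r rP] := functional_bounded Ll; have [k kP] := char_level.
have [j jP] := scaled_ex c.
have LD u v : L (u + v) = L u + L v by have := Ll 1 u v; rewrite !scale1r.
exists (k + j + (N + r) + r)%N => c' w u c'O uN wn; rewrite LD.
have -> : c' * c * (L u + L w) ^+ 2 = c' * c * L u ^+ 2 + c' * c * (L w * (2 * L u + L w)) by ring.
rewrite charD [X in _ * X]kP ?mulr1 // -mulrA; apply: scaledM0; first exact/scaled_integer.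
have wL : O (k + j + (N + r))%N (L w) by have := rP _ _ wn; rewrite PoszD addrK.
have uL : O (- (N + r)%N%:Z) (L u) by apply: scaled_leq (rP _ _ uN); lia.
have H : O (- (N + r)%N%:Z) (2 * L u + L w).
  apply: scaledD; last by apply: scaled_leq wL; lia.
  by apply: scaledM0 => //; exact: (integer_int F 2).
by apply: scaled_leq (scaledM jP (scaledM wL H)); lia.
Qed.

Lemma char_pow2 t : exists n : nat, psi t ^+ (2 ^ n) = 1.
Proof.
have [k kP] := char_level; have [j jP] := scaled_ex t; exists (k + j)%N; rewrite -charMn.
apply: kP; rewrite -mulr_natl natrX -[_ ^+ _]/(2 ^ ((k + j)%N : int)).
by have := scaledM (scaled_pow F (k + j)%N) jP; rewrite PoszD addrK.
Qed.

Hypothesis psi_nt : nontrivial_character psi.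

(** A bound on the conductor of [psi]. By compactness one exponent works on the whole shell [O_F]
    minus [2 O_F], and a power of 2 brings every nonzero element into the shell. *)
Lemma char_detect : exists r : nat, forall n t, (forall c, O n c -> psi (c * t) = 1) ->
  O (- r%:Z - n) t.
Proof.
have [t1 t1P] := psi_nt; have [k kP] := char_level.
have [r [r1 r2]] := Lat_regular F.
pose D := [set x : ltop F^o | O 0 (x : F) /\ ~ O 1 (x : F)].
have Dc : compact D.
  apply: subclosed_compact (@compact_Lat F F^o (0 - r%:Z)) _; last by move=> x [/r2].
  apply: (uniform_closed (@Lat_rel_equiv _ _) (@Lat_rel_nbhs F F^o) (n := r.+1)) => x y xy [xO xn].
  have {}xy : O 1 (y - x : F).
    by have := r1 _ _ xy; rewrite -addn1 PoszD addrAC subrr add0r.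
  split; first by have := scaledD xO (scaled_leq _ xy); rewrite [X in O 0 X]addrC subrK; apply.
  by move=> yO; apply: xn; have := scaledB yO xy; rewrite opprB addrC subrK.
have [m n y mn H Hy|x [xO xn]|s sP] := compact_uniform (@Lat_rel_nbhs F F^o)
   (Q := fun (n : nat) (x : F) => ~ forall c, O (- n%:Z) c -> psi (c * x) = 1) Dc.
- by apply: H => c cm; apply: Hy; apply: scaled_leq cm; rewrite lerN2 lez_nat.
- have x0 : (x : F) != 0 by apply/eqP => x0; apply: xn; rewrite x0; exact: scaled0.
  have [j jP] := scaled_ex (t1 / x : F).
  exists (maxn j (k + j + r)) => y xy _ H.
  have xy' : O (k + j)%N (y - x : F).
    have := r1 _ _ xy; apply: scaled_leq; rewrite lerBrDr -PoszD lez_nat; exact: leq_maxr.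
  case/eqP: t1P; rewrite -(mulfVK x0 t1) -[x in _ * x](subKr (y : F)) mulrBr charB.
  rewrite H ?(kP (_ * (y - x))) ?divr1 //.
    by have := scaledM jP xy'; rewrite PoszD addrC addrK.
  by apply: scaled_leq jP; rewrite lerN2 lez_nat leq_maxl.
have main t : (forall c, O 0 c -> psi (c * t) = 1) -> O (- s%:Z) t.
  move=> H; apply: contrapT => ts.
  have ex : exists j : nat, `[< O (- j%:Z) t >] by have [j jP] := scaled_ex t; exists j; apply/asboolP.
  case: (ex_minnP ex) => j /asboolP jP jmin.
  have sj : (s < j)%N.
    by rewrite ltnNge; apply/negP => js; apply: ts; apply: scaled_leq jP; rewrite lerN2 lez_nat.
  apply: (sP (2 ^ j%:Z * t)).
    split; first by have := scaledM (scaled_pow F j%:Z) jP; rewrite addrN.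
    move=> /(scaledMpow (- j%:Z)); rewrite mulrA -expfzDr ?two_neq0 // addNr expr0z mul1r => t1'.
    have : (j <= j.-1)%N; last by lia.
    apply: jmin; apply/asboolP; move: t1'; rewrite (_ : 1 - j%:Z = - j.-1%:Z) //.
    by rewrite -subn1 -subzn ?opprB // (leq_trans _ sj).
  move=> c cs; rewrite mulrA; apply: H.
  apply: scaled_leq (scaledM cs (scaled_pow F j%:Z)).
  by rewrite addrC subr_ge0 lez_nat ltnW.
exists s => n t H; have two0 := two_neq0 F.
rewrite -[t]mul1r -(expr0z (2 : F)) -(addNr n) expfzDr // -mulrA.
apply: scaledMpow; apply: main => c cO; rewrite mulrA; apply: H.
by have := scaledM cO (scaled_pow F n); rewrite add0r.
Qed.
End SmoothCharacters.

(** * Schwartz functions as finite sums over cosets *)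

Section SchwartzSpace.
Variables (F : fieldExtType Q2) (V : vectType F) (K : fieldType).
Local Notation S := (Cc (ltop V) K).
Implicit Types (f g h : S) (u v w y : V).

Definition level (n N : nat) (f : V -> K) : Prop :=
  (forall u w, Lat n w -> f (u + w) = f u) /\ (forall u, f u != 0 -> Lat (- N%:Z) u).

Lemma level_leq n n' N N' (f : V -> K) : (n <= n')%N -> (N <= N')%N -> level n N f -> level n' N' f.
Proof.
move=> nn NN [f1 f2]; split=> [u w wn|u fu]; first by apply/f1/Lat_leq/wn; rewrite lez_nat.
by apply: Lat_leq (f2 u fu); rewrite lerN2 lez_nat.
Qed.

Lemma CcE f g : (forall u : V, f u = g u) -> f = g.
Proof. by move=> fg; apply/val_inj/funext. Qed.

Lemma CcZE (c : K) f u : (c *: f : S) u = c * f u. Proof. by []. Qed.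
Lemma CcDE f g u : (f + g : S) u = f u + g u. Proof. by []. Qed.
Lemma CcNE f u : (- f : S) u = - f u. Proof. by []. Qed.

Lemma Cc_level f : exists n N, level n N f.
Proof.
have [fl fc] := CcP f.
have [n nP] := Cc_uniform (@Lat_rel_equiv _ V) (@Lat_rel_decr _ V) (@Lat_rel_nbhs _ V) fl fc.
have [m k y mk|x _|N NP] := compact_uniform (@Lat_rel_nbhs _ V) (Q := fun (N : nat) u => Lat (- N%:Z) (u : V)) fc.
- by apply: Lat_leq; rewrite lerN2 lez_nat.
- have [k kP] := Lat_ex (x : V); exists k => y xy _.
  rewrite -[y](subrK x); apply: LatD => //; apply: Lat_leq xy.
  lia.
- exists n, N; split=> // u w wn; apply/esym/nP.
  by rewrite /Lat_rel addrC addKr.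
Qed.

Lemma level_Cc n N (f : V -> K) : level n N f -> is_Cc (f : ltop V -> K^o).
Proof.
move=> [f1 f2]; apply/asboolP; split.
  move=> x; apply/nbhs_LatP; exists n => w wn; exact: f1.
apply: subclosed_compact (@compact_Lat _ V (- N%:Z)) f2.
apply: (uniform_closed (@Lat_rel_equiv _ V) (@Lat_rel_nbhs _ V) (n := n)) => x y xy /=.
by rewrite -[X in _ -> f X != 0](subrK x) addrC f1.
Qed.

Definition coset_fun (n : nat) (y : V) (u : V) : K := if `[< Lat n (u - y) >] then 1 else 0.

Lemma coset_fun_level (n : nat) y : exists N, forall M, (N <= M)%N -> level n M (coset_fun n y).
Proof.
have [N NP] := Lat_ex y; exists N => M NM; split=> [u w wn|u].
  rewrite /coset_fun; congr (if _ then _ else _); apply: asbool_equiv_eq.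
  split=> H; last by rewrite addrAC; exact: LatD.
  by have := LatB H wn; rewrite addrAC addrK.
rewrite /coset_fun; case: asboolP => [uy _|_]; last by rewrite eqxx.
rewrite -(subrK y u); apply: LatD.
  by apply: Lat_leq uy; lia.
by apply: Lat_leq NP; rewrite lerN2 lez_nat.
Qed.

Lemma coset_is_Cc n y : is_Cc (coset_fun n y : ltop V -> K^o).
Proof. by have [N /(_ N (leqnn N)) /level_Cc] := coset_fun_level n y. Qed.

Definition coset n y : S := Cc_of (coset_is_Cc n y).

Lemma coset1 (n : nat) y u : Lat n (u - y) -> coset n y u = 1.
Proof. by move=> H; rewrite /= /coset_fun asboolT. Qed.
Lemma coset0 (n : nat) y u : ~ Lat n (u - y) -> coset n y u = 0.
Proof. by move=> H; rewrite /= /coset_fun asboolF. Qed.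

Lemma Lat_transversal (n : nat) (m : int) : exists s : seq V, transversal (@Lat_rel _ V n) (Lat m) s.
Proof. by have [s] := compact_transversal (@Lat_rel_equiv _ V) (@Lat_rel_nbhs _ V) n (@compact_Lat _ V m); exists s. Qed.

Lemma Cc_sumE (I : Type) (r : seq I) (P : pred I) (h : I -> S) (u : V) :
  (\sum_(i <- r | P i) h i : S) u = \sum_(i <- r | P i) h i u.
Proof. by elim/big_rec2: _ => // i x g _ <-. Qed.

Lemma level_sum n N f s : level n N f -> transversal (@Lat_rel _ V n) (Lat (- N%:Z)) s ->
  f = \sum_(y <- s) (f y : K) *: coset n y.
Proof.
move=> [f1 f2] [us sE sD]; apply: CcE => u; rewrite Cc_sumE.
have fE y : Lat n (u - y) -> f u = f y by move=> H; rewrite -(subrK y u) addrC f1.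
have [fu0|fu0] := eqVneq (f u) 0.
  rewrite fu0 big1 // => y _; have [H|H] := pselect (Lat n (u - y)).
    by rewrite CcZE -fE // fu0 mul0r.
  by rewrite CcZE coset0 // mulr0.
have [y ys yu] := sD u (f2 u fu0).
rewrite (bigD1_seq y) // CcZE coset1 // mulr1 -(fE y yu) /=.
rewrite big1_seq ?addr0 // => z /andP[zy zs].
rewrite -[LHS]/(f z * coset n z u) coset0 ?mulr0 // => zu.
case/eqP: zy; apply: sE => //; have [_ Es Et] := @Lat_rel_equiv _ V n.
by apply: Et zu (Es _ _ yu).
Qed.

(* A functional that transforms under multiplication by enough functions chi
   as evaluation at a point would, vanishes off that point. *)
Lemma semilinear_functional_local (K' : fieldType) (sigma : {rmorphism K -> K'}) (lam : S -> K') f :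
  (forall g h, lam (g + h) = lam g + lam h) -> (forall c g, lam (c *: g) = sigma c * lam g) ->
  (forall y, f y != 0 -> exists (chi : V -> K) mu,
    [/\ exists n : nat, forall w, Lat n w -> chi (y + w) = chi y,
        forall g h, (forall u, h u = chi u * g u) -> lam h = mu * lam g & sigma (chi y) != mu]) ->
  lam f = 0.
Proof.
move=> lamD lamZ H; have [fl fc] := CcP f.
pose Q (n : nat) (y : V) := exists (chi : V -> K) mu, [/\ forall w, Lat n w -> chi (y + w) = chi y,
    forall g h, (forall u, h u = chi u * g u) -> lam h = mu * lam g & sigma (chi y) != mu].
have [m n y mn [chi [mu [c1 c2 c3]]]|x /H[chi [mu [[n c1] c2 c3]]]|n nP] :=
  compact_uniform (@Lat_rel_nbhs _ V) (Q := Q) fc.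
- exists chi, mu; split=> // w wn; apply: c1; apply: Lat_leq wn; by rewrite lez_nat.
- exists n => y xy _; exists chi, mu; have yx : chi y = chi x by rewrite -{1}(subrK x y) addrC c1.
  split=> //; last by rewrite yx.
  move=> w wn; rewrite yx -{1}(subrK x y) addrAC addrC c1 //; exact: LatD.
have [n' [N fN]] := Cc_level f; set m := maxn n n'.
have [s sP] := Lat_transversal m (- N%:Z).
have lam0 : lam 0 = 0 by rewrite -(scale0r (0 : S)) lamZ rmorph0 mul0r.
rewrite (level_sum (level_leq (leq_maxr n n') (leqnn N) fN) sP) -/m.
rewrite (big_morph lam lamD lam0) big1_seq // => y /andP[_ ys]; rewrite lamZ.
have [->|fy0] := eqVneq (f y) 0; first by rewrite rmorph0 mul0r.
have [chi [mu [c1 c2 c3]]] := nP y fy0.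
have E : lam (chi y *: coset m y) = mu * lam (coset m y).
  apply: c2 => u; rewrite CcZE.
  have [uy|uy] := pselect (Lat m (u - y)); last by rewrite coset0 // !mulr0.
  rewrite -(c1 (u - y)) ?[y + _]addrC ?subrK //; apply: Lat_leq uy.
  by rewrite lez_nat leq_maxl.
move/eqP: E; rewrite lamZ -subr_eq0 -mulrBl mulf_eq0 subr_eq0 (negPf c3) /= => /eqP ->.
by rewrite mulr0.
Qed.
End SchwartzSpace.

(** * Transvections and the twisted Weil representation *)

Section SymplecticGroup.
Variables (F : fieldExtType Q2) (W : vectType F) (form : {skew_symmetric W}).
Hypothesis form_nd : nondegenerate form.
Local Notation "<< u , v >>" := (form u v).
Local Notation Sp := (symplectic_group form).
Implicit Types (u v w : W) (g h : 'End(W)) (c : F).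

Lemma formC u v : << u, v >> = - << v, u >>.
Proof. by rewrite hermC /= expr1 mulN1r. Qed.

Lemma formZl a u v : << a *: u, v >> = a * << u, v >>. Proof. by rewrite linearZl_LR. Qed.
Lemma formZr a u v : << u, a *: v >> = a * << u, v >>. Proof. by rewrite linearZr_LR. Qed.
Lemma formDl u u' v : << u + u', v >> = << u, v >> + << u', v >>. Proof. exact: linearDl. Qed.
Lemma formDr u v v' : << u, v + v' >> = << u, v >> + << u, v' >>. Proof. exact: linearDr. Qed.

Lemma formvv v : << v, v >> = 0.
Proof.
by apply/eqP; have /eqP := formC v v; rewrite -subr_eq0 opprK -mulr2n -mulr_natl mulf_eq0 (negPf (two_neq0 F)).
Qed.

Lemma form_linl w : linear (fun u => << u, w >> : F^o).
Proof. by move=> a u v; rewrite linearDl linearZl. Qed.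
Lemma form_linr w : linear (fun u => << w, u >> : F^o).
Proof. by move=> a u v; rewrite linearDr linearZr. Qed.

Lemma form_nondeg v : v != 0 -> exists w, << w, v >> != 0.
Proof.
move=> v0; have : v \notin orthov form fullv by rewrite (eqP form_nd) memv0.
by move=> /mem_orthovPn[w _ wv]; exists w; rewrite formC oppr_eq0.
Qed.

Lemma form_nondeg2 v v' : v != 0 -> v' != 0 -> exists w, << w, v >> != 0 /\ << w, v' >> != 0.
Proof.
move=> /form_nondeg[a av] /form_nondeg[b bv].
have [av'|] := eqVneq << a, v' >> 0; last by exists a.
have [bv'|] := eqVneq << b, v >> 0; last by exists b.
by exists (a + b); rewrite !linearDl /= av' bv' addr0 add0r.
Qed.

Lemma symplecticM g h : Sp g -> Sp h -> Sp (g \o h)%VF.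
Proof. by move=> gS hS u v; rewrite !comp_lfunE gS hS. Qed.

Lemma symplectic_lker g : Sp g -> lker g == 0%VS.
Proof.
move=> gS; rewrite -subv0; apply/subvP => v; rewrite memv_ker memv0 => /eqP gv.
by apply: contraT => /form_nondeg[w]; rewrite -gS gv linear0r eqxx.
Qed.

Lemma symplectic_compfV g : Sp g -> (g \o g^-1 = \1)%VF.
Proof. by move=> /symplectic_lker; exact: lker0_compfV. Qed.
Lemma symplectic_fK g : Sp g -> cancel g (g^-1)%VF.
Proof. by move=> /symplectic_lker; exact: lker0_lfunK. Qed.
Lemma symplectic_fVK g : Sp g -> cancel (g^-1)%VF g.
Proof. by move=> gS v; rewrite -comp_lfunE symplectic_compfV // id_lfunE. Qed.

Lemma symplecticV g : Sp g -> Sp (g^-1)%VF.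
Proof. by move=> gS u v; rewrite -gS !symplectic_fVK. Qed.

Definition transvection v c : 'End(W) := (\1 + linfun (fun w => (c * << w, v >>) *: v))%VF.

Lemma transvectionE v c w : transvection v c w = w + (c * << w, v >>) *: v.
Proof.
have ll : linear (fun w => (c * << w, v >>) *: v).
  move=> a u u'; rewrite linearDl linearZl /= mulrDr scalerDl; congr (_ + _).
  by rewrite scalerA mulrCA.
pose L : {linear W -> W} := HB.pack (fun w => (c * << w, v >>) *: v) (GRing.isLinear.Build F W W _ _ ll).
by rewrite /transvection add_lfunE id_lfunE -[fun w => _]/(L : W -> W) lfunE.
Qed.

Lemma symplectic_transvection v c : Sp (transvection v c).
Proof.
move=> u w; rewrite !transvectionE !linearDl !linearDr !linearZl_LR !linearZr_LR /= formvv.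
by rewrite (formC v w); ring.
Qed.

Lemma transvection_conj g v c : Sp g -> (g \o transvection v c \o g^-1)%VF = transvection (g v) c.
Proof.
move=> gS; apply/lfunP => w; rewrite !comp_lfunE !transvectionE linearD linearZ /= symplectic_fVK //.
by rewrite -[<< _, g v >>](symplecticV gS) symplectic_fK.
Qed.

Lemma transvectionK v c : (transvection v c \o transvection v (- c))%VF = \1%VF.
Proof.
apply/lfunP => w; rewrite comp_lfunE !transvectionE id_lfunE linearDl linearZl_LR /= formvv.
by rewrite mulr0 addr0 -addrA -scalerDl mulNr addNr scale0r addr0.
Qed.

Lemma transvection_move w w' : << w, w' >> != 0 -> transvection (w' - w) (<< w, w' >>^-1) w = w'.
Proof.
move=> ww'; rewrite transvectionE linearBr /= formvv subr0 mulVf // scale1r.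
by rewrite addrC subrK.
Qed.

(** One transvection takes [w] to [w'] when they are not orthogonal; in general a vector [z]
    orthogonal to neither links them. *)
Lemma symplectic_transitive w w' : w != 0 -> w' != 0 -> exists2 g, Sp g & g w = w'.
Proof.
move=> w0 w'0; have [z [zw zw']] := form_nondeg2 w0 w'0.
exists (transvection (w' - z) (<< z, w' >>^-1) \o transvection (z - w) (<< w, z >>^-1))%VF.
  by apply: symplecticM; exact: symplectic_transvection.
by rewrite comp_lfunE !transvection_move // formC oppr_eq0.
Qed.

Let fixed g := lker (g - \1)%VF.
Let fixedP g w : reflect (g w = w) (w \in fixed g).
Proof. by rewrite memv_ker add_lfunE opp_lfunE id_lfunE subr_eq0; exact: eqP. Qed.

(* Transvections generate: multiplying by one of them along a direction
   g w - w enlarges the space of fixed vectors of g. *)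
Lemma symplectic_ind (P : 'End(W) -> Prop) x : x != 0 -> P \1%VF ->
  (forall g h, Sp g -> Sp h -> P g -> P h -> P (g \o h)%VF) ->
  (forall g h, Sp g -> Sp h -> P h -> P (g \o h \o g^-1)%VF) ->
  (forall c, P (transvection x c)) -> forall g, Sp g -> P g.
Proof.
move=> x0 P1 PM PJ Px.
have PT v c : P (transvection v c).
  have [->|v0] := eqVneq v 0.
    rewrite (_ : transvection 0 c = \1%VF) //; apply/lfunP => w.
    by rewrite transvectionE scaler0 addr0 id_lfunE.
  have [g gS <-] := symplectic_transitive x0 v0.
  by rewrite -transvection_conj //; apply: PJ => //; exact: symplectic_transvection.
have step1 g w : Sp g -> << w, g w >> != 0 -> exists v c h, [/\ Sp h, g = (transvection v c \o h)%VF &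
    (\dim (fixed g) < \dim (fixed h))%N].
  move=> gS wg; pose v := g w - w; pose c := << w, g w >>^-1.
  exists v, c, (transvection v (- c) \o g)%VF; split.
  - by apply: symplecticM => //; exact: symplectic_transvection.
  - by rewrite comp_lfunA transvectionK comp_lfun1l.
  have gw : g w = transvection v c w by rewrite transvection_move.
  have sub : (fixed g <= fixed (transvection v (- c) \o g)%VF)%VS.
    apply/subvP => u /fixedP gu; apply/fixedP; rewrite comp_lfunE transvectionE gu /v linearBr /=.
    have -> : << u, g w >> = << u, w >> by rewrite -{1}gu gS.
    by rewrite subrr mulr0 scale0r addr0.
  rewrite ltn_neqAle dimvS // andbT; apply/eqP => dE.
  have : w \in fixed (transvection v (- c) \o g)%VF.
    apply/fixedP; rewrite comp_lfunE gw -comp_lfunE.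
    by have := transvectionK v (- c); rewrite opprK => ->; rewrite id_lfunE.
  have -> : fixed (transvection v (- c) \o g)%VF = fixed g by apply/esym/eqP; rewrite eqEdim sub dE leqnn.
  by move=> /fixedP gww; case/eqP: wg; rewrite gww formvv.
suff H n : forall g, Sp g -> (\dim {:W} - \dim (fixed g) <= n)%N -> P g by move=> g gS; exact: H (leqnn _).
have dle g : (\dim (fixed g) <= \dim {:W})%N by apply: dimvS; exact: subvf.
have g1 g : ~ (exists w, g w != w) -> g = \1%VF.
  by move=> H; apply/lfunP => w; rewrite id_lfunE; apply: contrapT => /eqP gw; apply: H; exists w.
elim: n => [|n IH] g gS gn.
  rewrite (g1 g) // => -[w gw]; have := gn; rewrite leqn0 subn_eq0 => dg.
  have : fixed g = fullv by apply/eqP; rewrite eqEdim subvf dg.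
  by move=> E; case/eqP: gw; apply/fixedP; rewrite E memvf.
have good g' : Sp g' -> (\dim (fixed g) <= \dim (fixed g'))%N -> (exists w, << w, g' w >> != 0) -> P g'.
  move=> g'S gg' [w /(step1 _ _ g'S)[v [c [h [hS gE hd]]]]]; rewrite gE.
  apply: PM => //; first exact: symplectic_transvection.
  by apply: IH => //; have := dle h; lia.
have [gw|gw] := pselect (exists w, << w, g w >> != 0); first exact: good gw.
have [[w gww]|/g1 -> //] := pselect (exists w, g w != w).
(* Here every [<w, g w>] vanishes although [g] is not the identity. Multiplying by a transvection
   along [v] keeps the fixed vectors of [g], and the new value at [z] is [<z, v>] times
   [<z, g^-1 v>], so the previous case applies. *)
pose v := g w - w; have v0 : v != 0 by rewrite subr_eq0.
have gv0 : (g^-1)%VF v != 0.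
  by apply: contra v0 => /eqP /(congr1 g); rewrite symplectic_fVK // linear0 => ->.
have -> : g = (transvection v (- 1) \o (transvection v 1 \o g))%VF.
  by rewrite comp_lfunA; have := transvectionK v (- 1); rewrite opprK => ->; rewrite comp_lfun1l.
have TS := symplectic_transvection v.
apply: PM => //; first exact: symplecticM.
apply: good; first exact: symplecticM.
  apply: dimvS; apply/subvP => u /fixedP gu; apply/fixedP; rewrite comp_lfunE transvectionE gu /v linearBr /=.
  have -> : << u, g w >> = << u, w >> by rewrite -{1}gu gS.
    by rewrite subrr mulr0 scale0r addr0.
have [z [zv zgv]] := form_nondeg2 v0 gv0; exists z.
have gz : << z, g z >> = 0 by apply: contrapT => /eqP H; apply: gw; exists z.
rewrite comp_lfunE transvectionE linearDr linearZr_LR /= gz add0r mul1r mulf_neq0 //.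
by rewrite -[v in << _, v >>](symplectic_fVK gS) gS.
Qed.
End SymplecticGroup.

Section Twists.
Variables (F : fieldExtType Q2) (V : vectType F) (K K' : fieldType).
Variables (sigma : {rmorphism K -> K'}) (u : F).
Implicit Types f g : Cc (ltop V) K.

Lemma level_twist (n N : nat) (f : V -> K) : u != 0 -> level n N f ->
  exists n' N', level n' N' (fun y => sigma (f (u^-1 *: y))).
Proof.
move=> u0 [f1 f2]; have [a aP] := scaled_ex u^-1; have [b bP] := scaled_ex u.
exists (n + a)%N, (N + b)%N; split=> [y w wn|y].
  rewrite scalerDr f1 //; have := LatZ aP wn.
  by rewrite PoszD addrC addrK.
rewrite fmorph_eq0 => /f2 /(LatZ bP); rewrite scalerA mulfV // scale1r.
by rewrite PoszD opprD addrC.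
Qed.

Lemma twist_is_Cc f : is_Cc ((fun y => if u == 0 then 0 else sigma (f (u^-1 *: y))) : ltop V -> K'^o).
Proof.
have [n [N fN]] := Cc_level f; have [u0|u0] := eqVneq u 0; last first.
  by have [n' [N' /level_Cc]] := level_twist u0 fN.
apply: (@level_Cc _ V K' 0 0 (fun=> 0)); split=> // y.
by rewrite eqxx.
Qed.

(* f(y) |-> sigma(f(y / u)), with the junk value 0 at u = 0 *)
Definition twist f : Cc (ltop V) K' := Cc_of (twist_is_Cc f).

Hypothesis u0 : u != 0.

Lemma twistE f y : twist f y = sigma (f (u^-1 *: y)).
Proof. by rewrite /= (negPf u0). Qed.
Lemma twistD f g : twist (f + g) = twist f + twist g.
Proof. by apply: CcE => y; rewrite twistE !CcDE !twistE rmorphD. Qed.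
Lemma twistZ c f : twist (c *: f) = sigma c *: twist f.
Proof. by apply: CcE => y; rewrite twistE !CcZE !twistE rmorphM. Qed.
End Twists.

(** * Intertwiners of the Heisenberg representation *)

Section WeilRepresentation.
Variables (F : fieldExtType Q2) (W : vectType F) (form : {skew_symmetric W}) (X Y : {vspace W}).
Hypothesis form_nd : nondegenerate form.
Hypothesis XY : complete_polarisation form X Y.
Local Notation "<< u , v >>" := (form u v).
Local Notation Sp := (symplectic_group form).
Local Notation O := (@scaled F).

Lemma vsvalZ (a : F) (y : subvs_of Y) : vsval (a *: y) = a *: vsval y. Proof. exact: linearZ. Qed.
Lemma vsvalB (y y' : subvs_of Y) : vsval (y - y') = vsval y - vsval y'. Proof. exact: linearB. Qed.
Lemma vsvalD (y y' : subvs_of Y) : vsval (y + y') = vsval y + vsval y'. Proof. exact: linearD. Qed.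

Lemma polarisationX x x' : x \in X -> x' \in X -> << x, x' >> = 0.
Proof. by have [oX _ _ _] := XY; rewrite -{1}oX => /mem_orthovP; apply. Qed.
Lemma polarisationY y y' : y \in Y -> y' \in Y -> << y, y' >> = 0.
Proof. by have [_ oY _ _] := XY; rewrite -{1}oY => /mem_orthovP; apply. Qed.

Lemma piXY w : w = daddv_pi X Y w + daddv_pi Y X w.
Proof. by have [_ _ XY0 XYW] := XY; rewrite daddv_pi_add // XYW memvf. Qed.

Lemma piX_id x : x \in X -> daddv_pi X Y x = x.
Proof. by have [_ _ XY0 _] := XY; exact: daddv_pi_id. Qed.
Lemma piY_id y : y \in Y -> daddv_pi Y X y = y.
Proof. by have [_ _ XY0 _] := XY; apply: daddv_pi_id; rewrite capvC. Qed.
Lemma piX_Y y : y \in Y -> daddv_pi X Y y = 0.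
Proof.
by move=> yY; apply: (addIr (daddv_pi Y X y)); rewrite -piXY add0r piY_id.
Qed.
Lemma piY_X x : x \in X -> daddv_pi Y X x = 0.
Proof.
by move=> xX; apply: (addrI (daddv_pi X Y x)); rewrite -piXY addr0 piX_id.
Qed.

Lemma formYX_sep (y : subvs_of Y) : (forall x, x \in X -> << vsval y, x >> = 0) -> y = 0.
Proof.
move=> H; apply/eqP; rewrite -(inj_eq val_inj) /= ; apply: contraT => y0.
have yX : vsval y \in orthov form X by apply/mem_orthovP => x /H.
have [oX _ XY0 _] := XY; move: yX; rewrite oX => yX.
by rewrite -memv0 -XY0 memv_cap yX subvsP in y0.
Qed.

Lemma polarisationX_ex : fullv != 0%VS :> {vspace W} -> exists2 x, x \in X & x != 0.
Proof.
move=> W0; apply: contrapT => H.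
have X0 : X = 0%VS.
  apply/eqP; rewrite -subv0; apply/subvP => x xX; rewrite memv0; apply: contraT => x0.
  by case: H; exists x.
have [oX _ _ _] := XY; case/eqP: W0; rewrite -(orthov0 form) -X0 oX.
by rewrite X0.
Qed.

Let coordX (i : 'I_(\dim X)) (y : subvs_of Y) : F^o := << vsval y, (vbasis X)`_i >>.

Lemma coordX_linear i : linear (coordX i).
Proof. by move=> a u v; rewrite /coordX linearP /= linearDl linearZl. Qed.

Lemma coordX_bounded : exists r : nat, forall n (y : subvs_of Y),
  (forall i : 'I_(\dim X), O n << vsval y, (vbasis X)`_i >>) -> Lat (n - r%:Z) y.
Proof.
apply: (functionals_bounded coordX_linear) => y H; apply: formYX_sep => x xX.
rewrite (coord_vbasis xX) linear_sumr big1 // => i _.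
by rewrite linearZr_LR /= [<< _, _ >>]H mulr0.
Qed.

Section Character.
Variables (K : fieldType) (psi : smooth_character F K).
Local Notation SY := (Cc (ltop (subvs_of Y)) K).
Local Notation rho := (heisenberg_rep form X psi).
Implicit Types (f g : SY) (x : W) (y v : subvs_of Y).

Definition modulate x f : SY := rho (x, 0) f.
Definition translate (v : subvs_of Y) f : SY := rho (vsval v, 0) f.

Lemma modulateE x f y : x \in X -> modulate x f y = psi << vsval y, x >> * f y.
Proof.
move=> xX; rewrite /modulate /= /heisenberg_rep_fun /= piX_id // piY_X // !linear0 addr0.
by rewrite linear0l mulr0 addr0 char0 mul1r.
Qed.

Lemma translateE v f y : translate v f y = f (y + v).
Proof.
rewrite /translate /= /heisenberg_rep_fun /= piX_Y ?subvsP // piY_id ?subvsP //.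
by rewrite !linear0r mulr0 addr0 char0 !mul1r vsvalK.
Qed.
End Character.

(* The uniqueness of intertwiners of the Heisenberg representation, twisted by
   the automorphism x + y |-> alpha x + beta y and by sigma *)
Lemma heisenberg_schur (K K' : fieldType) (psi : smooth_character F K) (psi' : smooth_character F K')
    (sigma : {rmorphism K -> K'}) (alpha beta : F)
    (R : Cc (ltop (subvs_of Y)) K -> Cc (ltop (subvs_of Y)) K') :
  nontrivial_character psi' -> alpha != 0 -> beta != 0 ->
  (forall t, sigma (psi t) = psi' (alpha * beta * t)) ->
  (forall f g, R (f + g) = R f + R g) -> (forall c f, R (c *: f) = sigma c *: R f) ->
  (forall x f, x \in X -> R (modulate psi x f) = modulate psi' (alpha *: x) (R f)) ->
  (forall v f, R (translate psi v f) = translate psi' (beta *: v) (R f)) ->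
  exists kappa : K', forall f y, R f y = kappa * sigma (f (beta^-1 *: y)).
Proof.
move=> [t0 t0P] a0 b0 sP RD RZ RX RY.
(* Modulations by vectors of [X] separate the point [beta^-1 y0] from all others, so [R f y0]
   depends only on the value of [f] there. *)
have loc (f : Cc (ltop (subvs_of Y)) K) (y0 : subvs_of Y) : f (beta^-1 *: y0) = 0 -> R f y0 = 0.
  move=> fy0; apply: (@semilinear_functional_local _ _ _ _ sigma (fun f => R f y0)).
  - by move=> g h; rewrite RD.
  - by move=> c g; rewrite RZ.
  move=> y fy; pose d := beta *: y - y0.
  have d0 : d != 0.
    rewrite subr_eq0; apply: contra fy => /eqP yE.
    by rewrite (_ : y = beta^-1 *: y0) ?fy0 // -yE scalerA mulVf // scale1r.
  have [x1 x1X dx1] : exists2 x, x \in X & << vsval d, x >> != 0.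
    apply: contrapT => H; case/eqP: d0; apply: formYX_sep => x xX; apply: contrapT => /eqP dx.
    by apply: H; exists x.
  (* Scaled so that the two eigenvalues to be separated have quotient [psi' t0], which is not 1. *)
  pose x := (t0 / (alpha * << vsval d, x1 >>)) *: x1; have xX : x \in X by exact: memvZ.
  have dx : alpha * << vsval d, x >> = t0.
    by rewrite /x linearZr_LR /= mulrCA divfK // mulf_neq0.
  exists (fun y => psi << vsval y, x >>), (psi' (alpha * << vsval y0, x >>)); split.
  - have Ll : linear (fun u : subvs_of Y => << vsval u, x >> : F^o).
      by move=> a u v; rewrite linearP /= linearDl linearZl.
    have [n nP] := char_functional_level psi Ll; exists n => w /nP wn.
    by rewrite linearD linearDl /= charD wn mulr1.
  - move=> g h hE; have -> : h = modulate psi x g by apply: CcE => u; rewrite modulateE // hE.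
    by rewrite RX // modulateE ?memvZ // linearZr_LR.
  rewrite sP; apply: contra t0P => /eqP E; apply/eqP.
  have dE : << vsval d, x >> = beta * << vsval y, x >> - << vsval y0, x >>.
    by rewrite /d vsvalB vsvalZ linearBl linearZl_LR.
  rewrite -dx dE mulrBr mulrA charB E mulfV //.
  exact: char_neq0.
(* Translations make the constant the same at every point, so it can be read off at the origin on
   the standard lattice. *)
exists (R (coset K 0 0) 0) => f y.
pose c := coset K 0 (beta^-1 *: y).
have cE : c = translate psi (- (beta^-1 *: y)) (coset K 0 0).
  by apply: CcE => u; rewrite translateE /= /coset_fun subr0.
have Rc : R c y = R (coset K 0 0) 0.
  by rewrite cE RY translateE scalerN scalerA mulfV // scale1r subrr.
have : R (f - (f (beta^-1 *: y) : K) *: c) y = 0.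
  by apply: loc; rewrite CcDE CcNE CcZE coset1 ?mulr1 ?subrr //; exact: Lat0.
rewrite RD -scaleNr RZ CcDE CcZE Rc rmorphN mulNr => /eqP; rewrite subr_eq0 => /eqP ->.
by rewrite mulrC.
Qed.

Section Representation.
Variables (K : fieldType) (psi : smooth_character F K).
Variables (Mp : topGroupType) (p : Mp -> 'End(W)).
Local Notation SY := (Cc (ltop (subvs_of Y)) K).
Variable omega : Mp -> SY -> SY.
Hypothesis psi_nt : nontrivial_character psi.
Hypothesis W0 : fullv != 0%VS :> {vspace W}.
Hypothesis cover : metaplectic_cover form p.
Hypothesis weil : Weil_representation form X psi p omega.
Local Notation rho := (heisenberg_rep form X psi).
Implicit Types (f : SY) (x w : W) (y v : subvs_of Y) (g h : Mp) (c : F).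

Let omega_rep : representation omega := (weil_smooth weil).1.

Lemma weilD g f f' : omega g (f + f') = omega g f + omega g f'.
Proof. by have := rep_linear omega_rep g 1 f f'; rewrite !scale1r. Qed.
Lemma weilZ g (k : K) f : omega g (k *: f) = k *: omega g f.
Proof.
have w0 : omega g 0 = 0.
  by apply: (addrI (omega g 0)); rewrite -weilD !addr0.
by have := rep_linear omega_rep g k f 0; rewrite w0 !addr0.
Qed.
Lemma weilK g f : omega g^-1%g (omega g f) = f.
Proof. by rewrite -(repM omega_rep) mulVg (rep1 omega_rep). Qed.
Lemma weilVK g f : omega g (omega g^-1%g f) = f.
Proof. by rewrite -(repM omega_rep) mulgV (rep1 omega_rep). Qed.

Lemma cover_symplectic g : Sp (p g).
Proof. by rewrite -(mp_range cover); exists g. Qed.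
Lemma cover_lift n : Sp n -> exists g, p g = n.
Proof. by rewrite -(mp_range cover) => -[g _ <-]; exists g. Qed.
Lemma coverV g w : p g^-1%g (p g w) = w.
Proof. by rewrite -comp_lfunE -(mpM cover) mulVg (mp1 cover) id_lfunE. Qed.

Lemma weil_rho g w f : omega g (rho (w, 0) f) = rho (p g w, 0) (omega g f).
Proof. by have /= <- := weil_heisenberg weil g (w, 0) (omega g f); rewrite weilK. Qed.

Lemma weil_kernel g : p g = \1%VF -> (forall f, omega g f = f) \/ (forall f, omega g f = - f).
Proof.
have [->|g1] := eqVneq g 1%g; first by left=> f; rewrite (rep1 omega_rep).
by move=> pg; right=> f; apply: (weil_central weil).
Qed.

Lemma unipotent_transvection x c : x \in X -> unipotent_radical form X (transvection form x c).
Proof.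
move=> xX; split; first exact: symplectic_transvection.
split=> [x' x'X|w]; rewrite transvectionE.
  by rewrite polarisationX // mulr0 scale0r addr0.
by rewrite addrC addKr memvZ.
Qed.

(** The parameter [-2 c] cancels the factor 1/2 in the action of [N(X)] and the sign from
    [<x, y> = - <y, x>]. *)
Lemma weil_transvection x c : x \in X -> exists2 g, p g = transvection form x (- 2 * c) &
  forall f y, omega g f y = psi (c * << vsval y, x >> ^+ 2) * f y.
Proof.
move=> xX; have [s [sp _ sE]] := weil_unipotent weil.
have nU := unipotent_transvection (- 2 * c) xX.
exists (s (transvection form x (- 2 * c))); first exact: sp.
move=> f y; rewrite sE // transvectionE [_ + _ - _]addrC addKr linearZl_LR /= (formC form x).
congr (psi _ * _); have := two_neq0 F; move: << _, _ >> => t t2.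
by field.
Qed.

Section Intertwiner.
Variables (sigma : {rmorphism K -> K}) (u : F).
Hypotheses (u0 : u != 0) (sP : forall t, sigma (psi t) = psi (u ^+ 2 * t)).
Local Notation I := (twist sigma u : SY -> SY).

Lemma twist_rho w f : I (rho (w, 0) f) = rho (u *: w, 0) (I f).
Proof.
apply: CcE => y; rewrite twistE //= /heisenberg_rep_fun /= (negPf u0) !rmorphM !sP mulr0.
rewrite !linearZ /= scalerDr scalerA mulVf // scale1r; congr (_ * psi _ * _).
rewrite !formZl; move: << _, _ >> << _, _ >> => a b.
by rewrite mulrDr mulrA expr2 mulfK //; congr (_ + _); ring.
Qed.

(** The multiplier between [I omega(g)] and [omega(g) I], read off at the origin on the indicator
    function of the standard lattice. *)
Let kappa g : K := omega g^-1%g (I (omega g (coset K 0 0))) 0.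

Lemma kappaP g f : I (omega g f) = kappa g *: omega g (I f).
Proof.
have [k kP] : exists k : K, forall f y, omega g^-1%g (I (omega g f)) y = k * sigma (f (u^-1 *: y)).
  apply: (@heisenberg_schur K K psi psi sigma u u _ psi_nt u0 u0).
  - by move=> t; rewrite sP expr2.
  - by move=> f1 f2; rewrite weilD twistD // weilD.
  - by move=> c f1; rewrite weilZ twistZ // weilZ.
  - move=> x f1 xX; rewrite /modulate weil_rho twist_rho weil_rho.
    by rewrite linearZ /= coverV.
  - move=> v f1; rewrite /translate weil_rho twist_rho weil_rho.
    by rewrite vsvalZ linearZ /= coverV.
have -> : kappa g = k.
  by rewrite /kappa kP scaler0 coset1 ?rmorph1 ?mulr1 // subrr; exact: Lat0.
rewrite -weilZ -[LHS](weilVK g); congr (omega g _); apply: CcE => y.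
by rewrite kP CcZE twistE.
Qed.

Lemma twist_coset : I (coset K 0 0) 0 = 1.
Proof. by rewrite twistE // scaler0 coset1 ?rmorph1 // subrr; exact: Lat0. Qed.

Lemma kappa_eq g (k : K) : (forall f, I (omega g f) = k *: omega g (I f)) -> kappa g = k.
Proof.
by move=> H; rewrite /kappa H weilZ weilK CcZE twist_coset mulr1.
Qed.

Lemma kappaM g h : kappa (g * h)%g = kappa g * kappa h.
Proof.
apply: kappa_eq => f; rewrite !(repM omega_rep) kappaP kappaP weilZ scalerA.
by [].
Qed.

(** The kernel of the cover acts by signs, which commute with [I]; so the character [kappa] factors
    through [Sp(W)]. *)
Lemma kappa_ker g : p g = \1%VF -> kappa g = 1.
Proof.
move=> /weil_kernel[H|H]; apply: kappa_eq => f; rewrite !H scale1r //.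
by rewrite -scaleN1r twistZ // rmorphN1 scaleN1r.
Qed.

Lemma weil_twist g f : I (omega g f) = omega g (I f).
Proof.
suff k1 : kappa g = 1 by rewrite kappaP k1 scale1r.
have lift n g' : p g' = n -> kappa g' = 1 -> forall g, p g = n -> kappa g = 1.
  move=> g'n k1 g2 g2n; rewrite (_ : g2 = g' * (g'^-1 * g2))%g; last by rewrite mulgA mulgV mul1g.
  rewrite kappaM k1 mul1r kappa_ker //.
  rewrite (mpM cover); apply/lfunP => w; rewrite comp_lfunE id_lfunE g2n -g'n.
  exact: coverV.
have [x xX x0] := polarisationX_ex W0.
pose P n := forall g, p g = n -> kappa g = 1.
apply: (@symplectic_ind F W form form_nd P x x0 _ _ _ _ (p g) (cover_symplectic g) g erefl).
- exact: kappa_ker.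
- move=> n m nS mS Pn Pm; have [a an] := cover_lift nS; have [b bm] := cover_lift mS.
  apply: (lift _ (a * b)%g); first by rewrite (mpM cover) an bm.
  by rewrite kappaM Pn // Pm // mulr1.
- move=> n m nS mS Pm; have [a an] := cover_lift nS; have [b bm] := cover_lift mS.
  apply: (lift _ (a * b * a^-1)%g).
    rewrite !(mpM cover) an bm; congr (_ \o _)%VF; apply/lfunP => w.
    by rewrite -[w in LHS](symplectic_fVK form_nd nS) -{1}an coverV.
  by rewrite !kappaM (Pm b bm) mulr1 -kappaM mulgV kappa_ker ?(mp1 cover).
(* The lift acts by multiplication by [psi(- (c / 2) <y, x>^2)], where replacing [y] by [u^-1 y]
   cancels the factor [u^2] brought by [sigma]. *)
move=> c; have [a an aP] := weil_transvection (- (c / 2)) xX.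
apply: (lift _ a); first by rewrite an mulrNN mulrC divfK // two_neq0.
apply: kappa_eq => f1; rewrite scale1r; apply: CcE => y.
rewrite twistE // !aP twistE // rmorphM sP; congr (psi _ * _).
by rewrite vsvalZ formZl exprMn exprVn mulrCA mulVKf // expf_neq0.
Qed.
End Intertwiner.

(** An element of the Levi subgroup preserving [X] and [Y]. It acts on functions by a dilation up to
    a scalar, which allows comparing values at [y] and at [u^-1 y]. *)
Definition levi (u : F) : 'End(W) := (u^-1 *: linfun (daddv_pi X Y) + u *: linfun (daddv_pi Y X))%VF.

Lemma leviE u w : levi u w = u^-1 *: daddv_pi X Y w + u *: daddv_pi Y X w.
Proof. by rewrite /levi add_lfunE !scale_lfunE !lfunE. Qed.

Lemma symplectic_levi u : u != 0 -> Sp (levi u).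
Proof.
move=> u0 w w'; rewrite !leviE [in RHS](piXY w) [in RHS](piXY w').
have XX a b := polarisationX (memv_pi X Y a) (memv_pi X Y b).
have YY a b := polarisationY (memv_pi Y X a) (memv_pi Y X b).
rewrite !formDl !formDr !formZl !formZr !XX !YY !mulr0 !add0r !addr0.
by rewrite mulKf // mulVKf.
Qed.

(** After the dilation is undone, [omega g] commutes with all modulations and translations, so it is
    a scalar by [heisenberg_schur] with the trivial automorphism. *)
Lemma weil_levi u : u != 0 -> exists g k, forall f y, omega g f y = k * f (u^-1 *: y).
Proof.
move=> u0; have [g gp] := cover_lift (symplectic_levi u0); have uV0 : u^-1 != 0 by rewrite invr_neq0.
pose D : SY -> SY := twist (idfun : {rmorphism K -> K}) u^-1.
have [] := @heisenberg_schur K K psi psi (idfun : {rmorphism K -> K}) 1 1 (fun f => D (omega g f)) psi_nt.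
- exact: oner_neq0.
- exact: oner_neq0.
- by move=> t; rewrite !mul1r.
- by move=> f1 f2; rewrite weilD /D twistD.
- by move=> c f1; rewrite weilZ /D twistZ.
- move=> x f1 xX; rewrite /modulate weil_rho -/(modulate _ _ _) -/(modulate _ _ _) gp leviE.
  rewrite piX_id // piY_X // scaler0 addr0 scale1r; apply: CcE => y.
  rewrite /D twistE // !modulateE ?memvZ // twistE //= ?vsvalZ ?formZl ?formZr invrK.
  by rewrite mulrA mulfV // mul1r.
- move=> v f1; rewrite /translate weil_rho gp leviE.
  rewrite piX_Y ?subvsP // piY_id ?subvsP // scaler0 add0r scale1r -linearZ -/(translate _ _ _) -/(translate _ _ _).
  by apply: CcE => y; rewrite /D twistE // !translateE twistE //= invrK scalerDr.
move=> k kP; exists g, k => f y; have := kP f (u^-1 *: y).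
by rewrite /D twistE //= invr1 scale1r invrK scalerA mulfV // scale1r.
Qed.
End Representation.
End WeilRepresentation.

(** * Haar measures and Hecke operators *)

Section TopologicalGroups.
Variable G : topGroupType.
Implicit Types (g h x y : G) (U D A : set G).

Lemma mulg_continuousl x : continuous (fun y : G => (x * y)%g).
Proof.
move=> z; apply: (@cvg_comp _ _ _ (fun y => (x, y)) (fun gh : G * G => (gh.1 * gh.2)%g) _ (nbhs (x, z))).
  by apply: cvg_pair; [exact: cvg_cst|exact: cvg_id].
exact: (mulg_continuous (x, z)).
Qed.

Lemma divg_continuous1 A : nbhs (1%g : G) A -> exists U, [/\ open U, U 1%g &
  forall g h, U g -> U h -> A (g^-1 * h)%g].
Proof.
move=> A1.
have C : (fun gh : G * G => (gh.1^-1 * gh.2)%g) @ nbhs ((1%g : G), (1%g : G)) --> nbhs ((1^-1 * 1)%g : G).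
  apply: (@cvg_comp _ _ _ (fun gh : G * G => (gh.1^-1%g, gh.2)) (fun gh : G * G => (gh.1 * gh.2)%g) _ (nbhs ((1^-1)%g : G, 1%g : G))); last first.
    exact: (mulg_continuous ((1^-1)%g, 1%g)).
  apply: cvg_pair; last exact: cvg_snd.
  by apply: (@cvg_comp _ _ _ fst (fun g : G => (g^-1)%g) _ (nbhs (1%g : G))); [exact: cvg_fst|exact: invg_continuous].
have {}A1 : nbhs ((1^-1 * 1)%g : G) A by rewrite mulg1 invg1.
have [[B1 B2] [/= B1n B2n] BA] := C A A1.
have : nbhs (1%g : G) (B1 `&` B2) by exact: filterI.
rewrite nbhsE => -[U [oU U1] UB].
exists U; split=> // g h /UB[Bg _] /UB[_ Bh].
exact: (BA (g, h)).
Qed.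

Definition lcoset_rel U g h := U (g^-1 * h)%g.

Definition is_subgroup U := U 1%g /\ forall g h, U g -> U h -> U (g^-1 * h)%g.

Lemma compact_open_is_subgroup U : compact_open_subgroup U -> is_subgroup U.
Proof. by case. Qed.

Lemma subgroupV U g : is_subgroup U -> U g -> U g^-1%g.
Proof. by move=> [U1 UM] Ug; rewrite -[g^-1%g]mulg1; exact: UM. Qed.
Lemma subgroupM U g h : is_subgroup U -> U g -> U h -> U (g * h)%g.
Proof. by move=> US Ug Uh; rewrite -[g]invgK; apply: US.2 => //; exact: subgroupV. Qed.

Lemma lcoset_equiv U : is_subgroup U -> equivalence_Prop (lcoset_rel U).
Proof.
move=> US; split=> [g|g h|g h k]; rewrite /lcoset_rel; first by rewrite mulVg; exact: US.1.
  by move=> /(subgroupV US); rewrite invgM invgK.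
by move=> gh hk; have := subgroupM US gh hk; rewrite -mulgA (mulgA h) mulgV mul1g.
Qed.

Lemma lcoset_relM U k g h : lcoset_rel U (k * g)%g (k * h)%g = lcoset_rel U g h.
Proof. by rewrite /lcoset_rel invgM -mulgA (mulgA k^-1%g) mulVg mul1g. Qed.

Section Basis.
Variable B : nat -> set G.
Hypothesis B_sub : forall n, compact_open_subgroup (B n).
Hypothesis B_decr : forall m n, (m <= n)%N -> B n `<=` B m.
Hypothesis B_nbhs : forall A, nbhs (1%g : G) A -> exists n, B n `<=` A.

Let B_grp n : is_subgroup (B n). Proof. exact: compact_open_is_subgroup. Qed.

Lemma basis_equiv n : equivalence_Prop (lcoset_rel (B n)).
Proof. exact: lcoset_equiv. Qed.

Lemma basis_decr m n x y : (m <= n)%N -> lcoset_rel (B n) x y -> lcoset_rel (B m) x y.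
Proof. by move=> mn; exact: B_decr. Qed.

Lemma basis_nbhs x A : nbhs x A <-> exists n, forall y, lcoset_rel (B n) x y -> A y.
Proof.
split=> [xA|[n nA]].
  have : nbhs (1%g : G) (fun y => A (x * y)%g).
    by apply: mulg_continuousl; rewrite mulg1.
  move=> /B_nbhs[n nA]; exists n => y /nA.
  by rewrite mulgA mulgV mul1g.
have Bn : nbhs (x^-1 * x)%g (B n).
  by rewrite mulVg; apply: open_nbhs_nbhs; have [_ oB B1 _] := B_sub n.
have H : nbhs x (fun y => B n (x^-1 * y)%g) := @mulg_continuousl x^-1%g x _ Bn.
by apply: filterS H => y; exact: nA.
Qed.

Lemma subgroup_cover U D n : is_subgroup U -> B n `<=` U -> compact D ->
  exists s, coset_cover U D s.
Proof.
move=> US nU Dc; have [s [_ _ sD]] := compact_transversal basis_equiv basis_nbhs n Dc.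
apply: (@transversal_prune _ (lcoset_rel U) D s (lcoset_equiv US)) => g Dg.
by have [x xs xg] := sD g Dg; exists x => //; exact: nU.
Qed.

Lemma subgroup_index U n : compact_open_subgroup U -> B n `<=` U ->
  exists t, coset_cover (B n) U t /\ forall x, x \in t -> U x.
Proof.
move=> UP nU; have [Uc _ _ _] := UP; have US := compact_open_is_subgroup UP.
have [s [us sE sD]] := subgroup_cover (B_grp n) (fun g Bg => Bg) Uc.
exists [seq x <- s | `[< U x >]]; split; last by move=> x; rewrite mem_filter => /andP[/asboolP].
split; first exact: filter_uniq.
  by move=> x y; rewrite !mem_filter => /andP[_ xs] /andP[_ ys]; exact: sE.
move=> g Ug; have [x xs xg] := sD g Ug; exists x => //; rewrite mem_filter xs andbT.
apply/asboolP; have := subgroupM US Ug (subgroupV US (nU _ xg)).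
by rewrite invgM invgK mulgA mulgV mul1g.
Qed.

Lemma coset_sum (V : zmodType) U n D s s' t (f : G -> V) : is_subgroup U -> B n `<=` U ->
  (forall g u, U u -> f (g * u)%g = f g) -> (forall g, f g != 0 -> D g) ->
  coset_cover U D s -> coset_cover (B n) D s' ->
  coset_cover (B n) U t -> (forall x, x \in t -> U x) ->
  \sum_(x <- s') f x = (\sum_(x <- s) f x) *+ size t.
Proof.
move=> US nU fU fD sP s'P [ut tE tU] tsub.
apply: (@sum_transversal_refine _ V (lcoset_rel U) (lcoset_rel (B n)) D s s' f (fun x => [seq (x * y)%g | y <- t])) => //.
- exact: lcoset_equiv.
- exact: lcoset_equiv.
- by move=> x y; exact: nU.
- by move=> x y xy; rewrite -(fU x _ xy) mulgA mulgV mul1g.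
- move=> x; split; last by rewrite size_map.
  have inj : injective (fun y => (x * y)%g).
    by move=> y z /(congr1 (fun w => (x^-1 * w)%g)); rewrite !mulgA mulVg !mul1g.
  split; first by rewrite map_inj_uniq.
    by move=> _ _ /mapP[y yt ->] /mapP[z zt ->]; rewrite lcoset_relM => /(tE _ _ yt zt) ->.
  move=> g /tU[y yt yg]; exists (x * y)%g; first by apply/mapP; exists y.
  by rewrite -[g](mul1g) -(mulgV x) -mulgA lcoset_relM.
- by move=> x _ /mapP[y yt ->]; rewrite /lcoset_rel mulgA mulVg mul1g; exact: tsub.
Qed.

Section Haar.
Variable mu : set G -> rat.
Hypothesis muP : left_Haar_measure mu.

Lemma haar_cosets U t : compact_open_subgroup U -> {in t &, forall x y, U (x^-1 * y)%g -> x = y} ->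
  uniq t -> [/\ compact [set g | exists2 x, x \in t & U (x^-1 * g)%g],
    open [set g | exists2 x, x \in t & U (x^-1 * g)%g] &
    mu [set g | exists2 x, x \in t & U (x^-1 * g)%g] = (size t)%:R * mu U].
Proof.
move=> UP; have [Uc oU _ _] := UP; have US := compact_open_is_subgroup UP.
have [muL muD mupos] := muP.
have mu0 : mu set0 = 0.
  have c0 := @compact0 G; have o0 := @open0 G.
  have := muD _ _ c0 o0 c0 o0 (setI0 _); rewrite setU0 => /eqP.
  by rewrite -subr_eq0 opprD addrA subrr sub0r oppr_eq0 => /eqP.
have cosetE x : [set g | U (x^-1 * g)%g] = [set (x * a)%g | a in U].
  apply/seteqP; split=> [g Ug|_ [a Ua <-] /=]; last by rewrite mulgA mulVg mul1g.
  by exists (x^-1 * g)%g => //; rewrite mulgA mulgV mul1g.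
have cosetc x : compact [set g | U (x^-1 * g)%g].
  rewrite cosetE; apply: continuous_compact Uc; apply: continuous_subspaceT; exact: mulg_continuousl.
have coseto x : open [set g | U (x^-1 * g)%g].
  by move/continuousP: (@mulg_continuousl x^-1%g) => /(_ U oU).
elim: t => [|x t IH] tE /=.
  have -> : [set g | exists2 x, x \in [::] & U (x^-1 * g)%g] = set0 by apply/seteqP; split=> g // [].
  by rewrite mul0r mu0; split=> //; [exact: compact0|exact: open0].
move=> /andP[xt ut].
have [y z yt zt|ct ot mt] := IH _ ut; first by apply: tE; rewrite inE ?yt ?zt orbT.
have -> : [set g | exists2 y, y \in x :: t & U (y^-1 * g)%g] =
    [set g | U (x^-1 * g)%g] `|` [set g | exists2 y, y \in t & U (y^-1 * g)%g].
  apply/seteqP; split=> [g [y]|g [xg|[y yt yg]]].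
  - by rewrite inE => /predU1P[->|yt yg]; [left|right; exists y].
  - by exists x; rewrite ?mem_head.
  - by exists y; rewrite // inE yt orbT.
split; [exact: compactU|exact: openU|].
rewrite muD // ?mt ?cosetE ?muL -?cosetE //.
  by rewrite -addn1 natrD mulrDl mul1r addrC.
apply/seteqP; split=> g // [xg [y yt yg]]; move: xt; rewrite (tE x y) ?yt ?mem_head ?inE ?yt ?orbT //.
by have [_ Es Et] := lcoset_equiv US; apply: Et xg (Es _ _ yg).
Qed.

Lemma haar_index U n t : compact_open_subgroup U -> B n `<=` U -> coset_cover (B n) U t ->
  (forall x, x \in t -> U x) -> mu U = (size t)%:R * mu (B n).
Proof.
move=> UP nU [ut tE tU] tsub; have [_ _ <-] := haar_cosets (B_sub n) tE ut; congr (mu _).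
apply/seteqP; split=> [g /tU //|g [x /tsub Ux xg]].
have US := compact_open_is_subgroup UP; have := subgroupM US Ux (nU _ xg).
by rewrite mulgA mulgV mul1g.
Qed.

Section Hecke.
Variables (R : fieldType) (V : lmodType R) (pi : G -> V -> V) (phi : Cc G rat).
Hypothesis ratrD : {morph (ratr : rat -> R) : a b / a + b}.
Hypothesis piP : smooth_rep pi.

Definition hecke_admissible (v : V) (U : set G) (s : seq G) : Prop :=
  [/\ compact_open_subgroup U, forall u, U u -> pi u v = v,
      forall g u, U u -> phi (g * u)%g = phi g & coset_cover U [set g | phi g != 0] s].

Definition hecke_sum (v : V) (U : set G) (s : seq G) : V :=
  \sum_(x <- s) ratr (mu U * phi x) *: pi x v.

Let ratr0 : ratr 0 = 0 :> R.
Proof. by apply: (addrI (ratr 0)); rewrite -ratrD !addr0. Qed.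

Lemma ratrMn n (a : rat) : ratr (n%:R * a) = ratr a *+ n :> R.
Proof.
elim: n => [|n IH]; first by rewrite mul0r mulr0n.
by rewrite -addn1 natrD mulrDl mul1r ratrD IH mulrnDr mulr1n.
Qed.

Lemma hecke_ex v (A : set G) : nbhs (1%g : G) A -> exists n s, B n `<=` A /\ hecke_admissible v (B n) s.
Proof.
move=> A1; have [fl fc] := CcP phi.
have [n1 n1P] := Cc_uniform basis_equiv basis_decr basis_nbhs fl fc.
have [n2 n2P] := B_nbhs A1.
have [|n3 n3P] := B_nbhs (A := [set g | pi g v = v]).
  by apply: open_nbhs_nbhs; split; [exact: piP.2|exact: (rep1 piP.1)].
set n := (n1 + (n2 + n3))%N.
have [s sP] := subgroup_cover (B_grp n) (fun g Bg => Bg) fc.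
exists n, s; split; first by move=> g /(@B_decr n2 n) Bg; apply/n2P/Bg; rewrite /n; lia.
split=> //.
  by move=> u /(@B_decr n3 n) Bu; apply/n3P/Bu; rewrite /n; lia.
move=> g u Bu; apply/esym/n1P; rewrite /lcoset_rel mulgA mulVg mul1g.
by apply: B_decr Bu; rewrite /n; lia.
Qed.

(** Passing from [U] to [B n] multiplies the number of cosets by the index of [B n] in [U] and
    divides the measure by it. *)
Lemma hecke_refine v U s n s' : hecke_admissible v U s -> hecke_admissible v (B n) s' -> B n `<=` U ->
  hecke_sum v (B n) s' = hecke_sum v U s.
Proof.
move=> [UP Uv Uphi Us] [_ _ _ s'P] nU.
have [t [tP tU]] := subgroup_index UP nU; have US := compact_open_is_subgroup UP.
rewrite /hecke_sum.
rewrite (@coset_sum V U n [set g | phi g != 0] s s' t (fun x => ratr (mu (B n) * phi x) *: pi x v)) //; first last.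
- by move=> g; apply: contra => /eqP ->; rewrite mulr0 ratr0 scale0r.
- by move=> g u Uu; rewrite Uphi // (repM piP.1) Uv.
rewrite -sumrMnl; apply: eq_bigr => x _.
by rewrite (haar_index UP nU tP tU) -mulrA ratrMn scalerMnl.
Qed.

Lemma hecke_indep v U s U' s' : hecke_admissible v U s -> hecke_admissible v U' s' ->
  hecke_sum v U s = hecke_sum v U' s'.
Proof.
move=> UP UP'; have [[_ oU U1 _] _ _ _] := UP; have [[_ oU' U'1 _] _ _ _] := UP'.
have [|n [r [nU nP]]] := @hecke_ex v (U `&` U').
  by apply: filterI; exact: open_nbhs_nbhs.
rewrite -(hecke_refine UP nP) => [|g /nU[]//].
by apply: hecke_refine => // g /nU[].
Qed.

Lemma hecke_operator_ex : exists T, hecke_operator mu pi phi T.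
Proof.
have /choice[T TP] : forall v, exists w, exists U s, hecke_admissible v U s /\ w = hecke_sum v U s.
  move=> v; have [n [s [_ H]]] := @hecke_ex v setT filterT.
  by exists (hecke_sum v (B n) s), (B n), s.
exists T => v U s UP Uv Uphi Us; have [U' [s' [U'P ->]]] := TP v.
exact: hecke_indep.
Qed.

Lemma hecke_operatorE T v U s : hecke_operator mu pi phi T -> hecke_admissible v U s ->
  T v = hecke_sum v U s.
Proof. by move=> TP [UP Uv Uphi Us]; exact: TP. Qed.

(** The coefficients of a Hecke operator are rational, so semilinear intertwiners such as the twists
    commute with it too. *)
Lemma hecke_commute T (I : V -> V) : hecke_operator mu pi phi T ->
  (forall v w, I (v + w) = I v + I w) -> (forall a v, I (ratr a *: v) = ratr a *: I v) ->
  (forall g v, I (pi g v) = pi g (I v)) -> forall v, T (I v) = I (T v).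
Proof.
move=> TP ID IZ Ipi v; have [n [s [_ H]]] := @hecke_ex v setT filterT.
have I0 : I 0 = 0 by apply: (addrI (I 0)); rewrite -ID !addr0.
have H' : hecke_admissible (I v) (B n) s.
  by have [BP Bv Bphi sP] := H; split=> // u Bu; rewrite -Ipi Bv.
rewrite (hecke_operatorE TP H) (hecke_operatorE TP H') /hecke_sum (big_morph I ID I0).
by apply: eq_bigr => x _; rewrite IZ Ipi.
Qed.

Lemma hecke_linear T : hecke_operator mu pi phi T -> linear T.
Proof.
move=> TP a v w; have [n [s [_ [_ Bv _ _]]]] := @hecke_ex v setT filterT.
have [|m [r [mn [Bm Bw Bphi rP]]]] := @hecke_ex w (B n).
  by apply: open_nbhs_nbhs; have [_ oB B1 _] := B_sub n.
have lin g := rep_linear piP.1 g.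
have H1 : hecke_admissible v (B m) r by split=> // u /mn; exact: Bv.
have H2 : hecke_admissible w (B m) r by split.
have H3 : hecke_admissible (a *: v + w) (B m) r.
  by split=> // u Bu; rewrite lin (Bv _ (mn _ Bu)) Bw.
rewrite (hecke_operatorE TP H1) (hecke_operatorE TP H2) (hecke_operatorE TP H3) /hecke_sum.
rewrite scaler_sumr -big_split; apply: eq_bigr => x _ /=.
by rewrite lin scalerDr !scalerA mulrC.
Qed.
End Hecke.
End Haar.
End Basis.
End TopologicalGroups.

(** * Construction of a Haar measure *)

Section HaarExistence.
Variables (G : topGroupType) (B : nat -> set G).
Hypothesis B_sub : forall n, compact_open_subgroup (B n).
Hypothesis B_decr : forall m n, (m <= n)%N -> B n `<=` B m.
Hypothesis B_nbhs : forall A, nbhs (1%g : G) A -> exists n, B n `<=` A.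
Implicit Types (A : set G) (g h x : G).

Let B_grp n : is_subgroup (B n). Proof. exact: compact_open_is_subgroup. Qed.

Let ind A x : rat := if `[< A x >] then 1 else 0.
Let ind_neq0 A x : ind A x != 0 -> A x.
Proof. by rewrite /ind; case: asboolP => // _; rewrite eqxx. Qed.

Let right_inv A n := forall g u, B n u -> A (g * u)%g <-> A g.

Let right_inv_leq A m n : (m <= n)%N -> right_inv A m -> right_inv A n.
Proof. by move=> mn Am g u /(B_decr mn); exact: Am. Qed.

Lemma compact_open_right_inv A : compact A -> open A -> exists n, right_inv A n.
Proof.
move=> Ac oA.
have [m n y mn H u /(B_decr mn)|x Ax|n nP] := compact_uniform (basis_nbhs B_sub B_nbhs)
  (Q := fun n x => forall u, B n u -> A (x * u)%g) Ac.
- exact: H.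
- have /(basis_nbhs B_sub B_nbhs)[n nP] : nbhs x A by exact: open_nbhs_nbhs.
  exists n => y xy _ u Bu; apply: nP; rewrite /lcoset_rel mulgA.
  exact: subgroupM.
exists n => g u Bu; split=> [Agu|Ag]; last exact: nP.
have := nP _ Agu u^-1%g; rewrite -mulgA mulgV mulg1; apply.
exact: subgroupV.
Qed.

(** The measure of [A] is the number of cosets of [B n] in [A] divided by the index of [B n] in
    [B 0], for any [n] fine enough for [A]; multiplicativity of the index makes it independent of
    [n]. *)
Lemma haar_exists : exists mu : set G -> rat, left_Haar_measure mu.
Proof.
have /choice[t tP] : forall n, exists t, coset_cover (B n) (B 0%N) t /\ forall x, x \in t -> B 0%N x.
  by move=> n; apply: (subgroup_index B_sub B_nbhs) => //; exact: B_decr.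
have t0 n : (size (t n))%:R != 0 :> rat.
  have [[_ _ tc] _] := tP n; have [x] := tc 1%g (B_grp 0).1.
  by case: (t n) => // a l _ _; rewrite pnatr_eq0.
have refine n m r : (n <= m)%N -> coset_cover (B m) (B n) r -> (forall x, x \in r -> B n x) ->
    size (t m) = (size (t n) * size r)%N.
  move=> nm rP rB; have [tn tnB] := tP n; have [tm tmB] := tP m.
  have sizeE k : (size (t k))%:R = \sum_(x <- t k) ind (B 0%N) x.
    rewrite (eq_big_seq (fun=> 1)); first by rewrite big_const_seq count_predT iter_addr_0.
    by move=> x xt; rewrite /ind asboolT //; exact: (tP k).2.
  apply/eqP; rewrite -(eqr_nat rat) natrM !sizeE; apply/eqP; rewrite mulr_natr.
  apply: (coset_sum B_sub (B_grp n) (B_decr nm) _ _ tn tm rP rB); last exact: ind_neq0.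
  move=> g u Bu; have {}Bu : B 0%N u by apply: B_decr Bu.
  rewrite /ind; congr (if _ then _ else _); apply: asbool_equiv_eq; split=> H.
    by have := subgroupM (B_grp 0) H (subgroupV (B_grp 0) Bu); rewrite -mulgA mulgV mulg1.
  exact: subgroupM.
pose val n A s : rat := (\sum_(x <- s) ind A x) / (size (t n))%:R.
have valP n m A s s' : (n <= m)%N -> right_inv A n -> coset_cover (B n) A s ->
    coset_cover (B m) A s' -> val n A s = val m A s'.
  move=> nm An sP s'P; have [r [rP rB]] := subgroup_index B_sub B_nbhs (B_sub n) (B_decr nm).
  rewrite /val (refine n m r) // (@coset_sum G B B_sub _ (B n) m A s s' r (ind A)) //.
  - have := t0 m; rewrite (refine n m r) // natrM mulf_eq0 negb_or => /andP[_ r0].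
    by rewrite -[_ *+ size r]mulr_natr -mulf_div mulfV // mulr1.
  - exact: B_decr.
  - by move=> g u Bu; rewrite /ind; congr (if _ then _ else _); apply: asbool_equiv_eq; exact: An.
  - exact: ind_neq0.
have cover n A : compact A -> exists s, coset_cover (B n) A s.
  by move=> Ac; exact: (subgroup_cover B_sub B_nbhs (B_grp n) (fun g Bg => Bg) Ac).
(* Sets that are not compact, or not right invariant under any [B n], get the value 0. *)
have /choice[mu muP] : forall A, exists v, forall n s, compact A -> right_inv A n -> coset_cover (B n) A s -> v = val n A s.
  move=> A; have [[Ac [n An]]|H] := pselect (compact A /\ exists n, right_inv A n); last first.
    by exists 0 => n s Ac An _; case: H; split=> //; exists n.
  have [s sP] := cover n A Ac; exists (val n A s) => m s' _ Am s'P.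
  have [r rP] := cover (maxn n m) A Ac.
  by rewrite (valP n (maxn n m) A s r) ?leq_maxl // (valP m (maxn n m) A s' r) ?leq_maxr.
exists mu; split.
- move=> g A Ac oA; have [n An] := compact_open_right_inv Ac oA; have [s sP] := cover n A Ac.
  rewrite (muP A n s) //; have gE x : [set (g * a)%g | a in A] x <-> A (g^-1 * x)%g.
    split=> [[a Aa <-]|Ax]; first by rewrite mulgA mulVg mul1g.
    by exists (g^-1 * x)%g; rewrite // mulgA mulgV mul1g.
  have inj : injective (fun y => (g * y)%g).
    by move=> y z /(congr1 (fun w => (g^-1 * w)%g)); rewrite !mulgA mulVg !mul1g.
  have [us sE sD] := sP.
  rewrite (muP [set (g * a)%g | a in A] n [seq (g * x)%g | x <- s]).
  + rewrite /val big_map; congr (_ / _); apply: eq_bigr => x _; rewrite /ind.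
    congr (if _ then _ else _); apply: asbool_equiv_eq; rewrite gE.
    by rewrite mulgA mulVg mul1g.
  + by apply: continuous_compact Ac; apply: continuous_subspaceT; exact: mulg_continuousl.
  + by move=> x u Bu; rewrite !gE mulgA; exact: An.
  split; first by rewrite map_inj_uniq.
    by move=> _ _ /mapP[y yt ->] /mapP[z zt ->]; rewrite -/(lcoset_rel _ _ _) lcoset_relM => /(sE _ _ yt zt) ->.
  move=> _ [x /sD[y ys yx] <-]; exists (g * y)%g; first by apply/mapP; exists y.
  by rewrite -/(lcoset_rel _ _ _) lcoset_relM.
- move=> A A' Ac oA A'c oA' AA'; have [n An] := compact_open_right_inv Ac oA.
  have [n' A'n'] := compact_open_right_inv A'c oA'; set m := maxn n n'.
  have Am : right_inv A m by apply: right_inv_leq An; exact: leq_maxl.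
  have A'm : right_inv A' m by apply: right_inv_leq A'n'; exact: leq_maxr.
  have Uc := compactU Ac A'c; have [s sP] := cover m _ Uc.
  have sA : coset_cover (B m) A s by apply: (@sub_transversal _ _ (A `|` A')) sP => x; left.
  have sA' : coset_cover (B m) A' s by apply: (@sub_transversal _ _ (A `|` A')) sP => x; right.
  rewrite (muP _ m s Uc) // ?(muP A m s) ?(muP A' m s) //.
    rewrite /val -mulrDl -big_split; congr (_ / _); apply: eq_bigr => x _ /=; rewrite /ind.
    have [Ax|Ax] := pselect (A x); have [A'x|A'x] := pselect (A' x).
    + by have : set0 x by rewrite -AA'.
    + by rewrite (asboolT Ax) (asboolF A'x) addr0 asboolT //; left.
    + by rewrite (asboolF Ax) (asboolT A'x) add0r asboolT //; right.
    + by rewrite (asboolF Ax) (asboolF A'x) addr0 asboolF // => -[].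
  by move=> g u Bu; split=> -[H|H]; [left|right|left|right]; move: H; [move/(Am _ _ Bu)|move/(A'm _ _ Bu)|move=> H; apply/(Am _ _ Bu)|move=> H; apply/(A'm _ _ Bu)].
move=> A Ac oA [x Ax]; have [n An] := compact_open_right_inv Ac oA; have [s sP] := cover n A Ac.
rewrite (muP A n s) // divr_gt0 //; last by rewrite lt_neqAle eq_sym t0 ler0n.
have [_ _ /(_ x Ax)[y ys yx]] := sP.
have Ay : A y by apply/(An y _ yx); rewrite mulgA mulgV mul1g.
rewrite (big_rem y) //= /ind asboolT // ltr_pwDl // sumr_ge0 // => z _.
by case: ifP.
Qed.
End HaarExistence.

(** * Congruence subgroups of the metaplectic group *)

Section MetaplecticTopology.
Variables (F : fieldExtType Q2) (W : vectType F) (form : {skew_symmetric W}).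
Variables (Mp : topGroupType) (p : Mp -> 'End(W)).
Hypothesis cover : metaplectic_cover form p.
Local Notation "<< u , v >>" := (form u v).
Local Notation Sp := (symplectic_group form).
Local Notation O := (@scaled F).

Lemma comp_bounded : exists r : nat, forall n m (a b : 'End(W)), Lat n a -> Lat m b ->
  Lat (n + m - r%:Z) (a \o b)%VF.
Proof.
apply: bilinear_bounded => w a u v; first by rewrite comp_lfunDr comp_lfunZr.
by rewrite comp_lfunDl comp_lfunZl.
Qed.

Lemma symplectic_closed (g : 'End(W)) : (forall N : nat, exists2 h, Sp h & Lat N (h - g)) -> Sp g.
Proof.
move=> H u v; apply/eqP; rewrite -subr_eq0; apply/eqP/scaled_eq0 => n.
have [r1 r1P] : exists r : nat, forall n m (a : 'End(W)) w, Lat n a -> Lat m w -> Lat (n + m - r%:Z) (a w).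
  by apply: bilinear_bounded => w a u' v'; rewrite ?linearP // add_lfunE scale_lfunE.
have [r2 r2P] := bilinear_form_bounded (form_linr form) (form_linl form).
have [k1 k1P] := Lat_ex u; have [k2 k2P] := Lat_ex v.
have [k3 k3P] := Lat_ex (g u); have [k4 k4P] := Lat_ex (g v).
pose M := (n + r1 + r2 + k1 + k2 + k3 + k4)%N; have [h hS hg] := H (M + r1)%N.
have hu : Lat (M%:Z - k1%:Z) (h u - g u).
  have := r1P _ _ _ _ hg k1P; rewrite add_lfunE opp_lfunE.
  by apply: Lat_leq; lia.
have hv : Lat (M%:Z - k2%:Z) (h v - g v).
  have := r1P _ _ _ _ hg k2P; rewrite add_lfunE opp_lfunE.
  by apply: Lat_leq; lia.
have hvv : Lat (- k4%:Z) (h v).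
  by rewrite -(subrK (g v) (h v)); apply: LatD => //; apply: Lat_leq hv; lia.
rewrite -[<< u, v >>]hS (_ : _ - _ = - (<< h u - g u, h v >> + << g u, h v - g v >>)); last first.
  by rewrite !linearBl !linearBr /= addrA subrK opprB.
apply: scaledN; apply: scaledD.
  by apply: scaled_leq (r2P _ _ _ _ hvv hu) || apply: scaled_leq (r2P _ _ _ _ hu hvv); lia.
by apply: scaled_leq (r2P _ _ _ _ hv k3P) || apply: scaled_leq (r2P _ _ _ _ k3P hv); lia.
Qed.

(** Near 1 the cover is injective, so subgroups can be defined by a congruence on the image inside a
    neighbourhood [U1], and openness of [p] transports compactness from lattices of endomorphisms.
    This is the basis on which Haar measures and Hecke operators are built. *)
Lemma metaplectic_basis : exists B : nat -> set Mp, [/\ forall n, compact_open_subgroup (B n),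
  forall m n, (m <= n)%N -> B n `<=` B m & forall A, nbhs (1%g : Mp) A -> exists n, B n `<=` A].
Proof.
have [U' [oU' U'1 inj]] := mp_locally_injective cover.
have [U1 [oU1 U11 U1U']] := divg_continuous1 (open_nbhs_nbhs (conj oU' U'1)).
have U1sub g : U1 g -> U' g.
  by move=> /(U1U' _ _ U11); rewrite invg1 mul1g.
have pinj g h : U' g -> U' h -> p g = p h -> g = h.
  by move=> Ug Uh; apply: inj; rewrite inE.
have [O' oO' O'E] := mp_open cover oU1.
have O'1 : O' (\1%VF : 'End(W)).
  have : (O' `&` Sp) (\1%VF : 'End(W)) by rewrite -O'E; exists 1%g; rewrite ?(mp1 cover).
  by case.
have /nbhs_LatP[n0 n0P] := open_nbhs_nbhs (conj oO' O'1).
have [r rP] := comp_bounded.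
(* The term [n0] puts the images in [O'], so that they lift to [U1]; [r] absorbs the denominators of
   composition, and the successor leaves a strict gain of precision. *)
pose m n := (n0 + r + n).+1.
pose d g : 'End(W) := p g - \1%VF.
pose B n : set Mp := [set g | U1 g /\ Lat (m n) (d g)].
have pS g : Sp (p g) by rewrite -(mp_range cover); exists g.
have pE g : p g = \1%VF + d g by rewrite addrC subrK.
have dM g h : d (g * h)%g = d g + d h + (d g \o d h)%VF.
  apply/lfunP => w; rewrite /d (mpM cover) !(add_lfunE, opp_lfunE, id_lfunE, comp_lfunE) linearB /=.
  by rewrite -[RHS]addrA [X in _ = _ + X]addrC subrK [RHS]addrC addrA subrK.
have d1 : d 1%g = 0 by rewrite /d (mp1 cover) subrr.
(* The identity [d(g^-1) = - (d g + d g o d(g^-1))] turns any bound on [d(g^-1)] into a better one,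
   until the bound on [d g] is reached. *)
have dV (M : nat) g : (r < M)%N -> Lat M (d g) -> Lat M (d g^-1%g).
  move=> rM gM; have E : d g^-1%g = - (d g + (d g \o d g^-1%g)%VF).
    apply/eqP; rewrite -subr_eq0 opprK addrCA addrA -dM.
    by rewrite mulgV d1.
  have [k kP] := Lat_ex (d g^-1%g).
  have H (j : nat) : (j <= M + k)%N -> Lat (j%:Z - k%:Z) (d g^-1%g).
    elim: j => [|j IH] jM; first by rewrite sub0r.
    rewrite E; apply: LatN; apply: LatD; first by apply: Lat_leq gM; lia.
    by apply: Lat_leq (rP _ _ _ _ gM (IH (ltnW jM))); lia.
  by have := H _ (leqnn _); rewrite PoszD addrK.
have dMM (M : nat) g h : (r < M)%N -> Lat M (d g) -> Lat M (d h) -> Lat M (d (g * h)%g).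
  move=> rM gM hM; rewrite dM; apply: LatD; first exact: LatD.
  by apply: Lat_leq (rP _ _ _ _ gM hM); lia.
have rm n : (r < m n)%N by rewrite /m; lia.
have lift g n : Lat (m n) (d g) -> exists2 h, U1 h & p h = p g.
  move=> gn; have : (O' `&` Sp) (p g).
    split; last exact: pS.
    by rewrite pE; apply: n0P; apply: Lat_leq gn; rewrite /m; lia.
  by rewrite -O'E => -[h U1h hg]; exists h.
have Bopen n : open (B n).
  rewrite (_ : B n = U1 `&` p @^-1` [set h : ltop 'End(W) | Lat (m n) (h - \1%VF : 'End(W))]) //.
  apply: openI => //; move/continuousP: (mp_continuous cover) => pc; apply: pc.
  apply: (uniform_open (@Lat_rel_nbhs _ 'End(W)) (n := m n)) => x y xy /= xm.
  by have := LatD xy xm; rewrite addrA subrK.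
have Bsub n : is_subgroup (B n).
  split; first by split=> //; rewrite d1; exact: Lat0.
  move=> g h [U1g gn] [U1h hn].
  have ghn : Lat (m n) (d (g^-1 * h)%g) by apply: dMM => //; exact: dV.
  split=> //; have [k U1k kE] := lift _ _ ghn.
  by rewrite -(pinj k (g^-1 * h)%g) //; [exact: U1sub|exact: U1U'].
(* A cluster point [a] of the [p g - 1] in the compact lattice gives a symplectic [1 + a], which
   lifts to some [g1] in [U1]; as [p] is open and injective there, [g1] is a cluster point
   upstairs. *)
have Bcompact n : compact (B n).
  move=> G GP GB; have GF : Filter G by exact: _.
  have sub : B n `<=` (d @^-1` (Lat (m n) : set (ltop 'End(W)))) by move=> g [_ gn].
  have Fd : (d @ G) (Lat (m n) : set (ltop 'End(W))) := @filterS _ G GF _ _ sub GB.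
  have [a [am acl]] := @compact_Lat F 'End(W) (m n) (d @ G) _ Fd.
  pose g0 : 'End(W) := \1%VF + a.
  have near (N : nat) (A : set Mp) : G A -> exists g, [/\ A g, B n g & Lat N (p g - g0)].
    move=> GA; have [||_ [[g [Ag Bg] <-] ga]] := acl (d @` (A `&` B n)) [set h : ltop 'End(W) | Lat N (h - a : 'End(W))].
    - have sAB : A `&` B n `<=` d @^-1` (d @` (A `&` B n)) by move=> g ABg; exists g.
      exact: (@filterS _ G GF _ _ sAB (@filterI _ G GF _ _ GA GB)).
    - by apply/nbhs_LatP; exists N => w wN; rewrite /= addrC addKr.
    by exists g; split=> //; rewrite pE /g0 opprD addrACA subrr add0r.
  have g0S : Sp g0.
    apply: symplectic_closed => N; have [g [_ _ gN]] := near N setT filterT.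
    by exists (p g).
  have g0O : O' g0 by apply: n0P; apply: Lat_leq am; rewrite /m; lia.
  have [g1 U1g1 g1E] : exists2 g1, U1 g1 & p g1 = g0.
    by have : (O' `&` Sp) g0 by []; rewrite -O'E => -[h U1h hg]; exists h.
  have Bg1 : B n g1 by split=> //; rewrite /d g1E /g0 addrC addKr.
  exists g1; split=> // A C GA; rewrite nbhsE => -[C' [oC' C'g1] C'C].
  have [O'' oO'' O''E] := mp_open cover (openI oC' (Bopen n)).
  have O''g0 : O'' g0.
    have : (O'' `&` Sp) g0 by rewrite -O''E -g1E; exists g1.
    by case.
  have /nbhs_LatP[N NP] := open_nbhs_nbhs (conj oO'' O''g0).
  have [g [Ag Bg gN]] := near N A GA.
  have : (O'' `&` Sp) (p g).
    by split; [rewrite -(subrK g0 (p g)) addrC; exact: NP|exact: pS].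
  rewrite -O''E => -[h [C'h Bh] hg]; exists g; split=> //; apply: C'C.
  by rewrite -(pinj h g) //; apply: U1sub; [case: Bh|case: Bg].
exists B; split.
- by move=> n; have [B1 BM] := Bsub n.
- move=> k n kn g [U1g gn]; split=> //; apply: Lat_leq gn.
  by rewrite /m lez_nat; lia.
move=> A; rewrite nbhsE => -[C [oC C1] CA].
have [O'' oO'' O''E] := mp_open cover (openI oU1 oC).
have O''1 : O'' (\1%VF : 'End(W)).
  have : (O'' `&` Sp) (\1%VF : 'End(W)) by rewrite -O''E -(mp1 cover); exists 1%g.
  by case.
have /nbhs_LatP[N NP] := open_nbhs_nbhs (conj oO'' O''1).
exists N => g [U1g gN]; apply: CA.
have : (O'' `&` Sp) (p g).
  split; last exact: pS.
  by rewrite pE; apply: NP; apply: Lat_leq gN; rewrite /m; lia.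
rewrite -O''E => -[h [U1h Ch] hg].
by rewrite -(pinj h g) //; exact: U1sub.
Qed.
End MetaplecticTopology.

(** * Automorphisms of the field of 2-power roots of unity *)

Section CyclotomicAutomorphisms.
Implicit Types (x y w : Kcyc) (z : algC).

Lemma Kcyc_valK x : Kcyc_val x \in cyclotomic2. Proof. exact: valP. Qed.

Lemma Kcyc_level x : exists k z, (2 ^ k).-primitive_root z /\ Qadj z (Kcyc_val x).
Proof. by have /asboolP := Kcyc_valK x. Qed.

Lemma Kcyc_inj : injective Kcyc_val. Proof. exact: val_inj. Qed.

Lemma Kcyc_ex z k : (2 ^ k).-primitive_root z -> exists w, Kcyc_val w = z.
Proof.
move=> zP; have zK : z \in cyclotomic2.
  by apply/asboolP; exists k, z; split=> //; rewrite -[z in X in _ X]expr1; exact: QadjX.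
by exists (Kcyc_of zK).
Qed.

Lemma Kcyc_ratr (q : rat) : Kcyc_val (ratr q) = ratr q. Proof. exact: (fmorph_rat Kcyc_val). Qed.

Lemma Kcyc_ratrD : {morph (ratr : rat -> Kcyc) : a b / a + b}.
Proof. by move=> a b; apply: Kcyc_inj; rewrite Kcyc_ratr [LHS]rmorphD /= -!Kcyc_ratr -rmorphD. Qed.

Lemma Kcyc_comb (R : unitRingType) (f : {rmorphism Kcyc -> R}) (a b c d : rat) (t u v : Kcyc) :
  f (ratr a + ratr b * t + ratr c * u + ratr d * v) = ratr a + ratr b * f t + ratr c * f u + ratr d * f v.
Proof.
have E q : f (ratr q) = ratr q by exact: fmorph_rat.
by rewrite 3!rmorphD E rmorphM E rmorphM E rmorphM E.
Qed.

Lemma Kcyc_horner (P : {poly rat}) w :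
  (map_poly ratr P).[Kcyc_val w] = Kcyc_val (\sum_(i < size P) ratr P`_i * w ^+ i).
Proof.
rewrite horner_coef size_map_poly rmorph_sum; apply: eq_bigr => i _.
by rewrite coef_map /= -Kcyc_ratr -rmorphXn -rmorphM.
Qed.

Lemma Qadj_fixed (sigma : {rmorphism Kcyc -> Kcyc}) w a : sigma w = w -> Qadj (Kcyc_val w) a ->
  exists2 x, sigma x = x & Kcyc_val x = a.
Proof.
move=> sw [P _ <-]; exists (\sum_(i < size P) ratr P`_i * w ^+ i); last by rewrite Kcyc_horner.
by rewrite rmorph_sum; apply: eq_bigr => i _; rewrite rmorphM rmorphXn sw fmorph_rat.
Qed.

(* An automorphism of the union of the cyclotomic fields is glued from
   automorphisms that agree on roots of unity of 2-power order. *)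
Lemma Kcyc_glue (f : algC -> algC) (nu : nat -> {rmorphism algC -> algC}) :
  (forall k z, z ^+ (2 ^ k) = 1 -> nu k z = f z) ->
  exists sigma : {rmorphism Kcyc -> Kcyc}, forall w k, w ^+ (2 ^ k) = 1 -> Kcyc_val (sigma w) = f (Kcyc_val w).
Proof.
move=> nuf.
have nuP k z (P : {poly rat}) : z ^+ (2 ^ k) = 1 -> nu k (map_poly ratr P).[z] = (map_poly ratr P).[f z].
  move=> zk; rewrite -(nuf k) // -horner_map; congr (_.[_]).
  by apply/polyP => i; rewrite coef_map /= !coef_map /= fmorph_rat.
have /choice[k kP] : forall x, exists k, exists2 z, (2 ^ k).-primitive_root z & Qadj z (Kcyc_val x).
  by move=> x; have [k [z [zP xz]]] := Kcyc_level x; exists k, z.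
pose s x := nu (k x) (Kcyc_val x).
have sE x l z : (2 ^ l).-primitive_root z -> Qadj z (Kcyc_val x) -> s x = nu l (Kcyc_val x).
  have H m m' (y : algC) a : (m <= m')%N -> (2 ^ m).-primitive_root y -> Qadj y a -> nu m a = nu m' a.
    move=> mm' /prim_expr_order yP [P _ <-]; rewrite !nuP //.
    by rewrite -(subnKC mm') expnD exprM yP expr1n.
  move=> zl xz; have [y yP xy] := kP x; rewrite /s.
  have [kl|/ltnW lk] := leqP (k x) l; first exact: (H _ _ y).
  by rewrite (H l (k x) z).
have sK x : s x \in cyclotomic2.
  have [z zP [P _ xE]] := kP x; apply/asboolP; exists (k x), z; split=> //.
  rewrite /s -xE nuP ?(prim_expr_order zP) //; apply: Qadj_horner.
  have fz : f z ^+ (2 ^ k x) = 1.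
    by rewrite -(nuf (k x)) ?(prim_expr_order zP) // -rmorphXn (prim_expr_order zP) rmorph1.
  by have [i ->] := prim_rootP zP fz; exact: QadjX.
pose t x := Kcyc_of (sK x).
have join x y : exists l, [/\ s x = nu l (Kcyc_val x), s y = nu l (Kcyc_val y),
   s (x - y) = nu l (Kcyc_val (x - y)) & s (x * y) = nu l (Kcyc_val (x * y))].
  have [l [z [zP xz yz]]] := cyclotomic2_join (Kcyc_valK x) (Kcyc_valK y).
  exists l; split; apply: (sE _ _ z) => //; rewrite ?rmorphB ?rmorphM; [exact: QadjB|exact: QadjM].
have tB : zmod_morphism t.
  by move=> x y; apply: Kcyc_inj; rewrite rmorphB /=; have [l [-> -> -> _]] := join x y; rewrite !rmorphB.
have tM : monoid_morphism t.
  split; first by apply: Kcyc_inj; rewrite /= /s !rmorph1.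
  by move=> x y; apply: Kcyc_inj; rewrite rmorphM /=; have [l [-> -> _ ->]] := join x y; rewrite !rmorphM.
pose sigma : {rmorphism Kcyc -> Kcyc} := HB.pack t (GRing.isZmodMorphism.Build Kcyc Kcyc t tB)
  (GRing.isMonoidMorphism.Build Kcyc Kcyc t tM).
exists sigma => w l wl; rewrite /=; have [z zP] := @C_prim_root_exists (2 ^ l) (expn_gt0 2 l).
have wl' : Kcyc_val w ^+ (2 ^ l) = 1 by rewrite -rmorphXn wl rmorph1.
rewrite (sE w l z) // ?nuf //.
by have [i ->] := prim_rootP zP wl'; exact: QadjX.
Qed.

Lemma Kcyc_pow (b : nat) : odd b -> exists sigma : {rmorphism Kcyc -> Kcyc},
  forall w k, w ^+ (2 ^ k) = 1 -> sigma w = w ^+ b.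
Proof.
move=> bo; have cop k : coprime b (2 ^ k) by rewrite coprimeXr // coprimen2.
have [sigma sP] := @Kcyc_glue (fun z => z ^+ b) (fun k => sval (Qn_aut_exists (cop k)))
  (fun k => svalP (Qn_aut_exists (cop k))).
by exists sigma => w k wk; apply: Kcyc_inj; rewrite (sP w k wk) rmorphXn.
Qed.

Lemma Kcyc_conj : exists sigma : {rmorphism Kcyc -> Kcyc}, (forall x, Kcyc_val (sigma x) = (Kcyc_val x)^*) /\
  forall w k, w ^+ (2 ^ k) = 1 -> sigma w = w^-1.
Proof.
have rootV (z : algC) n : (0 < n)%N -> z ^+ n = 1 -> z^* = z^-1.
  move=> n0 zn; have z0 : z != 0 by apply: contra_eq_neq zn => ->; rewrite expr0n gtn_eqF // eq_sym oner_eq0.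
  have /eqP zz : `|z| == 1 by rewrite -(@pexpr_eq1 _ _ n) // -normrX zn normr1.
  by apply: (mulfI z0); rewrite mulfV // -normCK zz expr1n.
have [|sigma sP] := @Kcyc_glue (fun z => z^*) (fun=> Num.conj).
  by [].
have valE x : Kcyc_val (sigma x) = (Kcyc_val x)^*.
  have [k [z [zP xz]]] := Kcyc_level x; have [w wz] := Kcyc_ex zP.
  have wk : w ^+ (2 ^ k) = 1 by apply: Kcyc_inj; rewrite rmorphXn rmorph1 /= wz (prim_expr_order zP).
  move: xz => [P _]; rewrite -wz Kcyc_horner => /Kcyc_inj <-.
  pose s : {rmorphism Kcyc -> algC} := Kcyc_val \o sigma.
  pose c : {rmorphism Kcyc -> algC} := Num.conj \o Kcyc_val.
  set y := \sum_(i < size P) _; rewrite -[LHS]/(s y) -[RHS]/(c y) /y !rmorph_sum; apply: eq_bigr => i _.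
  rewrite [LHS]rmorphM [RHS]rmorphM; congr (_ * _).
    by transitivity (ratr P`_i : algC); [|symmetry]; exact: fmorph_rat.
  by rewrite !rmorphXn /=; congr (_ ^+ _); exact: (sP w k).
exists sigma; split=> // w k wk; apply: Kcyc_inj; rewrite valE fmorphV.
by apply: (rootV _ (2 ^ k)%N); rewrite ?expn_gt0 // -rmorphXn wk rmorph1.
Qed.

(** Each squaring raises the 2-adic valuation of [b^(2^j) - 1] by exactly one, starting from 3. This
    gives exact orbit lengths of roots of unity. *)
Lemma pow_order (b c : nat) j : odd c -> b = (1 + 8 * c)%N ->
  exists2 c', odd c' & (b ^ (2 ^ j) = 1 + 2 ^ (j + 3) * c')%N.
Proof.
move=> co ->; elim: j => [|j [c' c'o IH]]; first by exists c; rewrite ?expn1.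
exists (c' + 2 ^ (j + 2) * c' ^ 2)%N.
  by rewrite oddD oddM oddX c'o addn_eq0 andbF.
by rewrite expnSr expnM IH !addSn !addnS !addn0 !expnS; lia.
Qed.

(** * The eighth cyclotomic field *)

Section FixedFields.
Variable zeta : algC.
Hypothesis zetaP : 8.-primitive_root zeta.

Let zeta4 : zeta ^+ 4 = -1.
Proof.
have : (zeta ^+ 4 - 1) * (zeta ^+ 4 + 1) = 0.
  by rewrite -subr_sqr -exprM (prim_expr_order zetaP) expr1n subrr.
move/eqP; rewrite mulf_eq0 subr_eq0 -(prim_order_dvd zetaP) /= addr_eq0.
by move/eqP.
Qed.

Lemma Qadj8_basis a : Qadj zeta a -> exists q : rat * rat * (rat * rat),
  a = ratr q.1.1 + ratr q.1.2 * zeta ^+ 2 + ratr q.2.1 * (zeta + zeta ^+ 3) + ratr q.2.2 * (zeta - zeta ^+ 3).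
Proof.
move=> [P _ <-]; elim/poly_ind: P => [|P c [[[a0 a1] [a2 a3]] /= IH]].
  by exists (0, 0, (0, 0)); rewrite rmorph0 horner0 !rmorph0 !mul0r !addr0.
rewrite rmorphD rmorphM /= map_polyX map_polyC /= hornerD hornerM hornerX hornerC IH.
(* With [i = zeta^2], [r = zeta + zeta^3] and [s = zeta - zeta^3], multiplication by [zeta] takes
   [1, i, r, s] to [(r + s)/2, (r - s)/2, i - 1, i + 1]. *)
exists (c - a2 + a3, a2 + a3, (2^-1 * (a0 + a1), 2^-1 * (a0 - a1))) => /=.
rewrite !(rmorphB, rmorphD, rmorphM) /= !fmorphV !(rmorph_nat (ratr : {rmorphism rat -> algC})).
have two0 : 2%:R != 0 :> algC by rewrite pnatr_eq0.
have E4 : zeta * zeta ^+ 3 = -1 by rewrite -exprS.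
have E3 : zeta ^+ 3 = zeta * zeta ^+ 2 by rewrite -exprS.
apply/eqP; rewrite -subr_eq0; apply/eqP.
transitivity ((ratr a2 - ratr a3) * (zeta ^+ 4 + 1) : algC); last by rewrite zeta4 addNr mulr0.
by field.
Qed.

Lemma Qadj_opp a : Qadj (- a) = Qadj a.
Proof.
have H b : Qadj (- b) `<=` Qadj b.
  apply: Qadj_sub; rewrite -sub0r -[0](subrr b); have bb : Qadj b b by rewrite -[b in X in _ X]expr1; exact: QadjX.
  by apply: QadjB => //; exact: QadjB.
by apply/seteqP; split; [exact: H|rewrite -{1}[a]opprK; exact: H].
Qed.

Lemma Qadj_sqr a b : a ^+ 2 = b ^+ 2 -> Qadj a = Qadj b.
Proof. by move/eqP; rewrite eqf_sqr => /orP[/eqP ->//|/eqP ->]; exact: Qadj_opp. Qed.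

Lemma Qadj_sqrtN2 : Qadj (zeta + zeta ^+ 3) = Qadj (sqrtC (- 2)).
Proof.
apply: Qadj_sqr; rewrite sqrtCK; have := zeta4.
have -> : (zeta + zeta ^+ 3) ^+ 2 = zeta ^+ 2 * (1 + zeta ^+ 4) + 2 * zeta ^+ 4 by ring.
by move=> ->; ring.
Qed.

Lemma Qadj_sqrt2 : Qadj (zeta - zeta ^+ 3) = Qadj (sqrtC 2).
Proof.
apply: Qadj_sqr; rewrite sqrtCK; have := zeta4.
have -> : (zeta - zeta ^+ 3) ^+ 2 = zeta ^+ 2 * (1 + zeta ^+ 4) - 2 * zeta ^+ 4 by ring.
by move=> ->; ring.
Qed.

Lemma Qadj_i : Qadj (zeta ^+ 2) = Qadj 'i.
Proof. by apply: Qadj_sqr; rewrite -exprM zeta4 sqrCi. Qed.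

Lemma even_odd_split (P : {poly rat}) : exists E D : {poly rat}, forall w : algC,
  (map_poly ratr P).[w] = (map_poly ratr E).[w ^+ 2] + w * (map_poly ratr D).[w ^+ 2].
Proof.
elim/poly_ind: P => [|P c [E [D IH]]].
  by exists 0, 0 => w; rewrite rmorph0 !horner0 mulr0 addr0.
exists ('X * D + c%:P), E => w.
rewrite !rmorphD !rmorphM /= map_polyX !map_polyC /= !hornerD !hornerM !hornerX !hornerC IH.
by ring.
Qed.

(* For m >= 4 some power of z |-> z ^ b sends a primitive 2^m-th root of unity
   to its opposite, so that fixed elements lie in Q[z ^ 2]. *)
Lemma fixed_Qadj8 (sigma : {rmorphism Kcyc -> Kcyc}) (b c : nat) x : odd c -> b = (1 + 8 * c)%N ->
  (forall w k, w ^+ (2 ^ k) = 1 -> sigma w = w ^+ b) -> sigma x = x -> Qadj zeta (Kcyc_val x).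
Proof.
move=> co bE sP sx; have [m [z [zP xz]]] := Kcyc_level x.
elim: m z zP xz => [|m IH] z zP xz.
  have z1 : z ^+ 8 = 1 by rewrite -[8%N]/(1 * 8)%N exprM (prim_expr_order zP) expr1n.
  by have [i zE] := prim_rootP zetaP z1; apply: Qadj_sub xz; rewrite zE; exact: QadjX.
have [m3|m3] := leqP m.+1 3.
  have z1 : z ^+ 8 = 1 by rewrite -[8%N]/(2 ^ 3)%N -(subnKC m3) expnD exprM (prim_expr_order zP) expr1n.
  by have [i zE] := prim_rootP zetaP z1; apply: Qadj_sub xz; rewrite zE; exact: QadjX.
have z2P : (2 ^ m).-primitive_root (z ^+ 2).
  by have := dvdn_prim_root zP (dvdn_exp2l 2 (leqnSn m)); rewrite -expnB // subSnn expn1.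
apply: (IH _ z2P); have [w wz] := Kcyc_ex zP.
have wm : w ^+ (2 ^ m.+1) = 1 by apply: Kcyc_inj; rewrite rmorphXn rmorph1 /= wz (prim_expr_order zP).
(* Here [z] has order [2^(m + 1)] and [b^(2^(m - 3))] is 1 plus an odd multiple of [2^m], so that
   iterate sends [z] to [- z]. *)
have [c' c'o bj] := pow_order (m - 3) co bE.
have zm : z ^+ (2 ^ m) = -1.
  have : z ^+ (2 ^ m) != 1 by rewrite -(prim_order_dvd zP) dvdn_Pexp2l // ltnn.
  have : (z ^+ (2 ^ m)) ^+ 2 = 1 by rewrite -exprM -expnSr (prim_expr_order zP).
  by move/eqP; rewrite sqrf_eq1 => /orP[/eqP ->|/eqP -> //]; rewrite eqxx.
have iterP n : iter n sigma x = x /\ iter n sigma w = w ^+ (b ^ n).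
  elim: n => [//|n [IH1 IH2]]; rewrite !iterS IH1 IH2 rmorphXn (sP w m.+1) //.
  by rewrite -exprM expnSr mulnC.
have [P _ xE] := xz; have [E [D PE]] := even_odd_split P.
have xw : x = \sum_(i < size P) ratr P`_i * w ^+ i by apply: Kcyc_inj; rewrite -Kcyc_horner wz.
have iter_sum n : iter n sigma (\sum_(i < size P) ratr P`_i * w ^+ i) =
    \sum_(i < size P) ratr P`_i * (iter n sigma w) ^+ i.
  elim: n => [//|n IHn]; rewrite iterS IHn rmorph_sum; apply: eq_bigr => i _.
  by rewrite rmorphM rmorphXn fmorph_rat.
have wN : iter (2 ^ (m - 3)) sigma w = - w.
  rewrite (iterP _).2 bj subnK //; apply: Kcyc_inj.
  by rewrite rmorphN rmorphXn /= wz exprD expr1 exprM zm -signr_odd c'o mulrN1.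
have xN : Kcyc_val x = (map_poly ratr P).[- z].
  by rewrite -{1}(iterP (2 ^ (m - 3))%N).1 {1}xw iter_sum wN -Kcyc_horner rmorphN /= wz.
exists E => //; move: xE xN; rewrite !PE sqrrN mulNr => <- /eqP.
rewrite -subr_eq0 opprD opprK addrACA subrr add0r -mulr2n -mulr_natl mulf_eq0 pnatr_eq0 /= => /eqP ->.
by rewrite addr0.
Qed.

Lemma fixed_sqr (sigma : {rmorphism Kcyc -> Kcyc}) (b : nat) x :
  (forall w k, w ^+ (2 ^ k) = 1 -> sigma w = w ^+ b) -> sigma x = x ->
  exists2 tau : {rmorphism Kcyc -> Kcyc}, (forall w k, w ^+ (2 ^ k) = 1 -> tau w = w ^+ (b * b)) & tau x = x.
Proof.
move=> sP sx; exists (sigma \o sigma : {rmorphism Kcyc -> Kcyc}); last by rewrite /= !sx.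
by move=> w k wk; rewrite /= (sP w k) // rmorphXn (sP w k) // exprM.
Qed.

(** The exponent 3 is not of the form [1 + 8 c], but its square 9 is; likewise 25 for the exponent
    5. *)
Lemma fixed_Qadj8_3 (sigma : {rmorphism Kcyc -> Kcyc}) x :
  (forall w k, w ^+ (2 ^ k) = 1 -> sigma w = w ^+ 3) -> sigma x = x -> Qadj zeta (Kcyc_val x).
Proof. by move=> sP sx; have [tau tP tx] := fixed_sqr sP sx; apply: (@fixed_Qadj8 tau 9 1). Qed.

Lemma fixed_Qadj8_5 (sigma : {rmorphism Kcyc -> Kcyc}) x :
  (forall w k, w ^+ (2 ^ k) = 1 -> sigma w = w ^+ 5) -> sigma x = x -> Qadj zeta (Kcyc_val x).
Proof. by move=> sP sx; have [tau tP tx] := fixed_sqr sP sx; apply: (@fixed_Qadj8 tau 25 3). Qed.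

(** Coordinates in the basis 1, i, sqrt -2, sqrt 2 (up to signs). Each of the automorphisms with
    exponents 3, 5, -1 fixes one of the last three elements, namely sqrt -2, i, sqrt 2 respectively,
    and negates the other two. *)
Definition Qcomb (q : rat * rat * (rat * rat)) : algC :=
  ratr q.1.1 + ratr q.1.2 * zeta ^+ 2 + ratr q.2.1 * (zeta + zeta ^+ 3) + ratr q.2.2 * (zeta - zeta ^+ 3).

Lemma Qcomb_lift : exists w, [/\ Kcyc_val w = zeta, w ^+ (2 ^ 3) = 1, w ^+ 4 = -1 &
  forall x, Qadj zeta (Kcyc_val x) -> exists q : rat * rat * (rat * rat), Kcyc_val x = Qcomb q /\
  x = ratr q.1.1 + ratr q.1.2 * w ^+ 2 + ratr q.2.1 * (w + w ^+ 3) + ratr q.2.2 * (w - w ^+ 3)].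
Proof.
have [w wz] := @Kcyc_ex zeta 3 zetaP; exists w; split=> //.
- by apply: Kcyc_inj; rewrite rmorphXn rmorph1 /= wz (prim_expr_order zetaP).
- by apply: Kcyc_inj; rewrite rmorphXn rmorphN1 /= wz zeta4.
move=> x /Qadj8_basis[q xE]; exists q; split=> //; apply: Kcyc_inj; rewrite xE.
by rewrite Kcyc_comb rmorphXn rmorphD rmorphB rmorphXn /= wz.
Qed.

Section Action.
Variables (w : Kcyc) (q : rat * rat * (rat * rat)) (x : Kcyc) (sigma : {rmorphism Kcyc -> Kcyc}).
Hypotheses (w8 : w ^+ (2 ^ 3) = 1) (w4 : w ^+ 4 = -1).
Hypothesis xE : x = ratr q.1.1 + ratr q.1.2 * w ^+ 2 + ratr q.2.1 * (w + w ^+ 3) + ratr q.2.2 * (w - w ^+ 3).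

Lemma Qcomb_sigma : sigma x = ratr q.1.1 + ratr q.1.2 * (sigma w) ^+ 2 +
  ratr q.2.1 * (sigma w + (sigma w) ^+ 3) + ratr q.2.2 * (sigma w - (sigma w) ^+ 3).
Proof. by rewrite xE Kcyc_comb rmorphXn rmorphD rmorphB rmorphXn. Qed.

Lemma Qcomb_sigma3 : sigma w = w ^+ 3 -> sigma x = ratr q.1.1 - ratr q.1.2 * w ^+ 2 +
  ratr q.2.1 * (w + w ^+ 3) - ratr q.2.2 * (w - w ^+ 3).
Proof.
move=> sw; rewrite Qcomb_sigma sw.
have -> : (w ^+ 3) ^+ 2 = w ^+ 2 * w ^+ 4 by ring.
have -> : (w ^+ 3) ^+ 3 = w * (w ^+ 4) ^+ 2 by ring.
by rewrite w4; ring.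
Qed.

Lemma Qcomb_sigma5 : sigma w = w ^+ 5 -> sigma x = ratr q.1.1 + ratr q.1.2 * w ^+ 2 -
  ratr q.2.1 * (w + w ^+ 3) - ratr q.2.2 * (w - w ^+ 3).
Proof.
move=> sw; rewrite Qcomb_sigma sw.
have -> : w ^+ 5 = w * w ^+ 4 by ring.
by rewrite w4; ring.
Qed.

Lemma Qcomb_sigmaN : sigma w = w^-1 -> sigma x = ratr q.1.1 - ratr q.1.2 * w ^+ 2 -
  ratr q.2.1 * (w + w ^+ 3) + ratr q.2.2 * (w - w ^+ 3).
Proof.
move=> sw; rewrite Qcomb_sigma sw.
have -> : w^-1 = - w ^+ 3.
  have w0 : w != 0 by apply: contra_eq_neq w8 => ->; rewrite expr0n eq_sym oner_eq0.
  by apply: (mulfI w0); rewrite mulfV // mulrN -exprS w4 opprK.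
have -> : (- w ^+ 3) ^+ 2 = w ^+ 2 * w ^+ 4 by ring.
have -> : (- w ^+ 3) ^+ 3 = - (w * (w ^+ 4) ^+ 2) by ring.
by rewrite w4; ring.
Qed.
End Action.
End FixedFields.
End CyclotomicAutomorphisms.

(** * Traces, scalar extension and Galois descent *)

Section Traces.
Variables (R : fieldType) (V : lmodType R).
Implicit Types (T : V -> V) (v : V).

Definition indep n (e : 'I_n -> V) := forall c : 'I_n -> R, \sum_i c i *: e i = 0 -> forall i, c i = 0.

Lemma indep_extract (w : nat -> V) m : exists n (e : 'I_n -> V), indep e /\
  forall i, (i < m)%N -> exists c : 'I_n -> R, w i = \sum_k c k *: e k.
Proof.
elim: m => [|m [n [e [ei eP]]]]; first by exists 0%N, (fun=> 0); split=> // c _ [].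
have [[c wm]|wm] := pselect (exists c : 'I_n -> R, w m = \sum_k c k *: e k).
  exists n, e; split=> // i; rewrite ltnS leq_eqVlt => /predU1P[->|/eP//].
  by exists c.
pose e' (k : 'I_n.+1) := if unlift ord_max k is Some j then e j else w m.
have e'E (c : 'I_n.+1 -> R) : \sum_k c k *: e' k = \sum_(k < n) c (lift ord_max k) *: e k + c ord_max *: w m.
  rewrite big_ord_recr /= /e' unlift_none; congr (_ + _); apply: eq_bigr => i _.
  have -> : widen_ord (leqnSn n) i = lift ord_max i.
    by apply/val_inj; rewrite /= /bump leqNgt ltn_ord.
  by rewrite liftK.
exists n.+1, e'; split=> [c|i].
  rewrite e'E => c0; have cm : c ord_max = 0.
    apply: contrapT => /eqP cm; apply: wm; exists (fun k => - (c ord_max)^-1 * c (lift ord_max k)).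
    apply: (scalerI cm); rewrite scaler_sumr.
    have -> : \sum_k c ord_max *: ((- (c ord_max)^-1 * c (lift ord_max k)) *: e k) = - \sum_(k < n) c (lift ord_max k) *: e k.
      by rewrite -sumrN; apply: eq_bigr => k _; rewrite scalerA mulrA mulrN mulfV // mulN1r scaleNr.
    by apply/eqP; rewrite -subr_eq0 opprK addrC c0.
  move: c0; rewrite cm scale0r addr0 => /ei c0 i.
  by case: (unliftP ord_max i) => [j ->|->].
rewrite ltnS leq_eqVlt => /predU1P[->|/eP[c ->]].
  exists (fun k => if k == ord_max then 1 else 0); rewrite e'E eqxx scale1r big1 ?add0r // => k _.
  by rewrite eq_sym (negPf (neq_lift _ _)) scale0r.
exists (fun k => if unlift ord_max k is Some j then c j else 0).
by rewrite e'E unlift_none scale0r addr0; apply: eq_bigr => k _; rewrite liftK.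
Qed.

(** Each summand has rank one and trace [lam i (w i)]. The [w i] may be dependent, so they are
    expanded in the independent family [e] before the matrix is read off. *)
Lemma trace_family T m (w : 'I_m -> V) (lam : 'I_m -> V -> R) n (e : 'I_n -> V) (M : 'M[R]_n) :
  indep e -> (forall v, T v = \sum_i lam i v *: w i) ->
  (forall i a u v, lam i (a *: u + v) = a * lam i u + lam i v) ->
  (forall i, exists c : 'I_n -> R, w i = \sum_k c k *: e k) ->
  (forall j, T (e j) = \sum_i M i j *: e i) -> \tr M = \sum_i lam i (w i).
Proof.
move=> ei TE ll /choice[S SP] TM.
have l0 i : lam i 0 = 0 by have := ll i (-1) 0 0; rewrite scaler0 addr0 mulN1r addNr.
have lD i u v : lam i (u + v) = lam i u + lam i v by have := ll i 1 u v; rewrite scale1r mul1r.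
have lZ i a u : lam i (a *: u) = a * lam i u by have := ll i a u 0; rewrite l0 !addr0.
have ME k j : M k j = \sum_i lam i (e j) * S i k.
  apply/eqP; rewrite -subr_eq0; apply/eqP; apply: (ei (fun k => M k j - \sum_i lam i (e j) * S i k)).
  under eq_bigr => i _ do rewrite scalerBl; rewrite sumrB -TM TE; apply/eqP; rewrite subr_eq0; apply/eqP.
  under eq_bigr => i _ do rewrite {1}SP scaler_sumr; rewrite exchange_big; apply: eq_bigr => i _.
  by rewrite scaler_suml; apply: eq_bigr => l _; rewrite scalerA.
rewrite /mxtrace; under eq_bigr => k _ do rewrite ME; rewrite exchange_big; apply: eq_bigr => i _.
rewrite [in RHS]SP (big_morph (lam i) (lD i) (l0 i)); apply: eq_bigr => k _.
by rewrite lZ mulrC.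
Qed.

Lemma has_trace_family T m (w : 'I_m -> V) (lam : 'I_m -> V -> R) :
  (forall v, T v = \sum_i lam i v *: w i) ->
  (forall i a u v, lam i (a *: u + v) = a * lam i u + lam i v) ->
  has_trace T (\sum_i lam i (w i)).
Proof.
move=> TE ll; have [n [e [ei eP]]] := indep_extract (fun i => if insub i is Some j then w j else 0) m.
have wP i : exists c : 'I_n -> R, w i = \sum_k c k *: e k by have := eP i (ltn_ord i); rewrite valK.
have TP v : exists c : 'I_n -> R, T v = \sum_k c k *: e k.
  have [S SP] := choice wP; exists (fun k => \sum_i lam i v * S i k); rewrite TE.
  under eq_bigr => i _ do rewrite SP scaler_sumr; rewrite exchange_big; apply: eq_bigr => k _.
  by rewrite scaler_suml; apply: eq_bigr => l _; rewrite scalerA.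
have [M MP] := choice (fun j => TP (e j)).
exists n, e, (\matrix_(i, j) M j i); split=> //.
  by move=> j; rewrite MP; apply: eq_bigr => i _; rewrite mxE.
apply/esym; apply: (trace_family ei TE ll wP) => j.
by rewrite MP; apply: eq_bigr => i _; rewrite mxE.
Qed.

(** Two finite-dimensional spaces containing the image are compared inside their sum, where both
    traces equal that of a single matrix. *)
Lemma has_trace_uniq T t t' : linear T -> has_trace T t -> has_trace T t' -> t = t'.
Proof.
move=> Tl [n [e [M [ei eP eM ->]]]] [n' [e' [M' [e'i e'P e'M ->]]]].
pose f i := if (i < n)%N then (if insub i is Some j then e j else 0) else (if insub (i - n)%N is Some j then e' j else 0).
have [n'' [e'' [e''i e''P]]] := indep_extract f (n + n').
have eS i : exists c : 'I_n'' -> R, e i = \sum_k c k *: e'' k.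
  have := e''P i (ltn_addr _ (ltn_ord i)); rewrite /f ltn_ord.
  by rewrite valK.
have e'S i : exists c : 'I_n'' -> R, e' i = \sum_k c k *: e'' k.
  have := e''P (n + i)%N; rewrite ltn_add2l ltn_ord /f ltnNge leq_addr addKn valK.
  exact.
have lamE m (a : 'I_m -> V) (N : 'M[R]_m) : indep a -> (forall v, exists c : 'I_m -> R, T v = \sum_i c i *: a i) ->
    (forall j, T (a j) = \sum_i N i j *: a i) -> exists lam : 'I_m -> V -> R,
    [/\ forall v, T v = \sum_i lam i v *: a i,
        forall i b u v, lam i (b *: u + v) = b * lam i u + lam i v & forall i j, lam i (a j) = N i j].
  move=> ai /choice[c cP] aN; exists (fun i v => c v i); split=> //.
    move=> i b u v; apply/eqP; rewrite -subr_eq0; apply/eqP.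
    apply: (ai (fun i => c (b *: u + v) i - (b * c u i + c v i))).
    under eq_bigr => k _ do rewrite scalerBl scalerDl -scalerA.
    by rewrite sumrB big_split -scaler_sumr /= -!cP Tl subrr.
  move=> i j; apply/eqP; rewrite -subr_eq0; apply/eqP; apply: (ai (fun i => c (a j) i - N i j)).
  by under eq_bigr => k _ do rewrite scalerBl; rewrite sumrB -cP -aN subrr.
have [lam [l1 l2 l3]] := lamE _ _ _ ei eP eM; have [lam' [l1' l2' l3']] := lamE _ _ _ e'i e'P e'M.
have TP j : exists c : 'I_n'' -> R, T (e'' j) = \sum_k c k *: e'' k.
  have [S SP] := choice eS; exists (fun k => \sum_i lam i (e'' j) * S i k); rewrite l1.
  under eq_bigr => i _ do rewrite SP scaler_sumr; rewrite exchange_big; apply: eq_bigr => k _.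
  by rewrite scaler_suml; apply: eq_bigr => l _; rewrite scalerA.
have [N NP] := choice TP; pose M'' : 'M[R]_n'' := \matrix_(i, j) N j i.
have M''E j : T (e'' j) = \sum_i M'' i j *: e'' i by rewrite NP; apply: eq_bigr => i _; rewrite mxE.
have := trace_family e''i l1 l2 eS M''E; have := trace_family e''i l1' l2' e'S M''E.
rewrite /mxtrace => -> E; rewrite -(eq_bigr _ (fun i _ => l3 i i)) -E.
by apply: eq_bigr => i _; rewrite l3'.
Qed.
End Traces.

(** * Recognising scalar extensions *)

Section ScalarExtension.
Variables (k S : fieldType) (j : {rmorphism k -> S}) (V : lmodType k) (T : lmodType S) (e : V -> T).

Definition generates := forall t : T, exists l : seq (S * V), t = \sum_(x <- l) x.1 *: e x.2.
Definition preserves_indep := forall n (v : 'I_n -> V), indep v -> indep (e \o v).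

Hypothesis el : linear_for (j \; *:%R) e.

Let e0 : e 0 = 0.
Proof. by have := el (-1) 0 0; rewrite scaler0 addr0 /= rmorphN1 scaleN1r addNr. Qed.
Let eD u v : e (u + v) = e u + e v.
Proof. by have := el 1 u v; rewrite scale1r /= rmorph1 scale1r. Qed.
Let eZ a v : e (a *: v) = j a *: e v.
Proof. by have := el a v 0; rewrite e0 !addr0. Qed.

(** A relation between images under [e] is rewritten over an independent family, where all its
    coefficients vanish; hence [f] respects it and extends along the generating map [e]. *)
Lemma scalar_extensionP : generates -> preserves_indep -> scalar_extension j e.
Proof.
move=> gen ind; split=> // M f fl.
have f0 : f 0 = 0 by have := fl (-1) 0 0; rewrite scaler0 addr0 /= rmorphN1 scaleN1r addNr.
have fD u v : f (u + v) = f u + f v by have := fl 1 u v; rewrite scale1r /= rmorph1 scale1r.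
have fZ a v : f (a *: v) = j a *: f v by have := fl a v 0; rewrite f0 !addr0.
have wd (l : seq (S * V)) : \sum_(x <- l) x.1 *: e x.2 = 0 -> \sum_(x <- l) x.1 *: f x.2 = 0.
  have [n [b [bi bP]]] := indep_extract (fun i => (nth (0, 0) l i).2) (size l).
  have [c cP] : exists c : nat -> 'I_n -> k, forall i, (i < size l)%N -> (nth (0, 0) l i).2 = \sum_q c i q *: b q.
    have /choice[c cP] : forall i, exists c : 'I_n -> k, (i < size l)%N -> (nth (0, 0) l i).2 = \sum_q c q *: b q.
      move=> i; have [il|il] := boolP (i < size l)%N; last by exists (fun=> 0).
      by have [c cE] := bP i il; exists c.
    by exists c.
  have E (M' : lmodType S) (h : V -> M') : (forall u v, h (u + v) = h u + h v) -> (forall a v, h (a *: v) = j a *: h v) ->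
      h 0 = 0 -> \sum_(x <- l) x.1 *: h x.2 = \sum_q (\sum_(0 <= i < size l) (nth (0, 0) l i).1 * j (c i q)) *: h (b q).
    move=> hD hZ h0; rewrite (big_nth (0, 0)) big_nat.
    under eq_bigr => i /andP[_ il].
      rewrite cP // (big_morph h hD h0) scaler_sumr.
      under eq_bigr => q _ do rewrite hZ scalerA.
      over.
    rewrite -big_nat exchange_big; apply: eq_bigr => q _.
    by rewrite scaler_suml.
  by rewrite !E // => /(ind _ _ bi) H; rewrite big1 // => q _; rewrite H scale0r.
have /choice[r rP] := gen; pose g t := \sum_(x <- r t) x.1 *: f x.2.
have gE t l : t = \sum_(x <- l) x.1 *: e x.2 -> g t = \sum_(x <- l) x.1 *: f x.2.
  move=> tE; apply/eqP; rewrite -subr_eq0; apply/eqP.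
  have N (M' : lmodType S) (h : V -> M') : \sum_(x <- r t) x.1 *: h x.2 - \sum_(x <- l) x.1 *: h x.2 =
      \sum_(x <- r t ++ [seq (- x.1, x.2) | x <- l]) x.1 *: h x.2.
    rewrite big_cat big_map -sumrN; congr (_ + _); apply: eq_bigr => x _.
    by rewrite scaleNr.
  by rewrite /g N; apply: wd; rewrite -N -rP -tE subrr.
have gl : linear g.
  move=> a t t'; rewrite (gE _ ([seq (a * x.1, x.2) | x <- r t] ++ r t')).
    rewrite big_cat big_map scaler_sumr; congr (_ + _); apply: eq_bigr => x _.
    by rewrite scalerA.
  rewrite {1}(rP t) {1}(rP t') big_cat big_map scaler_sumr; congr (_ + _); apply: eq_bigr => x _.
  by rewrite scalerA.
have ge v : g (e v) = f v by rewrite (gE _ [:: (1, v)]) big_seq1 scale1r.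
exists g; split=> // g' [g'l g'e]; apply/funext => t.
have g'0 : g' 0 = 0 by have := g'l (-1) 0 0; rewrite scaler0 addr0 scaleN1r addNr.
have g'D u v : g' (u + v) = g' u + g' v by have := g'l 1 u v; rewrite !scale1r.
rewrite [in RHS](rP t) (big_morph g' g'D g'0); apply: eq_bigr => x _.
by have := g'l x.1 (e x.2) 0; rewrite g'0 !addr0 g'e.
Qed.
End ScalarExtension.

Lemma generates_comp (k K S : fieldType) (j : {rmorphism K -> S})
    (U : lmodType k) (V : lmodType K) (T : lmodType S) (d : U -> V) (e : V -> T) :
  linear_for (j \; *:%R) e -> generates d -> generates e -> generates (e \o d).
Proof.
move=> el gd ge t; have [l ->] := ge t.
have e0 : e 0 = 0 by have := el (-1) 0 0; rewrite scaler0 addr0 /= rmorphN1 scaleN1r addNr.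
have eD u v : e (u + v) = e u + e v by have := el 1 u v; rewrite scale1r /= rmorph1 scale1r.
have eZ a v : e (a *: v) = j a *: e v by have := el a v 0; rewrite e0 !addr0.
elim: l => [|x l [r IH]]; first by exists [::]; rewrite !big_nil.
have [s xE] := gd x.2; exists ([seq (x.1 * j y.1, y.2) | y <- s] ++ r).
rewrite big_cons IH big_cat big_map xE (big_morph e eD e0) scaler_sumr; congr (_ + _).
by apply: eq_bigr => y _; rewrite eZ scalerA.
Qed.

Record semilinear_map (K : fieldType) (sigma : {rmorphism K -> K}) (V : lmodType K) := SemilinearMap {
  semi_fun :> V -> V;
  semiD : forall u v, semi_fun (u + v) = semi_fun u + semi_fun v;
  semiZ : forall a v, semi_fun (a *: v) = sigma a *: semi_fun v }.

(** * Galois descent along a semilinear map *)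

Section Descent.
Variables (K : fieldType) (sigma : {rmorphism K -> K}).

Definition fixed_pred : {pred K} := fun c => sigma c == c.
Lemma fixed_divring : divring_closed fixed_pred.
Proof.
split; first by rewrite /in_mem /= /fixed_pred rmorph1.
  by move=> x y /eqP xE /eqP yE; apply/eqP; rewrite rmorphB xE yE.
by move=> x y /eqP xE /eqP yE; apply/eqP; rewrite fmorph_div xE yE.
Qed.
HB.instance Definition _ := GRing.isDivringClosed.Build K fixed_pred fixed_divring.

Record fixed_field := FixedField { fixed_val : K; _ : fixed_val \in fixed_pred }.
HB.instance Definition _ := [isSub for fixed_val].
HB.instance Definition _ := [Choice of fixed_field by <:].
HB.instance Definition _ := [SubChoice_isSubComUnitRing of fixed_field by <:].
HB.instance Definition _ := [SubComUnitRing_isSubIntegralDomain of fixed_field by <:].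
HB.instance Definition _ := [SubIntegralDomain_isSubField of fixed_field by <:].
HB.instance Definition _ := GRing.RMorphism.copy fixed_val (\val : fixed_field -> K).

Lemma fixed_valP (c : fixed_field) : sigma (fixed_val c) = fixed_val c.
Proof. by apply/eqP; exact: (valP c). Qed.

Variables (V : lmodType K) (I : semilinear_map sigma V).

Definition fixed_vec_pred : {pred V} := fun v => I v == v.
Lemma semi0 : I 0 = 0.
Proof. by rewrite -(scale0r (0 : V)) semiZ rmorph0 !scale0r. Qed.
Lemma semiN v : I (- v) = - I v.
Proof. by rewrite -scaleN1r semiZ rmorphN1 scaleN1r. Qed.
Lemma fixed_vec_zmod : zmod_closed fixed_vec_pred.
Proof.
split; first by apply/eqP; exact: semi0.
by move=> u v /eqP uE /eqP vE; apply/eqP; rewrite semiD semiN uE vE.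
Qed.
HB.instance Definition _ := GRing.isZmodClosed.Build V fixed_vec_pred fixed_vec_zmod.

Record fixed_space := FixedSpace { fixed_vec : V; _ : fixed_vec \in fixed_vec_pred }.
HB.instance Definition _ := [isSub for fixed_vec].
HB.instance Definition _ := [Choice of fixed_space by <:].
HB.instance Definition _ := [SubChoice_isSubZmodule of fixed_space by <:].

Lemma fixed_vecP (v : fixed_space) : I (fixed_vec v) = fixed_vec v.
Proof. by apply/eqP; exact: (valP v). Qed.

Lemma fixed_vecD (u v : fixed_space) : fixed_vec (u + v) = fixed_vec u + fixed_vec v.
Proof. exact: (raddfD (\val : fixed_space -> V)). Qed.

Lemma fixed_scale_proof (c : fixed_field) (v : fixed_space) : fixed_val c *: fixed_vec v \in fixed_vec_pred.
Proof. by apply/eqP; rewrite semiZ fixed_valP fixed_vecP. Qed.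
Definition fixed_scale c v : fixed_space := FixedSpace (fixed_scale_proof c v).
Lemma fixed_scaleA a b v : fixed_scale a (fixed_scale b v) = fixed_scale (a * b) v.
Proof. by apply: val_inj; rewrite /= scalerA. Qed.
Lemma fixed_scale1 : left_id 1 fixed_scale.
Proof. by move=> v; apply: val_inj; rewrite /= scale1r. Qed.
Lemma fixed_scaleDr : right_distributive fixed_scale +%R.
Proof. by move=> a u v; apply: val_inj; rewrite /= scalerDr. Qed.
Lemma fixed_scaleDl v : {morph fixed_scale^~ v : a b / a + b}.
Proof. by move=> a b; apply: val_inj; rewrite /= scalerDl. Qed.
HB.instance Definition _ := GRing.Zmodule_isLmodule.Build fixed_field fixed_space
  fixed_scaleA fixed_scale1 fixed_scaleDr fixed_scaleDl.

Lemma semi_sum (J : Type) (r : seq J) (P : pred J) (f : J -> V) :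
  I (\sum_(i <- r | P i) f i) = \sum_(i <- r | P i) I (f i).
Proof. exact: (big_morph I (semiD I) semi0). Qed.

(** Artin's argument: normalise one coefficient of a shortest relation to 1; applying [I] and
    subtracting gives a shorter one, so all coefficients are fixed by [sigma], against independence
    over the fixed field. *)
Lemma fixed_vec_indep : preserves_indep fixed_vec.
Proof.
move=> n v vi c.
have main m (d : 'I_n -> K) : (#|[set i | d i != 0%R]%SET| <= m)%N -> \sum_i d i *: fixed_vec (v i) = 0 -> forall i, d i = 0.
  elim: m d => [|m IH] d dm d0.
    move=> i; apply/eqP; move: dm; rewrite leqn0 cards_eq0 => /eqP/setP/(_ i).
    by rewrite !inE => /negbFE.
  have [[i0 di0]|H] := pselect (exists i, d i != 0); last first.
    by move=> i; apply: contrapT => /eqP di; apply: H; exists i.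
  pose d' i := d i / d i0.
  have d'0 : \sum_i d' i *: fixed_vec (v i) = 0.
    transitivity ((d i0)^-1 *: \sum_i d i *: fixed_vec (v i)); last by rewrite d0 scaler0.
    by rewrite scaler_sumr; apply: eq_bigr => i _; rewrite scalerA mulrC.
  have fix_d' i : sigma (d' i) = d' i.
    apply/eqP; rewrite -subr_eq0; apply/eqP; apply: (IH (fun i => sigma (d' i) - d' i)).
      have /proper_card : ([set i | sigma (d' i) - d' i != 0] \proper [set i | d i != 0%R])%SET.
        apply/properP; split; last by exists i0; rewrite !inE ?di0 // /d' mulfV // rmorph1 subrr eqxx.
        by apply/fintype.subsetP => l; rewrite !inE; apply: contra => /eqP dl; rewrite /d' dl mul0r rmorph0 subrr.
      by move=> H; rewrite -ltnS; exact: leq_trans H dm.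
    under eq_bigr => l _ do rewrite scalerBl.
    rewrite sumrB d'0 subr0; transitivity (I (\sum_l d' l *: fixed_vec (v l))); last by rewrite d'0 semi0.
    by rewrite semi_sum; apply: eq_bigr => l _; rewrite semiZ fixed_vecP.
  have fc l : d' l \in fixed_pred by apply/eqP.
  have dv0 : \sum_l FixedField (fc l) *: v l = 0.
    apply: val_inj; rewrite /= (big_morph fixed_vec fixed_vecD (erefl : fixed_vec 0 = 0)).
    by rewrite -[RHS]d'0; apply: eq_bigr.
  have /(congr1 fixed_val) /= := vi _ dv0 i0.
  by rewrite /d' mulfV // => /eqP; rewrite oner_eq0.
exact: main (leqnn _).
Qed.

(* Lagrange interpolation at the conjugates of zeta inverts the traces of the
   zeta ^ j v. *)
Lemma fixed_vec_generates : (forall v, exists zeta N, [/\ (0 < N)%N, iter N I v = v,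
    iter N sigma zeta = zeta & forall i, (0 < i < N)%N -> iter i sigma zeta != zeta]) ->
  generates fixed_vec.
Proof.
move=> H v; have [zeta [N [N0 IN sN zN]]] := H v.
pose x i := iter i sigma zeta.
have iterZ n a w : iter n I (a *: w) = iter n sigma a *: iter n I w.
  by elim: n => //= n ->; rewrite semiZ.
have iterX n a m : iter n sigma (a ^+ m) = (iter n sigma a) ^+ m.
  by elim: n => //= n ->; rewrite rmorphXn.
pose t m := \sum_(i < N) iter i I (zeta ^+ m *: v).
have tfix m : t m \in fixed_vec_pred.
  apply/eqP; rewrite /t semi_sum; case: N N0 IN sN zN @t => // N _ IN sN zN t.
  rewrite big_ord_recr [RHS]big_ord_recl /= addrC -iterS iterZ IN iterX sN; congr (_ + _).
(* The Lagrange polynomial equal to 1 at [zeta] and 0 at its other conjugates: combining the fixed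
   vectors [t m] with its coefficients returns [v]. *)
pose P := \prod_(1 <= i < N) ((zeta - x i)^-1 *: ('X - (x i)%:P)).
have P1 : P.[zeta] = 1.
  rewrite /P horner_prod big_nat big1 // => i /andP[i0 iN].
  by rewrite hornerZ hornerXsubC mulVf // subr_eq0 eq_sym zN // i0.
have P0 i : (0 < i < N)%N -> P.[x i] = 0.
  move=> /andP[i0 iN]; rewrite /P horner_prod (bigD1_seq i) ?mem_index_iota ?i0 ?iota_uniq //=.
  by rewrite hornerZ hornerXsubC subrr mulr0 mul0r.
exists [seq (P`_m, FixedSpace (tfix m)) | m <- index_iota 0 (size P)]; rewrite big_map /=.
rewrite /t; under eq_bigr => m _ do rewrite scaler_sumr.
rewrite exchange_big /= (eq_bigr (fun i : 'I_N => P.[x i] *: iter i I v)); last first.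
  move=> i _; rewrite horner_coef scaler_suml big_mkord.
  by apply: eq_bigr => m _; rewrite iterZ iterX scalerA.
case: N N0 IN sN zN {t tfix} @P P1 P0 => // N _ IN sN zN P P1 P0.
rewrite big_ord_recl P1 scale1r big1 ?addr0 // => i _.
by rewrite P0 ?scale0r // /bump /= ltnS.
Qed.
End Descent.

(** * The odd part of the Schwartz space *)

Section OddSpace.
Variables (F : fieldExtType Q2) (W : vectType F) (Y : {vspace W}).
Implicit Type y : subvs_of Y.

Section OddFunctions.
Variable K : fieldType.
Hypothesis two : 2 != 0 :> K.
Implicit Types f g : odd_Cc K Y.

Lemma oddE f y : f (- y) = - f y.
Proof. by have /asboolP := valP f; apply. Qed.

Lemma odd_valD f g : odd_val (f + g) = odd_val f + odd_val g. Proof. by []. Qed.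
Lemma odd_valZ c f : odd_val (c *: f) = c *: odd_val f. Proof. by []. Qed.
Lemma odd_val_inj : injective (@odd_val F K W Y). Proof. exact: val_inj. Qed.
Lemma odd_val_sum (J : Type) (r : seq J) (P : pred J) (h : J -> odd_Cc K Y) :
  odd_val (\sum_(i <- r | P i) h i) = \sum_(i <- r | P i) odd_val (h i).
Proof. exact: (big_morph (@odd_val F K W Y) odd_valD (erefl : odd_val 0 = 0)). Qed.

Lemma oddCcE f g : (forall y, f y = g y) -> f = g.
Proof. by move=> fg; apply/odd_val_inj/CcE. Qed.

Lemma odd_sumE (J : Type) (r : seq J) (P : pred J) (h : J -> odd_Cc K Y) y :
  (\sum_(i <- r | P i) h i : odd_Cc K Y) y = \sum_(i <- r | P i) h i y.
Proof. by rewrite odd_val_sum Cc_sumE. Qed.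

Lemma coset_opp n y u : coset K n y (- u) = coset K n (- y) u.
Proof.
rewrite /= /coset_fun; congr (if _ then _ else _); apply: asbool_equiv_eq.
by split=> /LatN; rewrite !opprD !opprK.
Qed.

Lemma odd_coset_odd n y : coset K n y - coset K n (- y) \in @is_odd F K W Y.
Proof.
apply/asboolP => u; change (coset K n y (- u) - coset K n (- y) (- u) = - (coset K n y u - coset K n (- y) u)).
by rewrite !coset_opp opprK opprB.
Qed.
Definition odd_coset n y : odd_Cc K Y := OddCc (odd_coset_odd n y).

Lemma odd_cosetE n y u : odd_coset n y u = coset K n y u - coset K n (- y) u.
Proof. by []. Qed.

(** The expansion over cosets is antisymmetrised; the division by 2 compensates for counting both
    [f y] and [f (- y)]. *)
Lemma odd_level_sum n N f s : @level F (subvs_of Y) K n N f -> transversal (@Lat_rel _ (subvs_of Y) n) (Lat (- N%:Z)) s ->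
  f = \sum_(y <- s) (f y / 2 : K) *: odd_coset n y.
Proof.
move=> fl sP; have E u : f u = \sum_(y <- s) f y * coset K n y u.
  by rewrite {1}(level_sum fl sP) Cc_sumE.
apply: oddCcE => u; have -> : f u = (f u - f (- u)) / 2.
  rewrite oddE opprK -mulr2n -[_ *+ 2]mulr_natr mulfK //.
rewrite odd_sumE !E -sumrB mulr_suml; apply: eq_bigr => y _.
rewrite coset_opp -mulrBr -[RHS]/(f y / 2 * (coset K n y u - coset K n (- y) u)).
by rewrite mulrAC.
Qed.
End OddFunctions.

Section OddTwist.
Variables (K K' : fieldType) (sigma : {rmorphism K -> K'}) (u : F).

Lemma odd_twist_odd (f : odd_Cc K Y) : twist sigma u f \in @is_odd F K' W Y.
Proof.
apply/asboolP => y /=; case: ifP => _; first by rewrite oppr0.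
by rewrite scalerN oddE rmorphN.
Qed.
Definition odd_twist (f : odd_Cc K Y) : odd_Cc K' Y := OddCc (odd_twist_odd f).

Hypothesis u0 : u != 0.

Lemma odd_twistE f y : odd_twist f y = sigma (f (u^-1 *: y)).
Proof. exact: twistE. Qed.
Lemma odd_twistD f g : odd_twist (f + g) = odd_twist f + odd_twist g.
Proof. by apply: odd_val_inj; rewrite odd_valD; exact: twistD. Qed.
Lemma odd_twistZ c f : odd_twist (c *: f) = sigma c *: odd_twist f.
Proof. by apply: odd_val_inj; rewrite odd_valZ; exact: twistZ. Qed.
End OddTwist.

Definition odd_semilinear (K : fieldType) (sigma : {rmorphism K -> K}) (u : F) (u0 : u != 0) :=
  SemilinearMap (odd_twistD sigma u0) (odd_twistZ sigma u0).

Section Extension.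
Variables (K K' : fieldType) (sigma : {rmorphism K -> K'}).
Hypothesis two : 2 != 0 :> K.
Let u1 : 1 != 0 :> F := oner_neq0 F.
Let e := odd_twist sigma 1 : odd_Cc K Y -> odd_Cc K' Y.

Lemma odd_extensionE f y : e f y = sigma (f y).
Proof. by rewrite odd_twistE // invr1 scale1r. Qed.

Lemma odd_extension_linear : linear_for (sigma \; *:%R) e.
Proof. by move=> a f g; rewrite /e odd_twistD // odd_twistZ. Qed.

Lemma odd_extension_generates : generates (S := K') e.
Proof.
move=> t; have [n [N tl]] := @Cc_level F (subvs_of Y) K' t; have [s sP] := Lat_transversal (subvs_of Y) n (- N%:Z).
have two' : 2 != 0 :> K' by rewrite -(rmorph_nat sigma) fmorph_eq0.
exists [seq (t y / 2, odd_coset K n y) | y <- s]; rewrite big_map {1}(odd_level_sum two' tl sP).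
apply: eq_bigr => y _ /=; congr (_ *: _); apply: oddCcE => u.
rewrite odd_extensionE !odd_cosetE rmorphB /= /coset_fun.
by do 2![case: asboolP => _]; rewrite ?rmorph0 ?rmorph1.
Qed.

(** Functions of a common level are given by their values at finitely many points; independence says
    that the matrix of values has full row rank, and rank does not change under field extension. *)
Lemma odd_extension_indep : preserves_indep (S := K') e.
Proof.
move=> m v vi.
have /choice[n /choice[N vl]] : forall i, exists n N, @level F (subvs_of Y) K n N (v i).
  by move=> i; have [n [N]] := @Cc_level F (subvs_of Y) K (v i); exists n, N.
pose n0 := \max_i n i; pose N0 := \max_i N i.
have vl0 i : @level F (subvs_of Y) K n0 N0 (v i) by apply: level_leq (vl i); exact: leq_bigmax.
have [s sP] := Lat_transversal (subvs_of Y) n0 (- N0%:Z).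
pose A : 'M[K]_(m, size s) := \matrix_(i, k) v i (nth 0 s k).
have Afree : row_free A.
  apply/inj_row_free => c cA; apply/rowP => i; rewrite mxE; apply: (vi (fun i => c 0 i)).
  have Slev : @level F (subvs_of Y) K n0 N0 (\sum_i c 0 i *: v i : odd_Cc K Y).
    split=> [u w wn|u]; rewrite !odd_sumE.
      by apply: eq_bigr => l _; rewrite !CcZE (vl0 l).1.
    move=> H; apply: contrapT => uN; case/eqP: H; apply: big1 => l _; rewrite CcZE.
    by have [->|/(vl0 l).2//] := eqVneq (v l u) 0; rewrite mulr0.
  rewrite (odd_level_sum two Slev sP) big1_seq // => y /andP[_ ys].
  suff -> : (\sum_i c 0 i *: v i : odd_Cc K Y) y = 0 by rewrite mul0r scale0r.
  have /rowP/(_ (Ordinal (etrans (index_mem y s) ys))) := cA; rewrite !mxE => <-.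
  by rewrite odd_sumE; apply: eq_bigr => l _; rewrite mxE /= nth_index.
move=> c c0 i; have : row_free (map_mx sigma A) by rewrite row_free_map.
move/row_freeP => [B AB]; pose r : 'rV[K']_m := \row_i c i.
suff : r *m map_mx sigma A *m B = 0 by rewrite -mulmxA AB mulmx1 => /rowP/(_ i); rewrite !mxE.
suff -> : r *m map_mx sigma A = 0 by rewrite mul0mx.
apply/rowP => k; rewrite !mxE; have := congr1 (fun f : odd_Cc K' Y => f (nth 0 s k)) c0.
rewrite odd_sumE => E; rewrite -[RHS]E; apply: eq_bigr => l _.
by rewrite !mxE CcZE odd_extensionE.
Qed.
End Extension.
End OddSpace.

(** * Unitarity, invariants and averaging *)

Section Integral.
Variables (F : fieldExtType Q2) (V : vectType F) (K : fieldType).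
Hypothesis char0K : forall n, n.+1%:R != 0 :> K.
Implicit Types (f g : V -> K) (u v w y : V).
Local Notation Tr n m s := (transversal (@Lat_rel _ V n) (Lat m) s).

Lemma Lat_transversal_sub (n : nat) (m : int) : m <= n -> exists2 s : seq V, Tr n m s & forall y, y \in s -> Lat m y.
Proof.
move=> mn; have [s [us sE sD]] := Lat_transversal V n m.
exists [seq y <- s | `[< Lat m y >]]; last by move=> y; rewrite mem_filter => /andP[/asboolP].
split; first exact: filter_uniq.
  by move=> x y; rewrite !mem_filter => /andP[_ xs] /andP[_ ys]; exact: sE.
move=> g gm; have [x xs xg] := sD g gm; exists x => //; rewrite mem_filter xs andbT.
by apply/asboolP; rewrite -(subKr g x); apply: LatB => //; exact: Lat_leq xg.
Qed.

Lemma transversal_shift (n : nat) m s v : Lat m v -> Tr n m s -> Tr n m [seq y - v | y <- s].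
Proof.
move=> vm [us sE sD]; split; first by rewrite map_inj_uniq //; exact: addIr.
  move=> _ _ /mapP[x xs ->] /mapP[y ys ->]; rewrite /Lat_rel opprB addrA subrK => /(sE _ _ xs ys) -> //.
move=> g gm; have [x xs xg] := sD (g + v) (LatD gm vm).
by exists (x - v); [exact: map_f|rewrite /Lat_rel opprB addrA].
Qed.

Lemma level_transversal (n N : nat) f s s' : level n N f -> Tr n (- N%:Z) s -> Tr n (- N%:Z) s' ->
  \sum_(y <- s) f y = \sum_(y <- s') f y.
Proof.
move=> fl; apply: sum_transversal fl.2; first exact: Lat_rel_equiv.
by move=> x y xy; rewrite -[y](subrK x) addrC fl.1.
Qed.

Lemma refine_sum : exists q, forall (n N : nat) f s s', level n N f -> Tr n (- N%:Z) s -> Tr n.+1 (- N%:Z) s' ->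
  \sum_(y <- s') f y = (\sum_(y <- s) f y) *+ q.+1.
Proof.
have [t [ut tE tD] t0] := @Lat_transversal_sub 1 0 isT.
exists (size t).-1 => n N f s s' [f1 f2] sT s'T.
have tn : size t != 0%N by have [x] := tD 0 (Lat0 _); case: (t).
rewrite prednK ?lt0n //.
have two0 : 2 ^ n%:Z != 0 :> F by rewrite expfz_neq0 // two_neq0.
have inj x : injective (fun y => x + 2 ^ n%:Z *: y) by move=> y y' /addrI /(scalerI two0).
have pull m y : Lat (m + n%:Z) y -> Lat m (2 ^ (- n%:Z) *: y).
  by move=> /(LatZ (@scaled_pow F (- n%:Z))); rewrite addrC addrK.
have pullK y : 2 ^ n%:Z *: (2 ^ (- n%:Z) *: y) = y :> V.
  by rewrite scalerA -expfzDr ?two_neq0 // subrr scale1r.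
have pullK' y : 2 ^ (- n%:Z) *: (2 ^ n%:Z *: y) = y :> V.
  by rewrite scalerA -expfzDr ?two_neq0 // addNr scale1r.
apply: (@sum_transversal_refine _ _ (@Lat_rel _ V n) (@Lat_rel _ V n.+1) (Lat (- N%:Z)) s s' f
  (fun x => [seq x + 2 ^ n%:Z *: y | y <- t])) => //.
- exact: Lat_rel_equiv.
- exact: Lat_rel_equiv.
- by move=> x y; apply: Lat_leq; rewrite lez_nat.
- by move=> x y xy; rewrite -[y](subrK x) addrC f1.
- move=> x; split; last by rewrite size_map.
  split; first by rewrite (map_inj_uniq (inj x)).
    move=> _ _ /mapP[y yt ->] /mapP[z zt ->]; rewrite /Lat_rel opprD addrACA subrr add0r -scalerBr.
    by rewrite -[n.+1]add1n PoszD => /pull; rewrite pullK' => /(tE _ _ yt zt) ->.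
  move=> g xg; have [y yt yg] := tD (2 ^ (- n%:Z) *: (g - x)) (pull 0 _ xg).
  exists (x + 2 ^ n%:Z *: y); first exact: map_f.
  rewrite /Lat_rel opprD addrA -(pullK (g - x)) -scalerBr -[n.+1]add1n PoszD addrC.
  exact: LatZ (@scaled_pow F n) yg.
- move=> x _ /mapP[y yt ->]; rewrite /Lat_rel addrAC subrr add0r -[X in Lat X]addr0.
  by apply: LatZ; [exact: scaled_pow|exact: t0].
Qed.

(** The invariant integral on Schwartz functions: dividing by [q.+1] once per level makes the sum
    over cosets independent of the level. Functions without a level get the value 0. *)
Lemma integral_ex : exists (q : nat) (J : (V -> K) -> K), forall (n N : nat) f s, level n N f -> Tr n (- N%:Z) s ->
  J f = (q.+1)%:R ^- n * \sum_(y <- s) f y.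
Proof.
have [q qP] := refine_sum; exists q.
pose Q : K := q.+1%:R.
have step (n N : nat) f s n' N' s' : level n N f -> Tr n (- N%:Z) s -> (n <= n')%N -> (N <= N')%N -> Tr n' (- N'%:Z) s' ->
    Q ^- n * \sum_(y <- s) f y = Q ^- n' * \sum_(y <- s') f y.
  move=> fl sT nn NN s'T; have [r rT] := Lat_transversal V n (- N'%:Z).
  have -> : \sum_(y <- s) f y = \sum_(y <- r) f y.
    by apply: (level_transversal fl sT); apply: sub_transversal rT; apply: Lat_leq; rewrite lerN2 lez_nat.
  have {}fl := level_leq (leqnn n) NN fl.
  move: n' nn s' s'T; elim=> [|n' IH] nn s' s'T.
    move: nn; rewrite leqn0 => /eqP n0; subst n; congr (_ * _).
    exact: (level_transversal fl rT s'T).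
  move: nn; rewrite leq_eqVlt => /predU1P[nn|nn].
    subst n; congr (_ * _); exact: (level_transversal fl rT s'T).
  have [r' r'T] := Lat_transversal V n' (- N'%:Z); rewrite (IH nn r' r'T).
  rewrite (qP n' N' f r' s') //; last exact: level_leq (leqnn _) fl.
  by rewrite -mulr_natl -/Q exprS invfM mulrACA mulVf ?mul1r //; exact: char0K.
have /choice[J JP] : forall f, exists j, forall (n N : nat) s, level n N f -> Tr n (- N%:Z) s ->
    j = Q ^- n * \sum_(y <- s) f y.
  move=> f; have [[n [N fl]]|H] := pselect (exists n N, level n N f); last first.
    by exists 0 => n N s fl; case: H; exists n, N.
  have [s sT] := Lat_transversal V n (- N%:Z); exists (Q ^- n * \sum_(y <- s) f y) => n' N' s' fl' s'T.
  have [r rT] := Lat_transversal V (maxn n n') (- (maxn N N')%:Z).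
  rewrite (step _ _ _ _ _ _ _ fl sT _ _ rT) ?leq_maxl //.
  by rewrite (step _ _ _ _ _ _ _ fl' s'T _ _ rT) ?leq_maxr.
by exists J => n N f s; exact: JP.
Qed.
End Integral.

(** * Uniqueness of the invariant hermitian form *)

Section Hermitian.
Variables (F : fieldExtType Q2) (W : vectType F) (form : {skew_symmetric W}) (X Y : {vspace W}).
Variables (K : fieldType) (psi : smooth_character F K) (cj : {rmorphism K -> K}).
Hypothesis XY : complete_polarisation form X Y.
Hypothesis psi_nt : nontrivial_character psi.
Hypothesis psi_cj : forall t, psi t * cj (psi t) = 1.
Local Notation "<< u , v >>" := (form u v).
Local Notation SY := (Cc (ltop (subvs_of Y)) K).
Local Notation O := (@scaled F).
Implicit Types (f g : SY) (x : W) (y v : subvs_of Y).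
Local Notation level := (@level F (subvs_of Y) K).
Local Notation Tr n m s := (transversal (@Lat_rel _ (subvs_of Y) n) (Lat m) s).

(** Biduality of lattices under [psi], up to a bounded shift: multiples of a basis of [X] that are
    small enough to annihilate [Lat n] bound the coordinates of [v] through [char_detect]. *)
Lemma dual_lattice : exists r : nat, forall (n : int) v,
  (forall x, x \in X -> (forall w : subvs_of Y, Lat n w -> psi << vsval w, x >> = 1) -> psi << vsval v, x >> = 1) ->
  Lat (n - r%:Z) v.
Proof.
have [r1 r1P] := char_detect psi_nt; have [r2 r2P] := coordX_bounded XY.
have [k kP] := char_level psi.
have lin (i : 'I_(\dim X)) : linear (fun y : subvs_of Y => << vsval y, (vbasis X)`_i >> : F^o).
  by move=> a u v; rewrite linearP /= linearDl linearZl.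
have /choice[r rP] : forall i : 'I_(\dim X), exists r : nat, forall n (w : subvs_of Y), Lat n w -> O (n - r%:Z) << vsval w, (vbasis X)`_i >>.
  by move=> i; have [r rP] := functional_bounded (lin i); exists r.
pose R := (\max_i r i)%N.
exists (r1 + r2 + R + k)%N => n v H.
have : Lat (n - R%:Z - k%:Z - r1%:Z - r2%:Z) v; last by apply: Lat_leq; lia.
apply: r2P => i.
have : O (- r1%:Z - (k%:Z - n + R%:Z)) << vsval v, (vbasis X)`_i >>; last by apply: scaled_leq; lia.
apply: r1P => c cP; have := H (c *: (vbasis X)`_i); rewrite linearZr_LR /=; apply.
  by apply: memvZ; apply: vbasis_mem; rewrite mem_nth // size_tuple.
move=> w wn; rewrite linearZr_LR /=; apply: kP.
have rR : (r i <= R)%N by exact: leq_bigmax.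
by have := scaledM cP (rP i n w wn); apply: scaled_leq; lia.
Qed.

Section Form.
Variable B : SY -> SY -> K.
Hypothesis BDl : forall f f' g, B (f + f') g = B f g + B f' g.
Hypothesis BZl : forall c f g, B (c *: f) g = c * B f g.
Hypothesis BDr : forall f g g', B f (g + g') = B f g + B f g'.
Hypothesis BZr : forall c f g, B f (c *: g) = cj c * B f g.
Hypothesis BX : forall x f g, x \in X -> B (modulate form X psi x f) (modulate form X psi x g) = B f g.
Hypothesis BY : forall v f g, B (translate form X psi v f) (translate form X psi v g) = B f g.

Let B0l g : B 0 g = 0. Proof. by rewrite -(scale0r (0 : SY)) BZl mul0r. Qed.
Let B0r f : B f 0 = 0. Proof. by rewrite -(scale0r (0 : SY)) BZr rmorph0 mul0r. Qed.
Let Bsuml (J : Type) (r : seq J) (h : J -> SY) g : B (\sum_(i <- r) h i) g = \sum_(i <- r) B (h i) g.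
Proof. exact: (big_morph (B^~ g) (fun a b => BDl a b g) (B0l g)). Qed.
Let Bsumr (J : Type) (r : seq J) (h : J -> SY) f : B f (\sum_(i <- r) h i) = \sum_(i <- r) B f (h i).
Proof. exact: (big_morph (B f) (BDr f) (B0r f)). Qed.

(** The two indicator functions are eigenvectors of a common modulation; if its eigenvalues on them
    differ, invariance of [B] makes them orthogonal. *)
Lemma form_near_diagonal : exists r : nat, forall (n : nat) y y', ~ Lat (n%:Z - r%:Z) (y - y') ->
  B (coset K n y) (coset K n y') = 0.
Proof.
have [r rP] := dual_lattice; exists r => n y y' yy'.
have [x [xX xn xv]] : exists x, [/\ x \in X, forall w : subvs_of Y, Lat n w -> psi << vsval w, x >> = 1 & psi << vsval (y - y'), x >> <> 1].
  apply: contrapT => H; apply/yy'/rP => x xX xn; apply: contrapT => xv.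
  by apply: H; exists x.
have mE (z : subvs_of Y) : modulate form X psi x (coset K n z) = (psi << vsval z, x >> : K) *: coset K n z.
  apply: CcE => u; rewrite (modulateE XY) // CcZE.
  have [uz|uz] := pselect (Lat n (u - z)); last by rewrite coset0 // !mulr0.
  by rewrite -{1}(subrK z u) vsvalD formDl charD (xn _ uz) mul1r.
have := BX (coset K n y) (coset K n y') xX; rewrite !mE BZl BZr mulrA.
set a := psi _; set b := psi _ => H; apply: contrapT => /eqP B0; apply: xv.
have ab : a * cj b = 1 by apply: (mulIf B0); rewrite mul1r.
have -> : psi << vsval (y - y'), x >> = a / b by rewrite vsvalB linearBl /= charB.
have -> : a = b by rewrite -[a]mulr1 -(psi_cj << vsval y', x >>) -/b mulrCA ab mulr1.
exact/divff/char_neq0.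
Qed.

(** Removes the shift [r]: both cosets are cut into cosets of level [n + r], and pieces of different
    cosets of level [n] are then far enough apart. *)
Lemma form_diagonal (n : nat) y y' : ~ Lat n (y - y') -> B (coset K n y) (coset K n y') = 0.
Proof.
move=> yy'; have [r rP] := form_near_diagonal.
have fine z : exists2 s : seq (subvs_of Y), coset K n z = \sum_(u <- s) coset K (n + r) u &
    forall u, u \in s -> Lat n (u - z).
  have [N /(_ N (leqnn _)) zl] := @coset_fun_level F (subvs_of Y) K n z.
  have [s sT] := Lat_transversal (subvs_of Y) (n + r) (- N%:Z).
  have {}zl := @level_leq F (subvs_of Y) K n (n + r) N N _ (leq_addr _ _) (leqnn N) zl.
  exists [seq u <- s | `[< Lat n (u - z) >]]; last by move=> u; rewrite mem_filter => /andP[/asboolP].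
  rewrite {1}(@level_sum F (subvs_of Y) K (n + r) N (coset K n z) s zl sT) big_filter [in RHS]big_mkcond.
  apply: eq_bigr => u _; case: asboolP => uz; first by rewrite coset1 // scale1r.
  by rewrite coset0 // scale0r.
have [s -> sP] := fine y; have [s' -> s'P] := fine y'.
rewrite Bsuml big1_seq // => u /andP[_ us]; rewrite Bsumr big1_seq // => u' /andP[_ us'].
apply: rP; rewrite PoszD addrK => H; apply: yy'.
have -> : y - y' = (y - u) + (u - u') + (u' - y') by rewrite !addrA subrK subrK.
by apply: LatD; [apply: LatD H; apply: LatBC; exact: sP|exact: s'P].
Qed.

Lemma form_level (n N : nat) f g s : level n N f -> level n N g -> Tr n (- N%:Z) s ->
  B f g = (\sum_(y <- s) f y * cj (g y)) * B (coset K n 0) (coset K n 0).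
Proof.
move=> fl gl sT; have [us sE _] := sT.
have Bt y : B (coset K n y) (coset K n y) = B (coset K n 0) (coset K n 0).
  have cE : coset K n y = translate form X psi (- y) (coset K n 0).
    by apply: CcE => u; rewrite (translateE XY) /= /coset_fun subr0.
  by rewrite {1 2}cE BY.
rewrite {1}(level_sum fl sT) {1}(level_sum gl sT) Bsuml mulr_suml; apply: eq_big_seq => y ys.
rewrite BZl Bsumr (bigD1_seq y) //= BZr Bt big1_seq ?addr0; last first.
  move=> z /andP[zy zs]; rewrite BZr form_diagonal ?mulr0 // => H; case/eqP: zy.
  exact: sE.
by rewrite mulrA.
Qed.

End Form.

Section Integral.
Variables (q : nat) (J : (subvs_of Y -> K) -> K).
Hypothesis JP : forall (n N : nat) (h : subvs_of Y -> K) s, level n N h -> Tr n (- N%:Z) s ->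
    J h = q.+1%:R ^- n * \sum_(y <- s) h y.

Lemma common_level f g (h : SY) : exists n N, [/\ level n N f, level n N g & level n N h].
Proof.
have [n1 [N1 fl]] := @Cc_level F (subvs_of Y) K f; have [n2 [N2 gl]] := @Cc_level F (subvs_of Y) K g.
have [n3 [N3 hl]] := @Cc_level F (subvs_of Y) K h.
exists (maxn n1 (maxn n2 n3)), (maxn N1 (maxn N2 N3)).
split; [apply: level_leq fl|apply: level_leq gl|apply: level_leq hl]; rewrite !leq_max leqnn ?orbT //.
Qed.

Lemma level_mul (n N : nat) f (h : subvs_of Y -> K) : level n N f -> (forall u w, Lat n w -> h (u + w) = h u) ->
  level n N (fun y => f y * h y).
Proof.
move=> [f1 f2] h1; split=> [u w wn|u]; first by rewrite f1 // h1.
by rewrite mulf_eq0 negb_or => /andP[/f2].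
Qed.

Definition inner f g : K := J (fun y => f y * cj (g y)).

Lemma innerE (n N : nat) f g s : level n N f -> level n N g -> Tr n (- N%:Z) s ->
  inner f g = q.+1%:R ^- n * \sum_(y <- s) f y * cj (g y).
Proof.
move=> fl gl sT; apply: JP sT; apply: (level_mul fl) => u w wn.
by rewrite gl.1.
Qed.

Lemma innerDl f f' g : inner (f + f') g = inner f g + inner f' g.
Proof.
have [n [N [fl f'l gl]]] := common_level f f' g; have [s sT] := Lat_transversal (subvs_of Y) n (- N%:Z).
have sl : level n N (f + f').
  split=> [u w wn|u]; rewrite !CcDE ?fl.1 ?f'l.1 //.
  by have [->|/fl.2//] := eqVneq (f u) 0; rewrite add0r => /f'l.2.
rewrite !(innerE _ _ sT) // -mulrDr -big_split; congr (_ * _); apply: eq_bigr => y _.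
by rewrite CcDE mulrDl.
Qed.
Lemma innerDr f g g' : inner f (g + g') = inner f g + inner f g'.
Proof.
have [n [N [fl gl g'l]]] := common_level f g g'; have [s sT] := Lat_transversal (subvs_of Y) n (- N%:Z).
have sl : level n N (g + g').
  split=> [u w wn|u]; rewrite !CcDE ?gl.1 ?g'l.1 //.
  by have [->|/gl.2//] := eqVneq (g u) 0; rewrite add0r => /g'l.2.
rewrite !(innerE _ _ sT) // -mulrDr -big_split; congr (_ * _); apply: eq_bigr => y _.
by rewrite CcDE rmorphD mulrDr.
Qed.
Lemma level_scale (n N : nat) c f : level n N f -> level n N (c *: f).
Proof.
move=> [f1 f2]; split=> [u w wn|u]; rewrite !CcZE ?f1 //.
by rewrite mulf_eq0 negb_or => /andP[_ /f2].
Qed.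
Lemma innerZl c f g : inner (c *: f) g = c * inner f g.
Proof.
have [n [N [fl _ gl]]] := common_level f f g; have [s sT] := Lat_transversal (subvs_of Y) n (- N%:Z).
rewrite (innerE (level_scale c fl) gl sT) (innerE fl gl sT) [RHS]mulrCA; congr (_ * _).
by rewrite mulr_sumr; apply: eq_bigr => y _; rewrite CcZE mulrA.
Qed.
Lemma innerZr c f g : inner f (c *: g) = cj c * inner f g.
Proof.
have [n [N [fl _ gl]]] := common_level f f g; have [s sT] := Lat_transversal (subvs_of Y) n (- N%:Z).
rewrite (innerE fl (level_scale c gl) sT) (innerE fl gl sT) [RHS]mulrCA; congr (_ * _).
by rewrite mulr_sumr; apply: eq_bigr => y _; rewrite CcZE rmorphM mulrCA.
Qed.

Lemma inner_rho w f g : inner (heisenberg_rep form X psi (w, 0) f) (heisenberg_rep form X psi (w, 0) g) = inner f g.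
Proof.
pose v := vsproj Y (daddv_pi Y X w).
have [n [N [fl gl _]]] := common_level f g g; have [k vk] := Lat_ex v.
have {}fl : level n (maxn N k) f by apply: level_leq fl; rewrite ?leq_maxl.
have {}gl : level n (maxn N k) g by apply: level_leq gl; rewrite ?leq_maxl.
have {}vk : Lat (- (maxn N k)%:Z) v by apply: Lat_leq vk; rewrite lerN2 lez_nat leq_maxr.
have [s sT] := Lat_transversal (subvs_of Y) n (- (maxn N k)%:Z).
have E : (fun y => heisenberg_rep form X psi (w, 0) f y * cj (heisenberg_rep form X psi (w, 0) g y)) =
    fun y => f (y + v) * cj (g (y + v)).
  apply/funext => y; rewrite /= /heisenberg_rep_fun /= char0 !mul1r rmorphM mulrACA psi_cj mul1r.
  by [].
rewrite {1}/inner E (innerE fl gl sT).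
rewrite (JP (h := fun y => f (y + v) * cj (g (y + v))) (n := n) (N := maxn N k) _ (transversal_shift vk sT)).
  by rewrite big_map; congr (_ * _); apply: eq_bigr => y _; rewrite subrK.
split=> [u w' wn|u]; first by rewrite addrAC fl.1 // gl.1.
rewrite mulf_eq0 negb_or => /andP[/fl.2 H _].
by rewrite -(addrK v u); apply: LatB.
Qed.

Lemma inner_coset : inner (coset K 0 0) (coset K 0 0) = 1.
Proof.
have [N /(_ N (leqnn _)) cl] := @coset_fun_level F (subvs_of Y) K 0 0.
have [s sT] := Lat_transversal (subvs_of Y) 0 (- N%:Z).
rewrite (@innerE 0 N (coset K 0 0) (coset K 0 0) s cl cl sT) expr0 invr1 mul1r.
have c1 : coset K 0 (0 : subvs_of Y) 0 = 1 by rewrite coset1 // subrr; exact: Lat0.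
have E : coset K 0 (0 : subvs_of Y) 0 = \sum_(y <- s) coset K 0 (0 : subvs_of Y) y * coset K 0 y 0.
  by rewrite {1}(@level_sum F (subvs_of Y) K 0 N (coset K 0 0) s cl sT) Cc_sumE.
rewrite -[RHS]c1 E; apply: eq_bigr => y _.
have [y0|y0] := pselect (Lat 0 y).
  by rewrite !coset1 ?rmorph1 // ?subr0 // sub0r; exact: LatN.
by rewrite [coset K 0 0 y]coset0 ?mul0r // subr0.
Qed.

(** At a common level, modulations make the indicator functions orthogonal and translations give
    them equal norm, which determines the form up to its value on the standard lattice. *)
Lemma form_integral (B : SY -> SY -> K) :
  (forall f f' g, B (f + f') g = B f g + B f' g) -> (forall c f g, B (c *: f) g = c * B f g) ->
  (forall f g g', B f (g + g') = B f g + B f g') -> (forall c f g, B f (c *: g) = cj c * B f g) ->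
  (forall w f g, B (heisenberg_rep form X psi (w, 0) f) (heisenberg_rep form X psi (w, 0) g) = B f g) ->
  forall f g, B f g = B (coset K 0 0) (coset K 0 0) * inner f g.
Proof.
move=> BDl BZl BDr BZr Brho f g; pose c : SY := coset K 0 0.
have [n [N [fl gl cl]]] := common_level f g c; have [s sT] := Lat_transversal (subvs_of Y) n (- N%:Z).
have H f' g' := @form_level B BDl BZl BDr BZr (fun x f g _ => Brho x f g) (fun v f g => Brho (vsval v) f g) n N f' g' s.
rewrite (H f g) // (H c c) // -[in LHS](mul1r (B _ _)) -inner_coset -/c (innerE fl gl sT) (innerE cl cl sT).
by ring.
Qed.
End Integral.
End Hermitian.

(** * Invariants of open subgroups *)

Section Invariants.
Variables (F : fieldExtType Q2) (W : vectType F) (form : {skew_symmetric W}) (X Y : {vspace W}).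
Variables (K : fieldType) (psi : smooth_character F K) (Mp : topGroupType) (p : Mp -> 'End(W)).
Local Notation SY := (Cc (ltop (subvs_of Y)) K).
Variable omega : Mp -> SY -> SY.
Hypothesis form_nd : nondegenerate form.
Hypothesis XY : complete_polarisation form X Y.
Hypothesis psi_nt : nontrivial_character psi.
Hypothesis W0 : fullv != 0%VS :> {vspace W}.
Hypothesis cover : metaplectic_cover form p.
Hypothesis weil : Weil_representation form X psi p omega.
Local Notation "<< u , v >>" := (form u v).
Local Notation Sp := (symplectic_group form).
Local Notation O := (@scaled F).
Local Notation rho := (heisenberg_rep form X psi).
Implicit Types (f : SY) (w : W).

Section Subgroup.
Variable Gamma : set Mp.
Hypotheses (Go : open Gamma) (G1 : Gamma 1%g).

Lemma small_transvections w : exists n : nat, forall c, O n c ->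
  exists2 g, Gamma g & p g = transvection form w c.
Proof.
have [U oU UE] := mp_open cover Go.
have U1 : U \1%VF by have [] : (U `&` Sp) \1%VF by rewrite -UE; exists 1%g => //; exact: (mp1 cover).
have /nbhs_LatP[n nP] : nbhs (\1%VF : ltop 'End(W)) U by apply: open_nbhs_nbhs.
have [k kP] := Lat_ex (transvection form w 1 - \1%VF); exists (n + k)%N => c cP.
have tE : transvection form w c = (\1 + c *: (transvection form w 1 - \1))%VF.
  apply/lfunP => u; rewrite transvectionE [RHS]add_lfunE scale_lfunE [X in c *: X]add_lfunE opp_lfunE transvectionE id_lfunE mul1r.
  by rewrite addrAC subrr add0r scalerA.
have : (U `&` Sp) (transvection form w c).
  split; last exact: symplectic_transvection.
  rewrite tE; apply: nP; have := LatZ cP kP.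
  by rewrite PoszD addrK.
by rewrite -UE => -[g gG gE]; exists g.
Qed.

(** After conjugating [w] to a vector [x] of [X], the small transvections in [Gamma] act by
    [psi(d <y, x>^2)] up to sign. Invariance bounds [<y, x>] on the support, and so small
    modulations by multiples of [x] act trivially. *)
Lemma invariant_heisenberg w : exists n : nat, forall c f, O n c -> (forall g, Gamma g -> omega g f = f) ->
  rho (c *: w, 0) f = f.
Proof.
have [->|w0] := eqVneq w 0.
  exists 0%N => c f _ _; rewrite scaler0; apply: CcE => y.
  by rewrite -/(modulate form X psi 0 f) (modulateE XY) ?mem0v // linear0r char0 mul1r.
have [x xX x0] := polarisationX_ex XY W0.
have [h0 h0S h0x] := symplectic_transitive form_nd x0 w0; have [h hE] := cover_lift cover h0S.
have [n nP] := small_transvections w; have [r rP] := char_detect psi_nt; have [k kP] := char_level psi.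
pose M := (r + n + 1)%N; exists (k + M)%N => c f cP fG; pose f' := omega h^-1%g f.
have omega_rep := (weil_smooth weil).1.
(* The factor 2 squares the multiplier: a conjugated transvection agrees with an element of [Gamma]
   only up to the kernel of the cover, which acts by a sign. *)
have f'2 d y : O n d -> psi (d * (2 * << vsval y, x >> ^+ 2)) * f' y = f' y.
  move=> dn; have [|g Gg gE] := nP (- 2 * d).
    apply: scaledM0 dn; apply: integerN; rewrite -[2]/(1 + 1); apply: integerD; exact: integer1.
  have [a aE aP] := weil_transvection XY weil d xX.
  have : p (g^-1 * (h * a * h^-1))%g = \1%VF.
    rewrite !(mpM cover) hE aE; have -> : (h0 \o transvection form x (- 2 * d) \o p h^-1%g)%VF = p g.
      rewrite gE -h0x -(transvection_conj form_nd _ _ h0S); congr (_ \o _)%VF; apply/lfunP => u.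
      by rewrite -[u in LHS](symplectic_fVK form_nd h0S) -{1}hE (coverV cover).
    by rewrite -(mpM cover) mulVg (mp1 cover).
  have E f1 : omega (g^-1 * (h * a * h^-1))%g f1 = omega g^-1%g (omega h (omega a (omega h^-1%g f1))).
    by rewrite !(repM omega_rep).
  have af' (e : bool) : omega (g^-1 * (h * a * h^-1))%g f = (-1) ^+ e *: f -> psi (d * << vsval y, x >> ^+ 2) * f' y = (-1) ^+ e * f' y.
    rewrite E => H; rewrite -aP -[RHS]/(((-1) ^+ e *: f' : SY) y).
    suff -> : omega a f' = (-1) ^+ e *: f' by []; rewrite -[LHS](weilK weil h) -/f'.
    rewrite -[omega h _](weilVK weil g) H (weilZ weil) (fG g Gg).
    by rewrite (weilZ weil).
  rewrite mulrCA mulr_natl mulrC charMn => /(weil_kernel weil)[/(_ f) H|/(_ f) H].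
    by have /(_ false) := af'; rewrite expr0 mul1r scale1r expr2 mulrC -mulrA => H'; rewrite !H'.
  have /(_ true) := af'; rewrite expr1 scaleN1r expr2 mulrC -mulrA => /(_ H) H'.
  by rewrite H' mulrCA H' mulrA mulrNN !mul1r.
have supp y : f' y != 0 -> O (- M%:Z) << vsval y, x >>.
  move=> fy; apply: scaled_sqrt; have := rP n (2 * << vsval y, x >> ^+ 2).
  have H d : O n d -> psi (d * (2 * << vsval y, x >> ^+ 2)) = 1.
    by move=> dn; apply: (mulIf fy); rewrite f'2 ?mul1r.
  move=> /(_ H) /(scaledMpow (-1)); rewrite exprN1 mulKf ?two_neq0 //.
  by apply: scaled_leq; rewrite /M; lia.
have mf' : modulate form X psi (c *: x) f' = f'.
  apply: CcE => y; rewrite (modulateE XY) ?memvZ // linearZr_LR /=.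
  have [->|/supp yM] := eqVneq (f' y) 0; first by rewrite mulr0.
  rewrite kP ?mul1r //; have := scaledM cP yM.
  by rewrite PoszD addrK.
rewrite -[f in LHS](weilVK weil h) -/f' -h0x -linearZ -hE -(weil_rho weil) -/(modulate form X psi (c *: x) f').
by rewrite mf' /f' (weilVK weil).
Qed.

(** Admissibility in explicit form: small translations along a basis of [Y] bound the level of an
    invariant function, and small modulations along a basis of [X] bound its support. *)
Lemma invariants_level : exists m N, forall f, (forall g, Gamma g -> omega g f = f) ->
  @level F (subvs_of Y) K m N f.
Proof.
have /choice[n nP] := invariant_heisenberg.
have [r rP] := char_detect psi_nt; have [r2 r2P] := coordX_bounded XY.
pose b (j : 'I_(\dim {:subvs_of Y})) : subvs_of Y := (vbasis {:subvs_of Y})`_j.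
pose m := (\max_j n (vsval (b j)))%N; pose R := (\max_(i < \dim X) n ((vbasis X)`_i)%R)%N.
exists m, (r + R + r2)%N => f fG; split=> [u w wm|u fu].
  have step j t u' : O m t -> f (u' + t *: b j) = f u'.
    move=> tm; have tn : O (n (vsval (b j))) t by apply: scaled_leq tm; rewrite lez_nat; exact: leq_bigmax.
    have := nP (vsval (b j)) t f tn fG; rewrite -vsvalZ -/(translate form X psi (t *: b j) f) => E.
    by rewrite -{2}E (translateE XY).
  rewrite (coord_vbasis (memvf w)).
  by elim/big_rec: _ u => [|j w' _ IH] u; rewrite ?addr0 // addrA IH step //; exact: wm.
have : Lat (- r%:Z - R%:Z - r2%:Z) u; last by apply: Lat_leq; lia.
apply: r2P => i; apply: rP => c cR.
have cn : O (n ((vbasis X)`_i)%R) c by apply: scaled_leq cR; rewrite lez_nat; exact: leq_bigmax.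
have iX : (vbasis X)`_i \in X by apply: vbasis_mem; rewrite mem_nth // size_tuple.
have := congr1 (fun f : SY => f u) (nP (vbasis X)`_i c f cn fG).
rewrite -/(modulate form X psi (c *: (vbasis X)`_i) f) (modulateE XY) ?memvZ // linearZr_LR /= => H.
by apply: (mulIf fu); rewrite H mul1r.
Qed.
End Subgroup.

Section Unitarity.
Variables (cj : {rmorphism K -> K}) (q : nat) (J : (subvs_of Y -> K) -> K).
Hypothesis psi_cj : forall t, psi t * cj (psi t) = 1.
Hypothesis JP : forall (n N : nat) (h : subvs_of Y -> K) s, level n N h ->
  transversal (@Lat_rel _ (subvs_of Y) n) (Lat (- N%:Z)) s -> J h = q.+1%:R ^- n * \sum_(y <- s) h y.

(** The form transported by [omega g] is again Heisenberg-invariant, hence proportional to the inner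
    product; the fixed vector [f0] of nonzero norm shows that the factor is 1. *)
Lemma weil_unitary g f0 : omega g f0 = f0 -> inner cj J f0 f0 != 0 ->
  forall f f', inner cj J (omega g f) (omega g f') = inner cj J f f'.
Proof.
move=> gf0 f00 f f'; pose B f f' := inner cj J (omega g f) (omega g f').
have BE f1 f2 : B f1 f2 = B (coset K 0 0) (coset K 0 0) * inner cj J f1 f2.
  apply: (form_integral XY psi_nt psi_cj JP) => [f3 f4 f5|c f3 f4|f3 f4 f5|c f3 f4|w f3 f4]; rewrite /B.
  - by rewrite (weilD weil) (innerDl _ JP).
  - by rewrite (weilZ weil) (innerZl _ JP).
  - by rewrite (weilD weil) (innerDr _ JP).
  - by rewrite (weilZ weil) (innerZr _ JP).
  - by rewrite !(weil_rho weil) (inner_rho form X psi_cj JP).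
have k1 : B (coset K 0 0) (coset K 0 0) = 1.
  by apply: (mulIf f00); rewrite mul1r -BE /B gf0.
by rewrite -/(B f f') BE k1 mul1r.
Qed.
End Unitarity.
End Invariants.

(** * Averaging projectors *)

Section Averaging.
Variables (G : topGroupType) (B : nat -> set G) (mu : set G -> rat).
Hypothesis B_sub : forall n, compact_open_subgroup (B n).
Hypothesis B_decr : forall m n, (m <= n)%N -> B n `<=` B m.
Hypothesis B_nbhs : forall A, nbhs (1%g : G) A -> exists n, B n `<=` A.
Hypothesis muP : left_Haar_measure mu.

Lemma left_translate_is_Cc (phi : Cc G rat) g : is_Cc ((fun x => phi (g^-1 * x)%g) : G -> rat^o).
Proof.
have [fl fc] := CcP phi; apply/asboolP; split.
  by move=> x; exact: (@mulg_continuousl G g^-1%g x _ (fl (g^-1 * x)%g)).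
have -> : [set x | phi (g^-1 * x)%g != 0] = (fun x => (g * x)%g) @` [set x | phi x != 0].
  apply/seteqP; split=> [x /= px|_ [x px <-] /=]; last by rewrite mulgA mulVg mul1g.
  by exists (g^-1 * x)%g => //; rewrite mulgA mulgV mul1g.
by apply: continuous_compact fc; apply: continuous_subspaceT; exact: mulg_continuousl.
Qed.

Lemma ratr1_field (R : fieldType) : ratr 1 = 1 :> R.
Proof. by rewrite /ratr (_ : numq 1 = 1) // (_ : denq 1 = 1) // divr1. Qed.

Variable k : nat.
Local Notation Gamma := (B k).

Lemma average_is_Cc : is_Cc ((fun x => if `[< Gamma x >] then (mu Gamma)^-1 else 0) : G -> rat^o).
Proof.
have GS := compact_open_is_subgroup (B_sub k); have [_ _ mupos] := muP; have [Gc Go G1 _] := B_sub k.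
apply/asboolP; split=> [x|].
  apply/(basis_nbhs B_sub B_nbhs); exists k => y xy /=; congr (if _ then _ else _); apply: asbool_equiv_eq.
  split=> [Gy|Gx]; last by have := subgroupM GS Gx xy; rewrite mulgA mulgV mul1g.
  by have := subgroupM GS Gy (subgroupV GS xy); rewrite invgM invgK mulgA mulgV mul1g.
have -> : [set x | (if `[< Gamma x >] then (mu Gamma)^-1 else 0) != 0] = Gamma; last exact: Gc.
apply/seteqP; split=> x /=; first by case: asboolP => //; rewrite eqxx.
by move=> Gx; rewrite asboolT // invr_neq0 // gt_eqF // mupos //; exists x.
Qed.
(** Normalised to total mass 1, so that its Hecke operator is the projector onto the invariants of
    [Gamma]. *)
Definition average : Cc G rat := Cc_of average_is_Cc.

Lemma averageE x : average x = if `[< Gamma x >] then (mu Gamma)^-1 else 0. Proof. by []. Qed.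

Section Representation.
Variables (R : fieldType) (V : lmodType R) (pi : G -> V -> V).
Hypothesis ratrD : {morph (ratr : rat -> R) : a b / a + b}.
Hypothesis piP : smooth_rep pi.

Lemma hecke_uniq (phi : Cc G rat) T T' : hecke_operator mu pi phi T -> hecke_operator mu pi phi T' -> T =1 T'.
Proof.
move=> TP T'P v; have [n [s [_ H]]] := @hecke_ex G B B_sub B_decr B_nbhs R V pi phi piP v setT filterT.
by rewrite (hecke_operatorE TP H) (hecke_operatorE T'P H).
Qed.

(** Makes [pi g] composed with the projector a Hecke operator again, so that its trace counts among
    the Hecke traces. *)
Lemma hecke_translate (phi phi' : Cc G rat) g T : hecke_operator mu pi phi T ->
  (forall x, phi' x = phi (g^-1 * x)%g) -> hecke_operator mu pi phi' (fun v => pi g (T v)).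
Proof.
move=> TP E v U s UP Uv Uphi [us sE sD]; have piM := repM piP.1.
have pil := rep_linear piP.1 g.
have pi0 : pi g 0 = 0 by have := pil (-1) 0 0; rewrite scaler0 addr0 scaleN1r addNr.
have piD u w : pi g (u + w) = pi g u + pi g w by have := pil 1 u w; rewrite !scale1r.
have piZ c w : pi g (c *: w) = c *: pi g w by have := pil c w 0; rewrite pi0 !addr0.
have inj : injective (fun x => (g^-1 * x)%g).
  by move=> x y /(congr1 (fun z => (g * z)%g)); rewrite !mulgA mulgV !mul1g.
have EK x : phi x = phi' (g * x)%g by rewrite E mulgA mulVg mul1g.
rewrite (TP v U [seq (g^-1 * x)%g | x <- s]) //.
- rewrite big_map (big_morph _ piD pi0); apply: eq_bigr => x _.
  by rewrite piZ -piM mulgA mulgV mul1g E.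
- by move=> x u Uu; rewrite !EK mulgA Uphi.
split; first by rewrite map_inj_uniq.
  move=> _ _ /mapP[x xs ->] /mapP[y ys ->]; rewrite invgM invgK -mulgA (mulgA g) mulgV mul1g => /(sE _ _ xs ys).
  by move=> ->.
move=> x /= px; have [|y ys yx] := sD (g * x)%g; first by rewrite /= -EK.
by exists (g^-1 * y)%g; [exact: map_f|rewrite invgM invgK -mulgA].
Qed.

Variable e : V -> V.
Hypothesis eP : hecke_operator mu pi average e.

Lemma average_invariant x v : Gamma x -> pi x (e v) = e v.
Proof.
move=> Gx; have GS := compact_open_is_subgroup (B_sub k); suff H : hecke_operator mu pi average (fun v => pi x (e v)) by exact: hecke_uniq H eP v.
apply: (hecke_translate eP) => y; rewrite !averageE; congr (if _ then _ else _); apply: asbool_equiv_eq.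
split=> [Gy|Gy]; first by apply: GS.2.
by have := subgroupM GS Gx Gy; rewrite mulgA mulgV mul1g.
Qed.

Lemma average_id v : (forall x, Gamma x -> pi x v = v) -> e v = v.
Proof.
move=> Gv; have GS := compact_open_is_subgroup (B_sub k); have [_ _ mupos] := muP; have [_ _ G1 GM] := B_sub k.
rewrite (eP (B_sub k) Gv (s := [:: 1%g])).
- rewrite big_seq1 averageE asboolT // divff ?gt_eqF ?mupos //; last by exists 1%g.
    by rewrite ratr1_field scale1r (rep1 piP.1).
  by have [] := B_sub k.
  by have [] := B_sub k.
- move=> x u Gu; rewrite !averageE; congr (if _ then _ else _); apply: asbool_equiv_eq.
  split=> [Gxu|Gx]; last exact: subgroupM.
  by have := subgroupM GS Gxu (subgroupV GS Gu); rewrite -mulgA mulgV mulg1.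
- split=> // [x y|x /=]; first by rewrite !inE => /eqP -> /eqP ->.
  by case: asboolP => [Gx _|]; [exists 1%g; rewrite ?mem_head // invg1 mul1g|rewrite eqxx].
Qed.
End Representation.

Section Form.
Variables (R : fieldType) (V : lmodType R) (pi : G -> V -> V) (cj : {rmorphism R -> R}) (ip : V -> V -> R).
Hypothesis ratrD : {morph (ratr : rat -> R) : a b / a + b}.
Hypothesis piP : smooth_rep pi.
Hypothesis ipD : forall u v w, ip u (v + w) = ip u v + ip u w.
Hypothesis ipZ : forall c u v, ip u (c *: v) = cj c * ip u v.
Hypothesis ipG : forall x u v, Gamma x -> ip (pi x u) (pi x v) = ip u v.
Variable e : V -> V.
Hypothesis eP : hecke_operator mu pi average e.

(* The coefficients in the average sum to 1, as the trivial representation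
   shows. *)
Lemma average_projection v : ip (e v) (e v) = ip (e v) v.
Proof.
have trivP : smooth_rep (fun (_ : G) (c : R^o) => c).
  split; first by split=> // g a u w.
  move=> c; rewrite (_ : [set _ | _] = setT); first exact: openT.
  by apply/seteqP; split.
have [n [s [_ H]]] := @hecke_ex G B B_sub B_decr B_nbhs R V pi average piP v setT filterT.
have [T TP] := hecke_operator_ex B_sub B_decr B_nbhs muP average ratrD trivP.
have T1 : T 1 = 1 by exact: (average_id trivP TP).
have H' : hecke_admissible (fun (_ : G) (c : R^o) => c) average (1 : R^o) (B n) s.
  by have [nP _ nphi sP] := H; split.
have c1 : \sum_(x <- s) ratr (mu (B n) * average x) = 1 :> R.
  by rewrite -[RHS]T1 (hecke_operatorE TP H'); apply: eq_bigr => x _; rewrite /GRing.scale /= mulr1.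
have ratr0 : ratr 0 = 0 :> R by apply: (addrI (ratr 0)); rewrite -ratrD !addr0.
have ip0 : ip (e v) 0 = 0 by have := ipZ 0 (e v) 0; rewrite scale0r rmorph0 mul0r.
rewrite {2}(hecke_operatorE eP H) /hecke_sum (big_morph _ (ipD (e v)) ip0).
rewrite -[RHS]mul1r -c1 mulr_suml; apply: eq_bigr => x _; rewrite ipZ (fmorph_rat cj).
have [Gx|Gx] := pselect (Gamma x).
  by rewrite -{1}(average_invariant piP eP v Gx) ipG.
by rewrite /= asboolF // mulr0 ratr0 !mul0r.
Qed.
End Form.
End Averaging.

(** * Subfields of the 8th cyclotomic field and classes of 2-adic units *)

Section Subfields.
Variables (E : set algC) (zeta : algC).
Hypotheses (E_sub : is_subfield E) (E_rat : forall q : rat, E (ratr q)) (zetaP : 8.-primitive_root zeta).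

Lemma subfield0 : E 0. Proof. by rewrite -(rmorph0 (ratr : {rmorphism rat -> algC})); exact: E_rat. Qed.
Lemma subfieldB x y : E x -> E y -> E (x - y). Proof. by have [_ H _] := E_sub; exact: H. Qed.
Lemma subfieldD x y : E x -> E y -> E (x + y).
Proof. by move=> Ex Ey; rewrite -[y]opprK -[- y]sub0r; do 2!apply: subfieldB => //; exact: subfield0. Qed.
Lemma subfield_div x y : E x -> E y -> E (x / y). Proof. by have [_ _ H] := E_sub; exact: H. Qed.
Lemma subfieldM x y : E x -> E y -> E (x * y).
Proof.
move=> Ex Ey; rewrite -[y]invrK -[y^-1]mul1r; apply: subfield_div Ex (subfield_div _ Ey).
by have [] := E_sub.
Qed.
Lemma subfieldX x n : E x -> E (x ^+ n).
Proof. by move=> Ex; elim: n => [|n IH]; rewrite ?exprS; [have [] := E_sub|exact: subfieldM]. Qed.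

Lemma subfield_Qadj x : E x -> Qadj x `<=` E.
Proof.
move=> Ex _ [P _ <-]; rewrite horner_coef; elim/big_rec: _ => [|k y _ Ey]; first exact: subfield0.
by apply: subfieldD => //; apply: subfieldM; [rewrite coef_map; exact: E_rat|exact: subfieldX].
Qed.

Lemma subfield_solve x y a b c d : E a -> E b -> E c -> E d -> a * d - b * c != 0 ->
  E (a * x + b * y) -> E (c * x + d * y) -> E x /\ E y.
Proof.
move=> Ea Eb Ec Ed D0 E1 E2; split.
  have -> : x = (d * (a * x + b * y) - b * (c * x + d * y)) / (a * d - b * c) by field.
  by apply: subfield_div; apply: subfieldB; exact: subfieldM.
have -> : y = (a * (c * x + d * y) - c * (a * x + b * y)) / (a * d - b * c) by field.
by apply: subfield_div; apply: subfieldB; exact: subfieldM.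
Qed.

Local Notation i := (zeta ^+ 2).
Local Notation r := (zeta + zeta ^+ 3).
Local Notation s := (zeta - zeta ^+ 3).

Lemma zeta_pow4 : zeta ^+ 4 = -1. Proof. by have [w [<- _ w4 _]] := Qcomb_lift zetaP; rewrite -rmorphXn w4 rmorphN1. Qed.
Lemma algC_two : 2 != 0 :> algC. Proof. by rewrite pnatr_eq0. Qed.

Lemma gen_ii : i * i = -1. Proof. by rewrite -exprD zeta_pow4. Qed.
Lemma gen_rr : r * r = -2.
Proof.
have -> : r * r = i * (zeta ^+ 4 + 1) + 2 * zeta ^+ 4 by ring.
by rewrite zeta_pow4 addNr mulr0 add0r mulrN1.
Qed.
Lemma gen_ss : s * s = 2.
Proof.
have -> : s * s = i * (zeta ^+ 4 + 1) - 2 * zeta ^+ 4 by ring.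
by rewrite zeta_pow4 addNr mulr0 sub0r mulrN1 opprK.
Qed.
Lemma gen_ir : i * r = - s.
Proof.
have -> : i * r = zeta * (zeta ^+ 4 + 1) - s by ring.
by rewrite zeta_pow4 addNr mulr0 sub0r.
Qed.
Lemma gen_is : i * s = r.
Proof.
have -> : i * s = r - zeta * (zeta ^+ 4 + 1) by ring.
by rewrite zeta_pow4 addNr mulr0 subr0.
Qed.
Lemma gen_rs : r * s = 2 * i.
Proof.
have -> : r * s = 2 * i - i * (zeta ^+ 4 + 1) by ring.
by rewrite zeta_pow4 addNr mulr0 subr0.
Qed.

Lemma subfield_nat n : E n%:R.
Proof. by rewrite -(rmorph_nat (ratr : {rmorphism rat -> algC})); exact: E_rat. Qed.
Lemma subfieldN x : E x -> E (- x).
Proof. by move=> Ex; rewrite -sub0r; apply: subfieldB Ex; exact: subfield0. Qed.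

Lemma subfield_zeta : [\/ E i /\ E r, E i /\ E s | E r /\ E s] -> E zeta.
Proof.
have E2 := subfield_nat 2; have zE : zeta = (r + s) / 2 by field.
move=> H; suff : E ((r + s) / 2) by rewrite -zE.
apply: subfield_div => //; case: H => -[H1 H2]; apply: subfieldD => //.
  by rewrite -[s]opprK -gen_ir -sub0r; apply: subfieldB; [exact: subfield0|exact: subfieldM].
by rewrite -gen_is; exact: subfieldM.
Qed.

Lemma sqr2_irrational (b c : rat) : c != 0 -> b ^+ 2 - 2 * c ^+ 2 != 0.
Proof.
move=> c0; apply/eqP => bc; pose q := b / c.
have q2 : q ^+ 2 = 2.
  by rewrite expr_div_n; apply: (mulIf (expf_neq0 2 c0)); rewrite divfK ?expf_neq0 //; apply/eqP; rewrite -subr_eq0 bc.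
have d0 : (denq q)%:~R != 0 :> rat by rewrite intr_eq0 denq_neq0.
have : ((numq q) ^+ 2 = 2 * (denq q) ^+ 2)%R.
  apply: (@intr_inj rat); rewrite [LHS]rmorphXn.
  have -> : (2 * denq q ^+ 2)%:~R = 2 * (denq q)%:~R ^+ 2 :> rat by rewrite rmorphM; congr (_ * _); rewrite rmorphXn.
  rewrite -q2 -exprMn.
  by rewrite -{2}(divq_num_den q) divfK.
move/(congr1 absz); rewrite abszM !abszX => /(congr1 (logn 2)).
have dn : (0 < absz (denq q))%N by rewrite absz_gt0 denq_neq0.
have nn : (0 < absz (numq q))%N.
  rewrite absz_gt0 numq_eq0; apply: contra_eq_neq q2 => ->.
  by rewrite expr0n.
rewrite lognM ?expn_gt0 ?dn // !lognX (_ : logn 2 (absz 2) = 1%N) //.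
lia.
Qed.

Local Notation Q := (ratr : {rmorphism rat -> algC}).
Lemma subfield_rat a : E (Q a). Proof. exact: E_rat. Qed.
Local Ltac in_subfield := repeat first [assumption | exact (subfield_rat _) | exact (subfield_nat _) |
  apply subfield_div | apply subfieldB | apply subfieldN | apply subfieldX | apply subfieldD | apply subfieldM].

Lemma rat_neq0 a : a != 0 -> Q a != 0. Proof. by rewrite fmorph_eq0. Qed.

(** Squaring gives [s], and the product with [s] gives a second combination of [i] and [r]; the
    determinant [b^2 - 2 c^2] is nonzero since 2 is not the square of a rational. *)
Lemma subfield_full_ir (b c : rat) : b != 0 -> c != 0 -> E (Q b * i + Q c * r) -> E zeta.
Proof.
move=> b0 c0 Ey; have E2 := subfield_nat 2.
have Es : E s.
  have -> : s = ((Q b * i + Q c * r) ^+ 2 + Q b ^+ 2 + 2 * Q c ^+ 2) / - (2 * Q b * Q c).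
    have N : - (2 * Q b * Q c) != 0 by rewrite oppr_eq0; exact: mulf_neq0 (mulf_neq0 algC_two (rat_neq0 b0)) (rat_neq0 c0).
    apply: (mulIf N); rewrite divfK //.
    transitivity (Q b ^+ 2 * (i * i) + Q c ^+ 2 * (r * r) + 2 * Q b * Q c * (i * r) + Q b ^+ 2 + 2 * Q c ^+ 2); last by ring.
    by rewrite gen_ii gen_rr gen_ir; ring.
  by in_subfield.
apply: subfield_zeta; apply: Or31; apply: (@subfield_solve i r (Q b) (Q c) (2 * Q c) (Q b)) => //; try by in_subfield.
- rewrite (_ : _ - _ = Q (b ^+ 2 - 2 * c ^+ 2)) ?rat_neq0 ?sqr2_irrational //.
  by rewrite (rmorphB Q) (rmorphM Q 2) !(rmorphXn Q) (rmorph_nat Q); ring.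
have -> : 2 * Q c * i + Q b * r = (Q b * i + Q c * r) * s.
  transitivity (Q b * (i * s) + Q c * (r * s)); last by ring.
  by rewrite gen_is gen_rs; ring.
exact: subfieldM.
Qed.

Lemma sumsqr_neq0 (b c : rat) (n : nat) : b != 0 -> b ^+ 2 + n%:R * c ^+ 2 != 0.
Proof.
move=> b0; rewrite gt_eqF //; apply: ltr_wpDr; last by rewrite exprn_even_gt0.
by rewrite mulr_ge0 // sqr_ge0.
Qed.

Lemma subfield_full_is (b d : rat) : b != 0 -> d != 0 -> E (Q b * i + Q d * s) -> E zeta.
Proof.
move=> b0 d0 Ey; have E2 := subfield_nat 2.
have Er : E r.
  have N : 2 * Q b * Q d != 0 by exact: mulf_neq0 (mulf_neq0 algC_two (rat_neq0 b0)) (rat_neq0 d0).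
  have -> : r = ((Q b * i + Q d * s) ^+ 2 + Q b ^+ 2 - 2 * Q d ^+ 2) / (2 * Q b * Q d).
    apply: (mulIf N); rewrite divfK //.
    transitivity (Q b ^+ 2 * (i * i) + Q d ^+ 2 * (s * s) + 2 * Q b * Q d * (i * s) + Q b ^+ 2 - 2 * Q d ^+ 2); last by ring.
    by rewrite gen_ii gen_ss gen_is; ring.
  by in_subfield.
apply: subfield_zeta; apply: Or32; apply: (@subfield_solve i s (Q b) (Q d) (2 * Q d) (- Q b)) => //; try by in_subfield.
- rewrite (_ : _ - _ = - Q (b ^+ 2 + 2%:R * d ^+ 2)) ?oppr_eq0 ?rat_neq0 ?sumsqr_neq0 //.
  by rewrite (rmorphD Q) (rmorphM Q 2) !(rmorphXn Q) (rmorph_nat Q); ring.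
have -> : 2 * Q d * i + - Q b * s = (Q b * i + Q d * s) * r.
  transitivity (Q b * (i * r) + Q d * (r * s)); last by ring.
  by rewrite gen_ir gen_rs; ring.
exact: subfieldM.
Qed.

Lemma subfield_full_rs (c d : rat) : c != 0 -> d != 0 -> E (Q c * r + Q d * s) -> E zeta.
Proof.
move=> c0 d0 Ey; have E2 := subfield_nat 2.
have Ei : E i.
  have four0 : 4 != 0 :> algC by rewrite pnatr_eq0.
  have N : 4 * Q c * Q d != 0 by exact: mulf_neq0 (mulf_neq0 four0 (rat_neq0 c0)) (rat_neq0 d0).
  have -> : i = ((Q c * r + Q d * s) ^+ 2 + 2 * Q c ^+ 2 - 2 * Q d ^+ 2) / (4 * Q c * Q d).
    apply: (mulIf N); rewrite divfK //.
    transitivity (Q c ^+ 2 * (r * r) + Q d ^+ 2 * (s * s) + 2 * Q c * Q d * (r * s) + 2 * Q c ^+ 2 - 2 * Q d ^+ 2); last by ring.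
    by rewrite gen_rr gen_ss gen_rs; ring.
  by in_subfield.
apply: subfield_zeta; apply: Or33; apply: (@subfield_solve r s (Q c) (Q d) (Q d) (- Q c)) => //; try by in_subfield.
- rewrite (_ : _ - _ = - Q (c ^+ 2 + 1%:R * d ^+ 2)) ?oppr_eq0 ?rat_neq0 ?sumsqr_neq0 //.
  by rewrite (rmorphD Q) (rmorphM Q 1) !(rmorphXn Q) (rmorph1 Q); ring.
have -> : Q d * r + - Q c * s = (Q c * r + Q d * s) * i.
  transitivity (Q c * (i * r) + Q d * (i * s)); last by ring.
  by rewrite gen_ir gen_is; ring.
exact: subfieldM.
Qed.

Lemma subfield_full (q : rat * rat * (rat * rat)) : E (Qcomb zeta q) ->
  [\/ q.1.2 != 0 /\ q.2.1 != 0, q.1.2 != 0 /\ q.2.2 != 0 | q.2.1 != 0 /\ q.2.2 != 0] -> E zeta.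
Proof.
case: q => [[a b] [c d]]; rewrite /Qcomb; set q := (a, b, (c, d)) => /= Eq.
have Ey : E (Q b * i + Q c * r + Q d * s).
  have -> : Q b * i + Q c * r + Q d * s = Q a + Q b * i + Q c * r + Q d * s - Q a by ring.
  by apply: subfieldB => //; exact: E_rat.
have E2 := subfield_nat 2.
have [b0|b0] := eqVneq b 0.
  move=> [[//]|[//]|[c0 d0]]; apply: (subfield_full_rs c0 d0); move: Ey.
  by rewrite b0 rmorph0 mul0r add0r.
have [c0|c0] := eqVneq c 0.
  move=> [[_ //]|[_ d0]|[//]]; apply: (subfield_full_is b0 d0); move: Ey.
  by rewrite c0 rmorph0 mul0r addr0.
have [d0|d0] := eqVneq d 0.
  by move=> _; apply: (subfield_full_ir b0 c0); move: Ey; rewrite d0 rmorph0 mul0r addr0.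
(* All three coordinates of [y] are nonzero. Half of [y^2] without its rational part is
   [2 c d i + b d r - b c s]; eliminating [i] between this and [y] leaves a combination of [r] and
   [s] with these two coefficients. *)
move=> _; apply: (@subfield_full_rs (d * (b ^+ 2 - 2 * c ^+ 2)) (- c * (b ^+ 2 + 2%:R * d ^+ 2))).
- by rewrite mulf_neq0 // sqr2_irrational.
- by rewrite mulf_neq0 ?oppr_eq0 // sumsqr_neq0.
pose y := Q b * i + Q c * r + Q d * s.
have Ez : E (2 * Q c * Q d * i + Q b * Q d * r - Q b * Q c * s).
  have -> : 2 * Q c * Q d * i + Q b * Q d * r - Q b * Q c * s =
      (y ^+ 2 + Q b ^+ 2 + 2 * Q c ^+ 2 - 2 * Q d ^+ 2) / 2.
    apply: (mulIf algC_two); rewrite divfK ?algC_two //.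
    transitivity (Q b ^+ 2 * (i * i) + Q c ^+ 2 * (r * r) + Q d ^+ 2 * (s * s) + 2 * Q b * Q c * (i * r) +
      2 * Q b * Q d * (i * s) + 2 * Q c * Q d * (r * s) + Q b ^+ 2 + 2 * Q c ^+ 2 - 2 * Q d ^+ 2); last by rewrite /y; ring.
    by rewrite gen_ii gen_rr gen_ss gen_ir gen_is gen_rs; ring.
  by rewrite /y; in_subfield.
have -> : Q (d * (b ^+ 2 - 2 * c ^+ 2)) * r + Q (- c * (b ^+ 2 + 2%:R * d ^+ 2)) * s =
    Q b * (2 * Q c * Q d * i + Q b * Q d * r - Q b * Q c * s) - 2 * Q c * Q d * y.
  have -> : Q (d * (b ^+ 2 - 2 * c ^+ 2)) = Q d * (Q b ^+ 2 - 2 * Q c ^+ 2).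
    by rewrite (rmorphM Q d) (rmorphB Q) (rmorphM Q 2) !(rmorphXn Q) (rmorph_nat Q).
  have -> : Q (- c * (b ^+ 2 + 2%:R * d ^+ 2)) = - Q c * (Q b ^+ 2 + 2 * Q d ^+ 2).
    by rewrite (rmorphM Q (- c)) (rmorphN Q) (rmorphD Q) (rmorphM Q 2) !(rmorphXn Q) (rmorph_nat Q).
  by rewrite /y; ring.
by rewrite /y; in_subfield.
Qed.

Lemma gen_sqr (x y B C : algC) : B * x + C * y = 0 -> B ^+ 2 * (x * x) = C ^+ 2 * (y * y).
Proof.
move/eqP; rewrite addr_eq0 => /eqP H; transitivity ((B * x) ^+ 2); first by ring.
by rewrite H; ring.
Qed.

Lemma gen_indep_ir (b c : rat) : Q b * i + Q c * r = 0 -> b = 0 /\ c = 0.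
Proof.
move=> /gen_sqr; rewrite gen_ii gen_rr => H.
have {}H : Q (b ^+ 2 - 2 * c ^+ 2) = 0.
  rewrite (rmorphB Q) (rmorphM Q 2) !(rmorphXn Q) (rmorph_nat Q); apply: oppr_inj.
  by rewrite oppr0 opprB -[- Q b ^+ 2]mulrN1 H; ring.
have [c0|/(sqr2_irrational b)/rat_neq0] := eqVneq c 0; last by rewrite H eqxx.
split=> //; move/eqP: H; rewrite c0 fmorph_eq0 expr0n mulr0 subr0 expf_eq0.
by move/eqP.
Qed.

Lemma gen_indep_is (b d : rat) : Q b * i + Q d * s = 0 -> b = 0 /\ d = 0.
Proof.
move=> /gen_sqr; rewrite gen_ii gen_ss => H.
have {}H : Q (b ^+ 2 + 2%:R * d ^+ 2) = 0.
  rewrite (rmorphD Q) (rmorphM Q 2) !(rmorphXn Q) (rmorph_nat Q).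
  by rewrite -[Q b ^+ 2]opprK -[- Q b ^+ 2]mulrN1 H; ring.
have [b0|/(@sumsqr_neq0 b d 2)/rat_neq0] := eqVneq b 0; last by rewrite H eqxx.
split=> //; move/eqP: H; rewrite b0 fmorph_eq0 expr0n add0r mulf_eq0 pnatr_eq0 /= expf_eq0.
by move/eqP.
Qed.

Lemma gen_indep_rs (c d : rat) : Q c * r + Q d * s = 0 -> c = 0 /\ d = 0.
Proof.
move=> /gen_sqr; rewrite gen_rr gen_ss => H.
have {}H : Q (c ^+ 2 + 1%:R * d ^+ 2) = 0.
  rewrite (rmorphD Q) (rmorphM Q 1) !(rmorphXn Q) (rmorph1 Q) mul1r.
  by apply: (mulIf algC_two); rewrite mulrDl -H; ring.
have [c0|/(@sumsqr_neq0 c d 1)/rat_neq0] := eqVneq c 0; last by rewrite H eqxx.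
split=> //; move/eqP: H; rewrite c0 fmorph_eq0 expr0n add0r mul1r expf_eq0.
by move/eqP.
Qed.

(** By [subfield_full], an element with two nonzero coordinates among those of [i], [r], [s] forces
    [zeta] into [E]; otherwise a nonzero coordinate stands alone and can be divided out. *)
Lemma subfield_single (q : rat * rat * (rat * rat)) : E (Qcomb zeta q) -> E zeta \/
  [/\ q.1.2 != 0 -> E i, q.2.1 != 0 -> E r & q.2.2 != 0 -> E s].
Proof.
move=> Eq; have [|H] := pselect (E zeta); first by left.
have nz x y : Q x != 0 -> E (Q x * y) -> E y.
  by move=> x0 Exy; rewrite -(mulKf x0 y) mulrC; apply: subfield_div => //; exact: subfield_rat.
have full : ~ [\/ q.1.2 != 0 /\ q.2.1 != 0, q.1.2 != 0 /\ q.2.2 != 0 | q.2.1 != 0 /\ q.2.2 != 0].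
  by move=> /(subfield_full Eq).
right; move: Eq full; case: q => [[a b] [c d]]; rewrite /Qcomb /= => Eq full.
have Ey : E (Q b * i + Q c * r + Q d * s).
  have -> : Q b * i + Q c * r + Q d * s = Q a + Q b * i + Q c * r + Q d * s - Q a by ring.
  by apply: subfieldB => //; exact: E_rat.
have [bc bd cd] : [/\ (b == 0) || (c == 0), (b == 0) || (d == 0) & (c == 0) || (d == 0)].
  split; apply: contrapT => /negP; rewrite negb_or => /andP[h1 h2]; apply: full.
  - exact: Or31.
  - exact: Or32.
  - exact: Or33.
have Z0 : Q 0 = 0 := rmorph0 Q.
split=> h; apply: (nz _ _ (rat_neq0 h)); move: bc bd cd; rewrite (negPf h) ?orbF /=.
- by move=> /eqP c0 /eqP d0 _; move: Ey; rewrite c0 d0 Z0 !mul0r !addr0.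
- by move=> /eqP b0 _ /eqP d0; move: Ey; rewrite b0 d0 Z0 !mul0r addr0 add0r.
- by move=> _ /eqP b0 /eqP c0; move: Ey; rewrite b0 c0 Z0 !mul0r !add0r.
Qed.
End Subfields.

Lemma Z2_unit_val3 (x : Z2) : x \is a GRing.unit -> Z2_val x 3 \in [:: 1; 3; 5; 7].
Proof.
rewrite Z2_unitE [Z2_val x 1]Z2_step [Z2_val x 2]Z2_step.
have := @modz_ge0 (Z2_val x 3) 8 isT; have := @ltz_pmod (Z2_val x 3) 8 isT; rewrite [(_ %% 8)%Z](Z2_mod x 3).
by case: (Z2_val x 3) => // -[|[|[|[|[|[|[|[|r]]]]]]]].
Qed.

Lemma Z2_unit_sqr_val3 (x : Z2) : x \is a GRing.unit -> Z2_val (x ^+ 2) 3 = 1.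
Proof. by move/Z2_unit_val3; rewrite expr2 Z2_valM !inE => /or4P[] /eqP ->. Qed.

(** * The group A and classes modulo 8 *)

Section SquareUnits.
Variable F : fieldExtType Q2.
Implicit Types (a b u : Z2).
Local Notation A := (square_units F).

Lemma square_unitsM a b : A a -> A b -> A (a * b).
Proof.
move=> [aU [u [u0 uO uVO] uE]] [bU [v [v0 vO vVO] vE]]; split; first by rewrite unitrM aU.
have E : Z2_to F (a * b) = Z2_to F a * Z2_to F b by exact: rmorphM.
exists (u * v); last by rewrite E uE vE exprMn.
by split; [rewrite mulf_neq0|exact: integerM|rewrite invfM; exact: integerM].
Qed.

Lemma square_units_sqr u : u \is a GRing.unit -> A (u ^+ 2).
Proof.
move=> uU; split; first by rewrite unitrX.
exists (Z2_to F u); last by rewrite (rmorphXn (Z2_to F)).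
split; last by rewrite -(rmorphV (Z2_to F) uU); exact: integer_Z2.
  by rewrite Z2_to_eq0; apply: contraTneq uU => ->; rewrite unitr0.
exact: integer_Z2.
Qed.

Lemma square_unitsV a : A a -> A a^-1.
Proof.
move=> Aa; have [aU _] := Aa.
have -> : a^-1 = a * (a^-1) ^+ 2 by rewrite expr2 mulrA divrr // mul1r.
by apply: square_unitsM => //; apply: square_units_sqr; rewrite unitrV.
Qed.

Lemma square_units_subgroup : is_unit_subgroup A.
Proof.
split=> [a []//||a b Aa Ab]; last by apply: square_unitsM => //; exact: square_unitsV.
by rewrite -[1](expr1n _ 2); apply: square_units_sqr; exact: unitr1.
Qed.

Lemma unit_class_sub a : A a -> unit_class a `<=` A.
Proof.
move=> Aa b; apply; split; first exact: square_units_subgroup.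
by move=> c [->//|[u uU ->]]; exact: square_units_sqr.
Qed.

(* Integrality of a square root is automatic. *)
Lemma square_unitsP a (v : F) : a \is a GRing.unit -> Z2_to F a * v ^+ 2 = 1 -> A a.
Proof.
move=> aU av; have a0 : Z2_to F a != 0.
  by rewrite Z2_to_eq0; apply: contraTneq aU => ->; rewrite unitr0.
have v0 : v != 0 by apply: contra_eq_neq av => ->; rewrite expr0n mulr0 eq_sym oner_eq0.
have uE : (v^-1) ^+ 2 = Z2_to F a by rewrite exprVn; apply: (mulIf (expf_neq0 2 v0)); rewrite mulVf ?expf_neq0.
split=> //; exists v^-1 => //; split; first by rewrite invr_neq0.
  by apply: integer_sqrt; rewrite uE; exact: integer_Z2.
rewrite invrK; apply: integer_sqrt; have -> : v ^+ 2 = Z2_to F a^-1; last exact: integer_Z2.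
have -> : Z2_to F a^-1 = (Z2_to F a)^-1 by exact: rmorphV.
by rewrite -uE exprVn invrK.
Qed.

(** An integer that is 1 modulo 8 is a square in [Z_2], so [c] is the inverse of [a b] times a
    square. *)
Lemma square_units_mod8 (a b c : int) : (a * b * c %% 8)%Z = 1 -> A a%:~R -> A b%:~R -> A c%:~R.
Proof.
move=> abc Aa Ab; have [|u uU uE] := @Z2_sqrt (a * b * c)%:~R; first by rewrite Z2_val_int /= abc.
have Aab := square_unitsM Aa Ab; have [abU _] := Aab.
have -> : c%:~R = u ^+ 2 * (a%:~R * b%:~R)^-1 :> Z2.
  by apply: (mulIr abU); rewrite divrK // -uE !rmorphM /= mulrC.
by apply: square_unitsM; [exact: square_units_sqr|exact: square_unitsV].
Qed.

(** The units congruent to 1 or [a] modulo 8 form a subgroup containing [a] and the squares, hence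
    the class; this shows which integers lie outside it. *)
Lemma unit_class_mod8 (a : int) (x : Z2) : (a * a %% 8)%Z = 1 -> unit_class a%:~R x ->
  Z2_val x 3 = 1 \/ Z2_val x 3 = (a %% 8)%Z.
Proof.
move=> aa; pose S : set Z2 := [set x | x \is a GRing.unit /\ (Z2_val x 3 = 1 \/ Z2_val x 3 = (a %% 8)%Z)].
suff SP : is_unit_subgroup S /\ a%:~R |` two_adic_square_units `<=` S by move=> /(_ S SP)[].
have cases y z : Z2_val y 3 = 1 \/ Z2_val y 3 = (a %% 8)%Z -> Z2_val z 3 = 1 \/ Z2_val z 3 = (a %% 8)%Z ->
    Z2_val (y * z) 3 = 1 \/ Z2_val (y * z) 3 = (a %% 8)%Z.
  rewrite Z2_valM => -[->|->] [->|->].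
  - by left.
  - by right; rewrite mul1r modz_mod.
  - by right; rewrite mulr1 modz_mod.
  - by left; rewrite modzMml modzMmr.
have Vval y : y \is a GRing.unit -> Z2_val y^-1 3 = Z2_val y 3.
  move=> yU; have -> : y^-1 = y * (y^-1) ^+ 2 by rewrite expr2 mulrA divrr // mul1r.
  by rewrite Z2_valM Z2_unit_sqr_val3 ?unitrV // mulr1 Z2_mod.
have aU : a%:~R \is a @GRing.unit Z2.
  have [|u uU uE] := @Z2_sqrt (a * a)%:~R; first by rewrite Z2_val_int aa.
  by have := uU; rewrite -(unitrX_pos u (isT : 0 < 2)%N) -uE rmorphM unitrM => /andP[].
split; first split=> [y []//||y z [yU y8] [zU z8]]; first by split; [exact: unitr1|left].
  by split; [rewrite unitrM yU unitrV|apply: cases; rewrite // Vval].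
move=> y [->|[u uU ->]]; first by split=> //; right; rewrite Z2_val_int.
by split; [rewrite unitrX|left; exact: Z2_unit_sqr_val3].
Qed.

(** As -15 is 1 modulo 8, a group containing -1 and the squares contains 3 exactly when it contains
    5, which leaves two possibilities. *)
Lemma square_units_N1 : A (-1) -> A = two_adic_units \/ A = unit_class (-1).
Proof.
move=> AN; have EN : (-1)%:~R = -1 :> Z2 by rewrite rmorphN1.
have [A3|A3] := pselect (A 3).
  have A5 : A 5 by apply: (@square_units_mod8 (-1) 3 5); rewrite // EN.
  left; apply/seteqP; split=> [x []//|x /Z2_unit_mod8[a aS [u uU ->]]].
  apply: square_unitsM (square_units_sqr uU).
  move: aS; rewrite !inE => /or4P[] /eqP ->; rewrite ?EN //.
  by rewrite -[1%:~R](expr1n _ 2); apply: square_units_sqr; exact: unitr1.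
have A5 : ~ A 5 by move=> A5; apply: A3; apply: (@square_units_mod8 (-1) 5 3); rewrite // EN.
right; apply/seteqP; split; last exact: unit_class_sub.
move=> x Ax; have [xU _] := Ax; have [a aS [u uU xE]] := Z2_unit_mod8 xU.
have Aa : A a%:~R.
  have -> : a%:~R = x * (u ^+ 2)^-1 :> Z2 by rewrite xE mulrK // unitrX.
  by apply: square_unitsM => //; apply: square_unitsV; exact: square_units_sqr.
move=> H [[HU H1 Hdiv] Hsub].
have HM y z : H y -> H z -> H (y * z).
  move=> Hy Hz; rewrite -[z]invrK -[z^-1]mul1r; exact: (Hdiv _ _ Hy (Hdiv _ _ H1 Hz)).
have Hsqr : H (u ^+ 2) by apply: Hsub; right; exists u.
move: aS Aa; rewrite xE !inE => /or4P[] /eqP -> Aa.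
- by rewrite mul1r.
- by case: A3.
- by case: A5.
by rewrite EN; apply: HM => //; apply: Hsub; left.
Qed.
End SquareUnits.

(** The gcd of [i] and [2^(N + 1)] would be a period too, and a proper divisor of [2^(N + 1)]
    divides [2^N]. *)
Lemma iter_period (T : Type) (f : T -> T) (x : T) (N : nat) : iter (2 ^ N.+1) f x = x -> iter (2 ^ N) f x <> x ->
  forall i, (0 < i < 2 ^ N.+1)%N -> iter i f x <> x.
Proof.
move=> xN xN2 i /andP[i0 iN] xi; case: xN2.
have mul a c : iter a f x = x -> iter (c * a) f x = x.
  by move=> xa; elim: c => // c IH; rewrite mulSn iterD IH.
have [c d cd _] := egcdnP (2 ^ N.+1) i0; set g := gcdn _ _ in cd.
have xg : iter g f x = x by rewrite -{1}(mul _ d xN) -iterD addnC -cd mul.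
have /(dvdn_pfactor _ _ (isT : prime 2))[e eN gE] : (g %| 2 ^ N.+1)%N by exact: dvdn_gcdr.
have eN' : (e <= N)%N.
  rewrite -ltnS ltn_neqAle eN andbT; apply: contraTneq iN => eE; rewrite -leqNgt.
  by rewrite -eE -gE dvdn_leq // dvdn_gcdl.
by rewrite -(subnK eN') expnD -gE mul.
Qed.

Lemma expn_pow2_cong (b k : nat) : odd b -> exists c, (b ^ (2 ^ k) = 1 + 2 ^ k * c)%N.
Proof.
move=> bo; elim: k => [|k [c IH]]; first by exists b.-1; rewrite mul1n add1n prednK // odd_gt0.
have [k0|k0] := posnP k.
  exists (b ^ 2).-1./2; rewrite k0 !expn1 add1n mul2n.
  have b2 : odd (b ^ 2) by rewrite oddX bo orbT.
  have := odd_double_half (b ^ 2).-1; rewrite -subn1 oddB ?odd_gt0 // b2 /= add0n => ->.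
  by rewrite subn1 prednK // odd_gt0.
exists (c + 2 ^ k.-1 * c ^ 2)%N; rewrite expnSr expnM IH.
by case: k k0 {IH} => // k _; rewrite !expnS /=; lia.
Qed.

(** * Realisation of the odd Weil representation *)

Section Realisation.
Variables (F : fieldExtType Q2) (W : vectType F) (form : {skew_symmetric W}) (X Y : {vspace W}).
Variables (psi : smooth_character F Kcyc) (Mp : topGroupType) (p : Mp -> 'End(W)).
Local Notation SY := (Cc (ltop (subvs_of Y)) Kcyc).
Variables (omega : Mp -> SY -> SY) (omega_odd : Mp -> odd_Cc Kcyc Y -> odd_Cc Kcyc Y).
Hypothesis form_nd : nondegenerate form.
Hypothesis XY : complete_polarisation form X Y.
Hypothesis psi_nt : nontrivial_character psi.
Hypothesis W0 : fullv != 0%VS :> {vspace W}.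
Hypothesis cover : metaplectic_cover form p.
Hypothesis weil : Weil_representation form X psi p omega.
Hypothesis odd_omega : odd_part omega omega_odd.
Local Notation O := (@scaled F).

Lemma Kcyc_two : 2 != 0 :> Kcyc.
Proof. by rewrite -(fmorph_eq0 Kcyc_val) rmorph_nat pnatr_eq0. Qed.

Lemma odd_omega_linear g : linear (omega_odd g).
Proof.
move=> a f f'; apply: odd_val_inj.
rewrite odd_omega !odd_valD !odd_valZ !odd_omega.
by rewrite (weilD weil) (weilZ weil).
Qed.

Lemma odd_omegaP : smooth_rep omega_odd.
Proof.
have [omega_rep omega_open] := weil_smooth weil; split.
  split=> [||g h] f; first exact: odd_omega_linear.
    by apply: odd_val_inj; rewrite odd_omega (rep1 omega_rep).
  by apply: odd_val_inj; rewrite !odd_omega (repM omega_rep).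
move=> f; have -> : [set g | omega_odd g f = f] = [set g | omega g (odd_val f) = odd_val f]; last exact: omega_open.
by apply/seteqP; split=> g /=; [move=> E; rewrite -odd_omega E|move=> E; apply: odd_val_inj; rewrite odd_omega].
Qed.

Lemma char_pow (sigma : {rmorphism Kcyc -> Kcyc}) (b : nat) :
  (forall w k, w ^+ (2 ^ k) = 1 -> sigma w = w ^+ b) -> forall t, sigma (psi t) = psi (b%:R * t).
Proof.
by move=> sP t; have [k kP] := char_pow2 psi t; rewrite (sP _ k kP) -charMn mulr_natl.
Qed.

Lemma odd_twist_omega (sigma : {rmorphism Kcyc -> Kcyc}) u : u != 0 ->
  (forall t, sigma (psi t) = psi (u ^+ 2 * t)) ->
  forall g f, odd_twist sigma u (omega_odd g f) = omega_odd g (odd_twist sigma u f).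
Proof.
move=> u0 sP g f; apply: odd_val_inj; rewrite odd_omega /= odd_omega.
exact: (weil_twist form_nd XY psi_nt W0 cover weil u0 sP).
Qed.

(** The odd functions with values in [algC] are a model of the tensor product; the universal
    property extends each operator to it. *)
Lemma base_change_odd : exists tau : Mp -> odd_Cc algC Y -> odd_Cc algC Y,
  base_change Kcyc_val omega_odd tau (odd_twist Kcyc_val 1).
Proof.
have ext : scalar_extension Kcyc_val (@odd_twist F W Y _ _ Kcyc_val 1).
  apply: scalar_extensionP; first exact: odd_extension_linear.
    exact: (odd_extension_generates _ Kcyc_two).
  exact: (odd_extension_indep Kcyc_two).
have [el univ] := ext.
have /choice[tau tauP] : forall g, exists t : odd_Cc algC Y -> odd_Cc algC Y,
    linear t /\ forall f, t (odd_twist Kcyc_val 1 f) = odd_twist Kcyc_val 1 (omega_odd g f).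
  move=> g; have [|t [tP _]] := univ _ (fun f => odd_twist Kcyc_val 1 (omega_odd g f)); last by exists t.
  by move=> a f f'; rewrite odd_omega_linear el.
by exists tau; split=> // g; [have [] := tauP g|have [_ H] := tauP g].
Qed.

Lemma iter_odd_twist (sigma : {rmorphism Kcyc -> Kcyc}) (u : F) (u0 : u != 0) n (f : odd_Cc Kcyc Y) y :
  iter n (odd_semilinear Y sigma u0) f y = iter n sigma (f ((u ^+ n)^-1 *: y)).
Proof.
elim: n f y => [|n IH] f y; first by rewrite /= expr0 invr1 scale1r.
rewrite iterSr IH odd_twistE // scalerA iterSr.
by rewrite exprS invfM.
Qed.

Section Descent.
Variables (sigma : {rmorphism Kcyc -> Kcyc}) (u : F) (b : nat).
Hypotheses (sP : forall w k, w ^+ (2 ^ k) = 1 -> sigma w = w ^+ b) (u2 : u ^+ 2 = b%:R).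
Hypotheses (uU : integer_units u) (odd_b : odd b).

Let u0 : u != 0. Proof. by have [] := uU. Qed.
Let I := odd_semilinear Y sigma u0.

Lemma iter_sigma n w k : w ^+ (2 ^ k) = 1 -> iter n sigma w = w ^+ (b ^ n).
Proof.
move=> wk; elim: n => [|n IH]; first by rewrite expr1.
by rewrite iterS IH rmorphXn (sP wk) -exprM expnSr mulnC.
Qed.

Lemma iter_sigma_fixed x : exists L, forall k, (L <= k)%N -> iter (2 ^ k) sigma x = x.
Proof.
have [L [z [zP xz]]] := Kcyc_level x; exists L => k Lk; have [w wz] := Kcyc_ex zP.
have wL : w ^+ (2 ^ L) = 1 by apply: Kcyc_inj; rewrite rmorphXn rmorph1 /= wz (prim_expr_order zP).
have [P _ ] := xz; rewrite -wz Kcyc_horner => /Kcyc_inj <-.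
have iter_sum n : iter n sigma (\sum_(i < size P) ratr P`_i * w ^+ i) =
    \sum_(i < size P) ratr P`_i * (iter n sigma w) ^+ i.
  elim: n => [//|n IHn]; rewrite iterS IHn rmorph_sum; apply: eq_bigr => i _.
  by rewrite rmorphM rmorphXn fmorph_rat.
rewrite iter_sum (iter_sigma _ wL); have [d ->] := expn_pow2_cong k odd_b.
by apply: eq_bigr => i _; rewrite -(subnKC Lk) expnD exprD expr1 !exprM wL !expr1n mulr1.
Qed.

(** For [a] close to 1, points of the bounded support move by less than the level of [f]; since [a]
    is a unit, the bound on the support holds for both points as soon as one value is nonzero. *)
Lemma scaling_invariant (f : odd_Cc Kcyc Y) : exists J, forall j a, (J <= j)%N -> O j (a - 1) ->
  ring_of_integers a -> ring_of_integers a^-1 -> a != 0 -> forall y, f (a^-1 *: y) = f y.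
Proof.
have [n [N [f1 f2]]] := @Cc_level F (subvs_of Y) Kcyc f; exists (n + N)%N => j a Jj aj aO aVO a0 y.
rewrite -{2}[y](scalerKV a0); move: (a^-1 *: y) => z.
have H z' : Lat (- N%:Z) (z' : subvs_of Y) -> f (a *: z') = f z'.
  move=> zN; have -> : a *: z' = z' + (a - 1) *: z' by rewrite scalerBl scale1r addrC subrK.
  by apply/f1/(Lat_leq _ (LatZ aj zN)); lia.
have [fz|/f2/H//] := eqVneq (f z) 0.
have [faz|/f2 zN] := eqVneq (f (a *: z)) 0; first by rewrite fz.
apply/esym/H; rewrite -[z](scalerK a0) -[- N%:Z]add0r; apply: LatZ zN.
exact/scaled_integer.
Qed.

(** As [u^2 = b], the scalar [u^(2^(k + 1)) = b^(2^k)] is 1 modulo [2^k] and ends up acting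
    trivially on [f], while the iterate of [sigma] fixes the finitely many values of [f]. *)
Lemma odd_twist_period (f : odd_Cc Kcyc Y) : exists L, forall k, (L <= k)%N -> iter (2 ^ k.+1) I f = f.
Proof.
have [J JP] := scaling_invariant f.
have [n [N fl]] := @Cc_level F (subvs_of Y) Kcyc f.
have [s sT] := Lat_transversal (subvs_of Y) n (- N%:Z).
have [M MP] : exists M, forall y, y \in s -> forall k, (M <= k)%N -> iter (2 ^ k) sigma (f y) = f y.
  elim: s {sT} => [|y s [M MP]]; first by exists 0%N.
  have [L LP] := iter_sigma_fixed (f y); exists (maxn M L) => y'.
  rewrite inE => /predU1P[->|ys] k; rewrite geq_max => /andP[Mk Lk]; first exact: LP.
  exact: MP.
exists (maxn J M) => k; rewrite geq_max => /andP[Jk Mk]; apply: oddCcE => y.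
have [u1 uO uVO] := uU.
rewrite iter_odd_twist (JP k); last first.
- exact: expf_neq0.
- by rewrite -exprVn; exact: integerX.
- exact: integerX.
- rewrite expnS exprM u2 -natrX; have [d ->] := expn_pow2_cong k odd_b.
  rewrite natrD [1%:R + _]addrC addrK natrM natrX; rewrite -[Posz k]add0r; apply: scaledMpow.
  by apply/scaled_integer; have := integer_int F d.
- by [].
have [fy|fy] := eqVneq (f y) 0.
  rewrite fy; elim: (2 ^ _)%N => //= m ->; exact: rmorph0.
have [_ _ sD] := sT; have [z zs zy] := sD y (fl.2 y fy).
have -> : f y = f z by rewrite -(subrK z y) addrC fl.1.
by apply: MP => //; exact: leqW.
Qed.

(** The exponent [e] brings [b] into the range of [pow_order]: it is 1 for [b = 3] and [b = 5], and
    0 for [b = 9]. *)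
Lemma realised_descent e c : odd c -> (b ^ (2 ^ e) = 1 + 8 * c)%N ->
  realised_over Kcyc_val omega_odd [set Kcyc_val x | x in [set x | sigma x = x]].
Proof.
move=> co bE; have [tau tauP] := base_change_odd; have [Ke Kl tauE] := tauP.
have psiP : forall t, sigma (psi t) = psi (u ^+ 2 * t) by rewrite u2; exact: char_pow.
pose j : {rmorphism fixed_field sigma -> algC} := Kcyc_val \o @fixed_val _ sigma.
have fixP g (f : fixed_space I) : omega_odd g (fixed_vec f) \in fixed_vec_pred I.
  by apply/eqP; rewrite -[RHS](congr1 (omega_odd g) (fixed_vecP f)); exact: odd_twist_omega.
pose pi' g f := FixedSpace (fixP g f).
have [[_ o1 oM] oo] := odd_omegaP.
exists (fixed_field sigma), j, (fixed_space I), pi', (odd_Cc algC Y), tau, (odd_twist Kcyc_val 1).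
exists (odd_twist Kcyc_val 1 \o @fixed_vec _ _ _ I); split=> //.
- apply/seteqP; split=> [_ [x _ <-]|_ [x xs <-]]; first by exists (fixed_val x) => //=; exact: fixed_valP.
  have xF : x \in fixed_pred sigma by apply/eqP.
  by exists (FixedField xF).
- split; last first.
    move=> f; have -> : [set g | pi' g f = f] = [set g | omega_odd g (fixed_vec f) = fixed_vec f]; last exact: oo.
    by apply/seteqP; split=> g /= => [/(congr1 (@fixed_vec _ _ _ I))|E]; last exact: val_inj.
  split=> [g a f f'|f|g h f]; apply: val_inj => /=; first exact: odd_omega_linear.
    exact: o1.
  exact: oM.
split=> // [|g f]; last by rewrite /= tauE.
have jl : linear_for (j \; *:%R) (odd_twist Kcyc_val 1 \o @fixed_vec _ _ _ I).
  by move=> a f f'; rewrite /= odd_twistD ?oner_neq0 // odd_twistZ ?oner_neq0.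
apply: scalar_extensionP => //.
- apply: (generates_comp (j := Kcyc_val)); first exact: odd_extension_linear.
    apply: fixed_vec_generates => f; have [L LP] := odd_twist_period f.
    have [c' c'o bj] := pow_order L co bE; rewrite -expnM -expnD in bj.
    (* The order is chosen because [b^(2^(e + L))] is 1 modulo [2^(L + 3)] but not modulo
       [2^(L + 4)]: the period of [z] is exactly [2^(e + L + 1)], which is also a period of [f]. *)
    have [z zP] := @C_prim_root_exists (2 ^ (L + 4)) (expn_gt0 2 _).
    have [w wz] := Kcyc_ex zP; exists w, (2 ^ (e + L).+1)%N.
    have wL : w ^+ (2 ^ (L + 4)) = 1 by apply: Kcyc_inj; rewrite rmorphXn rmorph1 /= wz (prim_expr_order zP).
    have wN : iter (2 ^ (e + L).+1) sigma w = w.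
      rewrite (iter_sigma _ wL); have -> : (b ^ 2 ^ (e + L).+1 = 1 + 2 ^ (L + 4) * (c' + 2 ^ (L + 2) * c' ^ 2))%N.
        by rewrite expnSr expnM bj !addnS !addn0 !expnS; lia.
      by rewrite exprD expr1 exprM wL expr1n mulr1.
    split=> //; [by rewrite expn_gt0|by apply: LP; exact: leq_addl|].
    move=> i iN; apply/eqP; move: i iN; apply: iter_period => //.
    rewrite (iter_sigma _ wL) bj exprD expr1 => E.
    have w0 : w != 0 by apply: contra_eq_neq wL => ->; rewrite expr0n expn_eq0 eq_sym oner_eq0.
    have : z ^+ (2 ^ (L + 3) * c') = 1.
      by rewrite -wz -rmorphXn /= (mulfI w0 (etrans E (esym (mulr1 w)))) rmorph1.
    move/eqP; rewrite -(prim_order_dvd zP) addnS expnSr dvdn_pmul2l ?expn_gt0 //.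
    by rewrite dvdn2 c'o.
  exact: (odd_extension_generates _ Kcyc_two).
- move=> n v vi; apply: (odd_extension_indep Kcyc_two); exact: fixed_vec_indep.
Qed.
End Descent.

Lemma Kcyc_char0 n : n.+1%:R != 0 :> Kcyc.
Proof. by rewrite -(fmorph_eq0 Kcyc_val) rmorph_nat pnatr_eq0. Qed.

Lemma char_level_seq (n0 : int) (ts : seq F) : exists n1 : nat, n0 <= n1 /\
  forall t (c : F^o), t \in ts -> Lat n1 c -> psi (c * t) = 1.
Proof.
elim: ts => [|t ts [n1 [n01 nP]]].
  by exists `|n0|%N; split=> //; lia.
have ll : linear (fun c : F^o => (c : F) * t : F^o) by move=> a c c'; rewrite /GRing.scale /= mulrDl mulrA.
have [n2 n2P] := char_functional_level psi ll; exists (maxn n1 n2); split; first lia.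
move=> t' c; rewrite inE => /predU1P[->|tts] cn.
  by apply: n2P; apply: Lat_leq cn; lia.
by apply: nP => //; apply: Lat_leq cn; lia.
Qed.

(** Orthogonality of characters on the quotient of two lattices: a shift by [c0] permutes the cosets
    and multiplies the sum by a value of [psi] other than 1. *)
Lemma char_sum (n0 : int) (n1 : nat) (s : seq F^o) t :
  transversal (@Lat_rel _ F^o n1) (Lat n0) s -> (forall c, c \in s -> Lat n0 c) -> n0 <= n1 ->
  (forall c : F^o, Lat n1 c -> psi (c * t) = 1) ->
  \sum_(c <- s) psi (c * t) = if `[< forall c : F^o, Lat n0 c -> psi (c * t) = 1 >] then (size s)%:R else 0.
Proof.
move=> sT sn n01 tn; case: asboolP => [H|].
  rewrite (eq_big_seq (fun=> 1)); first by rewrite big_const_seq count_predT iter_addr_0.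
  by move=> c /sn /H.
move=> /existsNP[c0 /not_implyP[c0n c0t]].
pose f (c : F^o) : Kcyc := if `[< Lat n0 c >] then psi (c * t) else 0.
have fE c : Lat n0 c -> f c = psi (c * t) by move=> cn; rewrite /f asboolT.
have f1 x y : @Lat_rel _ F^o n1 x y -> f x = f y.
  move=> xy; rewrite /f; have E : psi (x * t) = psi (y * t).
    by rewrite -[y](subrK x) mulrDl charD (tn _ xy) mul1r.
  rewrite E; congr (if _ then _ else _); apply: asbool_equiv_eq.
  have xy' : Lat n0 (y - x : F^o) by apply: Lat_leq xy.
  split=> H; first by rewrite -[y](subrK x); apply: LatD.
  by rewrite -(subKr y x); apply: LatB.
have f2 x : f x != 0 -> Lat n0 x by rewrite /f; case: asboolP => // _; rewrite eqxx.
have := sum_transversal (@Lat_rel_equiv _ F^o n1) f1 f2 sT (transversal_shift c0n sT).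
rewrite big_map => E; apply: contrapT => /eqP S0; apply: c0t.
have S1 : \sum_(c <- s) f c = \sum_(c <- s) psi (c * t) by apply: eq_big_seq => c /sn /fE.
have S2 : \sum_(c <- s) f (c - c0) = (psi (c0 * t))^-1 * \sum_(c <- s) psi (c * t).
  rewrite mulr_sumr; apply: eq_big_seq => c /sn cn; rewrite fE; last exact: LatB.
  by rewrite mulrBl charB mulrC.
apply: invr_inj; rewrite invr1; apply: (mulIf S0); rewrite mul1r -S2 -S1.
by rewrite -E.
Qed.

(** * Lower bound on the character field *)

Section LowerBound.
Variables (cj : {rmorphism Kcyc -> Kcyc}) (q : nat) (J : (subvs_of Y -> Kcyc) -> Kcyc).
Hypothesis cjE : forall x, Kcyc_val (cj x) = (Kcyc_val x)^*.
Hypothesis JP : forall (n N : nat) (h : subvs_of Y -> Kcyc) s, level n N h ->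
  transversal (@Lat_rel _ (subvs_of Y) n) (Lat (- N%:Z)) s -> J h = q.+1%:R ^- n * \sum_(y <- s) h y.
Local Notation lev := (@level F (subvs_of Y) Kcyc).

Lemma inner_pos (f : SY) : 0 <= Kcyc_val (inner cj J f f) ?= iff (f == 0).
Proof.
have [n [N fl]] := @Cc_level F (subvs_of Y) Kcyc f; have [s sT] := Lat_transversal (subvs_of Y) n (- N%:Z).
rewrite (innerE cj JP fl fl sT) rmorphM fmorphV rmorphXn rmorph_nat rmorph_sum /=.
have E : \sum_(y <- s) Kcyc_val (f y * cj (f y)) = \sum_(y <- s) `|Kcyc_val (f y)| ^+ 2.
  by apply: eq_bigr => y _; rewrite rmorphM /= cjE normCK.
rewrite E; split; first by rewrite mulr_ge0 ?invr_ge0 ?exprn_ge0 ?ler0n // sumr_ge0 // => y _; rewrite exprn_ge0.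
rewrite eq_sym mulf_eq0 invr_eq0 expf_eq0 pnatr_eq0 andbF /= psumr_eq0; last by move=> y _; rewrite exprn_ge0.
apply/allP/eqP => [H|-> y _]; last by apply/implyP => _; rewrite -[(0 : SY) y]/(0 : Kcyc) (rmorph0 Kcyc_val) normr0 expr0n.
rewrite (level_sum fl sT) big1_seq // => y /andP[_ ys].
have := H y ys; rewrite /= expf_eq0 normr_eq0 fmorph_eq0 => /eqP ->.
by rewrite scale0r.
Qed.

(** Indicator functions of cosets reproduce values at their level; the factor is the measure of a
    coset. *)
Lemma inner_evaluate (n N : nat) (f : SY) (y : subvs_of Y) : lev n N f -> inner cj J f (coset Kcyc n y) = q.+1%:R ^- n * f y.
Proof.
move=> fl; have [N' H] := @coset_fun_level F (subvs_of Y) Kcyc n y; have [k yk] := Lat_ex y.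
pose M := (maxn N (maxn N' k)).
have {}fl : lev n M f by apply: level_leq fl => //; exact: leq_maxl.
have cl : lev n M (coset Kcyc n y) by apply: H; rewrite /M !leq_max leqnn orbT.
have [s sT] := Lat_transversal (subvs_of Y) n (- M%:Z); rewrite (innerE cj JP fl cl sT); congr (_ * _).
have [us sE sD] := sT; have [|z zs zy] := sD y; first by apply: Lat_leq yk; rewrite /M; lia.
rewrite (bigD1_seq z) //= -[LHS]/(f z * cj (coset Kcyc n y z) + \sum_(i <- s | i != z) f i * cj (coset Kcyc n y i)).
rewrite coset1; last by apply: LatBC.
rewrite rmorph1 mulr1 big1_seq ?addr0; first by rewrite -[y](subrK z) addrC fl.1.
move=> z' /andP[zz' z's]; rewrite coset0 ?rmorph0 ?mulr0 // => z'y; case/eqP: zz'.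
by apply: sE => //; have [_ Es Et] := @Lat_rel_equiv _ (subvs_of Y) n; apply: Et (Es _ _ z'y) (Es _ _ zy).
Qed.

Lemma odd_coset_support n (y u : subvs_of Y) : odd_coset Kcyc n y u != 0 -> Lat n (u - y) \/ Lat n (u + y).
Proof.
move=> H; have [|uy] := pselect (Lat n (u - y)); first by left.
right; apply: contrapT => uy'; move: H; rewrite odd_cosetE !coset0 ?subrr ?eqxx // opprK.
by [].
Qed.

Variables (sigma : {rmorphism Kcyc -> Kcyc}) (a : F).
Hypotheses (a0 : a != 0) (aO : O 0 a) (aVO : O 0 a^-1).
Hypothesis sP : forall t, sigma (psi t) = psi (a * t).
Hypothesis psi_cj : forall t, psi t * cj (psi t) = 1.

Lemma dual_vector : exists x y, [/\ x \in X, y \in Y & form y x = 1].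
Proof.
have [x xX x0] := polarisationX_ex XY W0.
have [w wx] : exists w, form w x != 0.
  by have [z [_ zx]] := form_nondeg2 form_nd x0 x0; exists z.
exists x, ((form w x)^-1 *: daddv_pi Y X w); split=> //; first by apply: memvZ; exact: memv_pi.
rewrite linearZl_LR /=; apply: (mulfI wx); rewrite mulVKf // mulr1 {2}(piXY XY w) formDl.
by rewrite (polarisationX XY (memv_pi X Y w) xX) add0r.
Qed.

Lemma quadratic_level (L : subvs_of Y -> F^o) (n0 : int) (N : nat) : linear L -> exists m : nat,
  forall (c : F^o) (u w : subvs_of Y), Lat n0 c -> Lat (- N%:Z) u -> Lat m w -> psi (c * L (u + w) ^+ 2) = psi (c * L u ^+ 2).
Proof.
move=> Ll; have [r [rP _]] := Lat_regular F.
have [m mP] := char_square_level psi (2 ^ (n0 - r%:Z)) N Ll; exists m => c u w /rP/scaled_div[d dO ->] uN wm.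
by rewrite [2 ^ _ * d]mulrC mP //; exact/scaled_integer.
Qed.

Lemma traces_moved : (forall v, a * v ^+ 2 != 1) -> exists2 t, hecke_traces omega_odd t & sigma t != t.
Proof.
move=> a_ns; apply: contrapT => fixed.
have {}fixed t : hecke_traces omega_odd t -> sigma t = t.
  by move=> tH; apply: contrapT => /eqP st; apply: fixed; exists t.
have [s sep] := nonsquare_separated aO aVO a0 a_ns.
have [r rP] := char_detect psi_nt; have [rg [_ rgP]] := Lat_regular F.
(* Adds up the shift of [char_detect], the separation exponent and the shift between [Lat] on [F^o]
   and the ideals: if [psi] is trivial on the multiples of [t] by this lattice, then [t] lies in
   [2^s O_F]. *)
pose n0 : int := - r%:Z - s%:Z - rg%:Z.
have detect t : (forall c : F^o, Lat n0 c -> psi (c * t) = 1) -> O s t.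
  move=> H; have := rP (- r%:Z - s%:Z) t; rewrite (_ : - r%:Z - (- r%:Z - s%:Z) = s); last lia.
  apply.
  by move=> c /rgP /H.
have [x0 [y0' [x0X y0Y y0x]]] := dual_vector; pose y0 : subvs_of Y := vsproj Y y0'.
pose ell (y : subvs_of Y) : F^o := form (vsval y) x0.
have ell_lin : linear ell by move=> c u v; rewrite /ell linearP /= linearDl linearZl.
have ell0 : ell y0 = 1 by rewrite /ell vsprojK.
have ellN y : ell (- y) ^+ 2 = ell y ^+ 2.
  by rewrite /ell -scaleN1r vsvalZ formZl mulN1r sqrrN.
have y0n0 : y0 != 0.
  apply/eqP => y00; have := ell0; rewrite y00 /ell /= linear0l => /eqP.
  by rewrite eq_sym oner_eq0.
have [N1 y0N1] := Lat_ex y0; have [m1 m1P] := quadratic_level n0 N1 ell_lin.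
have [m2 m2P] : exists m2 : nat, ~ Lat m2 (y0 + y0).
  apply/existsNP => H; case/eqP: y0n0; have := Lat_eq0 H.
  by rewrite -mulr2n -scaler_nat => /eqP; rewrite scaler_eq0 (negPf (two_neq0 F)) => /eqP.
(* The level [m1] makes [psi(c ell(y)^2)] equal to [psi(c)] on the support of [f0]; [m2] keeps the
   cosets of [y0] and [- y0] disjoint, so that [f0] is nonzero. *)
pose m0 := maxn m1 m2; pose f0 := odd_coset Kcyc m0 y0.
have f0y0 : f0 y0 = 1.
  rewrite odd_cosetE coset1 ?coset0 ?subr0 // ?subrr; last exact: Lat0.
  by rewrite opprK => H; apply: m2P; apply: Lat_leq H; rewrite lez_nat leq_maxr.
have f0_ell u c : f0 u != 0 -> Lat n0 (c : F^o) -> psi (c * ell u ^+ 2) = psi c.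
  have H z : Lat m0 (z - y0) -> Lat n0 (c : F^o) -> psi (c * ell z ^+ 2) = psi c.
    move=> zm cn; rewrite -(subrK y0 z) addrC m1P //; first by rewrite ell0 expr1n mulr1.
    by apply: Lat_leq zm; rewrite lez_nat leq_maxl.
  case/odd_coset_support => [/H //|um]; rewrite -ellN; apply: H.
  by rewrite -opprD; exact: LatN.
have [B [B_sub B_decr B_nbhs]] := metaplectic_basis cover.
have [mu muP] := haar_exists B_sub B_decr B_nbhs.
have oddP := odd_omegaP.
have [|k kP] := B_nbhs [set g | omega_odd g f0 = f0].
  by apply: open_nbhs_nbhs; split; [exact: oddP.2|exact: (rep1 oddP.1)].
have [_ Go G1 _] := B_sub k.
have [e eP] := hecke_operator_ex B_sub B_decr B_nbhs muP (average B_sub B_nbhs muP k) Kcyc_ratrD oddP.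
have e_inv := average_invariant B_decr oddP eP.
have ef0 : e f0 = f0 by apply: (average_id oddP eP) => g /kP.
have e_lin := hecke_linear B_sub B_decr B_nbhs oddP eP.
have [m3 [N lev3]] := invariants_level form_nd XY psi_nt W0 cover weil Go G1.
have [m4 m4P] := quadratic_level n0 N ell_lin.
(* The level [m3] holds for all invariants of [B k]; [m4] makes the transvections along [x0] act on
   each [d y] by a scalar. *)
pose m := maxn m3 m4.
have e_lev f : lev m N (e f).
  apply: (level_leq (leq_maxl _ _) (leqnn N)); apply: lev3 => g Gg.
  by rewrite -odd_omega e_inv.
have [|S ST SN] := @Lat_transversal_sub _ (subvs_of Y) m (- N%:Z); first lia.
pose d y := odd_coset Kcyc m (y : subvs_of Y); pose P y := e (d y) y / 2; pose Q : Kcyc := q.+1%:R.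
have e_sum f : e f = \sum_(y <- S) (e f y / 2 : Kcyc) *: d y := odd_level_sum Kcyc_two (e_lev f) ST.
pose ip (f f' : odd_Cc Kcyc Y) := inner cj J (odd_val f) (odd_val f').
have f0n0 : f0 != 0.
  by apply/eqP => f00; have := f0y0; rewrite f00 => /eqP; rewrite eq_sym oner_eq0.
have f00 : ip f0 f0 != 0.
  rewrite -(fmorph_eq0 Kcyc_val) eq_sym (inner_pos (odd_val f0)).2.
  by apply: contra f0n0 => /eqP H; apply/eqP/odd_val_inj.
have ip_inv g f f' : B k g -> ip (omega_odd g f) (omega_odd g f') = ip f f'.
  move=> /kP gf0; rewrite /ip !odd_omega; apply: (weil_unitary XY psi_nt weil psi_cj JP (f0 := odd_val f0)) => //.
  by rewrite -odd_omega gf0.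
have e_proj f : ip (e f) (e f) = ip (e f) f.
  apply: (average_projection B_decr Kcyc_ratrD oddP _ _ ip_inv eP) => [u v w|c u v].
    by rewrite /ip odd_valD (innerDr _ JP).
  by rewrite /ip odd_valZ (innerZr _ JP).
have ip_d (f : odd_Cc Kcyc Y) (y : subvs_of Y) : lev m N f -> ip f (d y) = Q ^- m * (2 * f y).
  move=> fl; have dE : odd_val (d y) = coset Kcyc m y + -1 *: coset Kcyc m (- y) by rewrite scaleN1r.
  rewrite /ip dE (innerDr _ JP) (innerZr _ JP) !(inner_evaluate _ fl) oddE rmorphN1.
  by rewrite mulrN mulN1r opprK -mulrDr mulr_natl mulr2n.
have Q0 : Q ^+ m != 0 by rewrite expf_neq0 // Kcyc_char0.
(* One factor 2 is the denominator in [P], the other comes from the cosets of [y] and [- y]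
   contributing equally to the inner product with [d y]. *)
have PE y : P y = Q ^+ m / 4 * ip (e (d y)) (e (d y)).
  rewrite e_proj ip_d; last exact: e_lev.
  have E4 : 4 = 2 * 2 :> Kcyc by rewrite -natrM.
  by rewrite /P mulrACA mulfV // mul1r E4 invfM -mulrA mulKf ?Kcyc_two // mulrC.
have P_pos y : 0 <= Kcyc_val (P y) ?= iff (e (d y) == 0).
  have H := inner_pos (odd_val (e (d y))); rewrite -/(ip _ _) in H.
  have Q4 : 0 < Kcyc_val (Q ^+ m / 4).
    by rewrite fmorph_div rmorphXn !rmorph_nat divr_gt0 ?exprn_gt0 // ltr0n.
  rewrite PE rmorphM; split; first by rewrite pmulr_rge0 // H.1.
  by rewrite eq_sym mulf_eq0 gt_eqF //= eq_sym H.2 -(inj_eq (@odd_val_inj F W Y Kcyc)).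
pose t c := \sum_(y <- S) psi (c * ell y ^+ 2) * P y.
have t_fixed (c : F^o) : Lat n0 c -> sigma (t c) = t c.
  move=> cn; have [g _ gE] := weil_transvection XY weil c x0X.
  pose phi := Cc_of (left_translate_is_Cc (average B_sub B_nbhs muP k) g).
  apply: fixed; exists mu, phi, (fun f => omega_odd g (e f)); split=> //.
    by apply: (hecke_translate oddP eP).
  have gd y : y \in S -> omega_odd g (d y) = (psi (c * ell y ^+ 2) : Kcyc) *: d y.
    move=> yS; apply: oddCcE => u; rewrite odd_omega gE odd_valZ CcZE.
    have [->|/odd_coset_support um] := eqVneq (odd_val (d y) u) 0; first by rewrite !mulr0.
    congr (_ * _); rewrite -[form _ _]/(ell u); have yN := SN y yS.
    have m4m z : Lat m z -> @Lat F (subvs_of Y) m4 z by apply: Lat_leq; rewrite lez_nat leq_maxr.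
    case: um => [um|um]; first by rewrite -(subrK y u) addrC m4P //; exact: m4m.
    have -> : ell u ^+ 2 = ell (y + - (u + y)) ^+ 2 by rewrite opprD addrCA subrr addr0 ellN.
    by rewrite m4P //; apply/m4m/LatN.
  (* The operator is the sum of the rank one operators with vectors [omega_odd g (d y)] and linear
     forms [f -> e f y / 2], so its trace is the sum of the values of the forms on the vectors. *)
  have -> : t c = \sum_(i < size S) e (omega_odd g (d (nth 0 S i))) (nth 0 S i) / 2.
    rewrite /t (big_nth 0) big_mkord; apply: eq_bigr => i _; rewrite gd ?mem_nth //.
    have eZ b f : e (b *: f) = b *: e f.
      have e0 : e 0 = 0 by have := e_lin (-1) 0 0; rewrite scaler0 addr0 scaleN1r addNr.
      by have := e_lin b f 0; rewrite e0 !addr0.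
    by rewrite eZ odd_valZ CcZE mulrA.
  apply: (has_trace_family (w := fun i : 'I_(size S) => omega_odd g (d (nth 0 S i)))
    (lam := fun i f => e f (nth 0 S i) / 2)).
    move=> f; have gl := odd_omega_linear g.
    have g0 : omega_odd g 0 = 0 by have := gl (-1) 0 0; rewrite scaler0 addr0 scaleN1r addNr.
    have gD u v : omega_odd g (u + v) = omega_odd g u + omega_odd g v by have := gl 1 u v; rewrite !scale1r.
    have gZ b v : omega_odd g (b *: v) = b *: omega_odd g v by have := gl b v 0; rewrite g0 !addr0.
    rewrite {1}e_sum (big_morph _ gD g0) (big_nth 0) big_mkord; apply: eq_bigr => i _.
    by rewrite gZ.
  by move=> i b u v; rewrite e_lin odd_valD odd_valZ CcDE CcZE mulrDl mulrA.
(* All the characters to be averaged, with and without [a], are trivial on [Lat n1], so the averages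
   become finite sums over [Lat n0] modulo [Lat n1]. *)
have [n1 [n01 n1P]] := char_level_seq n0 ([seq (ell y ^+ 2 - 1 : F) | y <- S] ++ [seq a * ell y ^+ 2 - 1 | y <- S]).
have [SC SCT SCn] := @Lat_transversal_sub _ F^o n1 n0 n01.
have SC0 : (size SC)%:R != 0 :> Kcyc.
  have [_ _ /(_ 0 (Lat0 _))[c + _]] := SCT; case: (SC) => // b l _; exact: Kcyc_char0.
pose D := \sum_(c <- SC) psi (- c) * t c.
pose A y := `[< forall c : F^o, Lat n0 c -> psi (c * (ell y ^+ 2 - 1)) = 1 >].
have D1 : D = \sum_(y <- S) (if A y then (size SC)%:R else 0) * P y.
  rewrite /D; under eq_bigr => c _ do rewrite mulr_sumr; rewrite exchange_big; apply: eq_big_seq => y yS.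
  have sE : \sum_(c <- SC) psi (c * (ell y ^+ 2 - 1)) = if A y then (size SC)%:R else 0.
    by apply: (char_sum SCT SCn n01) => c; apply: n1P; rewrite mem_cat; apply/orP; left; apply/mapP; exists y.
  rewrite -sE mulr_suml; apply: eq_bigr => c _.
  by rewrite mulrA mulrBr mulr1 charB charN [_^-1 * _]mulrC.
have D0 : D = 0.
  have -> : D = \sum_(c <- SC) psi (- c) * sigma (t c) by apply: eq_big_seq => c /SCn cn; rewrite t_fixed.
  under eq_bigr => c _ do rewrite rmorph_sum mulr_sumr; rewrite exchange_big big1_seq // => y /andP[_ yS].
  have sE : \sum_(c <- SC) psi (c * (a * ell y ^+ 2 - 1)) = 0.
    rewrite (char_sum SCT SCn n01); last by move=> c; apply: n1P; rewrite mem_cat; apply/orP; right; apply/mapP; exists y.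
    by rewrite asboolF // => /detect /sep.
  transitivity ((\sum_(c <- SC) psi (c * (a * ell y ^+ 2 - 1))) * sigma (P y)); last by rewrite sE mul0r.
  rewrite mulr_suml; apply: eq_bigr => c _.
  rewrite rmorphM sP mulrA; congr (_ * _).
  by rewrite mulrBr mulr1 charB charN [_^-1 * _]mulrC mulrCA.
have P0 y : y \in S -> A y -> e (d y) = 0.
  move=> yS Ay; apply/eqP; rewrite -(P_pos y).2 eq_sym.
  have := congr1 Kcyc_val D0; rewrite D1 rmorph_sum rmorph0 => /eqP.
  rewrite psumr_eq0 => [/allP/(_ y yS)|z _].
    by rewrite Ay rmorphM mulf_eq0 !fmorph_eq0 (negPf SC0).
  rewrite rmorphM mulr_ge0 ?(P_pos z).1 //.
  by case: (A z); rewrite ?rmorph0 // rmorph_nat ler0n.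
case/eqP: f0n0; have e0 : e 0 = 0 by have := e_lin (-1) 0 0; rewrite scaler0 addr0 scaleN1r addNr.
have eD u v : e (u + v) = e u + e v by have := e_lin 1 u v; rewrite !scale1r.
have eZ b f : e (b *: f) = b *: e f by have := e_lin b f 0; rewrite e0 !addr0.
(* The function [f0] is fixed by [e] and expands in the [d y] with [y] in its support, where [A y]
   holds; so it would be 0. *)
have fE : f0 = \sum_(y <- S) (odd_val f0 y / 2 : Kcyc) *: d y by have := e_sum f0; rewrite ef0.
rewrite -[LHS]ef0 {1}fE (big_morph _ eD e0) big1_seq // => y /andP[_ yS]; rewrite eZ.
have [->|fy] := eqVneq (odd_val f0 y) 0; first by rewrite mul0r scale0r.
rewrite P0 ?scaler0 //; apply/asboolP => c cn.
by rewrite mulrBr mulr1 charB f0_ell // mulfV // char_neq0.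
Qed.
End LowerBound.

(** * Upper bound on the character field *)

Local Notation charfield := (character_field omega_odd).

Lemma charfieldP : [/\ is_subfield charfield, forall x, charfield (ratr x) & forall t, hecke_traces omega_odd t -> charfield t].
Proof.
split.
- split=> [|x y Ex Ey|x y Ex Ey] E' [E's E'P].
  + by have [] := E's.
  + by have [_ H _] := E's; apply: H; [exact: Ex|exact: Ey].
  + by have [_ _ H] := E's; apply: H; [exact: Ex|exact: Ey].
- by move=> x E' [_ E'P]; apply: E'P; left; exists x.
- by move=> t tH E' [_ E'P]; apply: E'P; right.
Qed.

Lemma charfield_fixed (sigma : {rmorphism Kcyc -> Kcyc}) :
  (forall t, hecke_traces omega_odd t -> sigma t = t) -> forall x, charfield x -> sigma x = x.
Proof.
move=> H x; pose S : set Kcyc := [set y | sigma y = y]; suff SP : is_subfield S /\ range ratr `|` hecke_traces omega_odd `<=` S.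
  by move=> /(_ S SP).
split.
  split=> [|y z /= yE zE|y z /= yE zE]; rewrite /S /=; first exact: rmorph1.
    by rewrite rmorphB yE zE.
  by rewrite fmorph_div yE zE.
by move=> y [[z _ <-]|/H //]; exact: fmorph_rat.
Qed.

Lemma charfield_moved (sigma : {rmorphism Kcyc -> Kcyc}) (a : F) : a != 0 -> O 0 a -> O 0 a^-1 ->
  (forall t, sigma (psi t) = psi (a * t)) -> (forall v, a * v ^+ 2 != 1) ->
  exists2 x, charfield x & sigma x != x.
Proof.
move=> a0 aO aVO sP a_ns; have [cj [cjE cjw]] := Kcyc_conj.
have psi_cj t : psi t * cj (psi t) = 1.
  by have [k kP] := char_pow2 psi t; rewrite (cjw _ _ kP) mulfV // char_neq0.
have [q [J JP]] := @integral_ex F (subvs_of Y) Kcyc Kcyc_char0.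
have [t tH st] := traces_moved cjE JP a0 aO aVO sP psi_cj a_ns.
by exists t => //; have [_ _] := charfieldP; apply.
Qed.

(** Conjugation by [I] preserves [T] and turns its matrix into the image under [sigma], so
    uniqueness of the trace applies. Finite orbits provide the bijectivity of [I] and [sigma]. *)
Lemma trace_fixed (sigma : {rmorphism Kcyc -> Kcyc}) (I : semilinear_map sigma (odd_Cc Kcyc Y)) :
  (forall x, exists n, iter n.+1 sigma x = x) -> (forall f, exists n, iter n.+1 I f = f) ->
  (forall g f, I (omega_odd g f) = omega_odd g (I f)) ->
  forall t, hecke_traces omega_odd t -> sigma t = t.
Proof.
move=> sper Iper Icom t [mu [phi [T [muP TP [n [e [M [ei eP eM tE]]]]]]]].
have [B [B_sub B_decr B_nbhs]] := metaplectic_basis cover.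
have oddP := odd_omegaP.
have Tlin := hecke_linear B_sub B_decr B_nbhs oddP TP.
have IZ a f : I (ratr a *: f) = ratr a *: I f by rewrite semiZ fmorph_rat.
have TI := hecke_commute B_sub B_decr B_nbhs oddP TP (semiD I) IZ Icom.
have tH : has_trace T t by exists n, e, M.
apply: (has_trace_uniq Tlin _ tH); exists n, (I \o e), (map_mx sigma M).
have I_inj f : I f = 0 -> f = 0.
  move=> If; have [m <-] := Iper f; rewrite iterSr If.
  by elim: m => //= m ->; exact: semi0.
split.
- move=> c c0; have /choice[d dP] : forall i, exists x, sigma x = c i.
    by move=> i; have [m mP] := sper (c i); exists (iter m sigma (c i)).
  have d0 : \sum_i d i *: e i = 0.
    by apply: I_inj; rewrite semi_sum -[RHS]c0; apply: eq_bigr => i _; rewrite semiZ dP.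
  by move=> i; rewrite -dP (ei _ d0) rmorph0.
- move=> f; have [m <-] := Iper f; rewrite iterS TI; have [c ->] := eP (iter m I f).
  by exists (sigma \o c); rewrite semi_sum; apply: eq_bigr => i _; rewrite semiZ.
- by move=> j; rewrite /= TI eM semi_sum; apply: eq_bigr => i _; rewrite semiZ mxE.
- by rewrite tE rmorph_sum; apply: eq_bigr => i _; rewrite mxE.
Qed.

Lemma charfield_fixed_pow (sigma : {rmorphism Kcyc -> Kcyc}) (u : F) (b : nat) :
  (forall w k, w ^+ (2 ^ k) = 1 -> sigma w = w ^+ b) -> u ^+ 2 = b%:R -> integer_units u -> odd b ->
  forall x, charfield x -> sigma x = x.
Proof.
move=> sP u2 uU bo; have [u0 _ _] := uU.
apply: charfield_fixed; apply: (@trace_fixed sigma (odd_semilinear Y sigma u0)).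
- move=> x; have [L LP] := iter_sigma_fixed sP bo x; exists (2 ^ L).-1.
  by rewrite prednK ?expn_gt0 // LP.
- move=> f; have [L LP] := odd_twist_period sP u2 uU bo f; exists (2 ^ L.+1).-1.
  by rewrite prednK ?expn_gt0 // LP.
- apply: odd_twist_omega => // t; rewrite u2; exact: char_pow.
Qed.

Lemma charfield_fixed_conj (sigma : {rmorphism Kcyc -> Kcyc}) (u : F) :
  (forall w k, w ^+ (2 ^ k) = 1 -> sigma w = w^-1) -> (forall x, sigma (sigma x) = x) -> u ^+ 2 = -1 ->
  forall x, charfield x -> sigma x = x.
Proof.
move=> sP sK u2; have u0 : u != 0 by apply: contra_eq_neq u2 => ->; rewrite expr0n eq_sym oppr_eq0 oner_eq0.
apply: charfield_fixed; apply: (@trace_fixed sigma (odd_semilinear Y sigma u0)).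
- by move=> x; exists 1%N; rewrite /= sK.
(* The square of [I] is [f(y) |-> f(- y)], so the fourth iterate is the identity. *)
- move=> f; exists 3%N; apply: oddCcE => y.
  by rewrite iter_odd_twist /= !sK (exprM u 2 2) u2 sqrrN expr1n invr1 scale1r.
apply: odd_twist_omega => // t; rewrite u2 mulN1r charN.
by have [k kP] := char_pow2 psi t; rewrite (sP _ _ kP).
Qed.

(** * Obstruction to a realisation over a real field *)

Section ConjugateModule.
Variable T : lmodType algC.
(** Antilinear maps are linear maps into the conjugate module, so the universal property of scalar
    extension constructs them and proves them equal. *)
Definition conj_mod : Type := T.
HB.instance Definition _ := GRing.Zmodule.on conj_mod.
Definition conj_scale (c : algC) (v : conj_mod) : conj_mod := c^* *: (v : T).
Lemma conj_scaleA a b v : conj_scale a (conj_scale b v) = conj_scale (a * b) v.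
Proof. by rewrite /conj_scale scalerA rmorphM. Qed.
Lemma conj_scale1 : left_id 1 conj_scale.
Proof. by move=> v; rewrite /conj_scale rmorph1 scale1r. Qed.
Lemma conj_scaleDr : right_distributive conj_scale +%R.
Proof. by move=> a u v; exact: scalerDr. Qed.
Lemma conj_scaleDl v : {morph conj_scale^~ v : a b / a + b}.
Proof. by move=> a b; rewrite /conj_scale rmorphD scalerDl. Qed.
HB.instance Definition _ := GRing.Zmodule_isLmodule.Build algC conj_mod
  conj_scaleA conj_scale1 conj_scaleDr conj_scaleDl.

Lemma conj_modZ (c : algC) (v : conj_mod) : c *: v = (c^* *: (v : T) : T). Proof. by []. Qed.
End ConjugateModule.

Section NotReal.
Variables (sigma : {rmorphism Kcyc -> Kcyc}) (u : F).
Hypothesis sE : forall x, Kcyc_val (sigma x) = (Kcyc_val x)^*.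
Hypothesis sP : forall w k, w ^+ (2 ^ k) = 1 -> sigma w = w^-1.
Hypothesis u2 : u ^+ 2 = -1.

Let u0 : u != 0.
Proof. by apply: contra_eq_neq u2 => ->; rewrite expr0n eq_sym oppr_eq0 oner_eq0. Qed.
Local Notation I := (odd_twist sigma u : odd_Cc Kcyc Y -> odd_Cc Kcyc Y).

Let uV2 y : u^-1 *: (u^-1 *: y) = - y :> subvs_of Y.
Proof. by rewrite scalerA -invfM -expr2 u2 invrN invr1 scaleN1r. Qed.

Lemma I_sqr f : I (I f) = - f.
Proof.
apply: oddCcE => y; rewrite !odd_twistE // uV2 oddE; apply: Kcyc_inj; rewrite !sE conjCK.
by [].
Qed.

Lemma I_omega g f : I (omega_odd g f) = omega_odd g (I f).
Proof.
apply: odd_twist_omega => // t; rewrite u2 mulN1r charN.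
by have [k kP] := char_pow2 psi t; rewrite (sP kP).
Qed.

(** Composing with it extends a functional on odd functions to all Schwartz functions, where
    [semilinear_functional_local] applies. *)
Definition oddize (h : SY) : SY := h - twist (idfun : {rmorphism Kcyc -> Kcyc}) (-1) h.
Lemma oddizeE h y : oddize h y = h y - h (- y).
Proof. by rewrite /oddize CcDE CcNE twistE ?oppr_eq0 ?oner_eq0 // invrN invr1 scaleN1r. Qed.
Lemma oddize_odd h : oddize h \in @is_odd F Kcyc W Y.
Proof. by apply/asboolP => y; rewrite !oddizeE opprK opprB. Qed.
Definition odd_of h : odd_Cc Kcyc Y := OddCc (oddize_odd h).
Lemma odd_ofE h y : odd_of h y = h y - h (- y). Proof. exact: oddizeE. Qed.

(** The squares agree at [x] exactly when [y - y'] or [y + y'] pairs to 0 with [x]. Each of these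
    two is detected by some vector of [X], and one of the two vectors or their sum detects both. *)
Lemma separating_square (y y' : subvs_of Y) : y != y' -> y != - y' ->
  exists2 x, x \in X & form (vsval y) x ^+ 2 != form (vsval y') x ^+ 2.
Proof.
move=> yy' yNy'.
have sep (v : subvs_of Y) : v != 0 -> exists2 x, x \in X & form (vsval v) x != 0.
  move=> v0; apply: contrapT => H; case/eqP: v0; apply: (formYX_sep XY) => x xX.
  by apply: contrapT => /eqP vx; apply: H; exists x.
have [|x xX vx] := sep (y - y'); first by rewrite subr_eq0.
have [|x' x'X vx'] := sep (y + y'); first by rewrite addr_eq0.
have E z : z \in X -> (form (vsval y) z ^+ 2 != form (vsval y') z ^+ 2) =
    (form (vsval (y - y')) z != 0) && (form (vsval (y + y')) z != 0).
  by move=> _; rewrite eqf_sqr negb_or vsvalB vsvalD linearBl /= formDl subr_eq0 addr_eq0.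
have [vx0|vx0] := eqVneq (form (vsval (y + y')) x) 0; last by exists x => //; rewrite E // vx.
have [v'x0|v'x0] := eqVneq (form (vsval (y - y')) x') 0; last by exists x' => //; rewrite E // v'x0.
exists (x + x'); first exact: memvD.
by rewrite E ?memvD // !formDr vx0 v'x0 add0r addr0 vx.
Qed.

(* The operators of multiplication by psi(c <y, x> ^ 2) separate y from the
   points other than y and - y. *)
Lemma odd_functional_local (lam : odd_Cc Kcyc Y -> algC) (y0 : subvs_of Y) :
  (forall f g, lam (f + g) = lam f + lam g) -> (forall c f, lam (c *: f) = Kcyc_val c * lam f) ->
  (forall x c g, x \in X -> (forall f y, omega g f y = psi (c * form (vsval y) x ^+ 2) * f y) ->
     forall f, lam (omega_odd g f) = Kcyc_val (psi (c * form (vsval y0) x ^+ 2)) * lam f) ->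
  forall f : odd_Cc Kcyc Y, f y0 = 0 -> lam f = 0.
Proof.
move=> lamD lamZ lamG f fy0.
have odd_ofD g h : odd_of (g + h) = odd_of g + odd_of h.
  by apply: oddCcE => y; rewrite odd_valD CcDE !odd_ofE !CcDE opprD addrACA.
have odd_ofZ c g : odd_of (c *: g) = c *: odd_of g.
  by apply: oddCcE => y; rewrite odd_ofE odd_valZ !CcZE odd_ofE mulrBr.
have : lam (odd_of (odd_val f)) = 0.
  apply: (semilinear_functional_local (sigma := Kcyc_val) (lam := lam \o odd_of)).
  - by move=> g h; rewrite /= odd_ofD lamD.
  - by move=> c g; rewrite /= odd_ofZ lamZ.
  move=> y fy; have yy0 : y != y0 by apply: contra fy => /eqP ->; rewrite fy0.
  have yNy0 : y != - y0 by apply: contra fy => /eqP ->; rewrite oddE fy0 oppr0.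
  have [x xX xy] := separating_square yy0 yNy0; have [t0 t0P] := psi_nt.
  pose d := form (vsval y) x ^+ 2 - form (vsval y0) x ^+ 2.
  have d0 : d != 0 by rewrite subr_eq0.
  pose c := t0 / d; have [g _ gE] := weil_transvection XY weil c xX.
  exists (fun z => psi (c * form (vsval z) x ^+ 2)), (Kcyc_val (psi (c * form (vsval y0) x ^+ 2))).
  split.
  - have [N yN] := Lat_ex y.
    have ll : linear (fun z : subvs_of Y => form (vsval z) x : F^o).
      by move=> a z z'; rewrite linearP /= linearDl linearZl.
    have [n nP] := char_square_level psi c N ll; exists n => w wn.
    by have := nP 1 w y _ yN wn; rewrite !mul1r; apply; apply/scaled_integer; exact: integer1.
  - move=> h h' hE; rewrite /= -(lamG x c g xX gE); congr (lam _); apply: oddCcE => z.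
    have zN : form (vsval (- z)) x ^+ 2 = form (vsval z) x ^+ 2 by rewrite -scaleN1r vsvalZ formZl mulN1r sqrrN.
    by rewrite odd_omega gE !odd_ofE !hE zN mulrBr.
  rewrite (inj_eq Kcyc_inj); apply: contra t0P => /eqP E.
  by rewrite -[t0](divfK d0) -/c mulrBr charB E mulfV // char_neq0.
have -> : odd_of (odd_val f) = (2 : Kcyc) *: f.
  by apply: oddCcE => y; rewrite odd_ofE oddE opprK odd_valZ CcZE mulr_natl mulr2n.
rewrite lamZ => /eqP; rewrite mulf_eq0 fmorph_eq0 (negPf Kcyc_two).
by move/eqP.
Qed.

Lemma not_realised_real (E : set algC) : (forall x, E x -> x^* = x) -> ~ realised_over Kcyc_val omega_odd E.
Proof.
move=> Ereal [k [j [V' [pi' [T [tau [e [e' [jE _ [[el univ] taul taue] [[e'l univ'] _ taue']]]]]]]]]].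
have conjD (a b : algC) : (a + b)^* = a^* + b^* by exact: rmorphD.
have conjM (a b : algC) : (a * b)^* = a^* * b^* by exact: rmorphM.
have conjN (a : algC) : (- a)^* = - a^* by exact: rmorphN.
have jreal a : (j a)^* = j a by apply: Ereal; rewrite -jE; exists a.
have uniq (M : lmodType algC) (g h : T -> M) : linear g -> linear h -> (forall f, g (e f) = h (e f)) -> g =1 h.
  move=> gl hl gh; have [|r [_ rP]] := univ M (fun f => g (e f)).
    by move=> a f f'; rewrite el gl.
  by move=> v; have <- := rP g (conj gl (fun=> erefl)); have <- := rP h (conj hl (fun f => esym (gh f))).
have uniq' (M : lmodType algC) (g h : T -> M) : linear g -> linear h -> (forall f, g (e' f) = h (e' f)) -> g =1 h.
  move=> gl hl gh; have [|r [_ rP]] := univ' M (fun f => g (e' f)).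
    by move=> a f f'; rewrite e'l gl.
  by move=> v; have <- := rP g (conj gl (fun=> erefl)); have <- := rP h (conj hl (fun f => esym (gh f))).
(* Complex conjugation of coefficients relative to [e']; it is well defined because [j] has real
   values. *)
have [J [Jl Je]] : exists J : T -> T, (forall a v w, J (a *: v + w) = a^* *: J v + J w) /\ forall v, J (e' v) = e' v.
  have [|J [[Jl Je] _]] := univ' (conj_mod T) (e' : V' -> conj_mod T); last by exists J.
  by move=> a v w; rewrite e'l /= conj_modZ jreal.
have [J0 [J0l J0e]] : exists J0 : T -> T, (forall a v w, J0 (a *: v + w) = a^* *: J0 v + J0 w) /\
    forall f, J0 (e f) = e (I f).
  have [|J0 [[J0l J0e] _]] := univ (conj_mod T) (fun f => e (I f) : conj_mod T); last by exists J0.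
  by move=> a f f'; rewrite odd_twistD // odd_twistZ // el /= conj_modZ sE.
have el' a f f' : e (a *: f + f') = Kcyc_val a *: e f + e f' := el a f f'.
have eD f f' : e (f + f') = e f + e f' by rewrite -[f]scale1r el' rmorph1 !scale1r.
have e0 : e 0 = 0 by apply: (addrI (e 0)); rewrite -eD !addr0.
have eZ a f : e (a *: f) = Kcyc_val a *: e f by have := el' a f 0; rewrite e0 !addr0.
have JJ v : J (J v) = v.
  by apply: (uniq' T (J \o J) id) => // [a w w'|w]; rewrite /= ?Jl ?conjCK // !Je.
have J0J0 v : J0 (J0 v) = - v.
  apply: (uniq T (J0 \o J0) -%R) => // [a w w'|a w w'|f]; first by rewrite /= !J0l conjCK.
    by rewrite opprD scalerN.
  by rewrite /= !J0e I_sqr -[- f]scaleN1r eZ rmorphN1 scaleN1r.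
have Jtau g v : J (tau g v) = tau g (J v).
  apply: (uniq' (conj_mod T) (fun v => J (tau g v)) (fun v => tau g (J v))) => [a w w'|a w w'|w].
  - by rewrite taul Jl.
  - by rewrite Jl taul.
  by rewrite taue' !Je taue'.
have J0tau g v : J0 (tau g v) = tau g (J0 v).
  apply: (uniq (conj_mod T) (fun v => J0 (tau g v)) (fun v => tau g (J0 v))) => [a w w'|a w w'|w].
  - by rewrite taul J0l.
  - by rewrite J0l taul.
  by rewrite taue !J0e taue I_omega.
have /choice[ev evP] : forall y : subvs_of Y, exists ev : T -> algC^o, linear ev /\ forall f : odd_Cc Kcyc Y, ev (e f) = Kcyc_val (f y).
  move=> y; have [|ev [[evl eve] _]] := univ algC^o (fun f : odd_Cc Kcyc Y => Kcyc_val (f y)); last by exists ev.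
  by move=> a f f'; rewrite odd_valD odd_valZ CcDE CcZE rmorphD rmorphM.
have evl y := (evP y).1; have eve y := (evP y).2.
have evZ y a v : ev y (a *: v) = a * ev y v.
  have ev0 : ev y 0 = 0 by have := evl y (-1) 0 0; rewrite scaler0 addr0 scaleN1r addNr.
  by have := evl y a v 0; rewrite ev0 !addr0.
have evJ0 y v : ev y (J0 v) = (ev (u^-1 *: y) v)^*.
  rewrite -[LHS]conjCK; congr (_^* ); move: v; apply: (uniq algC^o (fun v => (ev y (J0 v))^* )) => // [a v w|f].
    have -> : ev y (J0 (a *: v + w)) = a^* * ev y (J0 v) + ev y (J0 w) by rewrite J0l evl.
    by rewrite conjD conjM conjCK.
  by rewrite J0e !eve odd_twistE // sE conjCK.
(* The composite of two antilinear maps is linear, and it commutes with the group. *)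
pose S v := J (J0 v).
have Sl : linear S by move=> a v w; rewrite /S J0l Jl conjCK.
have Stau g v : S (tau g v) = tau g (S v) by rewrite /S J0tau Jtau.
have S_local (y : subvs_of Y) : y != 0 -> exists c, forall v, ev y (S v) = c * ev y v.
  move=> y0; pose lam f := ev y (S (e f)).
  have SD v w : S (v + w) = S v + S w by have := Sl 1 v w; rewrite !scale1r.
  have S0 : S 0 = 0 by apply: (addrI (S 0)); rewrite -SD !addr0.
  have SZ c v : S (c *: v) = c *: S v by have := Sl c v 0; rewrite S0 !addr0.
  have evD v w : ev y (v + w) = ev y v + ev y w by have := evl y 1 v w; rewrite !scale1r.
  have lamD f f' : lam (f + f') = lam f + lam f' by rewrite /lam eD SD evD.
  have lamZ c f : lam (c *: f) = Kcyc_val c * lam f by rewrite /lam eZ SZ evZ.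
  have lamG x c g : x \in X -> (forall (f : SY) (z : subvs_of Y), omega g f z = psi (c * form (vsval z) x ^+ 2) * f z) ->
      forall f, lam (omega_odd g f) = Kcyc_val (psi (c * form (vsval y) x ^+ 2)) * lam f.
    move=> xX gE f; rewrite /lam -taue Stau; move: (S (e f)).
    apply: (uniq algC^o (fun v => ev y (tau g v)) (fun v => Kcyc_val (psi (c * form (vsval y) x ^+ 2)) * ev y v)).
    - by move=> a v w; rewrite taul evl.
    - by move=> a v w; rewrite evl mulrDr mulrCA.
    by move=> f1; rewrite taue !eve odd_omega gE rmorphM.
  have [m ym] : exists m : nat, ~ Lat m (y + y).
    apply/existsNP => H; case/eqP: y0; have := Lat_eq0 H.
    by rewrite -mulr2n -scaler_nat => /eqP; rewrite scaler_eq0 (negPf (two_neq0 F)) => /eqP.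
  pose f1 := odd_coset Kcyc m y; have f1y : f1 y = 1.
    by rewrite odd_cosetE coset1 ?coset0 ?subr0 ?opprK // subrr; exact: Lat0.
  exists (lam f1); apply: (uniq algC^o (fun v => ev y (S v)) (fun v => lam f1 * ev y v)).
  - by move=> a v w; rewrite Sl evl.
  - by move=> a v w; rewrite evl mulrDr mulrCA.
  move=> f; rewrite eve -/(lam f).
  have : lam (f - (f y : Kcyc) *: f1) = 0.
    apply: (odd_functional_local lamD lamZ lamG).
    by rewrite odd_valD -scaleNr odd_valZ CcDE CcZE f1y mulr1 subrr.
  by rewrite lamD -scaleNr lamZ rmorphN mulNr => /eqP; rewrite subr_eq0 mulrC => /eqP.
have [x1 [y1 [_ y1Y y1x]]] := dual_vector; pose y : subvs_of Y := vsproj Y y1.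
have y0 : y != 0.
  apply/eqP => H; have := congr1 vsval H; rewrite vsprojK //= => y10; move: y1x.
  by rewrite y10 linear0l => /eqP; rewrite eq_sym oner_eq0.
have y'0 : u^-1 *: y != 0 by rewrite scaler_eq0 invr_eq0 negb_or u0.
have [c cP] := S_local y y0; have [c' c'P] := S_local _ y'0.
have [f1 f1y] : exists f1 : odd_Cc Kcyc Y, f1 y != 0.
  have [m ym] : exists m : nat, ~ Lat m (y + y).
    apply/existsNP => H; case/eqP: y0; have := Lat_eq0 H.
    by rewrite -mulr2n -scaler_nat => /eqP; rewrite scaler_eq0 (negPf (two_neq0 F)) => /eqP.
  exists (odd_coset Kcyc m y); rewrite odd_cosetE coset1 ?coset0 ?subr0 ?oner_neq0 ?opprK //.
  by rewrite subrr; exact: Lat0.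
(* The Levi element turns evaluation at [y] into a multiple of evaluation at [u^-1 y], and [S]
   commutes with it. *)
have cc' : c = c'.
  have [g [k0 gE]] := weil_levi XY psi_nt cover weil u0.
  have evtau v : ev y (tau g v) = Kcyc_val k0 * ev (u^-1 *: y) v.
    apply: (uniq algC^o (fun v => ev y (tau g v)) (fun v => Kcyc_val k0 * ev (u^-1 *: y) v)).
    - by move=> a w w'; rewrite taul evl.
    - by move=> a w w'; rewrite evl mulrDr mulrCA.
    by move=> f; rewrite taue !eve odd_omega gE rmorphM.
  pose v := e (omega_odd g^-1%g f1).
  have v0 : Kcyc_val k0 * ev (u^-1 *: y) v != 0.
    by rewrite -evtau taue eve fmorph_eq0 !odd_omega (weilVK weil).
  apply: (mulIf v0); rewrite -[in LHS]evtau -cP Stau evtau c'P.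
  by rewrite mulrCA.
have JN v : J (- v) = - J v.
  have J00 : J 0 = 0 by have := Jl (-1) 0 0; rewrite scaler0 addr0 rmorphN1 scaleN1r addNr.
  by have := Jl (-1) v 0; rewrite J00 !addr0 rmorphN1 !scaleN1r.
have evN z v : ev z (- v) = - ev z v by rewrite -scaleN1r evZ mulN1r.
(* Because [J0] squares to -1, [J v] is [- S (J0 v)], and [J0] is known on values. *)
have evJ z b v : (forall w, ev z (S w) = b * ev z w) -> ev z (J v) = - (b * (ev (u^-1 *: z) v)^*).
  by move=> bP; rewrite -evJ0 -bP /S J0J0 JN evN opprK.
have evNy v : ev (- y) v = - ev y v.
  apply: (uniq algC^o (ev (- y)) (fun v => - ev y v)) => [a w w'|a w w'|f]; first by rewrite evl.
    by rewrite evl opprD -mulrN.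
  by rewrite !eve oddE rmorphN.
have fy : ev y (e f1) != 0 by rewrite eve fmorph_eq0.
(* The formula for [J] used twice leads from [y] to [u^-1 (u^-1 y) = - y], and oddness supplies the
   sign. *)
have : ev y (e f1) = - (c * c^* ) * ev y (e f1).
  rewrite -{1}(JJ (e f1)) (evJ _ _ _ cP) (evJ _ _ _ c'P) uV2 evNy -cc'.
  by rewrite !(conjN, conjM, conjCK, mulrN, opprK) mulNr mulrA.
move/eqP; rewrite -subr_eq0 -{1}[ev y _]mul1r -mulrBl mulf_eq0 (negPf fy) orbF opprK -normCK => /eqP c1.
have : 0 < 1 + `|c| ^+ 2 by rewrite ltr_pwDl ?ltr01 // exprn_ge0.
by rewrite c1 ltxx.
Qed.
End NotReal.

(** * Character fields and Schur indices *)

Section Classification.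
Local Notation A := (square_units F).
Local Notation cfield := (Kcyc_val @` character_field omega_odd).
Local Notation realised := (realised_over Kcyc_val omega_odd).
Variable zeta : algC.
Hypothesis zetaP : 8.-primitive_root zeta.

Lemma square_units_root (a : int) : A a%:~R -> exists2 u : F, integer_units u & u ^+ 2 = a%:~R.
Proof. by move=> [_ [u uU uE]]; exists u => //; rewrite -uE; exact: (rmorph_int (Z2_to F)). Qed.

Lemma square_units_moved (sigma : {rmorphism Kcyc -> Kcyc}) (a : int) : (a * a %% 8)%Z = 1 -> ~ A a%:~R ->
  (forall t, sigma (psi t) = psi (a%:~R * t)) -> exists2 x, character_field omega_odd x & sigma x != x.
Proof.
move=> aa aA sP; have aU : a%:~R \is a @GRing.unit Z2.
  have [|u uU uE] := @Z2_sqrt (a * a)%:~R; first by rewrite Z2_val_int aa.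
  by have := uU; rewrite -(unitrX_pos u (isT : 0 < 2)%N) -uE rmorphM unitrM => /andP[].
have aE : Z2_to F a%:~R = a%:~R by exact: (rmorph_int (Z2_to F)).
apply: charfield_moved sP _.
- by rewrite -aE Z2_to_eq0; apply: contraTneq aU => ->; rewrite unitr0.
- by apply/scaled_integer; exact: integer_int.
- apply/scaled_integer; rewrite -aE; have <- : Z2_to F (a%:~R)^-1 = (Z2_to F a%:~R)^-1 by exact: rmorphV.
  exact: integer_Z2.
by move=> v; apply/eqP => av; apply: aA; apply: (square_unitsP aU (v := v)); rewrite aE.
Qed.

Lemma cfield_subfield : is_subfield cfield.
Proof.
have [[E1 EB Ediv] _ _] := charfieldP; split; first by exists 1 => //; exact: rmorph1.
  by move=> _ _ [x Ex <-] [y Ey <-]; exists (x - y); [exact: EB|rewrite rmorphB].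
by move=> _ _ [x Ex <-] [y Ey <-]; exists (x / y); [exact: Ediv|rewrite fmorph_div].
Qed.

Lemma cfield_rat q : cfield (ratr q).
Proof. by have [_ H _] := charfieldP; exists (ratr q); [exact: H|exact: Kcyc_ratr]. Qed.

Lemma integer_units3 : integer_units (3 : F).
Proof.
have U3 : 3 \is a @GRing.unit Z2 by rewrite Z2_unitE -[3]/(3%:~R) Z2_val_int.
have E3 : Z2_to F 3 = 3 by exact: (rmorph_nat (Z2_to F)).
split; first by rewrite -E3 Z2_to_eq0; apply: contraTneq U3 => ->; rewrite unitr0.
  by rewrite -E3; exact: integer_Z2.
rewrite -E3; have <- : Z2_to F 3^-1 = (Z2_to F 3)^-1 by exact: rmorphV.
exact: integer_Z2.
Qed.

Lemma Kcyc_ratr0 : ratr 0 = 0 :> Kcyc.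
Proof. by apply: Kcyc_inj; rewrite Kcyc_ratr !rmorph0. Qed.

Lemma Kcyc_pair a b (x y : Kcyc) : Kcyc_val (ratr a * x + ratr b * y) = ratr a * Kcyc_val x + ratr b * Kcyc_val y.
Proof.
have := Kcyc_comb Kcyc_val 0 a b 0 x y 0.
by rewrite Kcyc_ratr0 mul0r addr0 add0r rmorph0 mul0r addr0 add0r.
Qed.

Section Coordinates.
Variables (w : Kcyc) (s3 s5 s9 sN : {rmorphism Kcyc -> Kcyc}).
Hypotheses (wz : Kcyc_val w = zeta) (w8 : w ^+ (2 ^ 3) = 1) (w4 : w ^+ 4 = -1).
Hypothesis wdec : forall x, Qadj zeta (Kcyc_val x) -> exists q : rat * rat * (rat * rat), Kcyc_val x = Qcomb zeta q /\
  x = ratr q.1.1 + ratr q.1.2 * w ^+ 2 + ratr q.2.1 * (w + w ^+ 3) + ratr q.2.2 * (w - w ^+ 3).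
Hypotheses (s3P : forall w k, w ^+ (2 ^ k) = 1 -> s3 w = w ^+ 3)
  (s5P : forall w k, w ^+ (2 ^ k) = 1 -> s5 w = w ^+ 5) (s9P : forall w k, w ^+ (2 ^ k) = 1 -> s9 w = w ^+ 9)
  (sNP : forall w k, w ^+ (2 ^ k) = 1 -> sN w = w^-1) (sNE : forall x, Kcyc_val (sN x) = (Kcyc_val x)^* ).

Lemma character_field_Qadj8 (x : Kcyc) : character_field omega_odd x -> Qadj zeta (Kcyc_val x).
Proof.
move=> Ex; apply: (@fixed_Qadj8 zeta zetaP s9 9 1) => //.
by apply: (charfield_fixed_pow s9P (u := 3)) => //; [rewrite -natrX|exact: integer_units3].
Qed.

Section Coord.
Variables (q : rat * rat * (rat * rat)) (x : Kcyc).
Hypothesis xE : x = ratr q.1.1 + ratr q.1.2 * w ^+ 2 + ratr q.2.1 * (w + w ^+ 3) + ratr q.2.2 * (w - w ^+ 3).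

Lemma fixed3_coord : s3 x = x <-> q.1.2 = 0 /\ q.2.2 = 0.
Proof.
have E := Qcomb_sigma3 w4 xE (s3P w8); split=> [|[b0 d0]]; last first.
  by rewrite E [RHS]xE b0 d0 !Kcyc_ratr0; ring.
rewrite E [RHS]xE => /eqP; rewrite -subr_eq0 => /eqP H.
have {}H : ratr q.1.2 * w ^+ 2 + ratr q.2.2 * (w - w ^+ 3) = 0.
  by apply: (mulfI Kcyc_two); rewrite mulr0 -[RHS]oppr0 -H; ring.
apply: (gen_indep_is zetaP); have := congr1 Kcyc_val H; rewrite rmorph0 Kcyc_pair.
by rewrite rmorphB !rmorphXn /= wz.
Qed.

Lemma fixed5_coord : s5 x = x <-> q.2.1 = 0 /\ q.2.2 = 0.
Proof.
have E := Qcomb_sigma5 w4 xE (s5P w8); split=> [|[c0 d0]]; last first.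
  by rewrite E [RHS]xE c0 d0 !Kcyc_ratr0; ring.
rewrite E [RHS]xE => /eqP; rewrite -subr_eq0 => /eqP H.
have {}H : ratr q.2.1 * (w + w ^+ 3) + ratr q.2.2 * (w - w ^+ 3) = 0.
  by apply: (mulfI Kcyc_two); rewrite mulr0 -[RHS]oppr0 -H; ring.
apply: (gen_indep_rs zetaP); have := congr1 Kcyc_val H; rewrite rmorph0 Kcyc_pair.
by rewrite rmorphB rmorphD !rmorphXn /= wz.
Qed.

Lemma fixedN_coord : sN x = x <-> q.1.2 = 0 /\ q.2.1 = 0.
Proof.
have E := Qcomb_sigmaN w8 w4 xE (sNP w8); split=> [|[b0 c0]]; last first.
  by rewrite E [RHS]xE b0 c0 !Kcyc_ratr0; ring.
rewrite E [RHS]xE => /eqP; rewrite -subr_eq0 => /eqP H.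
have {}H : ratr q.1.2 * w ^+ 2 + ratr q.2.1 * (w + w ^+ 3) = 0.
  by apply: (mulfI Kcyc_two); rewrite mulr0 -[RHS]oppr0 -H; ring.
apply: (gen_indep_ir zetaP); have := congr1 Kcyc_val H; rewrite rmorph0 Kcyc_pair.
by rewrite rmorphD !rmorphXn /= wz.
Qed.
End Coord.

Local Notation i := (zeta ^+ 2).
Local Notation r := (zeta + zeta ^+ 3).
Local Notation s := (zeta - zeta ^+ 3).

Lemma cfield_coord y : cfield y -> exists x q, [/\ character_field omega_odd x, y = Qcomb zeta q, Kcyc_val x = y &
  x = ratr q.1.1 + ratr q.1.2 * w ^+ 2 + ratr q.2.1 * (w + w ^+ 3) + ratr q.2.2 * (w - w ^+ 3)].
Proof. by move=> [x Ex <-]; have [q [vq xq]] := wdec (character_field_Qadj8 Ex); exists x, q. Qed.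

Lemma cfield_fixed3 : A 3 -> forall x, character_field omega_odd x -> s3 x = x.
Proof.
move=> A3; have [u uU u2] := @square_units_root 3 A3.
exact: (charfield_fixed_pow s3P u2 uU).
Qed.

Lemma cfield_fixed5 : A 5 -> forall x, character_field omega_odd x -> s5 x = x.
Proof.
move=> A5; have [u uU u2] := @square_units_root 5 A5.
exact: (charfield_fixed_pow s5P u2 uU).
Qed.

Lemma square_unitsN : A (-1) -> exists u : F, u ^+ 2 = -1.
Proof.
move=> AN; have [|u _ u2] := @square_units_root (-1); first by rewrite rmorphN1.
by exists u; rewrite u2 rmorphN1.
Qed.

Lemma cfield_fixedN : A (-1) -> forall x, character_field omega_odd x -> sN x = x.
Proof.
move=> /square_unitsN[u u2]; apply: (charfield_fixed_conj sNP _ u2) => x.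
by apply: Kcyc_inj; rewrite !sNE conjCK.
Qed.

Lemma cfield_moved3 : ~ A 3 -> exists2 x, character_field omega_odd x & s3 x != x.
Proof. by move=> A3; apply: (@square_units_moved s3 3) => //; exact: (char_pow s3P). Qed.

Lemma cfield_moved5 : ~ A 5 -> exists2 x, character_field omega_odd x & s5 x != x.
Proof. by move=> A5; apply: (@square_units_moved s5 5) => //; exact: (char_pow s5P). Qed.

Lemma cfield_movedN : ~ A (-1) -> exists2 x, character_field omega_odd x & sN x != x.
Proof.
have EN : (-1)%:~R = -1 :> Z2 by rewrite rmorphN1.
move=> AN; apply: (@square_units_moved sN (-1)); rewrite ?EN //.
move=> t; rewrite rmorphN1 mulN1r charN; have [k kP] := char_pow2 psi t.
exact: sNP kP.
Qed.

Lemma Qadj_affine (a b : rat) (x : algC) : Qadj x (ratr a + ratr b * x).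
Proof.
exists (a%:P + b *: 'X) => //.
by rewrite rmorphD /= map_polyC map_polyZ map_polyX /= hornerD hornerC hornerZ hornerX.
Qed.

Lemma w_pow8 n : w ^+ (8 + n) = w ^+ n. Proof. by rewrite exprD (w8 : w ^+ 8 = 1) mul1r. Qed.

Lemma Qadj_r y : Qadj r y <-> exists2 x, s3 x = x & Kcyc_val x = y.
Proof.
split=> [|[x sx <-]].
  have -> : r = Kcyc_val (w + w ^+ 3) by rewrite rmorphD rmorphXn /= wz.
  apply: Qadj_fixed; rewrite rmorphD rmorphXn (s3P w8) -exprM addrC; congr (_ + _).
  exact: (w_pow8 1).
have [q [-> xq]] := wdec (fixed_Qadj8_3 zetaP s3P sx); have [/(_ sx)[b0 d0] _] := fixed3_coord xq.
rewrite /Qcomb b0 d0 rmorph0 !mul0r !addr0; exact: Qadj_affine.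
Qed.

Lemma Qadj_i_coord x : s5 x = x -> exists a b, Kcyc_val x = ratr a + ratr b * i.
Proof.
move=> sx; have [q [-> xq]] := wdec (fixed_Qadj8_5 zetaP s5P sx); have [/(_ sx)[c0 d0] _] := fixed5_coord xq.
by exists q.1.1, q.1.2; rewrite /Qcomb c0 d0 rmorph0 !mul0r !addr0.
Qed.

Lemma Qadj_ii y : Qadj i y <-> exists2 x, s5 x = x & Kcyc_val x = y.
Proof.
split=> [|[x /Qadj_i_coord[a [b ->]] <-]]; last exact: Qadj_affine.
have -> : i = Kcyc_val (w ^+ 2) by rewrite rmorphXn /= wz.
by apply: Qadj_fixed; rewrite rmorphXn (s5P w8) -exprM; exact: (w_pow8 2).
Qed.

Lemma realised_sqrtN2 : A 3 -> realised (Qadj (sqrtC (- 2))).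
Proof.
move=> A3; have [u uU u2] := @square_units_root 3 A3.
have := realised_descent s3P u2 uU (isT : odd 3) (isT : odd 1) (erefl : 3 ^ (2 ^ 1) = 1 + 8 * 1)%N.
rewrite -(Qadj_sqrtN2 zetaP) (_ : [set _ | _ in _] = Qadj r) //.
by apply/seteqP; split=> [y [x sx xy]|y /Qadj_r[x sx xy]]; [apply/Qadj_r|]; exists x.
Qed.

Lemma realised_i : A 5 -> realised (Qadj 'i).
Proof.
move=> A5; have [u uU u2] := @square_units_root 5 A5.
have := realised_descent s5P u2 uU (isT : odd 5) (isT : odd 3) (erefl : 5 ^ (2 ^ 1) = 1 + 8 * 3)%N.
rewrite -(Qadj_i zetaP) (_ : [set _ | _ in _] = Qadj i) //.
by apply/seteqP; split=> [y [x sx xy]|y /Qadj_ii[x sx xy]]; [apply/Qadj_ii|]; exists x.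
Qed.

Lemma realised_zeta8 : realised (Qadj zeta).
Proof.
have u2 : (3 : F) ^+ 2 = 9%:R by rewrite -natrX.
have := realised_descent s9P u2 integer_units3 (isT : odd 9) (isT : odd 1) (erefl : 9 ^ (2 ^ 0) = 1 + 8 * 1)%N.
rewrite (_ : [set _ | _ in _] = Qadj zeta) //; apply/seteqP; split=> [_ [x sx <-]|y].
  exact: (fixed_Qadj8 zetaP (isT : odd 1) (erefl : 9 = 1 + 8 * 1)%N s9P sx).
rewrite -wz => /(@Qadj_fixed s9)[|x sx <-]; last by exists x.
by rewrite (s9P w8); exact: (w_pow8 1).
Qed.

Lemma cfield_gens (q : rat * rat * (rat * rat)) : cfield (Qcomb zeta q) ->
  [/\ q.1.2 != 0 -> cfield i, q.2.1 != 0 -> cfield r & q.2.2 != 0 -> cfield s].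
Proof.
move=> /(subfield_single cfield_subfield cfield_rat zetaP)[Ez|//].
have EX n : cfield (zeta ^+ n) := subfieldX cfield_subfield n Ez.
split=> _; first exact: EX.
  exact: (subfieldD cfield_subfield cfield_rat Ez (EX 3)).
exact: (subfieldB cfield_subfield Ez (EX 3)).
Qed.

Lemma Qadj_cfield x : cfield x -> Qadj x `<=` cfield.
Proof. exact: (subfield_Qadj cfield_subfield cfield_rat). Qed.

Lemma cfield_units : A 3 -> A 5 -> cfield = range (ratr : rat -> algC).
Proof.
move=> A3 A5; apply/seteqP; split=> [y /cfield_coord[x [q [Ex -> _ xq]]]|_ [q _ <-]]; last exact: cfield_rat.
have [/(_ (cfield_fixed3 A3 Ex))[b0 d0] _] := fixed3_coord xq.
have [/(_ (cfield_fixed5 A5 Ex))[c0 _] _] := fixed5_coord xq.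
by exists q.1.1 => //; rewrite /Qcomb b0 c0 d0 rmorph0 !mul0r !addr0.
Qed.

Lemma cfield_sqrtN2 : A 3 -> ~ A 5 -> cfield = Qadj (sqrtC (- 2)).
Proof.
move=> A3 A5; rewrite -(Qadj_sqrtN2 zetaP); apply/seteqP; split.
  by move=> y [x Ex xy]; apply/Qadj_r; exists x => //; exact: cfield_fixed3.
have [x Ex /eqP sx] := cfield_moved5 A5; have [|x' [q [_ xq' xx' xq]]] := @cfield_coord (Kcyc_val x); first by exists x.
move/Kcyc_inj: xx' xq => -> xq; have [/(_ (cfield_fixed3 A3 Ex))[_ d0] _] := fixed3_coord xq.
have [|_ H _] := @cfield_gens q; first by rewrite -xq'; exists x.
apply: Qadj_cfield; apply: H; apply/eqP => c0; apply: sx.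
by have [_] := fixed5_coord xq; apply.
Qed.

Lemma cfield_i : A 5 -> ~ A 3 -> cfield = Qadj 'i.
Proof.
move=> A5 A3; rewrite -(Qadj_i zetaP); apply/seteqP; split.
  by move=> y [x Ex xy]; apply/Qadj_ii; exists x => //; exact: cfield_fixed5.
have [x Ex /eqP sx] := cfield_moved3 A3; have [|x' [q [_ xq' xx' xq]]] := @cfield_coord (Kcyc_val x); first by exists x.
move/Kcyc_inj: xx' xq => -> xq; have [/(_ (cfield_fixed5 A5 Ex))[_ d0] _] := fixed5_coord xq.
have [|H _ _] := @cfield_gens q; first by rewrite -xq'; exists x.
apply: Qadj_cfield; apply: H; apply/eqP => c0; apply: sx.
by have [_] := fixed3_coord xq; apply.
Qed.

Lemma cfield_s : A (-1) -> ~ A 3 -> cfield s.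
Proof.
move=> AN A3.
have [x Ex /eqP sx] := cfield_moved3 A3; have [|x' [q [_ xq' xx' xq]]] := @cfield_coord (Kcyc_val x); first by exists x.
move/Kcyc_inj: xx' xq => -> xq; have [/(_ (cfield_fixedN AN Ex))[b0 _] _] := fixedN_coord xq.
have [|_ _ H] := @cfield_gens q; first by rewrite -xq'; exists x.
apply: H; apply/eqP => c0; apply: sx.
by have [_] := fixed3_coord xq; apply.
Qed.

Lemma cfield_sqrt2 : A (-1) -> ~ A 3 -> cfield = Qadj (sqrtC 2).
Proof.
move=> AN A3; rewrite -(Qadj_sqrt2 zetaP); apply/seteqP; split; last exact: Qadj_cfield (cfield_s AN A3).
move=> y /cfield_coord[x [q [Ex -> _ xq]]].
have [/(_ (cfield_fixedN AN Ex))[b0 c0] _] := fixedN_coord xq.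
rewrite /Qcomb b0 c0 rmorph0 !mul0r !addr0; exact: Qadj_affine.
Qed.

(** Each of the three automorphisms fixes only one of the three quadratic generators, so moving the
    field under all of them puts at least two generators in it, and any two generate [zeta]. *)
Lemma cfield_zeta8 : ~ A 3 -> ~ A 5 -> ~ A (-1) -> cfield = Qadj zeta.
Proof.
move=> A3 A5 AN; apply/seteqP; split=> [_ [x Ex <-]|]; first exact: character_field_Qadj8.
apply/Qadj_cfield/(subfield_zeta cfield_subfield cfield_rat zetaP).
have gens (sigma : {rmorphism Kcyc -> Kcyc}) (P : rat * rat * (rat * rat) -> Prop) (Q1 Q2 : Prop) :
    (forall x q, x = ratr q.1.1 + ratr q.1.2 * w ^+ 2 + ratr q.2.1 * (w + w ^+ 3) + ratr q.2.2 * (w - w ^+ 3) -> P q -> sigma x = x) ->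
    (forall q, cfield (Qcomb zeta q) -> P q \/ (Q1 \/ Q2)) ->
    (exists2 x, character_field omega_odd x & sigma x != x) -> Q1 \/ Q2.
  move=> fixP PQ [x Ex /eqP sx].
  have [|x' [q [_ xq' xx' xq]]] := @cfield_coord (Kcyc_val x); first by exists x.
  move/Kcyc_inj: xx' xq => -> xq; have [|Pq|//] := PQ q; first by rewrite -xq'; exists x.
  by case: sx; exact: fixP xq Pq.
have dec (a : rat) (Q : Prop) : (a != 0 -> Q) -> a = 0 \/ Q.
  by move=> H; have [|/H] := eqVneq a 0; [left|right].
have H3 : cfield i \/ cfield s.
  apply: (gens s3 (fun q => q.1.2 = 0 /\ q.2.2 = 0) _ _ _ _ (cfield_moved3 A3)) => [x q xq Pq|q /cfield_gens[/dec Hi _ /dec Hs]].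
    by apply/(fixed3_coord xq).
  tauto.
have H5 : cfield r \/ cfield s.
  apply: (gens s5 (fun q => q.2.1 = 0 /\ q.2.2 = 0) _ _ _ _ (cfield_moved5 A5)) => [x q xq Pq|q /cfield_gens[_ /dec Hr /dec Hs]].
    by apply/(fixed5_coord xq).
  tauto.
have HN : cfield i \/ cfield r.
  apply: (gens sN (fun q => q.1.2 = 0 /\ q.2.1 = 0) _ _ _ _ (cfield_movedN AN)) => [x q xq Pq|q /cfield_gens[/dec Hi /dec Hr _]].
    by apply/(fixedN_coord xq).
  tauto.
case: H3 => [Ei|Es]; last first.
  by case: HN => [Ei|Er]; [apply: Or32|apply: Or33].
by case: H5 => [Er|Es]; [apply: Or31|apply: Or32].
Qed.

Lemma cfield1 : cfield 1. Proof. by have [] := cfield_subfield. Qed.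

Lemma degree_pos (E : set algC) d : has_degree E cfield d -> (0 < d)%N.
Proof.
case: d => // -[sub [b [_ bE]]]; have [c [[_]]] := bE 1 (sub _ cfield1).
by rewrite big_ord0 => /eqP; rewrite oner_eq0.
Qed.

Lemma schur_index1 : realised cfield -> is_schur_index Kcyc_val omega_odd 1.
Proof.
move=> R; split=> [|d [E [_ /degree_pos]] //].
exists cfield; split=> //; split=> //; exists (fun=> 1); split=> [_|x Ex]; first exact: cfield1.
exists (fun=> x); split=> [|c [_]]; first by rewrite big_ord1 mulr1.
by rewrite big_ord1 mulr1 => ->; apply/funext => k; rewrite (ord1 k).
Qed.

Lemma conj_i : i^* = - i.
Proof.
have -> : i = Kcyc_val (w ^+ 2) by rewrite rmorphXn /= wz.
have E : sN (w ^+ 2) = w^-1 ^+ 2 by rewrite rmorphXn (sNP w8).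
rewrite -sNE E -[RHS](rmorphN Kcyc_val); congr (Kcyc_val _).
have w0 : w ^+ 2 != 0.
  by apply/negP => /eqP w20; move: w4; rewrite (exprM w 2 2) w20 expr0n => /eqP; rewrite eq_sym oppr_eq0 oner_eq0.
by apply: (mulfI w0); rewrite exprVn mulfV // mulrN -exprD w4 opprK.
Qed.

Lemma cfield_real : A (-1) -> forall x, cfield x -> x^* = x.
Proof. by move=> AN _ [x Ex <-]; rewrite -sNE cfield_fixedN. Qed.

(** The basis [1, i] shows that 2 is attained. A realisation of degree 1 would be over the character
    field, which is real. *)
Lemma schur_index2 (E : set algC) : A (-1) -> realised E -> cfield `<=` E -> E i ->
  (forall x, E x -> exists a b, [/\ cfield a, cfield b & x = a + b * i]) ->
  is_schur_index Kcyc_val omega_odd 2.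
Proof.
move=> AN ER sub Ei Edec; have real := cfield_real AN; split.
  exists E; split=> //; split=> //; exists (fun k : 'I_2 => if val k == 0 then 1 else i).
  split=> [k|x /Edec[a [b [Ea Eb ->]]]]; first by case: ifP => _ //; apply: sub; exact: cfield1.
  exists (fun k : 'I_2 => if val k == 0 then a else b); split=> [|c [cE]].
    by rewrite !big_ord_recl big_ord0 /= mulr1 addr0; split=> // k; case: ifP.
  rewrite !big_ord_recl big_ord0 /= mulr1 addr0.
  set c0 := c ord0; set c1 := c (lift ord0 ord0) => H.
  have conjD (x1 y1 : algC) : (x1 + y1)^* = x1^* + y1^* by exact: rmorphD.
  have conjM (x1 y1 : algC) : (x1 * y1)^* = x1^* * y1^* by exact: rmorphM.
  (* Complex conjugation fixes the character field and negates [i]; together with [H] this separates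
     the two coordinates. *)
  have H' : a - b * i = c0 - c1 * i.
    have := congr1 Num.conj H; rewrite !conjD (conjM b) (conjM c1) conj_i !real ?mulrN //; exact: cE.
  have c0E : a = c0.
    apply: (mulfI algC_two); transitivity ((a + b * i) + (a - b * i)); first by ring.
    by rewrite H H'; ring.
  have i0 : i != 0.
    by apply/negP => /eqP i0; have /eqP := gen_ii zetaP; rewrite i0 mul0r eq_sym oppr_eq0 oner_eq0.
  have c1E : b = c1 by apply: (mulIf i0); apply: (addrI a); rewrite H c0E.
  apply/funext => k; case: (unliftP ord0 k) => [k' ->|->] /=; last by rewrite c0E.
  by rewrite ord1 c1E.
move=> d [E' [E'R [sub' [b [E'b bE]]]]]; rewrite ltnNge leq_eqVlt ltnS leqn0.
apply/negP => /orP[/eqP d1|/eqP d0]; last by have := degree_pos (conj sub' (ex_intro _ b (conj E'b bE))); rewrite d0.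
subst d; have [u u2] := square_unitsN AN.
apply: (not_realised_real sNE sNP u2 _ E'R) => x E'x; apply: real.
have [c [[cE]]] := bE 1 (sub' _ cfield1); rewrite big_ord1 => c1 _.
have [c' [[c'E]]] := bE x E'x; rewrite big_ord1 => xE _.
have c0 : c ord0 != 0 by apply/negP => /eqP c0; move: c1; rewrite c0 mul0r => /eqP; rewrite oner_eq0.
have -> : x = c' ord0 / c ord0.
  by rewrite xE; apply: (mulIf c0); rewrite divfK // -mulrA [b _ * _]mulrC -c1 mulr1.
exact: (subfield_div cfield_subfield).
Qed.

(** If 3 lies in [A], so does 5, and Q[i] is quadratic over Q. Otherwise Q[zeta_8] is used over
    Q[sqrt 2], with [r = i s] bringing its elements to the form [a + b i]. *)
Lemma schur_index_N1 : A (-1) -> is_schur_index Kcyc_val omega_odd 2.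
Proof.
move=> AN; have EN : (-1)%:~R = -1 :> Z2 by rewrite rmorphN1.
have Qadj_id x : Qadj x x by have := @Qadj_affine 0 1 x; rewrite rmorph0 rmorph1 add0r mul1r.
have Qadj_rat x q : Qadj x (ratr q) by have := @Qadj_affine q 0 x; rewrite rmorph0 mul0r addr0.
have [A3|A3] := pselect (A 3).
  have A5 : A 5 by apply: (@square_units_mod8 F (-1) 3 5); rewrite // EN.
  apply: (schur_index2 AN (realised_i A5)); rewrite -(Qadj_i zetaP) //.
    by rewrite cfield_units // => _ [q _ <-].
  move=> _ /Qadj_ii[x /Qadj_i_coord[a [b ->]] <-].
  by exists (ratr a), (ratr b); split=> //; exact: cfield_rat.
apply: (schur_index2 AN realised_zeta8) => [||y].
- by move=> _ [x Ex <-]; exact: character_field_Qadj8.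
- by exists 'X^2 => //; rewrite map_polyXn hornerXn.
move=> /(Qadj8_basis zetaP)[q ->].
have Es := cfield_s AN A3.
have aff (a b : rat) : cfield (ratr a + ratr b * s).
  apply: (subfieldD cfield_subfield cfield_rat); first exact: cfield_rat.
  by apply: (subfieldM cfield_subfield) => //; exact: cfield_rat.
exists (ratr q.1.1 + ratr q.2.2 * s), (ratr q.1.2 + ratr q.2.1 * s); split=> //.
by rewrite -(gen_is zetaP); ring.
Qed.

(** As 15 is -1 modulo 8, 3 and 5 are not both in [A], and each remaining case has a realisation
    over the character field. *)
Lemma schur_index_nonreal : ~ A (-1) -> is_schur_index Kcyc_val omega_odd 1.
Proof.
move=> AN; have EN : (-1)%:~R = -1 :> Z2 by rewrite rmorphN1.
apply: schur_index1; have [A3|A3] := pselect (A 3).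
  rewrite cfield_sqrtN2 //; first exact: realised_sqrtN2.
  by move=> A5; apply: AN; rewrite -EN; apply: (@square_units_mod8 F 3 5 (-1)).
have [A5|A5] := pselect (A 5); first by rewrite cfield_i //; exact: realised_i.
by rewrite cfield_zeta8 //; exact: realised_zeta8.
Qed.
End Coordinates.
End Classification.
End Realisation.

Lemma unit_class_id (a : Z2) : unit_class a a.
Proof. by move=> H [_]; apply; left. Qed.

Lemma two_adic_units_odd (a : int) : (a %% 2)%Z = 1 -> two_adic_units a%:~R.
Proof. by move=> a2; rewrite /two_adic_units /= Z2_unitE Z2_val_int expr1 a2. Qed.

Theorem theorem8p3 (F : fieldExtType Q2) (W : vectType F)
    (form : {skew_symmetric W}) (X Y : {vspace W})
    (psi : smooth_character F Kcyc)
    (Mp : topGroupType) (p : Mp -> 'End(W))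
    (omega : Mp -> Cc (ltop (subvs_of Y)) Kcyc -> Cc (ltop (subvs_of Y)) Kcyc)
    (omega_odd : Mp -> odd_Cc Kcyc Y -> odd_Cc Kcyc Y)
    (zeta8 : algC) :
  fullv != 0%VS :> {vspace W} ->
  nondegenerate form ->
  complete_polarisation form X Y ->
  nontrivial_character psi ->
  metaplectic_cover form p ->
  Weil_representation form X psi p omega ->
  odd_part omega omega_odd ->
  8.-primitive_root zeta8 ->
  let A := square_units F in
  let realised := realised_over Kcyc_val omega_odd in
  let charfield := Kcyc_val @` character_field omega_odd in
  let schur_index := is_schur_index Kcyc_val omega_odd in
  [/\ A = two_adic_units ->
        [/\ realised (Qadj (sqrtC (- 2))), realised (Qadj 'i) &
             charfield = range (ratr : rat -> algC)],
      A = unit_class 3 ->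
        realised (Qadj (sqrtC (- 2))) /\ charfield = Qadj (sqrtC (- 2)),
      A = unit_class 5 ->
        realised (Qadj 'i) /\ charfield = Qadj 'i,
      A = unit_class (- 1) ->
        realised (Qadj zeta8) /\ charfield = Qadj (sqrtC 2) &
      A = two_adic_square_units ->
        realised (Qadj zeta8) /\ charfield = Qadj zeta8] /\
  (A = two_adic_units \/ A = unit_class (- 1) -> schur_index 2%N) /\
  (~ (A = two_adic_units \/ A = unit_class (- 1)) -> schur_index 1%N).
Proof.
move=> W0 nd XY psi_nt cover weil odd_omega zetaP A realised charfield schur_index.
have [w [wz w8 w4 wdec]] := Qcomb_lift zetaP.
have [s3 s3P] := Kcyc_pow (isT : odd 3); have [s5 s5P] := Kcyc_pow (isT : odd 5).
have [s9 s9P] := Kcyc_pow (isT : odd 9); have [sN [sNE sNP]] := Kcyc_conj.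
have EN : (-1)%:~R = -1 :> Z2 by rewrite rmorphN1.
have R3 : A 3 -> realised (Qadj (sqrtC (- 2))) by eapply realised_sqrtN2; eassumption.
have R5 : A 5 -> realised (Qadj 'i) by eapply realised_i; eassumption.
have R8 : realised (Qadj zeta8) by eapply realised_zeta8; eassumption.
have C35 : A 3 -> A 5 -> charfield = range (ratr : rat -> algC) by eapply cfield_units; eassumption.
have C3 : A 3 -> ~ A 5 -> charfield = Qadj (sqrtC (- 2)) by eapply cfield_sqrtN2; eassumption.
have C5 : A 5 -> ~ A 3 -> charfield = Qadj 'i by eapply cfield_i; eassumption.
have CN : A (-1) -> ~ A 3 -> charfield = Qadj (sqrtC 2) by eapply cfield_sqrt2; eassumption.
have C1 : ~ A 3 -> ~ A 5 -> ~ A (-1) -> charfield = Qadj zeta8 by eapply cfield_zeta8; eassumption.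
have S2 : A (-1) -> schur_index 2 by eapply schur_index_N1; eassumption.
have S1 : ~ A (-1) -> schur_index 1 by eapply schur_index_nonreal; eassumption.
(* Residues modulo 8 translate each hypothesis on [A] into which of 3, 5, -1 it excludes. *)
have notin (a b : int) : A = unit_class a%:~R -> (a * a %% 8)%Z = 1 -> (b %% 8)%Z != 1 ->
    (b %% 8)%Z != (a %% 8)%Z -> ~ A b%:~R.
  move=> -> aa b1 ba /(unit_class_mod8 aa); rewrite Z2_val_int => -[/eqP|/eqP].
    by rewrite (negPf b1).
  by rewrite (negPf ba).
have notin_sqr (b : int) : A = two_adic_square_units -> (b %% 8)%Z != 1 -> ~ A b%:~R.
  move=> -> /negPf b1 [u /Z2_unit_sqr_val3 u8 bE]; move: u8; rewrite -bE Z2_val_int => /eqP.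
  by rewrite b1.
have unitsN : A = two_adic_units -> A (-1) by move=> ->; rewrite -EN; exact: two_adic_units_odd.
split; last first.
  split=> [[/unitsN//|AE]|N]; first by apply: S2; rewrite AE; exact: unit_class_id.
  (* The index depends only on whether -1 lies in [A], and that happens exactly in the two listed
     cases. *)
  by apply: S1 => /square_units_N1.
split=> AE.
- have [A3 A5] : A 3 /\ A 5.
    by rewrite AE; split; [exact: (@two_adic_units_odd 3)|exact: (@two_adic_units_odd 5)].
  by split; [exact: R3|exact: R5|exact: C35].
- have A3 : A 3 by rewrite AE; exact: unit_class_id.
  by split; [exact: R3|apply: C3 => //; exact: (@notin 3 5)].
- have A5 : A 5 by rewrite AE; exact: unit_class_id.
  by split; [exact: R5|apply: C5 => //; exact: (@notin 5 3)].
- have AN : A (-1) by rewrite AE; exact: unit_class_id.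
  by split=> //; apply: CN => //; apply: (@notin (-1) 3) => //; rewrite EN.
split=> //; apply: C1; [exact: (@notin_sqr 3)|exact: (@notin_sqr 5)|].
by rewrite -EN; exact: notin_sqr.
Qed.
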